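(* There exists a combinatorial algorithm that, given an undirected graph $G=(V,E)$ with $n$ vertices, $m$ edges and non-negative edge weights, constructs a distance oracle that answers $2$-approximate distance queries in constant time (i.e., on query $(u,v)$ it returns $\delta(u,v)$ with $d(u,v)\le\delta(u,v)\le 2d(u,v)$), uses $\tilde O(mn^{2/3})$ space, and has preprocessing time $\tilde O(mn^{2/3})$.
   Context: $d(u,v)$ denotes the weighted shortest-path distance in $G$. A distance oracle is a data structure built in a preprocessing phase that afterwards answers distance queries for arbitrary pairs of vertices. ''Combinatorial'' means the algorithm does not use fast (algebraic) matrix multiplication. $\tilde O(\cdot)$ hides polylogarithmic factors in $n$. *)

(* Defs.v *)
From HB Require Import structures.
From mathcomp Require Import all_boot all_order all_algebra.
From mathcomp Require Import all_classical all_reals all_analysis.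

Set Implicit Arguments.
Unset Strict Implicit.
Unset Printing Implicit Defensive.

Import Order.TTheory GRing.Theory Num.Theory.

Local Open Scope classical_set_scope.
Local Open Scope ring_scope.

(* Weighted undirected graphs on the vertex set {0, ..., n-1}; the values of
   [wt] on non-adjacent pairs are irrelevant. *)
Record wgraph (R : realType) (n : nat) := WGraph {
  adj : rel 'I_n;
  wt : 'I_n -> 'I_n -> R;
  adj_sym : symmetric adj;
  adj_irr : irreflexive adj;
  wt_sym : forall u v, adj u v -> wt u v = wt v u;
  wt_ge0 : forall u v, adj u v -> 0 <= wt u v }.

Definition num_edges (R : realType) (n : nat) (G : wgraph R n) : nat :=
  #|[set p : 'I_n * 'I_n | adj G p.1 p.2 && (p.1 < p.2)%N]%SET|.

(* Total weight of the walk that starts at u and then visits p in order. *)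
Definition walk_weight (R : realType) (n : nat) (G : wgraph R n)
    (u : 'I_n) (p : seq 'I_n) : R :=
  \sum_(x <- pairmap (wt G) u p) x.

(* +oo when u and v are not connected. *)
Definition dist (R : realType) (n : nat) (G : wgraph R n) (u v : 'I_n) :
    \bar R :=
  ereal_inf [set (walk_weight G u p)%:E |
    p in [set p : seq 'I_n | path (adj G) u p /\ last u p = v]].

(* es lists every edge exactly once, in any order and either orientation. *)
Definition edge_list (R : realType) (n : nat) (G : wgraph R n)
    (es : seq ('I_n * 'I_n)) : Prop :=
  [/\ uniq es,
      (forall u v, (u, v) \in es -> adj G u v) &
      (forall u v, adj G u v -> ((u, v) \in es) (+) ((v, u) \in es))].

(* The machine: a word RAM, programmed in a structured language, with two
   sorts of data, each having scalar variables and random-access arrays.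
   - Words are natural numbers below a capacity [cap].
   - Weights are extended reals, which can only be added and compared; a word
     cannot be computed from a weight except by branching on a comparison.
   "Combinatorial" is reflected in the instruction set.  Weights carry the
   operations of the (min, +) semiring only, and words the index operations
   (sum, quotient and remainder for digit extraction, comparison).  Neither
   sort has subtraction or multiplication, so there are no ring operations
   with which to run algebraic matrix multiplication.
   Programs do not mention the field of reals: the same program runs over any
   [R : realType]. *)
Inductive wexp :=
  | WConst of nat
  | WVar of nat
  | WRead of nat & wexp            (* array name, index *)
  | WAdd of wexp & wexp
  | WDiv of wexp & wexp
  | WMod of wexp & wexp.

Inductive rexp :=
  | RZero
  | RInfty
  | RVar of nat
  | RRead of nat & wexp
  | RAdd of rexp & rexp.

Inductive test :=
  | TLt of wexp & wexp
  | TEq of wexp & wexp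
  | TLe of rexp & rexp
  | TNot of test
  | TAnd of test & test.

Inductive cmd :=
  | Skip
  | WSet of nat & wexp
  | RSet of nat & rexp
  | WStore of nat & wexp & wexp    (* array name, index, value *)
  | RStore of nat & wexp & rexp
  | Seq of cmd & cmd
  | If of test & cmd & cmd
  | While of test & cmd.

Record state (R : realType) := State {
  wvar : nat -> nat;
  rvar : nat -> \bar R;
  warr : nat -> nat -> nat;
  rarr : nat -> nat -> \bar R }.

Definition upd (T : Type) (f : nat -> T) (x : nat) (v : T) : nat -> T :=
  fun y => if y == x then v else f y.

Definition upd2 (T : Type) (f : nat -> nat -> T) (a i : nat) (v : T) :
    nat -> nat -> T :=
  upd f a (upd (f a) i v).

Definition guard (T : Type) (b : bool) (x : T) : option T :=
  if b then Some x else None.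

(* Evaluation fails when a word reaches [cap] (overflow) or when an array is
   accessed at an index that is not below [len]. *)
Fixpoint weval (R : realType) (cap len : nat) (s : state R) (e : wexp) :
    option nat :=
  match e with
  | WConst k => guard (k < cap)%N k
  | WVar x => Some (wvar s x)
  | WRead a e1 =>
      obind (fun i => guard (i < len)%N (warr s a i)) (weval cap len s e1)
  | WAdd e1 e2 =>
      obind (fun x => obind (fun y => guard (x + y < cap)%N (x + y)%N)
        (weval cap len s e2)) (weval cap len s e1)
  | WDiv e1 e2 =>
      obind (fun x => omap (fun y => x %/ y)%N (weval cap len s e2))
        (weval cap len s e1)
  | WMod e1 e2 =>
      obind (fun x => omap (fun y => x %% y)%N (weval cap len s e2))
        (weval cap len s e1)
  end.

Fixpoint reval (R : realType) (cap len : nat) (s : state R) (e : rexp) :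
    option (\bar R) :=
  match e with
  | RZero => Some 0%E
  | RInfty => Some +oo%E
  | RVar x => Some (rvar s x)
  | RRead a e1 =>
      obind (fun i => guard (i < len)%N (rarr s a i)) (weval cap len s e1)
  | RAdd e1 e2 =>
      obind (fun x => omap (fun y => x + y)%E (reval cap len s e2))
        (reval cap len s e1)
  end.

Fixpoint teval (R : realType) (cap len : nat) (s : state R) (b : test) :
    option bool :=
  match b with
  | TLt e1 e2 =>
      obind (fun x => omap (fun y => x < y)%N (weval cap len s e2))
        (weval cap len s e1)
  | TEq e1 e2 =>
      obind (fun x => omap (fun y => x == y) (weval cap len s e2))
        (weval cap len s e1)
  | TLe e1 e2 =>
      obind (fun x => omap (fun y => x <= y)%E (reval cap len s e2))
        (reval cap len s e1)
  | TNot b1 => omap negb (teval cap len s b1)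
  | TAnd b1 b2 =>
      obind (fun x => omap (andb x) (teval cap len s b2)) (teval cap len s b1)
  end.

Definition set_wvar (R : realType) (s : state R) (x v : nat) : state R :=
  State (upd (wvar s) x v) (rvar s) (warr s) (rarr s).

Definition set_rvar (R : realType) (s : state R) (x : nat) (v : \bar R) :
    state R :=
  State (wvar s) (upd (rvar s) x v) (warr s) (rarr s).

Definition set_warr (R : realType) (s : state R) (a i v : nat) : state R :=
  State (wvar s) (rvar s) (upd2 (warr s) a i v) (rarr s).

Definition set_rarr (R : realType) (s : state R) (a i : nat) (v : \bar R) :
    state R :=
  State (wvar s) (rvar s) (warr s) (upd2 (rarr s) a i v).

(* [exec cap len c s t s']: started in state s, the program c terminates
   without failure in state s' after t steps.  Assignments and tests take one
   step each: a fixed program contains finitely many expressions, hence each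
   is evaluated with O(1) elementary operations.  Likewise it names finitely
   many variables and arrays, so a run uses O(len + 1) memory cells. *)
Inductive exec (R : realType) (cap len : nat) :
    cmd -> state R -> nat -> state R -> Prop :=
  | ExecSkip s : exec cap len Skip s 0 s
  | ExecWSet s x e v :
      weval cap len s e = Some v ->
      exec cap len (WSet x e) s 1 (set_wvar s x v)
  | ExecRSet s x e v :
      reval cap len s e = Some v ->
      exec cap len (RSet x e) s 1 (set_rvar s x v)
  | ExecWStore s a e1 e2 i v :
      weval cap len s e1 = Some i -> (i < len)%N ->
      weval cap len s e2 = Some v ->
      exec cap len (WStore a e1 e2) s 1 (set_warr s a i v)
  | ExecRStore s a e1 e2 i v :
      weval cap len s e1 = Some i -> (i < len)%N ->
      reval cap len s e2 = Some v ->
      exec cap len (RStore a e1 e2) s 1 (set_rarr s a i v)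
  | ExecSeq s s1 s2 c1 c2 t1 t2 :
      exec cap len c1 s t1 s1 -> exec cap len c2 s1 t2 s2 ->
      exec cap len (Seq c1 c2) s (t1 + t2)%N s2
  | ExecIf s s1 b (r : bool) c1 c2 t :
      teval cap len s b = Some r ->
      exec cap len (if r then c1 else c2) s t s1 ->
      exec cap len (If b c1 c2) s t.+1 s1
  | ExecWhileF s b c :
      teval cap len s b = Some false ->
      exec cap len (While b c) s 1 s
  | ExecWhileT s s1 s2 b c t1 t2 :
      teval cap len s b = Some true ->
      exec cap len c s t1 s1 -> exec cap len (While b c) s1 t2 s2 ->
      exec cap len (While b c) s (t1 + t2).+1 s2.

(* Words have c * log2 (n + 2) = O(log n) bits. *)
Definition word_cap (c n : nat) : nat := ((n + 2) ^ c)%N.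

(* Input of the preprocessing: n and m in word variables 0 and 1, the end
   points of the edges in word arrays 0 and 1, the weights in weight array 0,
   everything else 0. *)
Definition input_state (R : realType) (n : nat) (G : wgraph R n)
    (es : seq ('I_n * 'I_n)) : state R :=
  State
    (fun x => nth 0%N [:: n; size es] x)
    (fun _ => 0%E)
    (fun a i => nth 0%N
       (nth [::] [:: [seq val e.1 | e <- es]; [seq val e.2 | e <- es]] a) i)
    (fun a i => nth 0%E
       (nth [::] [:: [seq (wt G e.1 e.2)%:E | e <- es]] a) i).

(* The oracle consists of the arrays left by the preprocessing; a query only
   receives u and v in word variables 0 and 1 in addition. *)
Definition query_state (R : realType) (s : state R) (u v : nat) : state R :=
  State (fun x => nth 0%N [:: u; v] x) (fun _ => 0%E) (warr s) (rarr s).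

(* The query terminates within q steps with a 2-approximation of the distance
   in weight variable 0, and leaves the oracle intact for later queries. *)
Definition answers_2approx (R : realType) (n : nat) (G : wgraph R n)
    (cap len q : nat) (query : cmd) (oracle : state R) : Prop :=
  forall u v : 'I_n, exists t s',
    [/\ exec cap len query (query_state oracle u v) t s',
        (t <= q)%N,
        warr s' = warr oracle,
        rarr s' = rarr oracle &
        (dist G u v <= rvar s' 0)%E /\ (rvar s' 0 <= 2%:E * dist G u v)%E].

(* x <= C * (f + 1) * polylog n.  The "+ 1"s only matter when f = 0, that is,
   for graphs without edges, or when log n = 0. *)
Definition soft_bound (R : realType) (C k n : nat) (f : R) (x : nat) : Prop :=
  x%:R <= C%:R * (f + 1) * (trunc_log 2 n).+1%:R ^+ k.

(* Main.v *)
(* Vertices without an edge are at distance +oo from all others and the remaining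
   N <= min(n, 2 m) vertices are renamed by a trie.  Let q be about N^(1/3).  Greedy
   hitting sets yield a set A of O(q^2 log^2 N) landmarks such that every vertex lies
   in at most 2 q of the balls B(u) = {x | d(u, x) < d(u, p(u))}, where p(u) is the
   landmark nearest to u (repeat: hit the long windows of all near lists, and keep
   hitting only the vertices that still lie in too many balls).  All distances from
   landmarks are tabulated.

   If d(u, p(u)) <= d(u, v) / 2, the detour through p(u) costs at most 2 d(u, v), and
   likewise for v.  Otherwise a shortest walk from u to v runs through B(u) and B(v)
   only, hence some edge (x, y) joins x in B(v) to y in B(u), and the minimum of
   d(v, x) + w(x, y) + d(y, u) over such edges is exact.  An edge serves at most
   (2 q)^2 pairs, so that O(q^2 m) pairs have to be stored.  The dictionary for them
   is a hash table derandomized by conditional expectations, with O(log n) pairs per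
   cell, which are then separated by their residues modulo a small number. *)

(* All sizes are forced by the budget m N^(2/3). One Dijkstra run per landmark costs about m q^2 in
   total, and balls with at most 2 q centres per vertex give 4 q^2 m pairs; hence q is about
   N^(1/3). Near lists of length N / q^2 are then about as long as q, and finding them along the
   lightest edges only costs about N q^2. Short lists alone do not keep a vertex from lying in many
   balls. By averaging, once every ball holds at most a 1 / q^2 share of the crowded vertices, at
   most half of these still lie in more than 2 q balls; so log N phases suffice. Since n itself may
   exceed m n^(2/3), no array may have length n; the trie only needs a root of length about sqrt n.
   The second obstacle is lookup in constant time without random bits and without multiplication. A
   cell with b pairs is given a weight proportional to 2^b - 1. Conditional expectations keep the
   total weight linear, which forces b = O(log n). So few numbers are distinct modulo some p of
   polylogarithmic size, because otherwise lcm(1, ..., 2 k), which is at least 2^k, would divide the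
   product of their differences. *)
Require Import Defs.
From HB Require Import structures.
From mathcomp Require Import all_boot all_order all_algebra.
From mathcomp Require Import all_classical all_reals all_analysis.
From mathcomp Require Import zify ring lra.

Set Implicit Arguments.
Unset Strict Implicit.
Unset Printing Implicit Defensive.

Import Order.TTheory GRing.Theory Num.Theory.

Local Open Scope nat_scope.

(** * A program logic with time bounds *)

Section ProgramLogic.
Variables (R : realType) (cap len : nat).
Implicit Types (s : state R) (c : cmd) (Q : state R -> Prop).

(** Evaluation is split into a total value and a safety predicate. A goal about a program then falls
    apart into arithmetic side conditions and a state that is found by simplification. *)
Fixpoint wden s e : nat :=
  match e with
  | WConst k => k
  | WVar x => wvar s x
  | WRead a e1 => warr s a (wden s e1)
  | WAdd e1 e2 => wden s e1 + wden s e2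
  | WDiv e1 e2 => wden s e1 %/ wden s e2
  | WMod e1 e2 => wden s e1 %% wden s e2
  end.

Fixpoint wsafe s e : Prop :=
  match e with
  | WConst k => k < cap
  | WVar _ => True
  | WRead a e1 => wsafe s e1 /\ wden s e1 < len
  | WAdd e1 e2 => [/\ wsafe s e1, wsafe s e2 & wden s e1 + wden s e2 < cap]
  | WDiv e1 e2 | WMod e1 e2 => wsafe s e1 /\ wsafe s e2
  end.

Fixpoint rden s e : \bar R :=
  match e with
  | RZero => 0%E
  | RInfty => +oo%E
  | RVar x => rvar s x
  | RRead a e1 => rarr s a (wden s e1)
  | RAdd e1 e2 => (rden s e1 + rden s e2)%E
  end.

Fixpoint rsafe s e : Prop :=
  match e with
  | RRead a e1 => wsafe s e1 /\ wden s e1 < len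
  | RAdd e1 e2 => rsafe s e1 /\ rsafe s e2
  | _ => True
  end.

Fixpoint tden s b : bool :=
  match b with
  | TLt e1 e2 => wden s e1 < wden s e2
  | TEq e1 e2 => wden s e1 == wden s e2
  | TLe e1 e2 => (rden s e1 <= rden s e2)%E
  | TNot b1 => ~~ tden s b1
  | TAnd b1 b2 => tden s b1 && tden s b2
  end.

Fixpoint tsafe s b : Prop :=
  match b with
  | TLt e1 e2 | TEq e1 e2 => wsafe s e1 /\ wsafe s e2
  | TLe e1 e2 => rsafe s e1 /\ rsafe s e2
  | TNot b1 => tsafe s b1
  | TAnd b1 b2 => tsafe s b1 /\ tsafe s b2
  end.

Lemma wevalE s e : wsafe s e -> weval cap len s e = Some (wden s e).
Proof.
elim: e => //= [k ->//|a e IH [/IH-> /= ->]//|e1 IH1 e2 IH2 [/IH1-> /IH2-> /= ->]//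
  |e1 IH1 e2 IH2 [/IH1-> /IH2->]//|e1 IH1 e2 IH2 [/IH1-> /IH2->]//].
Qed.

Lemma revalE s e : rsafe s e -> reval cap len s e = Some (rden s e).
Proof.
elim: e => //= [a e [/wevalE-> /= ->]//|e1 IH1 e2 IH2 [/IH1-> /IH2->]//].
Qed.

Lemma tevalE s b : tsafe s b -> teval cap len s b = Some (tden s b).
Proof.
elim: b => //= [e1 e2 [/wevalE-> /wevalE->]//|e1 e2 [/wevalE-> /wevalE->]//
  |e1 e2 [/revalE-> /revalE->]//|b IH /IH->//|b1 IH1 b2 IH2 [/IH1-> /IH2->]//].
Qed.

Definition ok c s T Q : Prop :=
  exists t s', [/\ exec cap len c s t s', t <= T & Q s'].

(** The modified variables and arrays are lists computed from the program text, so that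
    non-membership is decided by reduction and [fr] can close it with [isT]. *)
Fixpoint wm c : seq nat :=
  match c with
  | WSet x _ => [:: x]
  | Seq c1 c2 | If _ c1 c2 => wm c1 ++ wm c2
  | While _ c1 => wm c1
  | _ => [::]
  end.

Fixpoint rm c : seq nat :=
  match c with
  | RSet x _ => [:: x]
  | Seq c1 c2 | If _ c1 c2 => rm c1 ++ rm c2
  | While _ c1 => rm c1
  | _ => [::]
  end.

Fixpoint wam c : seq nat :=
  match c with
  | WStore x _ _ => [:: x]
  | Seq c1 c2 | If _ c1 c2 => wam c1 ++ wam c2
  | While _ c1 => wam c1
  | _ => [::]
  end.

Fixpoint ram c : seq nat :=
  match c with
  | RStore x _ _ => [:: x]
  | Seq c1 c2 | If _ c1 c2 => ram c1 ++ ram c2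
  | While _ c1 => ram c1
  | _ => [::]
  end.

Record frame c s s' : Prop := Frame {
  fr_w : forall x, x \notin wm c -> wvar s' x = wvar s x;
  fr_r : forall x, x \notin rm c -> rvar s' x = rvar s x;
  fr_wa : forall x, x \notin wam c -> warr s' x = warr s x;
  fr_ra : forall x, x \notin ram c -> rarr s' x = rarr s x }.

Lemma frame_refl c s : frame c s s.
Proof. by []. Qed.

Lemma frame_trans c s1 s2 s3 : frame c s1 s2 -> frame c s2 s3 -> frame c s1 s3.
Proof.
case=> a1 b1 c1 d1 [a2 b2 c2 d2]; split=> x hx.
- by rewrite a2 ?a1. - by rewrite b2 ?b1. - by rewrite c2 ?c1. - by rewrite d2 ?d1.
Qed.

Lemma frame_sub c c' s s' :
  {subset wm c <= wm c'} -> {subset rm c <= rm c'} ->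
  {subset wam c <= wam c'} -> {subset ram c <= ram c'} ->
  frame c s s' -> frame c' s s'.
Proof.
move=> h1 h2 h3 h4 [a1 a2 a3 a4].
by split=> x hx; [apply: a1|apply: a2|apply: a3|apply: a4];
  apply: contra hx => hx; auto.
Qed.

Lemma frame_seql c1 c2 s s' : frame c1 s s' -> frame (Seq c1 c2) s s'.
Proof. by apply: frame_sub => x /= h; rewrite mem_cat h. Qed.

Lemma frame_seqr c1 c2 s s' : frame c2 s s' -> frame (Seq c1 c2) s s'.
Proof. by apply: frame_sub => x /= h; rewrite mem_cat h orbT. Qed.

Lemma exec_frame c s t s' : exec cap len c s t s' -> frame c s s'.
Proof.
elim=> {c s t s'} //=.
- by move=> s x e v _; split=> //= y; rewrite inE /upd => /negPf->.
- by move=> s x e v _; split=> //= y; rewrite inE /upd => /negPf->.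
- by move=> s a e1 e2 i v _ _ _; split=> //= y; rewrite inE /upd2 /upd => /negPf->.
- by move=> s a e1 e2 i v _ _ _; split=> //= y; rewrite inE /upd2 /upd => /negPf->.
- move=> s s1 s2 c1 c2 t1 t2 _ F1 _ F2.
  exact: frame_trans (frame_seql _ F1) (frame_seqr _ F2).
- move=> s s1 b [] c1 c2 t _ _; apply: frame_sub => x /= h;
    by rewrite mem_cat h ?orbT.
- move=> s s1 s2 b c t1 t2 _ _ F1 _ F2.
  by apply: frame_trans F2; apply: frame_sub F1.
Qed.

Lemma okW c s T T1 Q1 Q :
  ok c s T1 Q1 -> (forall s', frame c s s' -> Q1 s' -> Q s') -> T1 <= T ->
  ok c s T Q.
Proof.
move=> [t [s' [e ht h]]] hQ hT; exists t, s'; split=> //; first exact: leq_trans hT.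
by apply: hQ h; apply: exec_frame e.
Qed.

Lemma okS c1 c2 s T T1 T2 Q1 Q :
  ok c1 s T1 Q1 ->
  (forall s1, frame c1 s s1 -> Q1 s1 -> ok c2 s1 T2 Q) -> T1 + T2 <= T ->
  ok (Seq c1 c2) s T Q.
Proof.
move=> [t1 [s1 [e1 ht1 h1]]] h2 hT.
have [t2 [s2 [e2 ht2 hQ]]] := h2 s1 (exec_frame e1) h1.
exists (t1 + t2), s2; split=> //; first exact: ExecSeq e1 e2.
by apply: leq_trans hT; apply: leq_add.
Qed.

Lemma okIf b c1 c2 s T T1 Q :
  tsafe s b -> (tden s b -> ok c1 s T1 Q) -> (~~ tden s b -> ok c2 s T1 Q) ->
  T1 < T -> ok (If b c1 c2) s T Q.
Proof.
move=> /tevalE hb h1 h2 hT.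
have [t [s' [e ht hQ]]] : ok (if tden s b then c1 else c2) s T1 Q.
  by case: (tden s b) h1 h2 => h1 h2; [exact: h1|exact: h2].
exists t.+1, s'; split=> //; first exact: ExecIf hb e.
by apply: leq_trans hT; rewrite ltnS.
Qed.

(** Meant for straight-line code: [While] is sent to [False], so that loops have to go through
    [okWhile] and its derived rules. *)
Fixpoint wp c s Q : Prop :=
  match c with
  | Skip => Q s
  | WSet x e => wsafe s e /\ Q (set_wvar s x (wden s e))
  | RSet x e => rsafe s e /\ Q (set_rvar s x (rden s e))
  | WStore a e1 e2 => [/\ wsafe s e1, wden s e1 < len, wsafe s e2 &
      Q (set_warr s a (wden s e1) (wden s e2))]
  | RStore a e1 e2 => [/\ wsafe s e1, wden s e1 < len, rsafe s e2 &
      Q (set_rarr s a (wden s e1) (rden s e2))]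
  | Seq c1 c2 => wp c1 s (fun s1 => wp c2 s1 Q)
  | If b c1 c2 => tsafe s b /\ (if tden s b then wp c1 s Q else wp c2 s Q)
  | While _ _ => False
  end.

Fixpoint tm c : nat :=
  match c with
  | Skip => 0
  | Seq c1 c2 => tm c1 + tm c2
  | If _ c1 c2 => (maxn (tm c1) (tm c2)).+1
  | _ => 1
  end.

Lemma okWp c s T Q : wp c s Q -> tm c <= T -> ok c s T Q.
Proof.
elim: c s T Q => //=.
- by move=> s T Q h hT; exists 0, s; split=> //; apply: ExecSkip.
- move=> x e s T Q [/wevalE h q] hT.
  by exists 1, (set_wvar s x (wden s e)); split=> //; apply: ExecWSet.
- move=> x e s T Q [/revalE h q] hT.
  by exists 1, (set_rvar s x (rden s e)); split=> //; apply: ExecRSet.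
- move=> a e1 e2 s T Q [/wevalE h1 h2 /wevalE h3 q] hT.
  by eexists 1, _; split=> //; first apply: ExecWStore h1 h2 h3.
- move=> a e1 e2 s T Q [/wevalE h1 h2 /revalE h3 q] hT.
  by eexists 1, _; split=> //; first apply: ExecRStore h1 h2 h3.
- move=> c1 IH1 c2 IH2 s T Q h hT.
  apply: okS (IH1 _ _ _ h (leqnn _)) _ hT => s1 _ h1; exact: IH2.
- move=> b c1 IH1 c2 IH2 s T Q [hb h] hT.
  apply: okIf hb _ _ hT => hb; [apply: IH1|apply: IH2]; rewrite ?leq_maxl ?leq_maxr //.
    by move: h; rewrite hb.
  by move: h; rewrite (negPf hb).
Qed.

Lemma okWpS c1 c2 s T T2 Q :
  wp c1 s (fun s1 => ok c2 s1 T2 Q) -> tm c1 + T2 <= T -> ok (Seq c1 c2) s T Q.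
Proof. by move=> h hT; apply: okS (okWp h (leqnn _)) _ hT => s1 _. Qed.

(* The first argument of the invariant is the time budget that is left. *)
Lemma okWhile b c (I : nat -> state R -> Prop) v s T Q :
  I v s ->
  (forall v s', frame (While b c) s s' -> I v s' -> tsafe s' b) ->
  (forall v s', frame (While b c) s s' -> I v s' -> tden s' b ->
     exists T1, ok c s' T1 (fun s2 => exists2 v', I v' s2 & v' + T1 < v)) ->
  (forall v s', frame (While b c) s s' -> I v s' -> ~~ tden s' b -> Q s') ->
  v < T -> ok (While b c) s T Q.
Proof.
move=> Iv hs hb hQ.
(* Strong induction on the budget. An iteration takes [T1] steps and one more for the test, which is
   why the budget has to drop by more than [T1]. *)
have [k] := ubnP v; elim: k v s T Iv hs hb hQ => // k IH v s T Iv hs hb hQ hk hT.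
have sb := tevalE (hs v s (frame_refl _ _) Iv).
case E : (tden s b) sb => sb; last first.
  exists 1, s; split; first exact: ExecWhileF sb.
    exact: leq_ltn_trans hT.
  by apply: hQ Iv _ => //; rewrite E.
have [T1 [t1 [s1 [e1 ht1 [v' Iv' hv']]]]] := hb v s (frame_refl _ _) Iv E.
have F1 : frame (While b c) s s1 by apply: frame_sub (exec_frame e1).
have [t2 [s2 [e2 ht2 q2]]] : ok (While b c) s1 v'.+1 Q.
  apply: (IH v') => //.
  - by move=> v2 s2 F2; apply: hs; apply: frame_trans F2.
  - by move=> v2 s2 F2; apply: hb; apply: frame_trans F2.
  - by move=> v2 s2 F2; apply: hQ; apply: frame_trans F2.
  - by apply: leq_ltn_trans (leq_addr _ _) (leq_trans hv' _); rewrite -ltnS.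
exists (t1 + t2).+1, s2; split=> //; first exact: ExecWhileT sb e1 e2.
lia.
Qed.

Definition For i lo hi body : cmd :=
  Seq (WSet i lo)
    (While (TLt (WVar i) hi) (Seq body (WSet i (WAdd (WVar i) (WConst 1))))).

(** The summand 2 pays for the test and the increment of one iteration, the final 2 for the
    initialisation and the last test. The upper limit [hi] is evaluated anew in each iteration,
    hence it has to yield [b] in all states that the loop can reach. *)
Lemma okForS i lo hi body a b (I : nat -> state R -> Prop) f s T Q :
  i \notin wm body -> wsafe s lo -> wden s lo = a -> a <= b -> b < cap -> 1 < cap ->
  (forall s', frame (For i lo hi body) s s' -> wsafe s' hi /\ wden s' hi = b) ->
  I a (set_wvar s i a) ->
  (forall j s', a <= j < b -> wvar s' i = j -> frame (For i lo hi body) s s' ->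
     I j s' -> ok body s' (f j) (fun s2 => I j.+1 (set_wvar s2 i j.+1))) ->
  (forall s', wvar s' i = b -> frame (For i lo hi body) s s' -> I b s' -> Q s') ->
  \sum_(a <= j < b) (f j + 2) + 2 <= T ->
  ok (For i lo hi body) s T Q.
Proof.
move=> hi_ slo dlo ab bc c1 hhi I0 hbody hQ hT.
set c := For _ _ _ _ in hhi hbody hQ *.
apply: (@okS _ _ _ _ 1 (\sum_(a <= j < b) (f j + 2)).+1
         (fun s1 => s1 = set_wvar s i a)).
- by apply: okWp => //=; rewrite dlo.
- move=> s1 F1 E1.
  have F1' : frame c s s1 by apply: frame_seql.
  apply: (@okWhile _ _ (fun v s' => exists j, [/\ wvar s' i = j, a <= j <= b,
           I j s' & v = \sum_(j <= k < b) (f k + 2)])).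
  + by exists a; rewrite E1 /= /upd eqxx leqnn ab.
  + move=> v s' F2 [j [ij jb Ij _]] /=; split=> //.
    have F3 : frame c s s' by exact: frame_trans F1' (frame_seqr _ F2).
    by have [] := hhi s' F3.
  + move=> v s' F2 [j [ij /andP[aj _] Ij ->]] /=.
    have F3 : frame c s s' by exact: frame_trans F1' (frame_seqr _ F2).
    have [_ ->] := hhi s' F3; rewrite ij => jb.
    exists (f j + 1).
    apply: okS (hbody j s' _ ij F3 Ij) _ (leqnn _); first by rewrite aj.
    move=> s2 F4 I2; have i2 : wvar s2 i = j by rewrite (fr_w F4).
    apply: okWp => //=; split; first by rewrite i2; split=> //; lia.
    rewrite i2 addn1; exists (\sum_(j.+1 <= k < b) (f k + 2)).
      by exists j.+1; rewrite /= /upd eqxx; split=> //; lia.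
    rewrite [X in _ < X]big_ltn //; lia.
  + move=> v s' F2 [j [ij /andP[aj jb] Ij _]] /=.
    have F3 : frame c s s' by exact: frame_trans F1' (frame_seqr _ F2).
    have [_ ->] := hhi s' F3; rewrite ij -leqNgt => bj.
    have ejb : j = b by apply/eqP; rewrite eqn_leq jb.
    by subst j; apply: hQ F3 _; rewrite ?ejb ?ij // -ejb.
  + by [].
- by move: hT; lia.
Qed.

Lemma okFor i lo hi body a b (I : nat -> state R -> Prop) f s T Q :
  i \notin wm body -> wsafe s lo -> wden s lo = a -> a <= b -> b < cap -> 1 < cap ->
  (forall s', frame (For i lo hi body) s s' -> wsafe s' hi /\ wden s' hi = b) ->
  I a (set_wvar s i a) ->
  (forall j s', a <= j < b -> wvar s' i = j -> frame (For i lo hi body) s s' ->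
     I j s' -> ok body s' f (fun s2 => I j.+1 (set_wvar s2 i j.+1))) ->
  (forall s', wvar s' i = b -> frame (For i lo hi body) s s' -> I b s' -> Q s') ->
  (b - a) * (f + 2) + 2 <= T ->
  ok (For i lo hi body) s T Q.
Proof.
move=> h1 h2 h3 h4 h5 h6 h7 h8 h9 h10 h11.
apply: (okForS h1 h2 h3 h4 h5 h6 h7 h8 (f := fun=> f)) h10 _ => //.
by rewrite sum_nat_const_nat.
Qed.

(** A linked list with 0 as null pointer. For this reason edges, positions in near lists and stored
    pairs are all numbered from 1. *)
Fixpoint chain (nx : nat -> nat) e (l : seq nat) : Prop :=
  if l is x :: l' then [/\ e = x, x != 0 & chain nx (nx x) l'] else e = 0.

Lemma chain_ext nx nx' e l :
  {in l, nx =1 nx'} -> chain nx e l -> chain nx' e l.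
Proof.
elim: l e => //= x l IH e h [-> x0 hl]; split=> //.
rewrite -h ?mem_head //; apply: IH hl => y yl; apply: h.
by rewrite inE yl orbT.
Qed.

Definition ForL e hd nx body : cmd :=
  Seq (WSet e hd) (While (TNot (TEq (WVar e) (WConst 0)))
    (Seq body (WSet e (WRead nx (WVar e))))).

(** The invariant counts the processed entries. The body must establish it for every later value of
    [e], since the pointer is advanced only afterwards. The cost may depend on the entry, so that
    amortised bounds can be summed over the list. *)
Lemma okForLS e hd nx body l (I : nat -> state R -> Prop) f s T Q :
  e \notin wm body -> nx \notin wam body -> wsafe s hd -> 0 < cap ->
  chain (warr s nx) (wden s hd) l ->
  {in l, forall x, x < len} ->
  I 0 (set_wvar s e (wden s hd)) ->
  (forall j s', j < size l -> wvar s' e = nth 0 l j ->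
     frame (ForL e hd nx body) s s' -> I j s' ->
     ok body s' (f (nth 0 l j)) (fun s2 => forall v, I j.+1 (set_wvar s2 e v))) ->
  (forall s', frame (ForL e hd nx body) s s' -> I (size l) s' -> Q s') ->
  \sum_(x <- l) (f x + 2) + 2 <= T ->
  ok (ForL e hd nx body) s T Q.
Proof.
move=> he hnx shd cap0 hch hlen I0 hbody hQ hT.
set c := ForL _ _ _ _ in hbody hQ *.
apply: (@okS _ _ _ _ 1 (\sum_(x <- l) (f x + 2)).+1
         (fun s1 => s1 = set_wvar s e (wden s hd))).
- exact: okWp.
- move=> s1 F1 E1.
  have F1' : frame c s s1 by apply: frame_seql.
  have nx1 s' : frame c s s' -> warr s' nx = warr s nx.
    by move=> F; rewrite (fr_wa F) //= cats0.
  apply: (@okWhile _ _ (fun v s' => exists j, [/\ j <= size l,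
      chain (warr s nx) (wvar s' e) (drop j l),
      I j s' & v = \sum_(x <- drop j l) (f x + 2)])).
  + by exists 0; rewrite E1 /= /upd eqxx drop0.
  + by [].
  + move=> v s' F2 [j [jl ch Ij ->]] /= e0.
    have F3 : frame c s s' by exact: frame_trans F1' (frame_seqr _ F2).
    have jl' : j < size l.
      rewrite ltn_neqAle jl andbT; apply: contra e0 => /eqP jE.
      by move: ch; rewrite jE drop_size /= => ->.
    move: ch; rewrite (drop_nth 0) //= => -[eE nj0 ch].
    exists (f (nth 0 l j) + 1).
    apply: okS (hbody j s' jl' eE F3 Ij) _ (leqnn _) => s2 F4 I2.
    have e2 : wvar s2 e = nth 0 l j by rewrite (fr_w F4).
    apply: okWp => //=; rewrite e2; split.
      by split=> //; apply: hlen; rewrite mem_nth.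
    exists (\sum_(x <- drop j.+1 l) (f x + 2)); last by rewrite big_cons; lia.
    exists j.+1; split=> //=; rewrite /upd eqxx (fr_wa F4) // nx1 //.
  + move=> v s' F2 [j [jl ch Ij _]] /= /negPn/eqP e0.
    have F3 : frame c s s' by exact: frame_trans F1' (frame_seqr _ F2).
    apply: hQ F3 _.
    suff -> : size l = j by [].
    apply/eqP; rewrite eqn_leq jl andbT leqNgt; apply/negP => jl'.
    by move: ch; rewrite (drop_nth 0) //= e0 => -[<-].
  + by [].
- by move: hT; lia.
Qed.

End ProgramLogic.

(* [simpl] does not decide equality of numerals in applications of [upd]. *)
Ltac upds := repeat match goal with
  | |- context [@upd ?T ?f ?x ?v ?y] =>
      let b := eval lazy in (Nat.eqb y x) in
      match b with
      | true => change (@upd T f x v y) with v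
      | false => change (@upd T f x v y) with (f y)
      end
  | |- context [@upd2 ?T ?f ?x ?i ?v ?y] =>
      let b := eval lazy in (Nat.eqb y x) in
      match b with
      | true => change (@upd2 T f x i v y) with (upd (f y) i v)
      | false => change (@upd2 T f x i v y) with (f y)
      end
  end.
Ltac arith T := lazymatch T with
  | is_true (Order.le _ _) => fail
  | is_true (Order.lt _ _) => fail
  | is_true _ => idtac
  | @eq nat _ _ => idtac
  | ~ @eq nat _ _ => idtac
  | _ /\ _ => idtac
  | nat => idtac
  end.
(* [lia] on large contexts is slow unless the irrelevant hypotheses are
   cleared first. *)
Ltac nl := solve [
  lazymatch goal with |- ?T => arith T end;
  repeat match goal with
    | H : ?T |- _ => tryif arith T then fail else clear H
    end; lia].
Ltac spl := repeat match goal with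
  | |- True => constructor
  | |- _ /\ _ => split
  | |- and3 _ _ _ => split
  | |- and4 _ _ _ _ => split
  | |- and5 _ _ _ _ _ => split
  end.
Ltac sp := repeat progress (simpl; upds).
Ltac fr F := repeat (match type of F with
  | frame _ _ ?s' => match goal with
    | |- context [wvar s' ?x] => rewrite (fr_w F (x := x) isT)
    | |- context [rvar s' ?x] => rewrite (fr_r F (x := x) isT)
    | |- context [warr s' ?x] => rewrite (fr_wa F (x := x) isT)
    | |- context [rarr s' ?x] => rewrite (fr_ra F (x := x) isT)
    end end).

Lemma upd_eq T (f : nat -> T) x v : upd f x v x = v.
Proof. by rewrite /upd eqxx. Qed.

Lemma upd_neq T (f : nat -> T) x v y : y != x -> upd f x v y = f y.
Proof. by rewrite /upd => /negPf->. Qed.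

(** * Priority queue *)

Declare Scope cmd_scope.
Delimit Scope cmd_scope with cmd.
Local Notation "c1 ;; c2" := (Seq c1 c2)
  (at level 100, c2 at level 200, right associativity) : cmd_scope.
Local Notation "x ::= e" := (WSet x e) (at level 70) : cmd_scope.
Local Notation "x :+ y" := (WAdd x y) (at level 50, left associativity) : cmd_scope.
Local Notation V := WVar.
Local Notation C := WConst.

Local Notation vZ := 4.
Local Notation pi := 20.
Local Notation pl := 21.
Local Notation rK := 10.

(** A tournament tree: the key of [x] sits at the leaf [Z + x], inner nodes hold minima, and halving
    the index leads to the parent. Since positions never move, keys can be raised to infinity as
    easily as they are lowered. *)
Definition pq_set (x : wexp) (val : rexp) : cmd := (
  (pi ::= V vZ :+ x;;
   RStore rK (V pi) val;;
   pi ::= WDiv (V pi) (C 2));;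
  While (TLt (C 0) (V pi)) (
    pl ::= V pi :+ V pi;;
    If (TLe (RRead rK (V pl)) (RRead rK (V pl :+ C 1)))
      (RStore rK (V pi) (RRead rK (V pl)))
      (RStore rK (V pi) (RRead rK (V pl :+ C 1)));;
    pi ::= WDiv (V pi) (C 2)))%cmd.

(** A child that does not exceed its parent attains the minimum, so the descent follows it. The leaf
    reached has an index from [Z] to [2 Z - 1]; in the absence of subtraction, the remainder by [Z]
    recovers the key number. *)
Definition pq_argmin (x : nat) : cmd := (
  pi ::= C 1;;
  While (TLt (V pi) (V vZ)) (
    pl ::= V pi :+ V pi;;
    If (TLe (RRead rK (V pl)) (RRead rK (V pi)))
      (pi ::= V pl) (pi ::= V pl :+ C 1));;
  x ::= WMod (V pi) (V vZ))%cmd.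

Section PriorityQueue.
Variables (R : realType) (cap len : nat).
Implicit Types (s : state R).

(** [Z] may be any positive number: each index from 2 to [2 Z - 1] has its half between 1 and
    [Z - 1], so that all leaves lie below node 1. *)
Definition pqrep (Z : nat) (K key : nat -> \bar R) :=
  (forall i, i < Z -> K (Z + i) = key i) /\
  (forall i, 0 < i < Z -> K i = Order.min (K (i + i)) (K (i + i + 1))).

Lemma pqrep_ext Z K key key' :
  (forall i, i < Z -> key i = key' i) -> pqrep Z K key -> pqrep Z K key'.
Proof. by move=> h [h1 h2]; split=> // i iZ; rewrite h1 // h. Qed.

Lemma pqrep_min Z K key j : pqrep Z K key -> 0 < j < Z + Z -> (K 1%N <= K j)%E.
Proof.
move=> [_ h]; have [k] := ubnP j; elim: k j => // k IH j jk j0.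
have [j1|j1] := leqP j 1; first by have -> : j = 1 by lia.
have e : j = j./2 + j./2 + odd j by rewrite addnn addnC odd_double_half.
have hj : 0 < j./2 < Z by lia.
apply: le_trans (IH j./2 _ _) _; [lia|lia|rewrite (h _ hj)].
rewrite {5}e; by case: (odd j); rewrite ?addn0 ge_min lexx ?orbT.
Qed.

Lemma pq_setP s x val Z key :
  wsafe cap len s x -> rsafe cap len (set_wvar s pi (Z + wden s x)) val ->
  wvar s vZ = Z -> wden s x < Z -> Z + Z <= len -> len < cap -> 2 < cap ->
  pqrep Z (rarr s rK) key ->
  ok cap len (pq_set x val) s (5 * trunc_log 2 Z + 9) (fun s' =>
     pqrep Z (rarr s' rK)
       (upd key (wden s x) (rden (set_wvar s pi (Z + wden s x)) val))).
Proof.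
move=> sx sv eZ xZ hlen hcap cap2 [h1 h2].
set y := wden s x in sv xZ *; set vv := rden (set_wvar s pi (Z + y)) val.
(* On the way up the minimum equation may fail at the current node only. Once the index has become 0
   it holds everywhere. *)
pose J s' := [/\ wvar s' pi < Z,
  (forall i, i < Z -> rarr s' rK (Z + i) = upd key y vv i) &
  (forall i, 0 < i < Z -> i != wvar s' pi ->
     rarr s' rK i = Order.min (rarr s' rK (i + i)) (rarr s' rK (i + i + 1)))].
apply: (okWpS (T2 := 5 * trunc_log 2 Z + 6)); last by rewrite /=; lia.
sp; rewrite eZ -/y; do !split=> //; try lia.
set s1 := (X in ok _ _ _ X).
apply: (okWhile (I := fun v s' => J s' /\
   v = if 0 < wvar s' pi then 5 * (trunc_log 2 (wvar s' pi)).+1 else 0)).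
- split; last reflexivity; split=> /=.
  + by rewrite upd_eq; lia.
  + by move=> i iZ; sp; rewrite /upd eqn_add2l; case: eqP => // _; rewrite h1.
  + by move=> i iZ; sp => ne; rewrite !upd_neq; [exact: h2|lia..].
- by move=> v s' F [[? _ _] _] /=; lia.
- move=> v s' F [[piZ j1 j2] ->] /= pi0; rewrite pi0.
  exists 4; have eZ' : wvar s' vZ = Z by fr F; rewrite /s1; sp.
  set i := wvar s' pi in piZ j2 pi0 *.
  have hlog : 1 < i -> trunc_log 2 i = (trunc_log 2 (i %/ 2)).+1.
    by move=> i1; rewrite divn2 trunc_log2S.
  have budget : (if 0 < i %/ 2 then 5 * (trunc_log 2 (i %/ 2)).+1 else 0) + 4
      < 5 * (trunc_log 2 i).+1.
    by case: ifP => hh; [rewrite (hlog _); lia|lia].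
  apply: okWp => //; sp; rewrite -/i; do !split=> //; try lia.
  have JJ z : z = Order.min (rarr s' rK (i + i)) (rarr s' rK (i + i + 1)) ->
     J (set_wvar (set_rarr (set_wvar s' pl (i + i)) rK i z) pi (i %/ 2)).
    move=> ez; split=> /=; first by rewrite upd_eq; lia.
      by move=> k kZ; sp; rewrite /upd ifF ?j1 //; lia.
    move=> k kZ; sp => nk; case: (eqVneq k i) => [->|nki].
      by rewrite upd_eq !upd_neq //; lia.
    by rewrite !upd_neq; [exact: j2|lia..].
  case: ifP => hle; sp; rewrite -/i; do !split=> //; try lia;
    eexists; try exact: budget; split; sp; rewrite ?upd_eq //;
    apply: JJ; rewrite minEle hle //.
- move=> v s' F [[piZ j1 j2] _] /= pi0; split=> // i iZ; apply: j2 => //; lia.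
- have : trunc_log 2 ((Z + y) %/ 2) <= trunc_log 2 Z by apply: leq_trunc_log; lia.
  by rewrite /= upd_eq; case: ifP; lia.
Qed.

Lemma pq_argminP s x Z key :
  wvar s vZ = Z -> 0 < Z -> Z + Z <= len -> len < cap -> 2 < cap ->
  pqrep Z (rarr s rK) key ->
  x != vZ -> x != pi ->
  ok cap len (pq_argmin x) s (4 * trunc_log 2 Z + 7) (fun s' =>
    [/\ wvar s' x < Z, key (wvar s' x) = rarr s rK 1 &
      forall i, i < Z -> (key (wvar s' x) <= key i)%E]).
Proof.
move=> eZ Z0 hlen hcap cap2 hrep xZ xpi; have [h1 h2] := hrep.
apply: (okWpS (T2 := 4 * trunc_log 2 Z + 6)); last by rewrite /=; lia.
sp; split; first lia.
set s1 := (X in ok _ _ _ X).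
have eZ1 : wvar s1 vZ = Z by rewrite /s1; sp.
apply: (okS (T1 := 4 * (trunc_log 2 Z).+1 + 1) (T2 := 1) (Q1 := fun s' =>
  Z <= wvar s' pi < Z + Z /\ rarr s rK (wvar s' pi) = rarr s rK 1)).
- apply: (okWhile (I := fun v s' => [/\ 0 < wvar s' pi < Z + Z,
    rarr s rK (wvar s' pi) = rarr s rK 1 &
    v = 4 * ((trunc_log 2 Z).+1 - trunc_log 2 (wvar s' pi))])).
  + by rewrite /s1 /= upd_eq; split=> //; lia.
  + by [].
  + move=> v s' F [pi0 hk ->] /=; fr F; rewrite eZ1; set i := wvar s' pi in pi0 hk *.
    move=> iZ; exists 3.
    have eK : rarr s' rK = rarr s rK by fr F.
    have hi : rarr s rK i = _ := h2 i ltac:(lia).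
    have l1 : trunc_log 2 (i + i) = (trunc_log 2 i).+1.
      by rewrite addnn trunc_log2_double //; lia.
    have l2 : trunc_log 2 (i + i + 1) = (trunc_log 2 i).+1.
      by rewrite trunc_log2S ?addnn ?addn1 /= ?uphalf_double //; lia.
    have l3 : trunc_log 2 i <= trunc_log 2 Z by apply: leq_trunc_log; lia.
    apply: okWp => //; sp; rewrite -/i eK; do !split=> //; try lia.
    case: ifP => hle; sp; do !split=> //; try lia;
      eexists; try (split; [| |reflexivity]); rewrite ?l1 ?l2; try lia.
      rewrite -hk; apply/le_anti; rewrite hle /= hi ge_min lexx //.
    rewrite -hk hi minEle ifF //; apply: contraFF hle => h; rewrite hi.
    by rewrite minEle h.
  + move=> v s' F [pi0 hk _] /=; fr F; rewrite eZ1 => h; split=> //; lia.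
  + lia.
- move=> s2 F [hp hk]; apply: okWp => //; sp; do !split=> //; rewrite upd_eq;
    fr F; rewrite eZ1.
  + by rewrite ltn_mod.
  + rewrite -hk -h1 ?ltn_mod //; congr (rarr s rK _).
    have e : wvar s2 pi = (wvar s2 pi - Z) + Z by lia.
    by rewrite {1}e modnDr modn_small; lia.
  + move=> i iZ.
    have -> : wvar s2 pi %% Z = wvar s2 pi - Z.
      have e : wvar s2 pi = (wvar s2 pi - Z) + Z by lia.
      by rewrite {1}e modnDr modn_small; lia.
    rewrite -!h1 ?(subnKC _); try lia.
    by rewrite hk; apply: pqrep_min hrep _; lia.
- lia.
Qed.

End PriorityQueue.

(** * Truncated Dijkstra *)

(** All that the algorithms know about the renamed graph; walks no longer occur. The law [gd_cut]
    takes the place of a shortest walk and is true of an infimum over walks. The inequality [gNZ]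
    lets one queue of size [gZ] serve vertices as well as edges. *)
Record mgraph (R : realType) := MGraph {
  gN : nat;
  gZ : nat;
  gs : nat -> nat;
  gt : nat -> nat;
  gw : nat -> \bar R;
  gd : nat -> nat -> \bar R;
  gNZ : gN <= gZ;
  gs_lt : forall e, 0 < e < gZ -> gs e < gN;
  gt_lt : forall e, 0 < e < gZ -> gt e < gN;
  g_irr : forall e, 0 < e < gZ -> gs e != gt e;
  g_inj : forall e e', 0 < e < gZ -> 0 < e' < gZ -> gs e = gs e' ->
    gt e = gt e' -> e = e';
  gw_ge0 : forall e, 0 < e < gZ -> (0 <= gw e)%E;
  gw_fin : forall e, 0 < e < gZ -> (gw e < +oo)%E;
  gd0 : forall i, i < gN -> gd i i = 0%E;
  gd_ge0 : forall i j, (0 <= gd i j)%E;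
  gd_sym : forall i j, gd i j = gd j i;
  gd_tri : forall i j k, j < gN -> (gd i k <= gd i j + gd j k)%E;
  gd_edge : forall e, 0 < e < gZ -> (gd (gs e) (gt e) <= gw e)%E;
  (* Every walk that leaves [S] crosses some edge of the cut. *)
  gd_cut : forall (S : pred nat) i j M, i < gN -> j < gN -> S i -> ~~ S j ->
    (forall e, 0 < e < gZ -> S (gs e) -> ~~ S (gt e) ->
       (M <= gd i (gs e) + gw e + gd (gt e) j)%E) -> (M <= gd i j)%E }.

Section DijkstraInvariant.
Variables (R : realType) (g : mgraph R).
Local Notation N := (gN g).
Local Notation Z := (gZ g).
Local Notation dl := (gd g).
Variables (F : nat -> seq nat) (src lim : nat).
Hypothesis src_lt : src < N.
Hypothesis F_edge : forall x e, x < N -> e \in F x -> (0 < e < Z) && (gs g e == x).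
(* The lists [F] may omit edges, but never the lightest way out of a set of
   fewer than [lim] vertices. *)
Hypothesis F_cut : forall S : seq nat, uniq S -> {in S, forall x, x < N} ->
  size S < lim -> src \in S ->
  forall e, 0 < e < Z -> gs g e \in S -> gt g e \notin S ->
  exists2 e', e' \in F (gs g e) & (gt g e' \notin S) && (gw g e' <= gw g e)%E.

(** [S] holds the settled vertices in the order of settling, [PE x] the edges of a settled [x] that
    are already relaxed, and [D] the tentative distances. The touched vertices [tl] are recorded so
    that cleaning up costs no more than the search itself, instead of [N]. *)
Record dinv (S : seq nat) (PE : nat -> seq nat) (D : nat -> \bar R)
    (tl : seq nat) : Prop := DInv {
  di_uniq : uniq S;
  di_lt : {in S, forall x, x < N};
  di_sort : forall i j, i <= j < size S ->
    (dl src (nth 0%N S i) <= dl src (nth 0%N S j))%E;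
  di_far : forall x z, x \in S -> z < N -> z \notin S ->
    (dl src x <= dl src z)%E;
  di_eq : forall x, x \in S -> D x = dl src x /\ (dl src x < +oo)%E;
  di_ge : forall z, z < N -> (dl src z <= D z)%E;
  di_rel : forall x e, x \in S -> e \in PE x -> (D (gt g e) <= dl src x + gw g e)%E;
  di_src : (D src <= 0)%E;
  di_tlu : uniq tl;
  di_tl : forall z, (z \in tl) = (z < N) && (D z < +oo)%E;
  di_tls : forall z, z \in tl ->
    z = src \/ exists x e, [/\ x \in S, e \in PE x & gt g e = z] }.

Definition dkey (S : seq nat) (D : nat -> \bar R) z : \bar R :=
  if (z < N) && (z \notin S) then D z else +oo%E.

Lemma dinv_init D : (forall x, x < N -> D x = +oo%E) ->
  dinv [::] F (upd D src 0%E) [:: src].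
Proof.
move=> hD; split=> //=.
- by move=> i j; lia.
- move=> z zN; rewrite /upd; case: eqP => [->|_]; first by rewrite gd0.
  by rewrite hD // leey.
- by rewrite upd_eq.
- move=> z; rewrite inE /upd; case: eqP => [->|_]; first by rewrite src_lt ltry.
  by case: ltnP => // zN; rewrite hD // ltxx.
- by move=> z; rewrite inE => /eqP->; left.
Qed.

(** A walk to [z] has to leave [S] along some edge. By [F_cut] the same vertex has a listed edge
    that leaves [S] and is no heavier, and the head of that edge has been relaxed. If the source is
    still unsettled, then [M] is at most 0. *)
Lemma dinv_far S D tl M : dinv S F D tl -> size S < lim ->
  (forall z, z < N -> z \notin S -> (M <= D z)%E) ->
  forall z, z < N -> z \notin S -> (M <= dl src z)%E.
Proof.
move=> I hs hM z zN zS; have [srcS|srcS] := boolP (src \in S); last first.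
  by apply: le_trans (hM _ src_lt srcS) _; apply: le_trans (di_src I) (gd_ge0 _ _ _).
apply: (@gd_cut _ g (mem S)) => // e he eS eT.
have [e' e'F /andP[e'S hw]] := F_cut (di_uniq I) (di_lt I) hs srcS he eS eT.
have /andP[he' _] := F_edge (gs_lt he) e'F.
apply: le_trans (hM _ (gt_lt he') e'S) _.
apply: le_trans (di_rel I eS e'F) _.
apply: le_trans (leeDl _ (gd_ge0 _ _ _)).
exact: leeD.
Qed.

(** With the least key as [M], [dinv_far] makes the key of [z0] exact and puts all other unsettled
    vertices at least as far away. The edges of [z0] are still to be relaxed, hence the empty
    list. *)
Lemma dinv_pop S D tl z0 : dinv S F D tl -> size S < lim ->
  z0 < Z -> (dkey S D z0 < +oo)%E ->
  (forall i, i < Z -> (dkey S D z0 <= dkey S D i)%E) ->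
  [/\ z0 < N, z0 \notin S & dinv (rcons S z0)
    (fun y => if y == z0 then [::] else F y) D tl].
Proof.
move=> I hs z0Z; rewrite {1}/dkey; case: ifP => [/andP[z0N z0S] Dfin|_]; last by rewrite ltxx.
rewrite {1}/dkey z0N z0S /= => hmin.
have hM z : z < N -> z \notin S -> (D z0 <= D z)%E.
  move=> zN zS; have := hmin z (leq_trans zN (gNZ g)).
  by rewrite /dkey zN zS.
have far := dinv_far I hs hM.
have Dz0 : D z0 = dl src z0.
  by apply/le_anti; rewrite far //= (di_ge I).
split=> //; split; try by case: I.
- by rewrite rcons_uniq z0S (di_uniq I).
- by move=> x; rewrite mem_rcons inE => /orP[/eqP->//|/(di_lt I)].
- move=> i j; rewrite size_rcons !nth_rcons => /andP[ij].
  rewrite ltnS leq_eqVlt => /orP[/eqP jS|jS].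
    rewrite jS ltnn eqxx; case: ltnP => iS.
      by apply: (di_far I) => //; rewrite mem_nth.
    by rewrite ifT //; apply/eqP/anti_leq; rewrite iS -jS ij.
  by rewrite jS (leq_ltn_trans ij jS); apply: (di_sort I); rewrite ij.
- move=> x z; rewrite !mem_rcons !inE negb_or => /orP[/eqP->|xS] zN /andP[_ zS].
    by rewrite -Dz0 far.
  exact: (di_far I).
- move=> x; rewrite mem_rcons inE => /orP[/eqP->|]; last exact: (di_eq I).
  by rewrite -Dz0.
- move=> x e; rewrite mem_rcons inE; case: eqP => //= _; exact: (di_rel I).
- move=> z /(di_tls I)[->|[x [e [xS eF <-]]]]; first by left.
  right; exists x, e; rewrite mem_rcons inE xS orbT; split=> //.
  by case: eqP => // xz; rewrite xz (negPf z0S) in xS.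
Qed.

(** Every touched vertex other than the source is the head of some relaxed edge; this pays for the
    clean-up. *)
Lemma dinv_touched S D tl : dinv S F D tl ->
  size tl <= (\sum_(x <- S) size (F x)).+1.
Proof.
move=> I; have -> : \sum_(x <- S) size (F x) =
    size (flatten [seq [seq gt g e | e <- F x] | x <- S]).
  rewrite size_flatten /shape -map_comp sumnE big_map.
  by apply: eq_bigr => x _; rewrite /= size_map.
rewrite -[_.+1]/(size (src :: _)); apply: uniq_leq_size (di_tlu I) _ => z zt.
rewrite inE; have [->|[x [e [xS eF <-]]]] := di_tls I zt; first by rewrite eqxx.
by apply/orP; right; apply/flatten_mapP; exists x => //; apply: map_f.
Qed.

Section Relax.
Variables (S tl : seq nat) (D : nat -> \bar R) (x j : nat).
Hypothesis xS : x \in S.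
Hypothesis jF : j < size (F x).
Let PE k y := if y == x then take k (F x) else F y.
Hypothesis I : dinv S (PE j) D tl.
Let e := nth 0 (F x) j.
Let nd : \bar R := (D x + gw g e)%E.

Let eF : e \in F x. Proof. exact: mem_nth. Qed.
Let xN : x < N. Proof. exact: (di_lt I). Qed.
Let he : 0 < e < Z. Proof. by have /andP[] := F_edge xN eF. Qed.
Let hes : gs g e = x. Proof. by have /andP[_ /eqP] := F_edge xN eF. Qed.

Lemma dinv_skip : (D (gt g e) <= nd)%E -> dinv S (PE j.+1) D tl.
Proof.
move=> h; case: (I); rewrite -/PE => I1 I2 I3 I4 I5 I6 I7 I8 I9 I10 I11; split=> //; last first.
  move=> z /I11[->|[y [f [yS yF <-]]]]; [by left|right; exists y, f; split=> //].
  by move: yF; rewrite /PE; case: eqP => // _ yF; rewrite (take_nth 0) // mem_rcons inE yF orbT.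
move=> y f yS.
have := I7 y f yS; rewrite /PE; case: eqP => // ->; rewrite (take_nth 0) // mem_rcons inE.
move=> h1 /orP[/eqP->|/h1//]; rewrite -(I5 x xS).1 //.
Qed.

Lemma dinv_relax : (nd < D (gt g e))%E ->
  [/\ gt g e \notin S, (nd < +oo)%E & dinv S (PE j.+1) (upd D (gt g e) nd)
       (if (D (gt g e) < +oo)%E then tl else rcons tl (gt g e))].
Proof.
move=> h; set y := gt g e in h *.
have yN : y < N := gt_lt he.
have ndfin : (nd < +oo)%E by apply: lt_le_trans h (leey _).
have hnd : (dl src y <= nd)%E.
  have h3 : (dl src y <= dl src x + dl x y)%E by exact: gd_tri.
  apply: le_trans h3 _; rewrite /nd (di_eq I xS).1 //.
  by apply: leeD => //; have := gd_edge he; rewrite hes.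
(* The tentative value of a settled vertex is its distance already, and no walk through [x] can be
   shorter. *)
have yS : y \notin S.
  apply/negP => yS; have [Dy _] := di_eq I yS.
  by have := lt_le_trans h (eq_ind_r (fun t => (t <= nd)%E) hnd Dy); rewrite ltxx.
case: (I); rewrite -/PE => I1 I2 I3 I4 I5 I6 I7 I8 I9 I10 I11.
have ne z : z \in S -> z != y by apply: contraTneq => ->.
split=> //; split=> //.
- by move=> z zS; rewrite upd_neq ?ne //; apply: I5.
- by move=> z zN; rewrite /upd; case: eqP => [->//|_]; apply: I6.
- move=> z f zS hf.
  have [fE|fE] := eqVneq (gt g f) y.
    rewrite fE upd_eq.
    move: hf; rewrite /PE; case: (eqVneq z x) => zx.
      rewrite (take_nth 0) // mem_rcons inE => /orP[/eqP->|hf].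
        by rewrite zx -(I5 x xS).1.
      rewrite zx; apply/ltW/(lt_le_trans h); rewrite -fE.
      by apply: I7 => //; rewrite /PE eqxx.
    by move=> hf; apply/ltW/(lt_le_trans h); rewrite -fE; apply: I7 => //;
      rewrite /PE (negPf zx).
  rewrite upd_neq //; move: hf; rewrite /PE; case: (eqVneq z x) => zx hf.
    apply: I7 => //; rewrite /PE zx eqxx.
    move: hf; rewrite (take_nth 0) // mem_rcons inE => /orP[/eqP fe|//].
    by rewrite fe eqxx in fE.
  by apply: I7 => //; rewrite /PE (negPf zx).
- by rewrite /upd; case: eqP => // sy; apply: ltW; apply: lt_le_trans h _; rewrite -sy.
- by case: ifP => // hy; rewrite rcons_uniq I10 yN hy I9.
- move=> z; case: ifP => hy; rewrite ?mem_rcons ?inE I10 /upd; case: (eqVneq z y) => //=.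
  + by move->; rewrite yN ndfin hy.
  + by move->; rewrite yN ndfin.
- have old z : z \in tl ->
      z = src \/ exists x0 e0, [/\ x0 \in S, e0 \in PE j.+1 x0 & gt g e0 = z].
    move=> /I11[->|[y' [f [yS' yF <-]]]]; [by left|right; exists y', f; split=> //].
    by move: yF; rewrite /PE; case: eqP => // _ yF; rewrite (take_nth 0) // mem_rcons inE yF orbT.
  move=> z; case: ifP => hy; first exact: old.
  rewrite mem_rcons inE => /orP[/eqP->|]; last exact: old.
  right; exists x, e; split=> //.
  by rewrite /PE eqxx (take_nth 0) // mem_rcons mem_head.
Qed.

End Relax.
End DijkstraInvariant.

Local Notation vN := 3.
Local Notation dsrc := 22.
Local Notation dlim := 23.
Local Notation op := 24.
Local Notation dk := 25.
Local Notation dx := 26.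
Local Notation de := 27.
Local Notation dy := 28.
Local Notation tc := 29.
Local Notation rnd := 1.
Local Notation aS := 2.
Local Notation aT := 3.
Local Notation oV := 8.
Local Notation tch := 20.
Local Notation rW := 1.
Local Notation rD := 11.
Local Notation oD := 12.

Definition relax : cmd := (
  dy ::= WRead aT (V de);;
  RSet rnd (RAdd (RRead rD (V dx)) (RRead rW (V de)));;
  If (TLe (RRead rD (V dy)) (RVar rnd)) Skip (
    (If (TLe RInfty (RRead rD (V dy)))
       (WStore tch (V tc) (V dy);; tc ::= V tc :+ C 1) Skip;;
     RStore rD (V dy) (RVar rnd));;
    pq_set (V dy) (RVar rnd)))%cmd.

Definition dij_step (hd nx : nat) : cmd := (
  pq_argmin dx;;
  pq_set (V dx) RInfty;;
  (WStore oV (V op) (V dx);;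
   RStore oD (V op) (RRead rD (V dx));;
   op ::= V op :+ C 1;;
   dk ::= V dk :+ C 1);;
  ForL de (WRead hd (V dx)) nx relax)%cmd.

Definition dij (hd nx : nat) : cmd := (
  (RStore rD (V dsrc) RZero;;
   WStore tch (C 0) (V dsrc);;
   tc ::= C 1;;
   dk ::= C 0);;
  pq_set (V dsrc) RZero;;
  While (TAnd (TLt (V dk) (V dlim)) (TNot (TLe RInfty (RRead rK (C 1)))))
    (dij_step hd nx))%cmd.

Definition dij_clean : cmd := (
  For de (C 0) (V tc) (
    dy ::= WRead tch (V de);;
    RStore rD (V dy) RInfty;;
    pq_set (V dy) RInfty))%cmd.

Lemma mkseq_upd T (f : nat -> T) i v k : k <= i -> mkseq (upd f i v) k = mkseq f k.
Proof.
move=> ki; apply/eq_in_map => j; rewrite mem_iota /= => jk.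
by rewrite upd_neq //; apply/eqP; lia.
Qed.

Lemma uniq_lt_size (N : nat) (l : seq nat) :
  uniq l -> {in l, forall x, x < N} -> size l <= N.
Proof.
move=> ul hl; rewrite -(size_iota 0 N); apply: uniq_leq_size => // x xl.
by rewrite mem_iota hl.
Qed.

Definition gst (R : realType) (g : mgraph R) (s : state R) :=
  [/\ wvar s vN = gN g, wvar s vZ = gZ g,
      forall e, 0 < e < gZ g -> warr s aS e = gs g e,
      forall e, 0 < e < gZ g -> warr s aT e = gt g e &
      forall e, 0 < e < gZ g -> rarr s rW e = gw g e].

Definition lists N (hd nx : nat -> nat) (F : nat -> seq nat) :=
  forall x, x < N -> chain nx (hd x) (F x).

Section Dijkstra.
Variables (R : realType) (g : mgraph R) (cap len : nat).
Local Notation N := (gN g).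
Local Notation Z := (gZ g).
Local Notation dl := (gd g).
Variables (F : nat -> seq nat) (src lim hd nx p0 : nat).
Hypothesis src_lt : src < N.
Hypothesis F_edge : forall x e, x < N -> e \in F x -> (0 < e < Z) && (gs g e == x).
Hypothesis F_cut : forall S : seq nat, uniq S -> {in S, forall x, x < N} ->
  size S < lim -> src \in S ->
  forall e, 0 < e < Z -> gs g e \in S -> gt g e \notin S ->
  exists2 e', e' \in F (gs g e) & (gt g e' \notin S) && (gw g e' <= gw g e)%E.
Hypothesis Z_len : Z + Z <= len.
Hypothesis len_cap : len < cap.
Hypothesis cap2 : 2 < cap.
Hypothesis p0_len : p0 + N <= len.
Hypothesis hd_fresh : (hd != tch) && (hd != oV).
Hypothesis nx_fresh : (nx != tch) && (nx != oV).

Variable s0 : state R.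

(** The settled vertices are appended from position [p0] on to output arrays that all runs share;
    [ds_v0] and [ds_d0] protect the lists of earlier runs. *)
Record dst (S : seq nat) PE (s : state R) : Prop := DSt {
  ds_inv : dinv g src S PE (rarr s rD) (mkseq (warr s tch) (wvar s tc));
  ds_pq : pqrep Z (rarr s rK) (dkey g S (rarr s rD));
  ds_k : wvar s dk = size S;
  ds_kl : size S <= lim;
  ds_op : wvar s op = p0 + size S;
  ds_v : forall i, i < size S -> warr s oV (p0 + i) = nth 0 S i;
  ds_d : forall i, i < size S -> rarr s oD (p0 + i) = dl src (nth 0 S i);
  ds_v0 : forall p, p < p0 -> warr s oV p = warr s0 oV p;
  ds_d0 : forall p, p < p0 -> rarr s oD p = rarr s0 oD p }.

Local Notation tl := (trunc_log 2 Z).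

Lemma dst_ext S PE s s' :
  wvar s' tc = wvar s tc -> wvar s' dk = wvar s dk -> wvar s' op = wvar s op ->
  warr s' tch = warr s tch -> warr s' oV = warr s oV ->
  rarr s' rD = rarr s rD -> rarr s' oD = rarr s oD ->
  pqrep Z (rarr s' rK) (dkey g S (rarr s rD)) ->
  dst S PE s -> dst S PE s'.
Proof.
by move=> e1 e2 e3 e4 e5 e6 e7 h []; rewrite -e1 -e2 -e3 -e4 -e5 -e6 -e7 => *; split=> //; rewrite e6.
Qed.

Lemma relaxP S x j s : gst g s -> x \in S -> j < size (F x) ->
  wvar s dx = x -> wvar s de = nth 0 (F x) j ->
  dst S (fun y => if y == x then take j (F x) else F y) s ->
  ok cap len relax s (5 * tl + 17) (fun s' =>
    dst S (fun y => if y == x then take j.+1 (F x) else F y) s').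
Proof.
move=> [eN eZ eS eT eW] xS jF ex ee H.
case: (H) => I P K KL OP HV HD HV0 HD0.
set e := nth 0 (F x) j in ee.
have xN := di_lt I xS.
have eF : e \in F x by apply: mem_nth.
have /andP[he /eqP hes] := F_edge xN eF.
have yN := gt_lt he; have NZ := gNZ g.
have tlN := uniq_lt_size (di_tlu I) _.
rewrite /relax; apply: (okWpS (T2 := 5 * tl + 15)); last by rewrite /=; lia.
sp; rewrite ee eT //; do !split=> //; try nl.
apply: (okWpS (T2 := 5 * tl + 14)); last by rewrite /=; lia.
sp; rewrite ex ee eW //; do !split=> //; try nl.
apply: (okIf (T1 := 5 * tl + 13)) => //; sp.
- by do !split=> //; lia.
- move=> hle; apply: okWp => //; have I' := dinv_skip xS jF I hle.
  apply: (dst_ext (s := s)) => //.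
- rewrite -ltNge => hlt; have [yS ndfin I'] := dinv_relax F_edge xS jF I hlt.
  apply: (okWpS (T2 := 5 * tl + 9)); last by rewrite /=; lia.
  set y := gt g e in yN yS I' hlt *; set nd := (_ + _)%E in ndfin I' hlt *.
  (* A vertex touched for the first time prolongs a duplicate-free list of vertices, so the list had
     fewer than [N] entries and the store is in range. *)
  have tN : (+oo <= rarr s rD y)%E -> wvar s tc < N.
    rewrite leye_eq => /eqP hoo; have := uniq_lt_size (di_tlu I').
    rewrite hoo ltxx size_rcons size_mkseq; apply => z.
    by move: (di_tl I' z); rewrite hoo ltxx => -> /andP[].
  have mk : mkseq (if (+oo <= rarr s rD y)%E then upd (warr s tch) (wvar s tc) y else warr s tch)
      (if (+oo <= rarr s rD y)%E then wvar s tc + 1 else wvar s tc) =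
      if (rarr s rD y < +oo)%E then mkseq (warr s tch) (wvar s tc)
      else rcons (mkseq (warr s tch) (wvar s tc)) y.
    rewrite leNgt; case: (rarr s rD y < +oo)%E => //=.
    by rewrite addn1 mkseqS upd_eq mkseq_upd.
  have fin s1 : wvar s1 dk = wvar s dk -> wvar s1 op = wvar s op ->
     warr s1 oV = warr s oV -> rarr s1 oD = rarr s oD ->
     wvar s1 tc = (if (+oo <= rarr s rD y)%E then wvar s tc + 1 else wvar s tc) ->
     warr s1 tch = (if (+oo <= rarr s rD y)%E then upd (warr s tch) (wvar s tc) y else warr s tch) ->
     rarr s1 rD = upd (rarr s rD) y nd ->
     pqrep Z (rarr s1 rK) (upd (dkey g S (rarr s rD)) y nd) ->
     dst S (fun y => if y == x then take j.+1 (F x) else F y) s1.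
    move=> f1 f2 f3 f4 e1 e2 e3 e4; split; rewrite ?e1 ?e2 ?e3 ?mk ?f1 ?f2 ?f3 ?f4 //.
    apply: pqrep_ext e4 => i iZ; rewrite /dkey /upd.
    by case: eqP => // ->; rewrite yN yS.
  sp; do !split=> //; try nl.
  have yZ : y < Z := leq_trans yN NZ.
  case: ifP => hoo; [have tN1 := tN hoo|]; sp; do !split=> //; try nl.
  + apply: okW (pq_setP (Z := Z) (key := dkey g S (rarr s rD)) _ _ _ _ _ _ _ _) _ _ => //; sp => //.
    by move=> s' Fr hpq; apply: fin; rewrite ?hoo //; fr Fr.
  + apply: okW (pq_setP (Z := Z) (key := dkey g S (rarr s rD)) _ _ _ _ _ _ _ _) _ _ => //; sp => //.
    by move=> s' Fr hpq; apply: fin; rewrite ?hoo //; fr Fr.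
- lia.
Qed.

Lemma dij_stepP S s : gst g s -> lists N (warr s hd) (warr s nx) F ->
  dst S F s -> size S < lim -> (rarr s rK 1 < +oo)%E ->
  exists z0, [/\ z0 < N, z0 \notin S &
    ok cap len (dij_step hd nx) s ((size (F z0)).+1 * (9 * tl + 30))
      (dst (rcons S z0) F)].
Proof.
move=> hg hl H hS hK; have [eN eZ eS eT eW] := hg.
have NZ := gNZ g; have Z0 : 0 < Z by lia.
have [t1 [s1 [ex1 ht1 [xZ kx kmin]]]] :=
  pq_argminP eZ Z0 Z_len len_cap cap2 (ds_pq H) (isT : dx != vZ) (isT : dx != pi).
have F1 := exec_frame ex1.
set z0 := wvar s1 dx in xZ kx kmin.
have [|z0N z0S I1] := dinv_pop src_lt F_edge F_cut (ds_inv H) hS xZ _ kmin.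
  by rewrite kx.
exists z0; split=> //.
have sz0 : size (rcons S z0) <= N.
  by apply: uniq_lt_size (di_uniq I1) _ => x /(di_lt I1).
rewrite size_rcons in sz0.
set f := size (F z0).
apply: (okS (T1 := 4 * tl + 7) (T2 := 5 * tl + 23 + f * (5 * tl + 19))
  (Q1 := fun s' => s' = s1)); first by exists t1, s1.
  move=> s2 _ ->.
  apply: (okS (T2 := 14 + f * (5 * tl + 19))); first apply:
    (pq_setP (Z := Z) (key := dkey g S (rarr s rD))) => //.
  - by fr F1.
  - by fr F1; apply: ds_pq H.
  - move=> s3 F3; rewrite /= -/z0 => hpq.
    have F13 x : x \notin wam (pq_argmin dx) -> x \notin wam (pq_set (V dx) RInfty) ->
       warr s3 x = warr s x by move=> h1 h2; rewrite (fr_wa F3) // (fr_wa F1).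
    apply: (okWpS (T2 := 10 + f * (5 * tl + 19))); last by rewrite /=; lia.
    have e3x : wvar s3 dx = z0 by fr F3.
    have e3o : wvar s3 op = p0 + size S by fr F3; fr F1; apply: ds_op H.
    have e3k : wvar s3 dk = size S by fr F3; fr F1; apply: ds_k H.
    sp; rewrite e3x e3o e3k; do !split=> //; try nl.
    have e3D : rarr s3 rD = rarr s rD by fr F3; fr F1.
    have D0 : dst (rcons S z0) (fun y => if y == z0 then take 0 (F z0) else F y)
      (set_wvar (set_wvar (set_rarr (set_warr s3 8 (p0 + size S) z0) 12
                   (p0 + size S) (rarr s3 11 z0))
                24 (p0 + size S + 1)) 25 (size S + 1)).
      case: (H) => I P K KL OP HV HD HV0 HD0.
      split; sp; rewrite ?size_rcons //.
      + by rewrite e3D take0; fr F3; fr F1.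
      + apply: pqrep_ext hpq => i iZ; rewrite e3D /dkey mem_rcons inE negb_or.
        by rewrite /upd; case: eqP => //= _; rewrite andbF.
      + by lia.
      + by lia.
      + move=> i iS; rewrite /upd eqn_add2l nth_rcons; case: eqP => [->|/eqP ne].
          by rewrite ltnn.
        have iS' : i < size S by lia.
        by rewrite iS'; fr F3; fr F1; apply: HV.
      + move=> i iS; rewrite /upd eqn_add2l nth_rcons; case: eqP => [->|/eqP ne].
          by rewrite ltnn e3D (di_eq I1 _).1 // mem_rcons mem_head.
        have iS' : i < size S by lia.
        by rewrite iS'; fr F3; fr F1; apply: HD.
      + by move=> p hp; rewrite upd_neq; [fr F3; fr F1; apply: HV0|lia].
      + by move=> p hp; rewrite upd_neq; [fr F3; fr F1; apply: HD0|lia].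
    set s4 := set_wvar _ _ _ in D0 *.
    have hd4 : warr s4 hd = warr s hd.
      rewrite /s4 /= /upd2 upd_neq; last by have /andP[] := hd_fresh.
      by rewrite (fr_wa F3) // (fr_wa F1).
    have nx4 : warr s4 nx = warr s nx.
      rewrite /s4 /= /upd2 upd_neq; last by have /andP[] := nx_fresh.
      by rewrite (fr_wa F3) // (fr_wa F1).
    have g4 : gst g s4.
      by rewrite /s4; split; sp => *; fr F3; fr F1; auto.
    have e4x : wvar s4 dx = z0 by rewrite /s4; sp.
    clearbody s4.
    apply: (okForLS (l := F z0) (I := fun j s' => dst (rcons S z0)
      (fun y => if y == z0 then take j (F z0) else F y) s') (f := fun=> 5 * tl + 17)) => //.
    - by rewrite /= inE; have /andP[] := nx_fresh.
    - by rewrite /= e4x; split=> //; lia.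
    - by lia.
    - by rewrite /= e4x hd4 nx4; apply: hl.
    - by move=> e /(F_edge z0N)/andP[]; lia.
    - by case: D0 => *; split.
    - move=> j s' jF ej F5 D5; apply: okW (relaxP (x := z0) (j := j) _ _ _ _ _ D5) _ _ => //.
      + by case: g4 => *; split; fr F5.
      + by rewrite mem_rcons mem_head.
      + by fr F5.
      + by move=> s5 F6 D6 v; case: D6 => *; split.
    - move=> s' F5; rewrite take_size.
      by have -> : (fun y => if y == z0 then F z0 else F y) = F
        by apply: boolp.funext => y; case: eqP => // ->.
    - by rewrite big_const_seq count_predT iter_addn_0 -/f; lia.
  - by lia.
by lia.
Qed.

(** The cost of a run depends on which vertices get settled, and this is unknown beforehand. [TB]
    bounds it for all sets of at most [lim] vertices. *)
Variable TB : nat.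
Hypothesis TBP : forall S, uniq S -> {in S, forall x, x < N} -> size S <= lim ->
  \sum_(x <- S) ((size (F x)).+1 * (9 * tl + 30) + 1) <= TB.

Lemma dijP : gst g s0 -> lists N (warr s0 hd) (warr s0 nx) F ->
  wvar s0 dsrc = src -> wvar s0 dlim = lim -> wvar s0 op = p0 ->
  pqrep Z (rarr s0 rK) (fun=> +oo%E) ->
  (forall x, x < N -> rarr s0 rD x = +oo%E) ->
  ok cap len (dij hd nx) s0 (TB + 5 * tl + 14) (fun s' => exists S,
    dst S F s' /\
    forall z, z < N -> z \notin S -> size S = lim \/ dl src z = +oo%E).
Proof.
move=> hg hl es el eo hpq hD; have [eN eZ eS eT eW] := hg; have NZ := gNZ g.
apply: (okWpS (T2 := TB + 5 * tl + 10)); last by rewrite /=; lia.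
sp; rewrite es; do !split=> //; try nl.
apply: (okS (T2 := TB + 1)); first apply: (pq_setP (Z := Z) (key := fun=> +oo%E)) => //; sp => //; try nl.
move=> s1 F1; sp; rewrite es => hpq1.
have D1 : dst [::] F s1.
  have ini := dinv_init F src_lt hD.
  split=> //; try by fr F1; sp.
  - apply: pqrep_ext hpq1 => i iZ; fr F1; sp; rewrite /dkey /upd /=.
    case: eqP => [->|_]; rewrite ?src_lt // andbT.
    by case: ltnP => // iN; rewrite hD.
  - by fr F1; sp; rewrite addn0.
have sub x : x != tch -> x != oV -> warr s1 x = warr s0 x.
  by move=> h1 h2; rewrite (fr_wa F1) // /= /upd2 upd_neq.
have g1 : gst g s1.
  by split=> *; fr F1; sp; auto; rewrite ?sub //; auto.
have hd1 : warr s1 hd = warr s0 hd by have /andP[] := hd_fresh; apply: sub.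
have nx1 : warr s1 nx = warr s0 nx by have /andP[] := nx_fresh; apply: sub.
apply: (okWhile (I := fun v s' => exists S, dst S F s' /\
   v = TB - \sum_(x <- S) ((size (F x)).+1 * (9 * tl + 30) + 1))).
- by exists [::].
- by move=> v s' F2 [S [D2 _]] /=; do !split=> //; lia.
- move=> v s' F2 [S [D2 ->]] /= /andP[]; rewrite (ds_k D2) -ltNge.
  have -> : wvar s' dlim = lim by fr F2; fr F1; sp.
  move=> hS hK.
  have fz x : x != tch -> x != oV -> warr s' x = warr s1 x.
    by move=> h1 h2; rewrite (fr_wa F2) //= !inE negb_or h1 h2.
  have g2 : gst g s' by case: g1 => *; split=> *; fr F2; auto.
  have [|z0 [z0N z0S ok0]] := dij_stepP g2 _ D2 hS hK.
    rewrite fz ?fz ?hd1 ?nx1 //;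
    by have /andP[? ?] := nx_fresh; have /andP[? ?] := hd_fresh.
  exists ((size (F z0)).+1 * (9 * tl + 30)).
  apply: okW ok0 _ (leqnn _) => s3 F3 D3; have I3 := ds_inv D3.
  exists (TB - \sum_(x <- rcons S z0) ((size (F x)).+1 * (9 * tl + 30) + 1)).
    by exists (rcons S z0).
  have := TBP (di_uniq I3) (di_lt I3) (ds_kl D3).
  by rewrite big_rcons /=; lia.
- move=> v s' F2 [S [D2 _]] /=; rewrite (ds_k D2) negb_and => hx.
  exists S; split=> // z zN zS; have [hS|hS] := ltnP (size S) lim; last first.
    by left; apply/anti_leq; rewrite (ds_kl D2).
  right; have I2 := ds_inv D2.
  have koo i : i < Z -> dkey g S (rarr s' rD) i = +oo%E.
    move=> iZ; apply/eqP; rewrite -leye_eq.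
    have [h1 h2] := ds_pq D2; rewrite -h1 //.
    have := pqrep_min (ds_pq D2) (j := Z + i).
    case/orP: hx => hx; first by rewrite (_ : wvar s' dlim = lim) ?hS in hx; fr F2; fr F1; sp.
    by rewrite negbK in hx; move=> h; apply: le_trans hx _; apply: h; lia.
  apply/eqP; rewrite -leye_eq; apply: (dinv_far src_lt F_edge F_cut I2 hS) => // y yN yS.
  by have := koo y (leq_trans yN NZ); rewrite /dkey yN yS /= => ->.
- by lia.
Qed.

(** Restores precisely what [dijP] assumes about the queue and the tentative distances, so that runs
    can follow one another without a full initialisation. *)
Lemma dij_cleanP S s : wvar s vZ = Z -> dst S F s ->
  ok cap len dij_clean s ((\sum_(x <- S) size (F x)).+1 * (5 * tl + 13) + 2)
    (fun s' => pqrep Z (rarr s' rK) (fun=> +oo%E) /\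
      forall x, x < N -> rarr s' rD x = +oo%E).
Proof.
move=> eZ H; have I := ds_inv H; have NZ := gNZ g.
have tN : wvar s tc <= N.
  rewrite -[wvar s tc](size_mkseq (warr s tch)); apply: uniq_lt_size (di_tlu I) _.
  by move=> z; rewrite (di_tl I) => /andP[].
set tl0 := mkseq (warr s tch) (wvar s tc) in I.
have tls : size tl0 = wvar s tc by rewrite size_mkseq.
apply: (okFor (a := 0) (b := wvar s tc) (f := 5 * tl + 11)
  (I := fun j s' => pqrep Z (rarr s' rK) (fun z => if z \in take j tl0 then +oo%E
          else dkey g S (rarr s rD) z) /\
     forall x, x < N -> rarr s' rD x = if x \in take j tl0 then +oo%E else rarr s rD x)) => //.
- by rewrite /=; lia.
- by lia.
- by lia.
- by move=> s' F1; split=> //=; fr F1.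
- by rewrite take0; split=> //; apply: ds_pq H.
- move=> j s' jt ej F1 [P1 D1].
  have e1 : warr s' tch j = nth 0 tl0 j by fr F1; rewrite nth_mkseq.
  have jl : j < size tl0 by rewrite tls.
  have yt : nth 0 tl0 j \in tl0 by rewrite mem_nth.
  have yN : nth 0 tl0 j < N by move: yt; rewrite (di_tl I) => /andP[].
  have yZ : nth 0 tl0 j < Z by lia.
  have tk z : (z \in take j.+1 tl0) = (z == nth 0 tl0 j) || (z \in take j tl0).
    by rewrite (take_nth 0) // mem_rcons inE.
  apply: (okWpS (T2 := 5 * tl + 10)); last by rewrite /=; lia.
  sp; rewrite ej e1; split; first by split=> //; lia.
  apply: (okWpS (T2 := 5 * tl + 9)); last by rewrite /=; lia.
  sp; do !split=> //; try nl.
  apply: okW (pq_setP (Z := Z) (key := fun z => if z \in take j tl0 then +oo%E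
          else dkey g S (rarr s rD) z) _ _ _ _ _ _ _ _) _ _ => //; sp => //.
    by fr F1.
  move=> s2 F2; sp => hp; split; sp.
    by apply: pqrep_ext hp => i iZ; rewrite tk /upd; case: eqP.
  move=> x xN; fr F2; sp; rewrite tk /upd; case: eqP => //= _; exact: D1.
- move=> s' ej F1 []; rewrite -tls take_size => P1 D1; split.
    apply: pqrep_ext P1 => i iZ; case: ifP => // it; rewrite /dkey.
    case: ifP => // /andP[iN _]; move: it; rewrite (di_tl I) iN /=.
    by rewrite lt_neqAle leey andbT => /negbFE/eqP.
  move=> x xN; rewrite D1 //; case: ifP => //.
  by rewrite (di_tl I) xN /= lt_neqAle leey andbT => /negbFE/eqP.
- by have := dinv_touched I; rewrite tls subn0; nia.
Qed.

End Dijkstra.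

(** * Distances *)

Section GraphDistance.
Variables (R : realType) (n : nat) (G : wgraph R n).
Implicit Types (u v : 'I_n) (p : seq 'I_n).

Lemma ww_cat u p1 p2 :
  walk_weight G u (p1 ++ p2) = (walk_weight G u p1 + walk_weight G (last u p1) p2)%R.
Proof. by rewrite /walk_weight pairmap_cat big_cat. Qed.

Lemma ww_cons u v p : walk_weight G u (v :: p) = (wt G u v + walk_weight G v p)%R.
Proof. by rewrite /walk_weight /= big_cons. Qed.

Lemma ww_ge0 u p : path (adj G) u p -> (0 <= walk_weight G u p)%R.
Proof.
elim: p u => [|v p IH] u /=; first by rewrite /walk_weight big_nil.
by move=> /andP[a /IH h]; rewrite ww_cons addr_ge0 // wt_ge0.
Qed.

Lemma dist_le u p : path (adj G) u p -> (dist G u (last u p) <= (walk_weight G u p)%:E)%E.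
Proof. by move=> h; apply: ereal_inf_lbound => /=; exists p. Qed.

Lemma le_dist u v M :
  (forall p, path (adj G) u p -> last u p = v -> (M <= (walk_weight G u p)%:E)%E) ->
  (M <= dist G u v)%E.
Proof. by move=> h; apply: le_ereal_inf_tmp => x /= [p [h1 h2] <-]; apply: h. Qed.

Lemma dist_ge0 u v : (0 <= dist G u v)%E.
Proof. by apply: le_dist => p h _; rewrite lee_fin ww_ge0. Qed.

Lemma dist_refl u : dist G u u = 0%E.
Proof.
apply/le_anti; rewrite dist_ge0 andbT.
by have := @dist_le u [::] isT; rewrite /walk_weight big_nil.
Qed.

Lemma dist_edge u v : adj G u v -> (dist G u v <= (wt G u v)%:E)%E.
Proof.
move=> a; have := @dist_le u [:: v]; rewrite /= a => /(_ isT).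
by rewrite ww_cons /walk_weight big_nil addr0.
Qed.

Lemma dist_tri u v w : (dist G u w <= dist G u v + dist G v w)%E.
Proof.
have h p : path (adj G) u p -> last u p = v ->
    (dist G u w <= (walk_weight G u p)%:E + dist G v w)%E.
  move=> hp hl; rewrite -leeBlDl //; apply: le_dist => p' hp' hl'.
  rewrite leeBlDl // -EFinD.
  have := @dist_le u (p ++ p'); rewrite cat_path hp hl hp' last_cat hl hl' ww_cat hl.
  exact.
have [e|e] := eqVneq (dist G v w) +oo%E.
  by rewrite e addey ?leey // gt_eqF // (lt_le_trans _ (dist_ge0 _ _)).
have f : dist G v w \is a fin_num by rewrite ge0_fin_numE ?dist_ge0 // lt_neqAle e leey.
by rewrite -leeBlDr //; apply: le_dist => p hp hl; rewrite leeBlDr // h.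
Qed.

Lemma rev_walk u p : path (adj G) u p -> exists p',
  [/\ path (adj G) (last u p) p', last (last u p) p' = u &
     walk_weight G (last u p) p' = walk_weight G u p].
Proof.
elim: p u => [|v p IH] u /=; first by move=> _; exists [::]; split.
move=> /andP[a /IH[p' [h1 h2 h3]]]; exists (rcons p' u).
rewrite rcons_path h1 h2 adj_sym a last_rcons -cats1 ww_cat h3 h2 !ww_cons.
rewrite (wt_sym a) addrC; split=> //; congr (_ + _)%R.
by rewrite /walk_weight big_nil addr0.
Qed.

Lemma dist_sym u v : dist G u v = dist G v u.
Proof.
have h u' v' : (dist G u' v' <= dist G v' u')%E.
  apply: le_dist => p hp hl; have [p' [h1 h2 h3]] := rev_walk hp.
  by rewrite -h3; have := dist_le h1; rewrite h2 hl.
by apply/le_anti; rewrite !h.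
Qed.

(** Each walk is split at an edge by which it leaves [S], and its two parts are bounded by
    distances; the infimum is taken only afterwards, so it may fail to be known as a minimum. *)
Lemma dist_cut (S : pred 'I_n) u v M : S u -> ~~ S v ->
  (forall x y, adj G x y -> S x -> ~~ S y ->
     (M <= dist G u x + (wt G x y)%:E + dist G y v)%E) -> (M <= dist G u v)%E.
Proof.
move=> Su Sv h; apply: le_dist => p hp hl.
suff H q w : S w -> path (adj G) w q -> last w q = v ->
    exists q1 y q2, [/\ q = q1 ++ y :: q2, S (last w q1) & ~~ S y].
  have [q1 [y [q2 [pE S1 S2]]]] := H p u Su hp hl.
  move: hp; rewrite pE cat_path /= => /and3P[p1 a p2].
  rewrite ww_cat ww_cons !EFinD addeA.
  apply: le_trans (h _ _ a S1 S2) _.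
  rewrite leeD // ?leeD ?dist_le //.
  by have := dist_le p2; rewrite -hl pE last_cat.
elim: q w => [|y q IH] w Sw /=; first by move=> _ e; rewrite -e Sw in Sv.
move=> /andP[a hq] hlq; have [Sy|Sy] := boolP (S y); last by exists [::], y, q.
have [q1 [z [q2 [-> s1 s2]]]] := IH _ Sy hq hlq.
by exists (y :: q1), z, q2.
Qed.

(** Turning each listed pair upwards is injective, since an edge is listed in one orientation only,
    and its image is the set counted by [num_edges]. *)
Lemma edge_list_size es : edge_list G es -> size es = num_edges G.
Proof.
move=> [ues h1 h2].
pose f (e : 'I_n * 'I_n) := if e.1 < e.2 then e else (e.2, e.1).
have fi : {in es &, injective f}.
  move=> [a b] [c d] e1 e2; rewrite /f /=.
  have /h2 x1 : adj G a b by exact: h1.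
  have /h2 x2 : adj G c d by exact: h1.
  by case: ltnP => _; case: ltnP => _ [E1 E2]; move: e2 x1; rewrite e1 E1 E2 // => ->.
rewrite /num_edges -(size_map f) -(card_uniqP _); last by rewrite map_inj_in_uniq.
apply: eq_card => -[a b]; rewrite inE /=; apply/mapP/idP.
  move=> [[c d] /h1 ad ]; rewrite /f /=; case: ltnP => cd [-> ->]; first by rewrite ad.
  rewrite adj_sym ad ltn_neqAle cd andbT; apply: contraTneq ad => /val_inj->.
  by rewrite adj_irr.
move=> /andP[/h2 ab lt]; have [e|e] := boolP ((a, b) \in es).
  by exists (a, b); rewrite // /f lt.
exists (b, a); first by move: ab; rewrite (negPf e).
by rewrite /f /= ltnNge (ltnW lt).
Qed.

(** * The graph on the renamed vertices, with directed edges numbered from 1 *)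

Variables (es : seq ('I_n * 'I_n)) (names : seq 'I_n) (p0 : 'I_n * 'I_n).
Hypothesis hes : edge_list G es.
Hypothesis names_uniq : uniq names.
Hypothesis names_es : forall a b, (a, b) \in es -> a \in names /\ b \in names.
Hypothesis names_size : size names <= (size es).*2.

(* Edge [i] of the input gives the two directed edges [2 i + 1] and [2 i + 2]. *)
Definition dir_edge (e : nat) : 'I_n * 'I_n :=
  let p := nth p0 es e.-1./2 in if odd e then p else (p.2, p.1).

Let nd i := nth p0.1 names i.
Let id x := index x names.
Let Z := (size es).*2.+1.

Lemma dir_edgeP e : 0 < e < Z ->
  [/\ adj G (dir_edge e).1 (dir_edge e).2, (dir_edge e).1 \in names &
      (dir_edge e).2 \in names].
Proof.
move=> he; have hi : e.-1./2 < size es by rewrite /Z in he; lia.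
have := mem_nth p0 hi; rewrite /dir_edge; case: (nth _ _ _) => a b ab.
have [h1 h2] := names_es ab; case: hes => _ /(_ _ _ ab) h3 _.
by case: odd; split; rewrite //= adj_sym.
Qed.

Lemma dir_edge_ex a b : adj G a b -> exists2 e, 0 < e < Z & dir_edge e = (a, b).
Proof.
move=> ab; case: hes => _ _ /(_ _ _ ab); case: (boolP ((a, b) \in es)) => /= [h _|_ h].
  have H : index (a, b) es < size es by rewrite index_mem.
  exists (index (a, b) es).*2.+1; first by move: (index _ _) H => i; rewrite /Z; lia.
  by rewrite /dir_edge /= odd_double /= doubleK nth_index.
have H : index (b, a) es < size es by rewrite index_mem.
exists (index (b, a) es).*2.+2; first by move: (index _ _) H => i; rewrite /Z; lia.
rewrite /dir_edge /= odd_double /= uphalf_double nth_index //.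
Qed.

Lemma dir_edge_inj e e' : 0 < e < Z -> 0 < e' < Z -> dir_edge e = dir_edge e' -> e = e'.
Proof.
move=> he he'; case: hes => ues h1 h2.
have hi : e.-1./2 < size es by rewrite /Z in he; lia.
have hi' : e'.-1./2 < size es by rewrite /Z in he'; lia.
have E i i' : i < size es -> i' < size es -> nth p0 es i = nth p0 es i' -> i = i'.
  by move=> *; apply/eqP; rewrite -(nth_uniq p0 _ _ ues) //; apply/eqP.
have NE i i' : i < size es -> i' < size es -> nth p0 es i = ((nth p0 es i').2, (nth p0 es i').1) -> False.
  move=> /(mem_nth p0) hh /(mem_nth p0); case: (nth p0 es i') => a b ab ee.
  by rewrite ee /= in hh; have := h2 _ _ (h1 _ _ ab); rewrite ab hh.
rewrite /dir_edge; case o: (odd e); case o': (odd e') => eq.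
- by have := E _ _ hi hi' eq; lia.
- by case: (NE _ _ hi hi' eq).
- by case: (NE _ _ hi' hi (esym eq)).
- have : nth p0 es e.-1./2 = nth p0 es e'.-1./2.
    by case: (nth _ _ _) (nth _ _ _) eq => a b [c d] [-> ->].
  by move/(E _ _ hi hi'); lia.
Qed.

Let ndK x : x \in names -> nd (id x) = x.
Proof. by move=> h; rewrite /nd nth_index. Qed.

Let idK i : i < size names -> id (nd i) = i.
Proof. by move=> h; rewrite /id index_uniq. Qed.

(** Distances are those of [G]; the cut law carries over because both ends of every edge have a
    name. The definition is transparent, since [gN] and [gZ] have to compute later on. *)
Definition named_graph : mgraph R.
Proof.
refine (@MGraph R (size names) Z (fun e => id (dir_edge e).1) (fun e => id (dir_edge e).2)
  (fun e => (wt G (dir_edge e).1 (dir_edge e).2)%:E) (fun i j => dist G (nd i) (nd j))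
  _ _ _ _ _ _ _ _ _ _ _ _ _).
- by rewrite /Z; lia.
- by move=> e /dir_edgeP[_ h _]; rewrite index_mem.
- by move=> e /dir_edgeP[_ _ h]; rewrite index_mem.
- move=> e /dir_edgeP[a h1 h2]; apply: contraTneq a => E.
  by rewrite -(ndK h1) E ndK // adj_irr.
- move=> e e' he he' E1 E2; apply: dir_edge_inj => //.
  have [_ a1 a2] := dir_edgeP he; have [_ b1 b2] := dir_edgeP he'.
  have := ndK a1; rewrite E1 ndK // => e1; have := ndK a2; rewrite E2 ndK // => e2.
  by rewrite [LHS]surjective_pairing -e1 -e2 -surjective_pairing.
- by move=> e /dir_edgeP[a _ _]; rewrite lee_fin wt_ge0.
- by move=> e _; rewrite ltry.
- by move=> i _; rewrite dist_refl.
- by move=> i j; apply: dist_ge0.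
- by move=> i j; apply: dist_sym.
- by move=> i j k _; apply: dist_tri.
- by move=> e /dir_edgeP[a h1 h2]; rewrite !ndK // dist_edge.
- move=> S i j M iN jN Si Sj h.
  apply: (@dist_cut (fun x => S (id x))); rewrite ?idK // => x y a Sx Sy.
  have [e he ee] := dir_edge_ex a; have [_ h1 h2] := dir_edgeP he.
  by have := h e he; rewrite !ndK // ee; apply.
Defined.

Lemma dist_unnamed u v : u \notin names -> u != v -> dist G u v = +oo%E.
Proof.
move=> un uv; apply/eqP; rewrite -leye_eq; apply: le_dist => -[|x p] /=.
  by move=> _ E; rewrite E eqxx in uv.
move=> /andP[a _] _; have [e he ee] := dir_edge_ex a.
by have [_ ] := dir_edgeP he; rewrite ee /= (negPf un).
Qed.

End GraphDistance.

(* With [r_u] the distance to the pivot of [u], a shortest walk on which neither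
   pivot is close is covered by two balls that are joined by an edge. *)
Lemma query_bound (R : realType) (g : mgraph R) (u v : nat) (ru rv du dv t : \bar R) :
  u < gN g -> v < gN g -> u != v ->
  (0 <= ru)%E -> (0 <= rv)%E ->
  (du <= ru + (ru + gd g u v))%E -> (dv <= rv + (rv + gd g u v))%E ->
  (forall e, 0 < e < gZ g -> (gd g v (gs g e) < rv)%E -> (gd g u (gt g e) < ru)%E ->
     (t <= gd g v (gs g e) + gw g e + gd g u (gt g e))%E) ->
  (Order.min t (Order.min du dv) <= 2%:E * gd g u v)%E.
Proof.
move=> uN vN uv ru0 rv0 hdu hdv ht; set d := gd g u v in hdu hdv *.
have d0 : (0 <= d)%E by apply: gd_ge0.
have [doo|dfin] := eqVneq d +oo%E.
  by rewrite doo mulry gtr0_sg // mul1e leey.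
have fd : d \is a fin_num by rewrite ge0_fin_numE // lt_neqAle dfin leey.
have near r : (0 <= r)%E -> (r + r <= d)%E -> (r + (r + d) <= 2%:E * d)%E.
  by move=> r0 hr; rewrite addeA (_ : 2%R = 1 + 1)%R // EFinD ge0_muleDl // !mul1e leeD2r.
have le_d : (d <= 2%:E * d)%E.
  by rewrite (_ : 2%R = 1 + 1)%R // EFinD ge0_muleDl // !mul1e leeDl.
rewrite !ge_min; case: (leP (ru + ru)%E d) => [h|hu].
  by rewrite (le_trans hdu (near _ ru0 h)) orbT.
case: (leP (rv + rv)%E d) => [h|hv]; first by rewrite (le_trans hdv (near _ rv0 h)) !orbT.
suff -> : (t <= 2%:E * d)%E by [].
apply: le_trans le_d.
have ruv : (d < ru + rv)%E.
  have [rr|rr] := leP ru rv.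
    by apply: lt_le_trans hu _; rewrite leeD2l.
  by apply: lt_le_trans hv _; rewrite leeD2r // ltW.
have pos r : (0 <= r)%E -> (d < r + r)%E -> (0 < r)%E.
  move=> r0 hr; rewrite lt_neqAle r0 andbT; apply: contraTneq hr => <-.
  by rewrite adde0 -leNgt.
(* Argue with the minimum of [t] and the (larger) sum of the radii. *)
have : (Order.min t (ru + rv)%E <= d)%E.
  rewrite /d gd_sym.
  (* The cut is the ball of [v] without [u], so that [u] is outside even if the ball contains it. An
     edge leaving this set either ends in the ball of [u], and then [ht] applies, or it ends outside
     both balls, and then a detour over its end is at least [ru + rv]. *)
  apply: (@gd_cut _ g (fun y => (y != u) && (gd g v y < rv)%E)) => //.
  - by rewrite eq_sym uv gd0 // pos.
  - by rewrite eqxx.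
  - move=> e he /andP[yu hy]; rewrite negb_and negbK => hx.
    have xN := gt_lt he; have yN := gs_lt he.
    have far : (rv <= gd g v (gt g e))%E -> (ru <= gd g u (gt g e))%E ->
        (ru + rv <= gd g v (gs g e) + gw g e + gd g (gt g e) u)%E.
      move=> h1 h2; rewrite addeC leeD //; last by rewrite gd_sym.
      apply: le_trans h1 _.
      have h3 : (gd g v (gt g e) <= gd g v (gs g e) + gd g (gs g e) (gt g e))%E by apply: gd_tri.
      by apply: le_trans h3 _; rewrite leeD // gd_edge.
    rewrite ge_min; case: (ltP (gd g u (gt g e)) ru) => h2.
      by rewrite (gd_sym _ (gt g e)) ht.
    rewrite far ?orbT //; move: hx => /orP[/eqP xu|]; last by rewrite -leNgt.
    by move: h2; rewrite xu gd0 // leNgt pos.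
by rewrite ge_min => /orP[//|]; rewrite leNgt ruv.
Qed.

(** * Renaming the vertices that have an edge *)

Local Notation vB := 2.
Local Notation al := 5.
Local Notation ci := 6.
Local Notation cc := 7.
Local Notation cx := 8.
Local Notation cg := 9.
Local Notation cy := 12.
Local Notation cu := 13.
Local Notation aRoot := 30.
Local Notation aPres := 31.
Local Notation aCid := 32.
Local Notation aPar := 33.

(** The square [cc] of [vB] is kept along by doubling twice, as the machine cannot multiply. The
    result lies between sqrt n and 2 sqrt n. *)
Definition sqrt_pow2 : cmd := (
  (vB ::= C 1;; cc ::= C 1);;
  While (TLt (V cc) (V 0)) (
    vB ::= V vB :+ V vB;; cc ::= V cc :+ V cc;; cc ::= V cc :+ V cc))%cmd.

(* A trie of depth two maps the vertices that have an edge to 0, 1, and so on,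
   so that the space does not depend on the number of isolated vertices. *)
Definition intern : cmd := (
  cg ::= WDiv (V cx) (V vB);;
  If (TEq (WRead aRoot (V cg)) (C 0))
    (WStore aRoot (V cg) (V al);; al ::= V al :+ V vB) Skip;;
  cg ::= WRead aRoot (V cg) :+ WMod (V cx) (V vB);;
  If (TEq (WRead aPres (V cg)) (C 0))
    (WStore aPres (V cg) (C 1);; WStore aCid (V cg) (V vN);; vN ::= V vN :+ C 1) Skip;;
  cy ::= WRead aCid (V cg))%cmd.

Definition add_edge (x y : nat) : cmd := (
  WStore aS (V vZ) (V x);; WStore aT (V vZ) (V y);;
  RStore rW (V vZ) (RRead 0 (V ci));; vZ ::= V vZ :+ C 1)%cmd.

(** A query sees the arrays only, so [aPar] saves the block length and a flag telling that there is
    an edge. Allocation starts at address 1, so that a root entry 0 can mean that there is no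
    block. *)
Definition compress : cmd := (
  sqrt_pow2;;
  (WStore aPar (C 0) (C 1);; WStore aPar (C 1) (V vB);;
   al ::= C 1;; vN ::= C 0;; vZ ::= C 1);;
  For ci (C 0) (V 1) (
    cx ::= WRead 0 (V ci);;
    intern;;
    (cu ::= V cy;; cx ::= WRead 1 (V ci));;
    intern;;
    (add_edge cu cy;; add_edge cy cu)))%cmd.

Section Compress.
Variables (R : realType) (cap len n : nat).
Implicit Types (s : state R).

Lemma sqrt_pow2P s : wvar s 0 = n -> 0 < n -> 4 * n < cap ->
  ok cap len sqrt_pow2 s (5 * trunc_log 2 n + 9) (fun s' =>
    [/\ 0 < wvar s' vB, n <= wvar s' vB * wvar s' vB & wvar s' vB * wvar s' vB <= 4 * n]).
Proof.
move=> en n0 hcap.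
apply: (okWpS (T2 := 5 * trunc_log 2 n + 7)); last by rewrite /=; lia.
sp; do !split=> //; try lia.
apply: (okWhile (I := fun v s' => [/\ 0 < wvar s' vB, wvar s' cc = wvar s' vB * wvar s' vB,
  wvar s' cc <= 4 * n & v = 5 * ((trunc_log 2 n).+1 - trunc_log 2 (wvar s' cc))])).
- by sp; split=> //; lia.
- by [].
- move=> v s' F [b0 cb c4 ->] /=; have -> : wvar s' 0 = n by fr F; sp.
  set b := wvar s' vB in b0 cb *; set c := wvar s' cc in cb c4 * => cn.
  have c0 : 0 < c by nia.
  have l1 : trunc_log 2 (c + c) = (trunc_log 2 c).+1 by rewrite addnn trunc_log2_double.
  have l2 : trunc_log 2 (c + c + (c + c)) = (trunc_log 2 (c + c)).+1.
    by rewrite addnn trunc_log2_double //; lia.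
  have l3 : trunc_log 2 c <= trunc_log 2 n by apply: leq_trunc_log; lia.
  have bc : b <= c by rewrite cb; nia.
  exists 3; apply: okWp => //; sp; rewrite -/b -/c; do !split=> //; try nl.
  eexists; last first; last (split; sp; rewrite -/b -/c; [lia| nia|lia|reflexivity]).
  rewrite l2 l1; lia.
- move=> v s' F [b0 cb c4 _] /=; have -> : wvar s' 0 = n by fr F; sp.
  by rewrite -leqNgt -cb.
- by sp; rewrite trunc_log1; lia.
Qed.

(** [k] counts the calls of [intern] and bounds the number of blocks. Distinct block addresses, all
    of the form 1 + j B with B the block length, make the blocks disjoint, and [tr_clean] makes a
    new block read as empty. *)
Record trie (k : nat) (nm : seq nat) s : Prop := Trie {
  tr_uniq : uniq nm;
  tr_lt : {in nm, forall x, x < n};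
  tr_N : wvar s vN = size nm;
  tr_B : 0 < wvar s vB;
  tr_BB : n <= wvar s vB * wvar s vB;
  tr_al : exists2 j, wvar s al = 1 + j * wvar s vB & j <= k;
  tr_root : forall b, b < wvar s vB -> warr s aRoot b != 0 ->
    exists2 j, warr s aRoot b = 1 + j * wvar s vB & warr s aRoot b < wvar s al;
  tr_inj : forall b b', b < wvar s vB -> b' < wvar s vB -> warr s aRoot b != 0 ->
    warr s aRoot b = warr s aRoot b' -> b = b';
  tr_clean : forall g, wvar s al <= g -> warr s aPres g = 0;
  tr_none : forall x, x \in nm -> warr s aRoot (x %/ wvar s vB) != 0;
  tr_pres : forall x, x < n -> let r := warr s aRoot (x %/ wvar s vB) in r != 0 ->
    warr s aPres (r + x %% wvar s vB) = (x \in nm) /\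
    (x \in nm -> warr s aCid (r + x %% wvar s vB) = index x nm) }.

Lemma trie_addr_inj k nm s x y : trie k nm s -> x < n -> y < n ->
  warr s aRoot (x %/ wvar s vB) != 0 -> warr s aRoot (y %/ wvar s vB) != 0 ->
  warr s aRoot (x %/ wvar s vB) + x %% wvar s vB =
  warr s aRoot (y %/ wvar s vB) + y %% wvar s vB -> x = y.
Proof.
move=> T xn yn; have B0 := tr_B T; have BB := tr_BB T.
set B := wvar s vB in B0 BB *.
have xb : x %/ B < B by rewrite ltn_divLR //; lia.
have yb : y %/ B < B by rewrite ltn_divLR //; lia.
move=> rx ry; have [j ej _] := tr_root T xb rx; have [i ei _] := tr_root T yb ry.
have mx := ltn_pmod x B0; have my := ltn_pmod y B0.
rewrite ej ei -/B => E.
have ji : j = i.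
  have h a r : r < B -> (a * B + r) %/ B = a by move=> hr; rewrite divnMDl // divn_small ?addn0.
  by rewrite -(h j _ mx) -(h i _ my); congr (_ %/ _); lia.
have E2 : x %/ B = y %/ B by apply: (tr_inj T) => //; rewrite ej ei ji.
by rewrite (divn_eq x B) (divn_eq y B) E2; move: E; rewrite ji; lia.
Qed.
Definition intern_block : cmd := (
  cg ::= WDiv (V cx) (V vB);;
  If (TEq (WRead aRoot (V cg)) (C 0))
    (WStore aRoot (V cg) (V al);; al ::= V al :+ V vB) Skip)%cmd.

Lemma intern_blockP k nm s x : trie k nm s -> wvar s cx = x -> x < n ->
  1 + k.+2 * wvar s vB <= len -> len < cap ->
  ok cap len intern_block s 4 (fun s' =>
    [/\ trie k.+1 nm s', wvar s' cg = x %/ wvar s vB & warr s' aRoot (x %/ wvar s vB) != 0]).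
Proof.
move=> T ex xn hlen hcap; have B0 := tr_B T; have BB := tr_BB T.
set B := wvar s vB in B0 BB hlen *.
have xb : x %/ B < B by rewrite ltn_divLR //; lia.
have [j ej jk] := tr_al T; rewrite -/B in ej.
have hB : B <= len by nia.
have jB : j * B <= k * B by rewrite leq_mul2r jk orbT.
have kB : k.+2 * B = k * B + B + B by rewrite !mulSn; lia.
apply: okWp => //; rewrite /intern_block; sp; rewrite ex -/B; spl; try nl.
case: eqP => r0; sp; rewrite -/B; last first.
  split; [|by []|exact/eqP].
  by case: T => *; split=> //; exists j => //; lia.
have rU b : b != x %/ B -> upd (warr s aRoot) (x %/ B) (wvar s al) b = warr s aRoot b.
  by move=> h; rewrite upd_neq.
spl; try nl; last by rewrite upd_eq ej.
have rne b i : i <= j -> b < B -> warr s aRoot b != 0 -> warr s aRoot b <> 1 + j * B.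
  move=> ij bB rb E; have [i' _ h] := tr_root T bB rb.
  by rewrite E ej ltnn in h.
case: (T) => T1 T2 T3 T4 T5 T6 T7 T8 T9 T10 T11; split; sp => //.
- by rewrite -/B; exists j.+1; lia.
- rewrite -/B ej => b bB; rewrite /upd; case: (eqVneq b (x %/ B)) => [_ _|_ rb].
    by exists j; lia.
  by have [i h1 h2] := T7 b bB rb; exists i => //; rewrite -/B in h1 *; rewrite ej -/B in h2; lia.
- rewrite -/B => b b' bB b'B; rewrite ej /upd.
  case: (eqVneq b (x %/ B)) => [->|_]; case: (eqVneq b' (x %/ B)) => [->|_] // h1 h2.
  + by case: (rne b' j) => //; rewrite -h2; lia.
  + by case: (rne b j).
  + exact: T8.
- by move=> g hg; apply: T9; rewrite ej; lia.
- rewrite -/B => y ym; rewrite /upd; case: (eqVneq _ (x %/ B)) => _; first by rewrite ej; lia.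
  exact: T10.
- rewrite -/B => y yn; rewrite /upd; case: (eqVneq _ (x %/ B)) => [yb _|yb]; last exact: T11.
  have ym : y \notin nm.
    by apply/negP => /T10; rewrite -/B yb r0 eqxx.
  rewrite (negPf ym); split=> //; apply: T9; rewrite ej; lia.
Qed.

Lemma internP k nm s x : trie k nm s -> wvar s cx = x -> x < n ->
  1 + k.+2 * wvar s vB <= len -> len < cap -> size nm < len ->
  ok cap len intern s 10 (fun s' => let nm' := if x \in nm then nm else rcons nm x in
    trie k.+1 nm' s' /\ wvar s' cy = index x nm').
Proof.
move=> T ex xn hlen hcap hsz; have B0 := tr_B T; have BB := tr_BB T.
(* The program is proved with its first two commands bracketed together, so that [intern_blockP]
   applies. The derivation is then bracketed anew with the same number of steps. *)
have stp : ok cap len (Seq intern_block (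
  cg ::= WRead aRoot (V cg) :+ WMod (V cx) (V vB);;
  If (TEq (WRead aPres (V cg)) (C 0))
    (WStore aPres (V cg) (C 1);; WStore aCid (V cg) (V vN);; vN ::= V vN :+ C 1) Skip;;
  cy ::= WRead aCid (V cg))%cmd) s 10 (fun s' => let nm' := if x \in nm then nm else rcons nm x in
    trie k.+1 nm' s' /\ wvar s' cy = index x nm'); last first.
  have [t [s' [e ht h]]] := stp; exists t, s'; split=> //.
  inversion e as [| | | | |s0 s1 s2 c1 c2 t1 t2 e1 e2 E1 E2 E3 E4| | |]; subst.
  inversion e1 as [| | | | |s0 s1' s2 c1 c2 t1' t2' e1' e2' E1 E2 E3 E4| | |]; subst.
  by rewrite -addnA; apply: ExecSeq e1' (ExecSeq e2' e2).
apply: (okS (T2 := 6)); first exact: intern_blockP T ex xn hlen hcap; last by [].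
move=> s1 F1 [T1 eg r0].
have eB : wvar s1 vB = wvar s vB by fr F1.
set B := wvar s vB in B0 BB hlen eg r0 eB.
have xb : x %/ B < B by rewrite ltn_divLR //; lia.
have [j ej jk] := tr_al T1; rewrite eB in ej.
have [i ei hi] : exists2 j, warr s1 aRoot (x %/ B) = 1 + j * B & warr s1 aRoot (x %/ B) < wvar s1 al.
  by have := tr_root T1; rewrite eB => h; apply: h.
have mx := ltn_pmod x B0; set r := warr s1 aRoot (x %/ B) in r0 ei hi *.
have hB : B <= len by nia.
have kB : k.+2 * B = k * B + B + B by rewrite !mulSn; lia.
have jB : j * B <= k.+1 * B by rewrite leq_mul2r jk orbT.
have kB' : k.+1 * B = k * B + B by rewrite mulSn addnC.
have rl : r + x %% B < len by rewrite ej in hi; lia.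
have ex1 : wvar s1 cx = x by fr F1.
have [p1 p2] : warr s1 aPres (r + x %% B) = (x \in nm) /\
    (x \in nm -> warr s1 aCid (r + x %% B) = index x nm).
  by have := tr_pres T1 xn; rewrite eB -/r => /(_ r0).
have eN := tr_N T1.
apply: okWp => //; sp; rewrite eg ex1 eB -/r; spl; try nl.
rewrite p1; case xm : (x \in nm) p1 p2; sp => p1 p2.
  spl; try nl; last by rewrite p2.
  by case: T1 => *; split.
rewrite eN; spl; try nl; last first.
  by rewrite upd_eq -cats1 index_cat xm /= eqxx addn0.
case: (T1) => U1 U2 U3 U4 U5 U6 U7 U8 U9 U10 U11.
have ne y : y < n -> y != x -> warr s1 aRoot (y %/ B) != 0 ->
    warr s1 aRoot (y %/ B) + y %% B != r + x %% B.
  move=> yn yx ry; apply: contra yx => /eqP E; apply/eqP.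
  by have := trie_addr_inj T1 yn xn; rewrite eB -/r; apply.
split; sp => //.
- by rewrite rcons_uniq xm.
- by move=> y; rewrite mem_rcons inE => /orP[/eqP->|/U2].
- by rewrite size_rcons addn1.
(* The address written lies in a block that starts before the allocation pointer; both starts have
   the form 1 + j B, so the whole block ends before it. *)
- move=> g hg; rewrite upd_neq; first exact: U9.
  apply/eqP => E; move: hg; rewrite E ej.
  move: hi; rewrite ej ei => hi.
  have ij : i < j by rewrite -(ltn_pmul2r B0); lia.
  have : i.+1 * B <= j * B by rewrite leq_mul2r ij orbT.
  by rewrite mulSn; lia.
- by move=> y; rewrite mem_rcons inE => /orP[/eqP->|/U10 //]; rewrite eB.
- move=> y yn; rewrite eB => ry; rewrite mem_rcons inE.
  have [yx|yx] := eqVneq y x.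
    rewrite yx -/r !upd_eq /=; split=> // _.
    by rewrite -cats1 index_cat xm /= eqxx addn0.
  rewrite !upd_neq ?ne //=; have := U11 y yn; rewrite eB => /(_ ry)[-> h2]; split=> // ym.
  by rewrite h2 // -cats1 index_cat ym.
Qed.

Variables (G : wgraph R n) (es : seq ('I_n * 'I_n)) (p0 : 'I_n * 'I_n).
Hypothesis hes : edge_list G es.
Local Notation m := (size es).

Definition edge_done (nm : seq nat) s i :=
  let a := val (nth p0 es i).1 in let b := val (nth p0 es i).2 in
  [/\ a \in nm, b \in nm,
      warr s aS i.*2.+1 = index a nm /\ warr s aT i.*2.+1 = index b nm,
      warr s aS i.*2.+2 = index b nm /\ warr s aT i.*2.+2 = index a nm &
      rarr s rW i.*2.+1 = (wt G (nth p0 es i).1 (nth p0 es i).2)%:E /\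
      rarr s rW i.*2.+2 = (wt G (nth p0 es i).1 (nth p0 es i).2)%:E].

Lemma index_ext (nm nm' : seq nat) x : prefix nm nm' -> x \in nm ->
  x \in nm' /\ index x nm' = index x nm.
Proof. by move=> /prefixP[l ->] xn; rewrite mem_cat index_cat xn. Qed.

Lemma intern_prefix (nm : seq nat) x :
  let nm' := if x \in nm then nm else rcons nm x in
  [/\ prefix nm nm', x \in nm' & size nm' <= (size nm).+1].
Proof.
move=> nm'; rewrite /nm'; case xm : (x \in nm); first by rewrite prefix_refl xm.
by rewrite -cats1 prefix_prefix mem_cat mem_seq1 eqxx orbT size_cat addn1.
Qed.

Lemma slot_neq i j : i != j -> [/\ i.*2.+1 != j.*2.+1, i.*2.+2 != j.*2.+1 + 1,
  i.*2.+1 != j.*2.+1 + 1 & i.*2.+2 != j.*2.+1].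
Proof. by move=> ij; split; lia. Qed.

Lemma compressP : 0 < m -> 0 < n -> 4 * n < cap -> len < cap -> 3 * m + 3 < len ->
  (forall B, B * B <= 4 * n -> 1 + (m + m).+2 * B <= len) ->
  ok cap len compress (input_state G es) (5 * trunc_log 2 n + 33 * m + 16) (fun s' =>
    exists names hu hn hs,
    [/\ gst (@named_graph R n G es names p0 hes hu hn hs) s',
      trie (m + m) [seq val x | x <- names] s' &
      [/\ warr s' aPar 0 = 1, warr s' aPar 1 = wvar s' vB, 0 < size names &
        1 + (m + m).+2 * wvar s' vB <= len]]).
Proof.
move=> m0 n0 ncap lcap mlen hB.
apply: (okS (T2 := 33 * m + 7)); first exact: sqrt_pow2P.
  move=> s1 F1 [B0 BB B4]; set B := wvar s1 vB in B0 BB B4.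
  have hBl : B <= len by have := hB B B4; nia.
  apply: (okWpS (T2 := 33 * m + 2)); last by rewrite /=; lia.
  sp; rewrite -/B; spl; try nl.
  pose J j s := exists nm, [/\ trie (j + j) nm s, wvar s vZ = j.*2.+1, size nm <= j + j &
    forall i, i < j -> edge_done nm s i].
  apply: (okFor (a := 0) (b := m) (f := 31) (I := J)) => //; try by rewrite /=; lia.
  - by move=> s' F; split=> //=; fr F; sp; fr F1.
  - exists [::]; split=> //.
    have z30 b : warr s1 aRoot b = 0 by fr F1; rewrite /= nth_nil.
    have z31 b : warr s1 aPres b = 0 by fr F1; rewrite /= nth_nil.
    split=> //; sp => //.
    - by exists 0.
    - by move=> b _; rewrite z30.
    - by move=> b b' _ _; rewrite z30.
  - move=> j s2 /andP[_ jm] ej F2 [nm [T eZ snm hd]].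
    have eB : wvar s2 vB = B by fr F2; sp.
    have pB : wvar s2 vB * wvar s2 vB <= 4 * n by rewrite eB.
    have hBj k : k <= (m + m).+2 -> 1 + k * B <= len.
      move=> hk; apply: leq_trans (hB B B4); rewrite leq_add2l leq_mul2r hk orbT //.
    have in0 : warr s2 0 j = val (nth p0 es j).1.
      by fr F2; sp; fr F1; rewrite /= (nth_map p0).
    have in1 : warr s2 1 j = val (nth p0 es j).2.
      by fr F2; sp; fr F1; rewrite /= (nth_map p0).
    have inw : rarr s2 0 j = (wt G (nth p0 es j).1 (nth p0 es j).2)%:E.
      by fr F2; sp; fr F1; rewrite /= (nth_map p0).
    set a := val (nth p0 es j).1 in in0; set b := val (nth p0 es j).2 in in1.
    have an : a < n by apply: ltn_ord.
    have bn : b < n by apply: ltn_ord.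
    apply: (okWpS (T2 := 30)); last by rewrite /=; lia.
    sp; rewrite ej in0; split; first by split=> //; lia.
    set s3 := set_wvar _ _ _.
    have T3 : trie (j + j) nm s3 by case: T => *; split.
    apply: (okS (T2 := 20)); first apply: (internP T3 (x := a)) => //.
    + by have := hBj (j + j).+2; rewrite /s3; sp; rewrite eB; apply; lia.
    + lia.
    + move=> s4 F4; set nm4 := if a \in nm then nm else rcons nm a => -[T4 ey].
      have [pf4 am4 sz4] := intern_prefix nm a; rewrite -/nm4 in pf4 am4 sz4.
      have e4i : wvar s4 ci = j by fr F4; rewrite /s3; sp.
      apply: (okWpS (T2 := 18)); last by rewrite /=; lia.
      sp; rewrite e4i.
      have -> : warr s4 1 j = b by fr F4; rewrite /s3; sp.
      spl; try nl.
      set s5 := set_wvar _ _ _.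
      have T5 : trie (j + j).+1 nm4 s5 by case: T4 => *; split.
      apply: (okS (T2 := 8)); first apply: (internP T5 (x := b)) => //.
      * by have := hBj (j + j).+3; rewrite /s5; sp; fr F4; rewrite /s3; sp; rewrite eB; apply; lia.
      * lia.
      * move=> s6 F6; set nm6 := if b \in nm4 then nm4 else rcons nm4 b => -[T6 eb].
        have [pf6 bm6 sz6] := intern_prefix nm4 b; rewrite -/nm6 in pf6 bm6 sz6.
        have [am6 ea6] := index_ext pf6 am4.
        have e6u : wvar s6 cu = index a nm6 by fr F6; rewrite /s5; sp; rewrite ey ea6.
        have e6Z : wvar s6 vZ = j.*2.+1 by fr F6; rewrite /s5; sp; fr F4; rewrite /s3; sp.
        have e6i : wvar s6 ci = j by fr F6; rewrite /s5; sp.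
        have e6w : rarr s6 0 j = (wt G (nth p0 es j).1 (nth p0 es j).2)%:E.
          by fr F6; rewrite /s5; sp; fr F4; rewrite /s3; sp.
        apply: okWp => //; rewrite /add_edge; sp; rewrite e6u e6Z e6i eb e6w; spl; try nl.
        have sub x : x \in [:: aS; aT] -> warr s6 x = warr s2 x.
          by rewrite !inE => /orP[]/eqP->; fr F6; rewrite /s5; sp; fr F4; rewrite /s3; sp.
        have subw : rarr s6 rW = rarr s2 rW.
          by fr F6; rewrite /s5; sp; fr F4; rewrite /s3; sp.
        exists nm6; split; sp.
        -- by move: T6; rewrite -[in trie _ _ s6]addSn -addnS => -[] *; split.
        -- by lia.
        -- by lia.
        -- move=> i ij; rewrite /edge_done; sp.
           have [->|ne] := eqVneq i j.
             by rewrite -/a -/b; split=> //; split; rewrite /upd; repeat case: eqP => //; lia.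
           have ij' : i < j by lia.
           have [h1 h2 [h3 h4] [h5 h6] [h7 h8]] := hd i ij'.
           have pf : prefix nm nm6 by apply: prefix_trans pf4 pf6.
           have [k1 l1] := index_ext pf h1; have [k2 l2] := index_ext pf h2.
           have [n1 n2 n3 n4] := slot_neq ne.
           rewrite !upd_neq //.
           by rewrite (sub aS isT) (sub aT isT) subw k1 k2 l1 l2.
      * by [].
    + by [].
  - move=> s' ej F2 [nm [T eZ snm hd]].
    pose names := [seq insubd p0.1 x | x <- nm].
    have vn : [seq val x | x <- names] = nm.
      rewrite -map_comp -[RHS]map_id; apply/eq_in_map => x xn /=.
      by rewrite val_insubd (tr_lt T).
    have mn (x : 'I_n) : (x \in names) = (val x \in nm).
      by rewrite -vn mem_map //; apply: val_inj.
    have idx (x : 'I_n) : index x names = index (val x) nm.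
      by rewrite -[in RHS]vn index_map //; apply: val_inj.
    have hu : uniq names by rewrite -(map_inj_uniq val_inj) vn (tr_uniq T).
    have hn a b : (a, b) \in es -> a \in names /\ b \in names.
      move=> ab; have hi : index (a, b) es < m by rewrite index_mem.
      by have [h1 h2 _ _ _] := hd _ hi; move: h1 h2; rewrite nth_index // !mn.
    have hs : size names <= m.*2 by rewrite size_map -addnn.
    exists names, hu, hn, hs.
    have dd e : 0 < e < m.*2.+1 -> [/\ warr s' aS e = index (dir_edge es p0 e).1 names,
      warr s' aT e = index (dir_edge es p0 e).2 names &
      rarr s' rW e = (wt G (dir_edge es p0 e).1 (dir_edge es p0 e).2)%:E].
      move=> he; have hi : e.-1./2 < m by lia.
      have [h1 h2 [h3 h4] [h5 h6] [h7 h8]] := hd _ hi.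
      have ad : adj G (nth p0 es e.-1./2).1 (nth p0 es e.-1./2).2.
        by case: hes => _ hadj _; apply: hadj; rewrite -surjective_pairing mem_nth.
      rewrite /dir_edge; case o: (odd e).
        have e1 : e = (e.-1./2).*2.+1 by lia.
        by rewrite [in warr _ _ e]e1 [in warr _ aT e]e1 [in rarr _ _ e]e1 !idx.
      have e1 : e = (e.-1./2).*2.+2 by lia.
      by rewrite -e1 in h5 h6 h8; split; rewrite /= ?idx // h8 (wt_sym ad).
    split.
    + split; sp.
      * by change (wvar s' vN = size names); rewrite size_map (tr_N T).
      * exact: eZ.
      * by move=> e /dd[].
      * by move=> e /dd[].
      * by move=> e /dd[].
    + by rewrite vn.
    + rewrite size_map; fr F2; sp; split=> //.
      by have [+ _ _ _ _] := hd 0 m0; case: (nm).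
      exact: hB.
by lia.
Qed.

End Compress.

(** * Parameters and adjacency lists *)

Local Notation vq := 14.
Local Notation vk := 15.
Local Notation vs := 16.
Local Notation vQ := 17.
Local Notation hF := 44.
Local Notation nF := 45.
Local Notation hT := 46.
Local Notation nT := 47.
Local Notation aDeg := 48.

(** [q] is a power of two with [N <= q ^ 3 <= 8 * N], and its powers are again updated by doubling.
    [vk] is q^2, [vs] is the permitted number 2 q of balls through a vertex, and [vQ] is the length
    of near lists, which exceeds N / q^2. *)
Definition params : cmd := (
  (vq ::= C 1;; vk ::= C 1;; cc ::= C 1);;
  While (TLt (V cc) (V vN)) (
    vq ::= V vq :+ V vq;;
    vk ::= V vk :+ V vk;; vk ::= V vk :+ V vk;;
    cc ::= V cc :+ V cc;; cc ::= V cc :+ V cc;; cc ::= V cc :+ V cc);;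
  (vs ::= V vq :+ V vq;; vQ ::= WDiv (V vN) (V vk) :+ C 1))%cmd.

Definition pq_init : cmd := (
  For de (C 0) (V vZ :+ V vZ) (RStore rK (V de) RInfty);;
  For de (C 0) (V vN) (RStore rD (V de) RInfty))%cmd.

Definition push (hd nx x e : nat) : cmd :=
  (WStore nx (V e) (WRead hd (V x));; WStore hd (V x) (V e))%cmd.

Definition full_adj : cmd := (
  For de (C 1) (V vZ) (
    (dx ::= WRead aS (V de);; push hF nF dx de);;
    pq_set (V de) (RRead rW (V de))))%cmd.

(* Edges leave the queue in order of weight, so that the truncated lists
   receive the lightest edges of each vertex. *)
Definition light_adj : cmd := (
  While (TNot (TLe RInfty (RRead rK (C 1)))) (
    pq_argmin de;;
    pq_set (V de) RInfty;;
    dx ::= WRead aS (V de);;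
    If (TLt (WRead aDeg (V dx)) (V vQ))
      (WStore aDeg (V dx) (WRead aDeg (V dx) :+ C 1);; push hT nT dx de)
      Skip))%cmd.

Lemma lists_cons N hd nx F x e : lists N hd nx F -> x < N -> e != 0 ->
  (forall y, y < N -> e \notin F y) ->
  lists N (upd hd x e) (upd nx e (hd x)) (fun y => if y == x then e :: F y else F y).
Proof.
move=> h xN e0 he y yN.
have ext : chain (upd nx e (hd x)) (hd y) (F y).
  apply: chain_ext (h y yN) => z zF; rewrite upd_neq //.
  by apply: contraNneq (he y yN) => <-.
case: (eqVneq y x) => [E|ne]; last by rewrite upd_neq.
by rewrite -E in ext *; rewrite /= !upd_eq.
Qed.

Lemma lists_ext N hd nx F F' : (forall x, x < N -> F x = F' x) ->
  lists N hd nx F -> lists N hd nx F'.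
Proof. by move=> e h x xN; rewrite -e //; apply: h. Qed.

(** In decreasing order, because a list that grows at its front holds the latest entry first. *)
Definition below (P : pred nat) j := [seq e <- rev (iota 0 j) | P e].

Lemma belowS P j : below P j.+1 = if P j then j :: below P j else below P j.
Proof.
by rewrite /below -addn1 iotaD rev_cat filter_cat /=; case: (P j).
Qed.

Lemma mem_below P j e : (e \in below P j) = (e < j) && P e.
Proof. by rewrite mem_filter mem_rev mem_iota /= andbC. Qed.

Lemma below_uniq P j : uniq (below P j).
Proof. by rewrite filter_uniq // rev_uniq iota_uniq. Qed.

(** Each number has a single key and so enters at most one of the lists. *)
Lemma sum_size_below (key : nat -> nat) N j :
  \sum_(x < N) size (below (fun e => (0 < e) && (key e == x)) j) <= j.
Proof.
elim: j => [|j IH]; first by rewrite big1.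
rewrite (eq_bigr (fun x : 'I_N => ((0 < j) && (key j == x)) +
   size (below (fun e => (0 < e) && (key e == x)) j))); last first.
  by move=> x _; rewrite belowS; case: ifP.
rewrite big_split -[j.+1]add1n leq_add //.
case: (ltnP (key j) N) => kN.
  rewrite (bigD1 (Ordinal kN)) //= big1 ?addn0; first by case: (_ && _).
  by move=> i; rewrite -val_eqE /= eq_sym => /negPf->; rewrite andbF.
rewrite big1 // => i _; case: eqP; rewrite ?andbF // => E.
by have := ltn_ord i; rewrite -E ltnNge kN.
Qed.

Lemma sum_uniq_le (f : nat -> nat) N S : uniq S -> {in S, forall x, x < N} ->
  \sum_(x <- S) f x <= \sum_(x < N) f x.
Proof.
move=> uS hS; rewrite -(big_mkord xpredT f).
have -> : \sum_(x <- S) f x = \sum_(x <- index_iota 0 N | x \in S) f x.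
  rewrite -[RHS]big_filter; apply: perm_big; apply: uniq_perm => //.
    by rewrite filter_uniq // iota_uniq.
  by move=> x; rewrite mem_filter mem_index_iota; case xS : (x \in S) => //=; rewrite hS.
by rewrite [X in _ <= X](bigID (mem S)) /= leq_addr.
Qed.

Section Adjacency.
Variables (R : realType) (cap len : nat).
Implicit Types s : state R.

Lemma paramsP s N : wvar s vN = N -> 0 < N -> 8 * N < cap -> 1 < cap ->
  ok cap len params s (7 * trunc_log 2 N + 14) (fun s' =>
    exists2 q, 0 < q & [/\ wvar s' vq = q, wvar s' vk = q * q,
      N <= q * (q * q) <= 8 * N, wvar s' vs = q + q & wvar s' vQ = N %/ (q * q) + 1]).
Proof.
move=> eN N0 hcap cap1.
apply: (okWpS (T2 := 7 * trunc_log 2 N + 11)); last by rewrite /=; lia.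
sp; spl; try nl.
apply: (okS (T1 := 7 * (trunc_log 2 N).+1 + 1) (T2 := 2) (Q1 := fun s' => exists2 q, 0 < q &
  [/\ wvar s' vq = q, wvar s' vk = q * q & N <= q * (q * q) <= 8 * N])).
- apply: (okWhile (I := fun v s' => exists2 q, 0 < q & [/\ wvar s' vq = q, wvar s' vk = q * q,
    wvar s' cc = q * (q * q), q * (q * q) <= 8 * N &
    v = 7 * ((trunc_log 2 N).+1 - trunc_log 2 (q * (q * q)))])).
  + by exists 1 => //; sp; split=> //; lia.
  + by [].
  + move=> v s' F [q q0 [e1 e2 e3 e4 ->]] /=; rewrite e3 (_ : wvar s' vN = N); last by fr F; sp.
    move=> cN; set c := q * (q * q) in e3 e4 cN *.
    have c0 : 0 < c by rewrite /c; nia.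
    have qc : q <= c /\ q * q <= c by rewrite /c; split; nia.
    have l1 : trunc_log 2 (c + c) = (trunc_log 2 c).+1 by rewrite addnn trunc_log2_double.
    have l2 : trunc_log 2 (c + c + (c + c)) = (trunc_log 2 (c + c)).+1.
      by rewrite addnn trunc_log2_double //; lia.
    have l4 : trunc_log 2 (8 * c) = (trunc_log 2 (c + c + (c + c))).+1.
      by rewrite -trunc_log2_double; [congr trunc_log; lia|lia].
    have l3 : trunc_log 2 c <= trunc_log 2 N by apply: leq_trunc_log; lia.
    exists 6; apply: okWp => //; sp; rewrite e1 e2 e3; spl; try nl.
    have E : (q + q) * ((q + q) * (q + q)) = 8 * c by rewrite /c; lia.
    exists (7 * ((trunc_log 2 N).+1 - trunc_log 2 (8 * c))).
      by exists (q + q); first lia; sp; split=> //; rewrite ?E; lia.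
    by rewrite l4 l2 l1; lia.
  + move=> v s' F [q q0 [e1 e2 e3 e4 _]] /=; rewrite e3 (_ : wvar s' vN = N); last by fr F; sp.
    by rewrite -leqNgt => h; exists q => //; split=> //; rewrite h e4.
  + by sp; rewrite muln1 trunc_log1; lia.
- move=> s1 F [q q0 [e1 e2 e3]]; have e4 : wvar s1 vN = N by fr F; sp.
  have qq : q <= 8 * N by nia.
  have dv : N %/ (q * q) <= N by apply: leq_div.
  have qq2 : q + q <= 8 * N.
    have := e3; case: q q0 {e1 e2 e3 qq dv} => // -[|q] _; [lia|nia].
  apply: okWp => //; sp; rewrite e1 e2 e4; spl; try nl.
  by exists q.
- lia.
Qed.

Variable g : mgraph R.
Local Notation N := (gN g).
Local Notation Z := (gZ g).
Local Notation tl := (trunc_log 2 Z).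
Hypothesis Z_len : Z + Z <= len.
Hypothesis len_cap : len < cap.
Hypothesis cap2 : 2 < cap.

Lemma pq_initP s : gst g s ->
  ok cap len pq_init s (3 * (Z + Z) + 3 * N + 4) (fun s' =>
    pqrep Z (rarr s' rK) (fun=> +oo%E) /\ forall x, x < N -> rarr s' rD x = +oo%E).
Proof.
move=> [eN eZ _ _ _]; have NZ := gNZ g.
apply: (okS (T1 := 3 * (Z + Z) + 2) (T2 := 3 * N + 2)
  (Q1 := fun s' => forall i, i < Z + Z -> rarr s' rK i = +oo%E)); last by lia.
  apply: (okFor (a := 0) (b := Z + Z) (f := 1)
    (I := fun j s' => forall i, i < j -> rarr s' rK i = +oo%E)) => //; try nl.
  - by rewrite /=; lia.
  - by move=> s' F; sp; fr F; rewrite eZ; spl; lia.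
  - move=> j s' jb ej F h; apply: okWp => //; sp; rewrite ej; spl; try nl.
    move=> i ij; rewrite /upd; case: eqP => // ne; apply: h; lia.
move=> s1 F1 h1.
apply: (okFor (a := 0) (b := N) (f := 1)
    (I := fun j s' => forall i, i < j -> rarr s' rD i = +oo%E)) => //; try nl.
- by rewrite /=; lia.
- by move=> s' F; sp; fr F; fr F1.
- move=> j s' jb ej F h; apply: okWp => //; sp; rewrite ej; spl; try nl.
  move=> i ij; rewrite /upd; case: eqP => // ne; apply: h; lia.
- move=> s' _ F h; split=> //; fr F; split=> i hi; rewrite ?h1 //; try nl.
Qed.

Definition Fadj x := below (fun e => (0 < e) && (gs g e == x)) Z.

Lemma Fadj_edge x e : x < N -> e \in Fadj x -> (0 < e < Z) && (gs g e == x).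
Proof. by move=> _; rewrite mem_below => /and3P[-> -> ->]. Qed.

Lemma full_adjP s : gst g s -> 1 < Z -> pqrep Z (rarr s rK) (fun=> +oo%E) ->
  (forall x, warr s hF x = 0) ->
  ok cap len full_adj s (Z * (5 * tl + 14) + 2) (fun s' =>
    lists N (warr s' hF) (warr s' nF) Fadj /\
    pqrep Z (rarr s' rK) (fun i => if 0 < i < Z then gw g i else +oo%E)).
Proof.
move=> [eN eZ eS eT eW] Z1 hpq h0; have NZ := gNZ g.
apply: (okFor (a := 1) (b := Z) (f := 5 * tl + 12) (I := fun j s' =>
   lists N (warr s' hF) (warr s' nF) (fun x => below (fun e => (0 < e) && (gs g e == x)) j) /\
   pqrep Z (rarr s' rK) (fun i => if 0 < i < j then gw g i else +oo%E))) => //; try nl.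
- by rewrite /=; lia.
- by move=> s' F; sp; fr F.
- split; sp.
    by move=> x xN; rewrite h0.
  by apply: pqrep_ext hpq => i _; rewrite ifF //; lia.
- move=> j s' jb ej F [hl hp].
  have j0 : 0 < j < Z by lia.
  have gsj := gs_lt j0.
  have eSj : warr s' aS j = gs g j by fr F; apply: eS.
  have eWj : rarr s' rW j = gw g j by fr F; apply: eW.
  apply: (okWpS (T2 := 5 * tl + 9)); last by rewrite /=; lia.
  sp; rewrite ej eSj; spl; try nl.
  apply: okW (pq_setP (Z := Z) (key := fun i => if 0 < i < j then gw g i else +oo%E) _ _ _ _ _ _ _ _) _ _ => //; sp; rewrite ?ej ?eWj //; try nl.
  + by fr F.
  + move=> s2 F2 hp2; split; sp.
      fr F2; sp.
      apply: (lists_ext (F := fun y => if y == gs g j then j :: below (fun e => (0 < e) && (gs g e == y)) j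
          else below (fun e => (0 < e) && (gs g e == y)) j)).
        by move=> x xN; rewrite belowS (eq_sym x); case/andP: j0 => -> _.
      apply: lists_cons => //; first by lia.
      by move=> y yN; rewrite mem_below ltnn.
    apply: pqrep_ext hp2 => i iZ; rewrite /upd; case: eqP => [->|ne].
      by rewrite ifT //; lia.
    by congr (if _ then _ else _); lia.
Qed.

Record light (Q : nat) (T : nat -> seq nat) : Prop := Light {
  lg_uniq : forall x, x < N -> uniq (T x);
  lg_edge : forall x e, x < N -> e \in T x -> (0 < e < Z) && (gs g e == x);
  lg_size : forall x, x < N -> size (T x) <= Q;
  lg_min : forall e, 0 < e < Z -> e \notin T (gs g e) ->
    size (T (gs g e)) = Q /\ {in T (gs g e), forall e', (gw g e' <= gw g e)%E} }.

(** An omitted edge belongs to a vertex with a full list of [Q] edges, none heavier. As there are no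
    parallel edges, these have [Q] distinct heads, which cannot all lie in a set of fewer than [Q]
    vertices. *)
Lemma light_cut Q T : light Q T -> forall S : seq nat, uniq S ->
  {in S, forall x, x < N} -> size S < Q ->
  forall e, 0 < e < Z -> gs g e \in S -> gt g e \notin S ->
  exists2 e', e' \in T (gs g e) & (gt g e' \notin S) && (gw g e' <= gw g e)%E.
Proof.
move=> L S uS hS sS e he eS eT; have xN := gs_lt he; set x := gs g e in eS xN *.
have [eTx|eTx] := boolP (e \in T x); first by exists e; rewrite // eT lexx.
have [sT hmin] := lg_min L he eTx.
have [|] := boolP (has (fun e' => gt g e' \notin S) (T x)).
  by move=> /hasP[e' e'T e'S]; exists e' => //; rewrite e'S hmin.
rewrite -all_predC => /allP h; suff : Q <= size S by rewrite leqNgt sS.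
rewrite -sT -(size_map (gt g)); apply: uniq_leq_size.
  rewrite map_inj_in_uniq ?(lg_uniq L) // => a b aT bT E.
  have /andP[ha /eqP sa] := lg_edge L xN aT; have /andP[hb /eqP sb] := lg_edge L xN bT.
  by apply: (@g_inj _ g) => //; rewrite sa sb.
by move=> y /mapP[e' e'T ->]; have := h e' e'T; rewrite /= negbK.
Qed.

Lemma light_adjP s Q : gst g s -> wvar s vQ = Q -> Q < len -> 0 < Z ->
  pqrep Z (rarr s rK) (fun i => if 0 < i < Z then gw g i else +oo%E) ->
  (forall x, warr s hT x = 0) -> (forall x, warr s aDeg x = 0) ->
  ok cap len light_adj s (Z * (9 * tl + 24) + 1) (fun s' =>
    pqrep Z (rarr s' rK) (fun=> +oo%E) /\
    exists2 T, light Q T & lists N (warr s' hT) (warr s' nT) T).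
Proof.
move=> [eN eZ eS eT eW] eQ Qlen Z0 hpq h0 d0; have NZ := gNZ g.
pose J P T s' := [/\ pqrep Z (rarr s' rK) (fun i => if (0 < i < Z) && (i \notin P) then gw g i else +oo%E),
  uniq P /\ {in P, forall e, 0 < e < Z},
  (forall e f, e \in P -> 0 < f < Z -> f \notin P -> (gw g e <= gw g f)%E),
  lists N (warr s' hT) (warr s' nT) T /\ (forall x, x < N -> warr s' aDeg x = size (T x)) &
  [/\ (forall x, x < N -> uniq (T x) /\ size (T x) <= Q),
   (forall x e, x < N -> e \in T x -> (e \in P) && (gs g e == x)) &
   (forall e, e \in P -> e \notin T (gs g e) ->
      size (T (gs g e)) = Q /\ {in T (gs g e), forall e', (gw g e' <= gw g e)%E})]].
apply: (okWhile (I := fun v s' => exists P T, J P T s' /\ v = (Z - size P) * (9 * tl + 24))).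
- exists [::], (fun=> [::]); split; last by rewrite subn0.
  split=> //; first by apply: pqrep_ext hpq => i iZ; rewrite andbT.
  by split=> // x xN; rewrite ?h0.
- by move=> v s' _ _ /=; do !split=> //; lia.
- move=> v s' F [P [T [[hp [uP hP] hmin [hl hd] [hT1 hT2 hT3]] ->]]] /=; rewrite -ltNge => hK.
  have eZ' : wvar s' vZ = Z by fr F.
  have [t1 [s1 [ex1 ht1 [xZ kx kmin]]]] :=
    pq_argminP eZ' Z0 Z_len len_cap cap2 hp (isT : de != vZ) (isT : de != pi).
  have F1 := exec_frame ex1.
  set e0 := wvar s1 de in xZ kx kmin.
  have /andP[he0 e0P] : (0 < e0 < Z) && (e0 \notin P).
    by move: hK; rewrite -kx; case: ifP; rewrite ?ltxx.
  have uP' : uniq (e0 :: P) by rewrite /= e0P.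
  have sP : size (e0 :: P) < Z.
    have : size (0 :: e0 :: P) <= Z.
      apply: uniq_lt_size; first by rewrite /= uP e0P !inE negb_or; case: (e0) he0 => //= ? _;
        rewrite andbT; apply/negP => /hP.
      by move=> x; rewrite !inE => /or3P[/eqP->|/eqP->|/hP /andP[]].
    by [].
  exists (9 * tl + 22).
  apply: (okS (T1 := 4 * tl + 7) (T2 := 5 * tl + 15) (Q1 := fun s2 => s2 = s1)); [by exists t1, s1| |lia].
  move=> s2 _ ->.
  apply: (okS (T2 := 6)); [apply:
    (pq_setP (Z := Z) (key := fun i => if (0 < i < Z) && (i \notin P) then gw g i else +oo%E)) => //; try nl| |lia].
    by fr F1.
    by fr F1.
  move=> s3 F3; rewrite /= -/e0 => hp3.
  have e3 : wvar s3 de = e0 by fr F3.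
  have eS3 : warr s3 aS e0 = gs g e0 by fr F3; fr F1; fr F; apply: eS.
  have xN := gs_lt he0; set x := gs g e0 in eS3 xN.
  have eD3 : warr s3 aDeg x = size (T x) by fr F3; fr F1; apply: hd.
  have eQ3 : wvar s3 vQ = Q by fr F3; fr F1; fr F.
  have eh3 : warr s3 hT = warr s' hT by fr F3; fr F1.
  have en3 : warr s3 nT = warr s' nT by fr F3; fr F1.
  have ed3 : warr s3 aDeg = warr s' aDeg by fr F3; fr F1.
  have hp' : pqrep Z (rarr s3 rK) (fun i => if (0 < i < Z) && (i \notin e0 :: P) then gw g i else +oo%E).
    apply: pqrep_ext hp3 => i iZ; rewrite inE /upd; case: eqP => //= _.
    by rewrite andbF.
  have hmin' e f : e \in e0 :: P -> 0 < f < Z -> f \notin e0 :: P -> (gw g e <= gw g f)%E.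
    rewrite !inE negb_or => /orP[/eqP->|eP] hf /andP[fe fP]; last exact: hmin.
    have /andP[_ fZ] := hf.
    by have := kmin f fZ; rewrite hf fP he0 e0P.
  have hP' : {in e0 :: P, forall e, 0 < e < Z} by move=> y; rewrite inE => /orP[/eqP->|/hP].
  have e0T y : y < N -> e0 \notin T y.
    by move=> yN; apply: contraNN e0P => /(hT2 _ _ yN)/andP[].
  have fin (s4 : state R) T' : J (e0 :: P) T' s4 ->
    exists2 v', (exists P T, J P T s4 /\ v' = (Z - size P) * (9 * tl + 24)) &
      v' + (9 * tl + 22) < (Z - size P) * (9 * tl + 24).
    move=> h; exists ((Z - size (e0 :: P)) * (9 * tl + 24)); first by exists (e0 :: P), T'.
    have -> : Z - size P = (Z - size (e0 :: P)).+1 by rewrite /= in sP *; lia.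
    by rewrite mulSn; lia.
  have [sl1 sl2] := hT1 x xN.
  apply: okWp => //; sp; rewrite e3 eS3 eD3 eQ3; spl; try nl.
  case: ltnP => sQ; sp; rewrite ?e3 ?eS3 ?eD3; spl; try nl.
    apply: (fin _ (fun y => if y == x then e0 :: T y else T y)).
    split=> //; sp; rewrite ?eh3 ?en3 ?ed3.
    + split; first by apply: lists_cons => //; lia.
      by move=> y yN; rewrite /upd; case: eqP => [->|_]; rewrite ?addn1 // hd.
    + split.
      * move=> y yN; case: eqP => [->|_]; last exact: hT1.
        by rewrite /= e0T.
      * move=> y e yN; rewrite inE; case: eqP => [->|_].
          rewrite inE => /orP[/eqP->|/(hT2 _ _ xN)/andP[-> ->]]; first by rewrite !eqxx.
          by rewrite orbT.
        by move=> /(hT2 _ _ yN)/andP[-> ->]; rewrite orbT.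
      * move=> e; rewrite inE => /orP[/eqP->|eP]; first by rewrite eqxx mem_head.
        case: (eqVneq (gs g e) x) => [ex|_]; last exact: hT3.
        move: (hT3 e eP); rewrite ex inE negb_or => h /andP[_ /h[sz _]].
        by rewrite sz ltnn in sQ.
  apply: (fin _ T); split=> //; sp; rewrite ?eh3 ?en3 ?ed3 //.
  split=> //.
  + by move=> y e yN /(hT2 _ _ yN)/andP[eP ->]; rewrite inE eP orbT.
  + move=> e; rewrite inE => /orP[/eqP-> _|eP]; last exact: hT3.
    split; first by rewrite -/x; lia.
    by move=> e' /(hT2 _ _ xN)/andP[e'P _]; apply: hmin.
- move=> v s' F [P [T [[hp [uP hP] hmin [hl hd] [hT1 hT2 hT3]] _]]] /= /negPn hK.
  have all_P e : 0 < e < Z -> e \in P.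
    move=> he; apply/negPn/negP => eP; have /andP[_ eZ'] := he.
    have := pqrep_min hp (j := Z + e) ltac:(lia).
    have [-> // _] := hp; rewrite he eP /=.
    by move=> h; have := lt_le_trans (gw_fin he) (le_trans hK h); rewrite ltxx.
  split.
    apply: pqrep_ext hp => i iZ; case: ifP => // /andP[hi]; by rewrite all_P.
  exists T => //; split.
  + by move=> x xN; have [] := hT1 x xN.
  + by move=> x e xN /(hT2 _ _ xN)/andP[/hP-> ->].
  + by move=> x xN; have [] := hT1 x xN.
  + by move=> e he; apply: hT3; apply: all_P.
- by rewrite addn1.
Qed.

End Adjacency.

(** * Near lists and landmark distances *)

Local Notation du := 30.
Local Notation vtop := 31.
Local Notation row := 32.
(* The near list of [u] occupies [aBase u <= i < aLend u] in [oV] (vertices) and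
   [oD] (distances); later [aEnd u] is where the ball of [u] stops. *)
Local Notation aBase := 40.
Local Notation aEnd := 41.
Local Notation aLend := 42.
Local Notation aOwn := 43.
Local Notation aInA := 49.
Local Notation aRow := 50.
Local Notation rTab := 13.

Definition near_lists : cmd := (
  op ::= C 1;;
  For du (C 0) (V vN) (
    (dsrc ::= V du;; dlim ::= V vQ;; WStore aBase (V du) (V op));;
    dij hT nT;;
    dij_clean;;
    (WStore aEnd (V du) (V op);; WStore aLend (V du) (V op));;
    For de (WRead aBase (V du)) (V op) (WStore aOwn (V de) (V du))))%cmd.

(** The settled list of this run is scratch: it is written beyond the near lists, at [vtop], and
    overwritten by the next landmark. Only the row of distances is kept, and row addresses advance
    by addition. *)
Definition land_row : cmd := (
  (dsrc ::= V du;; dlim ::= V vN;; op ::= V vtop;; WStore aRow (V du) (V row));;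
  dij hF nF;;
  For de (C 0) (V vN) (RStore rTab (V row :+ V de) (RRead rD (V de)));;
  dij_clean;;
  row ::= V row :+ V vN)%cmd.

Definition land_table : cmd := (
  (vtop ::= V op;; row ::= C 0);;
  For du (C 0) (V vN) (If (TEq (WRead aInA (V du)) (C 1)) land_row Skip))%cmd.

(** The lists are stored one after the other; the successor keeps position 0 free for the null
    pointer. *)
Definition base (L : nat -> seq nat) u := (\sum_(w < u) size (L w)).+1.

Lemma baseS L u : base L u.+1 = base L u + size (L u).
Proof. by rewrite /base big_ord_recr. Qed.

Lemma base_ext L L' u : (forall w, w < u -> L w = L' w) -> base L u = base L' u.
Proof. by move=> h; congr _.+1; apply: eq_bigr => w _; rewrite h. Qed.

Lemma base_le L Q u : (forall w, w < u -> size (L w) <= Q) -> base L u <= (u * Q).+1.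
Proof.
move=> h; rewrite ltnS; apply: leq_trans (_ : \sum_(w < u) Q <= _).
  by apply: leq_sum => w _; apply: h.
by rewrite sum_nat_const card_ord.
Qed.

Lemma base_mono L u v : u <= v -> base L u <= base L v.
Proof.
by elim: v => [|v IH]; [case: u|rewrite leq_eqVlt => /orP[/eqP->//|/IH h]; rewrite baseS; lia].
Qed.

Section NearLists.
Variables (R : realType) (cap len : nat) (g : mgraph R).
Implicit Types s : state R.
Local Notation N := (gN g).
Local Notation Z := (gZ g).
Local Notation tl := (trunc_log 2 Z).
Hypothesis Z_len : Z + Z <= len.
Hypothesis len_cap : len < cap.
Hypothesis cap2 : 2 < cap.

Record nlist (Q u : nat) (l : seq nat) : Prop := NList {
  nl_uniq : uniq l;
  nl_lt : {in l, forall x, x < N};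
  nl_sort : forall i j, i <= j < size l ->
    (gd g u (nth 0%N l i) <= gd g u (nth 0%N l j))%E;
  nl_far : forall x z, x \in l -> z < N -> z \notin l -> (gd g u x <= gd g u z)%E;
  nl_fin : forall x, x \in l -> (gd g u x < +oo)%E;
  nl_size : size l <= Q;
  nl_full : forall z, z < N -> z \notin l -> size l = Q \/ gd g u z = +oo%E }.

Definition layout (L : nat -> seq nat) k s := forall u, u < k ->
  [/\ warr s aBase u = base L u, warr s aLend u = base L u.+1 &
    forall i, i < size (L u) -> [/\ warr s oV (base L u + i) = nth 0 (L u) i,
       rarr s oD (base L u + i) = gd g u (nth 0 (L u) i) &
       warr s aOwn (base L u + i) = u]].

Lemma layout_ext L k s s' : layout L k s ->
  (forall u, u < k -> warr s' aBase u = warr s aBase u) ->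
  (forall u, u < k -> warr s' aLend u = warr s aLend u) ->
  (forall p, p < base L k -> warr s' oV p = warr s oV p) ->
  (forall p, p < base L k -> rarr s' oD p = rarr s oD p) ->
  (forall p, p < base L k -> warr s' aOwn p = warr s aOwn p) -> layout L k s'.
Proof.
move=> h e1 e2 e3 e4 e5 u uk; have [h1 h2 h3] := h u uk.
split; rewrite ?e1 ?e2 // => i il; have [k1 k2 k3] := h3 i il.
have b : base L u + i < base L k.
  by apply: leq_trans (base_mono L uk); rewrite baseS ltn_add2l.
by rewrite e3 // e4 // e5.
Qed.

Lemma near_listsP s Q T : gst g s -> wvar s vQ = Q -> light g Q T ->
  lists N (warr s hT) (warr s nT) T ->
  pqrep Z (rarr s rK) (fun=> +oo%E) -> (forall x, x < N -> rarr s rD x = +oo%E) ->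
  N * Q + N < len ->
  ok cap len near_lists s
    (N * (Q * (Q.+1 * (9 * tl + 30) + 1) + (Q * Q).+1 * (5 * tl + 13) + 5 * tl + 3 * Q + 26) + 3)
    (fun s' => exists2 L, forall u, u < N -> nlist Q u (L u) &
      [/\ layout L N s', forall u, u < N -> warr s' aEnd u = base L u.+1,
        wvar s' op = base L N, pqrep Z (rarr s' rK) (fun=> +oo%E) &
        forall x, x < N -> rarr s' rD x = +oo%E]).
Proof.
move=> hg eQ LT hl hpq hD hlen; have [eN eZ eS eT eW] := hg; have NZ := gNZ g.
set TB := Q * (Q.+1 * (9 * tl + 30) + 1).
set TC := (Q * Q).+1 * (5 * tl + 13).
have sumT S : uniq S -> {in S, forall x, x < N} -> size S <= Q ->
    \sum_(x <- S) size (T x) <= Q * Q.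
  move=> uS hS sS; apply: leq_trans (_ : \sum_(x <- S) Q <= _).
    by rewrite big_seq [X in _ <= X]big_seq; apply: leq_sum => x /hS xN; apply: (lg_size LT).
  by rewrite big_const_seq count_predT iter_addn_0 mulnC leq_mul2r sS orbT.
have TBP S : uniq S -> {in S, forall x, x < N} -> size S <= Q ->
    \sum_(x <- S) ((size (T x)).+1 * (9 * tl + 30) + 1) <= TB.
  move=> uS hS sS; apply: leq_trans (_ : \sum_(x <- S) (Q.+1 * (9 * tl + 30) + 1) <= _).
    rewrite big_seq [X in _ <= X]big_seq; apply: leq_sum => x /hS xN.
    by rewrite leq_add2r leq_mul2r ltnS (lg_size LT) ?orbT.
  by rewrite big_const_seq count_predT iter_addn_0 mulnC leq_mul2r sS orbT.
apply: (okWpS (T2 := N * (TB + TC + 5 * tl + 3 * Q + 26) + 2)); last by rewrite /=; lia.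
sp; spl; try nl.
pose J j s' := exists L, [/\ forall u, u < j -> nlist Q u (L u),
  layout L j s' /\ (forall u, u < j -> warr s' aEnd u = base L u.+1),
  wvar s' op = base L j, pqrep Z (rarr s' rK) (fun=> +oo%E) &
  forall x, x < N -> rarr s' rD x = +oo%E].
apply: (okFor (a := 0) (b := N) (f := TB + TC + 5 * tl + 3 * Q + 24) (I := J)) => //; try nl.
- by rewrite /=; lia.
- by move=> s' F; split=> //=; fr F.
- by exists (fun=> [::]); split=> //=; rewrite /base big_ord0.
- move=> u s1 /andP[_ uN] ej F1 [L [hL [hlay hend] hop hpq1 hD1]].
  have bl : base L u <= (u * Q).+1 by apply: base_le => w /hL /nl_size.
  have blN : base L u + N <= len.
    have : u * Q <= N * Q by rewrite leq_mul2r (ltnW uN) orbT.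
    by lia.
  apply: (okWpS (T2 := TB + TC + 5 * tl + 3 * Q + 21)); last by rewrite /=; lia.
  sp; rewrite ej hop; spl; try nl.
  set s2 := set_warr _ _ _ _.
  have p1 : base L u + N <= len by [].
  have cut S : uniq S -> {in S, forall x, x < N} -> size S < Q -> u \in S ->
      forall e, 0 < e < Z -> gs g e \in S -> gt g e \notin S ->
      exists2 e', e' \in T (gs g e) & (gt g e' \notin S) && (gw g e' <= gw g e)%E.
    by move=> uS hS sS _; apply: light_cut LT S uS hS sS.
  apply: (okS (T1 := TB + 5 * tl + 14) (T2 := TC + 3 * Q + 7)).
    apply: (@dijP R g cap len T u Q hT nT (base L u) uN (lg_edge LT) cut Z_len
      len_cap cap2 p1 isT isT s2 TB TBP).
    + by rewrite /s2; split; sp => *; fr F1; sp; auto.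
    + by rewrite /s2; sp; fr F1; sp.
    + by rewrite /s2; sp.
    + by rewrite /s2; sp; fr F1; sp.
    + by rewrite /s2; sp.
    + by [].
    + by [].
  + move=> s3 F3 [S [D3 hfull]]; have I3 := ds_inv D3.
    have sS : size S <= Q := ds_kl D3.
    have sSN : size S <= N by apply: uniq_lt_size (di_uniq I3) (di_lt I3).
    apply: (okS (T1 := TC + 2) (T2 := 3 * Q + 5)).
      have eZ3 : wvar s3 vZ = Z by fr F3; rewrite /s2; sp; fr F1; sp.
      have cl := dij_cleanP (hd := hT) (nx := nT) uN Z_len len_cap cap2 p1 isT isT eZ3 D3.
      apply: okW cl (fun s' _ h => h) _.
      - by have hh := sumT S (di_uniq I3) (di_lt I3) sS; rewrite leq_add2r leq_mul2r ltnS hh orbT.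
    + move=> s4 F4 [hpq4 hD4].
      have e4 : wvar s4 op = base L u + size S by fr F4; rewrite (ds_op D3).
      have e4u : wvar s4 du = u by fr F4; fr F3; rewrite /s2; sp.
      have e4b : warr s4 aBase u = base L u by fr F4; fr F3; rewrite /s2; sp; rewrite upd_eq.
      apply: (okWpS (T2 := 3 * Q + 3)); last by rewrite /=; lia.
      sp; rewrite e4 e4u; spl; try nl.
      set s5 := set_warr _ _ _ _.
      have e5u : wvar s5 du = u by rewrite /s5; sp.
      have e5o : wvar s5 op = base L u + size S by rewrite /s5; sp.
      have e5b : warr s5 aBase u = base L u by rewrite /s5; sp.
      pose L' w := if w == u then S else L w.
      have Lw w : w < u -> L w = L' w by rewrite /L'; case: eqP => // ->; rewrite ltnn.
      have bu : base L u = base L' u by apply: base_ext.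
      have Lu : L' u = S by rewrite /L' eqxx.
      apply: (okFor (a := base L u) (b := base L u + size S) (f := 1)
        (I := fun j s' => forall p, warr s' aOwn p = if base L u <= p < j then u else warr s5 aOwn p)) => //.
      * by rewrite /= e5u; split=> //; lia.
      * by rewrite /= e5u.
      * by lia.
      * by lia.
      * by lia.
      * by move=> s' F; sp; fr F.
      * by move=> p; rewrite /= ifF //; lia.
      * move=> j s6 jb ej6 F6 h6; have e6u : wvar s6 du = u by fr F6.
        apply: okWp => //; sp; rewrite ej6 e6u; spl; try nl.
        move=> p; rewrite /upd h6; case: eqP => [->|ne]; first by rewrite ifT //; lia.
        by congr (if _ then _ else _); lia.
      * move=> s' _ F6 h6.
        have base' w : w <= u -> base L' w = base L w.
          by move=> wu; apply: base_ext => x xw; rewrite -Lw //; lia.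
        have lay5 : layout L u s'.
          apply: layout_ext hlay _ _ _ _ _.
          -- by move=> w wu; fr F6; rewrite /s5; sp; fr F4; fr F3; rewrite /s2; sp; rewrite upd_neq //; lia.
          -- by move=> w wu; fr F6; rewrite /s5; sp; fr F4; fr F3; rewrite /s2; sp; rewrite upd_neq //; lia.
          -- by move=> p hp; fr F6; rewrite /s5; sp; fr F4; rewrite (ds_v0 D3) // /s2; sp.
          -- by move=> p hp; fr F6; rewrite /s5; sp; fr F4; rewrite (ds_d0 D3) // /s2; sp.
          -- by move=> p hp; rewrite h6 ifF; [rewrite /s5; sp; fr F4; fr F3; rewrite /s2; sp|lia].
        exists L'; split.
        -- move=> w; rewrite ltnS leq_eqVlt => /orP[/eqP->|wu]; last by rewrite -Lw //; apply: hL.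
           rewrite Lu; split; [exact: di_uniq I3|exact: di_lt I3|exact: di_sort I3|
             exact: di_far I3| |by []|exact: hfull].
           by move=> x /(di_eq I3)[].
        -- split.
             move=> w; rewrite ltnS leq_eqVlt => /orP[/eqP->|wu].
               rewrite baseS Lu -bu; split.
               ++ by sp; fr F6.
               ++ by sp; fr F6; rewrite /s5; sp; rewrite upd_eq.
               ++ move=> i iS; sp; rewrite h6 ifT; last by lia.
                  by  fr F6; rewrite /s5; sp; fr F4; rewrite (ds_v D3) // (ds_d D3).
             have [k1 k2 k3] := lay5 w wu.
             by rewrite (base' w (ltnW wu)) (base' w.+1 wu) -(Lw _ wu).
           move=> w; rewrite ltnS leq_eqVlt => /orP[/eqP->|wu].
             by rewrite baseS Lu -bu; sp; fr F6; rewrite /s5; sp; rewrite upd_eq.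
           rewrite base' //; sp; fr F6; rewrite /s5; sp; rewrite upd_neq; last by lia.
           by fr F4; fr F3; rewrite /s2; sp; apply: hend.
        -- by sp; fr F6; rewrite baseS Lu -bu; sp.
        -- by sp; fr F6; rewrite /s5; sp.
        -- by move=> x xN; sp; fr F6; rewrite /s5; sp; apply: hD4.
      * by have := leq_mul2r 3 (size S) Q; lia.
    + lia.
  + lia.
- move=> s' _ F1 [L [hL [hlay hend] hop hpq1 hD1]].
  by exists L.
Qed.

Lemma sum_FadjP S : uniq S -> {in S, forall x, x < N} ->
  \sum_(x <- S) size (Fadj g x) <= Z.
Proof.
by move=> uS hS; apply: leq_trans (sum_uniq_le _ uS hS) _; apply: sum_size_below.
Qed.

Lemma land_rowP s u top r : gst g s -> lists N (warr s hF) (warr s nF) (Fadj g) ->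
  pqrep Z (rarr s rK) (fun=> +oo%E) -> (forall x, x < N -> rarr s rD x = +oo%E) ->
  u < N -> wvar s du = u -> wvar s vtop = top -> wvar s row = r ->
  top + N <= len -> r + N <= len ->
  ok cap len land_row s ((Z + N) * (14 * tl + 45) + 4 * N + 10 * tl + 60) (fun s' =>
    [/\ pqrep Z (rarr s' rK) (fun=> +oo%E), forall x, x < N -> rarr s' rD x = +oo%E,
      forall p, p < top -> warr s' oV p = warr s oV p /\ rarr s' oD p = rarr s oD p,
      warr s' aRow = upd (warr s aRow) u r /\ wvar s' row = r + N &
      forall p, rarr s' rTab p = if r <= p < r + N then gd g u (p - r) else rarr s rTab p]).
Proof.
move=> hg hl hpq hD uN eu et er htop hr; have [eN eZ eS eT eW] := hg; have NZ := gNZ g.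
set c := 9 * tl + 30.
have TBP S : uniq S -> {in S, forall x, x < N} -> size S <= N ->
    \sum_(x <- S) ((size (Fadj g x)).+1 * c + 1) <= (Z + N) * c + N.
  move=> uS hS sS.
  have -> : \sum_(x <- S) ((size (Fadj g x)).+1 * c + 1) =
     (\sum_(x <- S) size (Fadj g x) + size S) * c + size S.
    rewrite big_split /= -big_distrl /= sum1_size; congr (_ * c + _).
    rewrite -sum1_size -big_split /=; apply: eq_bigr => x _; lia.
  by have := sum_FadjP uS hS => h; rewrite leq_add // leq_mul2r leq_add ?orbT.
have cut S : uniq S -> {in S, forall x, x < N} -> size S < N -> u \in S ->
    forall e, 0 < e < Z -> gs g e \in S -> gt g e \notin S ->
    exists2 e', e' \in Fadj g (gs g e) & (gt g e' \notin S) && (gw g e' <= gw g e)%E.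
  move=> uS hS sS _ e he eS' eT'; exists e; rewrite ?eT' ?lexx //.
  by rewrite mem_below eqxx; case/andP: he => -> ->.
apply: (okWpS (T2 := (Z + N) * (14 * tl + 45) + 4 * N + 10 * tl + 56)); last by rewrite /=; lia.
sp; rewrite eu et er eN; spl; try nl.
set s2 := set_warr _ _ _ _.
apply: (okS (T1 := (Z + N) * c + N + 5 * tl + 14) (T2 := (Z + 1) * (5 * tl + 13) + 3 * N + 6)).
- apply: (@dijP R g cap len (Fadj g) u N hF nF top uN (@Fadj_edge R g) cut Z_len
    len_cap cap2 htop isT isT s2 _ TBP).
  + by rewrite /s2; split; sp; auto.
  + by rewrite /s2; sp.
  + by rewrite /s2; sp.
  + by rewrite /s2; sp.
  + by rewrite /s2; sp.
  + by [].
  + by [].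
- move=> s3 F3 [S [D3 hfull]]; have I3 := ds_inv D3.
  (* With limit [N] the run stops early only if all remaining vertices are at infinite distance, and
     those have kept the value +oo. *)
  have Dv x : x < N -> rarr s3 rD x = gd g u x.
    move=> xN; have [xS|xS] := boolP (x \in S); first by have [] := di_eq I3 xS.
    have [sz|oo] := hfull x xN xS; last first.
      by have := di_ge I3 xN; rewrite oo leye_eq => /eqP.
    have : size (x :: S) <= N.
      apply: uniq_lt_size; first by rewrite /= xS (di_uniq I3).
      by move=> y; rewrite inE => /orP[/eqP->|/(di_lt I3)].
    by rewrite /= sz ltnn.
  have e3r : wvar s3 row = r by fr F3; rewrite /s2; sp.
  have e3N : wvar s3 vN = N by fr F3; rewrite /s2; sp.
  apply: (okS (T1 := 3 * N + 2) (T2 := (Z + 1) * (5 * tl + 13) + 3)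
    (Q1 := fun s' => forall p, rarr s' rTab p = if r <= p < r + N then gd g u (p - r) else rarr s rTab p)).
  + apply: (okFor (a := 0) (b := N) (f := 1) (I := fun j s' => forall p,
      rarr s' rTab p = if r <= p < r + j then gd g u (p - r) else rarr s rTab p)) => //; try nl.
    * by rewrite /=; lia.
    * by move=> s' F; split=> //=; fr F.
    * by move=> p; rewrite /= ifF; [fr F3; rewrite /s2; sp|lia].
    * move=> j s' /andP[_ jN] ej F h; have er' : wvar s' row = r by fr F.
      have eD' : rarr s' rD j = gd g u j by fr F; apply: Dv.
      apply: okWp => //; sp; rewrite ej er' eD'; spl; try nl.
      move=> p; rewrite /upd h; case: eqP => [->|ne]; first by rewrite ifT ?addKn //; lia.
      by congr (if _ then _ else _); lia.
  + move=> s4 F4 h4; have eZ4 : wvar s4 vZ = Z by fr F4; fr F3; rewrite /s2; sp.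
    have D4 : dst g u N top s2 S (Fadj g) s4.
      by case: D3 => *; split; fr F4.
    have cl := dij_cleanP (hd := hF) (nx := nF) uN Z_len len_cap cap2 htop isT isT eZ4 D4.
    apply: (okS (T1 := (Z + 1) * (5 * tl + 13) + 2) (T2 := 1)).
    * apply: okW cl (fun s' _ h => h) _.
      by have hh := sum_FadjP (di_uniq I3) (di_lt I3); rewrite leq_add2r leq_mul2r addn1 ltnS hh orbT.
    * move=> s5 F5 [hpq5 hD5].
      have e5r : wvar s5 row = r by fr F5; fr F4.
      have e5N : wvar s5 vN = N by fr F5; fr F4.
      apply: okWp => //; sp; rewrite e5r e5N; spl; try nl; try by [].
      -- by move=> p hp; fr F5; rewrite (ds_v0 D4) // (ds_d0 D4) // /s2; sp.
      -- by fr F5; fr F4; fr F3; rewrite /s2; sp.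
      -- by move=> p; fr F5.
    * lia.
  + lia.
- rewrite /c; lia.
Qed.

(** The bound on [aRow x] and the sign of the table are stated for all entries: a vertex without a
    pivot will read from row 0 and add the entry to an infinite radius, where only -oo would do
    harm. *)
Lemma land_tableP s top : gst g s -> lists N (warr s hF) (warr s nF) (Fadj g) ->
  pqrep Z (rarr s rK) (fun=> +oo%E) -> (forall x, x < N -> rarr s rD x = +oo%E) ->
  (forall x, warr s aInA x <= 1) -> wvar s op = top -> (forall p, 0 <= rarr s rTab p)%E ->
  (forall x, warr s aRow x = 0) ->
  top + N <= len -> (\sum_(x < N) warr s aInA x) * N + N <= len ->
  ok cap len land_table s
    ((\sum_(x < N) warr s aInA x) * ((Z + N) * (14 * tl + 45) + 4 * N + 10 * tl + 60) + 3 * N + 4)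
    (fun s' => [/\ forall p, p < top -> warr s' oV p = warr s oV p /\ rarr s' oD p = rarr s oD p,
      forall x v, x < N -> warr s aInA x = 1 -> v < N -> rarr s' rTab (warr s' aRow x + v) = gd g x v,
      forall x, warr s' aRow x + N <= (\sum_(x < N) warr s aInA x) * N + N &
      forall p, (0 <= rarr s' rTab p)%E]).
Proof.
move=> hg hl hpq hD hA eop hT hR htop hlen; have [eN eZ eS eT eW] := hg; have NZ := gNZ g.
set TR := (Z + N) * _ + _ + _ + _.
pose cnt j := \sum_(x < j) warr s aInA x.
have cntS j : cnt j.+1 = cnt j + warr s aInA j by rewrite /cnt big_ord_recr.
have cntm j : j <= N -> cnt j <= cnt N.
  move=> jN; rewrite /cnt -!(big_mkord xpredT (warr s aInA)).
  by rewrite [X in _ <= X](big_cat_nat (leq0n j) jN) //= leq_addr.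
apply: (okWpS (T2 := cnt N * TR + 3 * N + 2)); last by rewrite /= -/(cnt N); lia.
sp; rewrite eop; spl; try nl.
apply: (okForS (a := 0) (b := N) (f := fun j => 1 + warr s aInA j * TR) (I := fun j s' =>
  [/\ pqrep Z (rarr s' rK) (fun=> +oo%E) /\ (forall x, x < N -> rarr s' rD x = +oo%E),
   (forall p, p < top -> warr s' oV p = warr s oV p /\ rarr s' oD p = rarr s oD p),
   wvar s' row = cnt j * N /\ (forall x, warr s' aRow x <= cnt N * N),
   (forall x, x < j -> warr s aInA x = 1 -> warr s' aRow x + N <= cnt j * N /\
      forall v, v < N -> rarr s' rTab (warr s' aRow x + v) = gd g x v) &
   forall p, (0 <= rarr s' rTab p)%E])) => //.
- by rewrite /=; lia.
- by lia.
- by lia.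
- by move=> s' F; split=> //=; fr F.
- by split; sp => //; split=> // [|x]; [rewrite /cnt big_ord0|rewrite hR].
- move=> j s1 /andP[_ jN] ej F1 [[hpq1 hD1] hO [er hRow] hTab hpos].
  have eA : warr s1 aInA j = warr s aInA j by fr F1.
  have h1 : cnt j * N <= cnt N * N by rewrite leq_mul2r cntm ?orbT // ltnW.
  have [A1|A1] : warr s aInA j = 1 \/ warr s aInA j = 0 by have := hA j; lia.
  + apply: (okIf (T1 := TR)) => //; sp; rewrite ?ej ?eA ?A1 //; try by [].
    * by do !split; lia.
    * move=> _; have g1 : gst g s1 by split=> *; fr F1; sp; auto.
      apply: okW (land_rowP (u := j) (top := top) (r := cnt j * N) g1 _ hpq1 hD1 jN ej _ er htop _) _ _ => //.
      -- by fr F1.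
      -- by fr F1; sp.
      -- by apply: leq_trans hlen; rewrite leq_add2r.
      -- move=> s2 F2 [k1 k2 k3 [k4 k5] k6].
         have eqS : cnt j.+1 * N = cnt j * N + N by rewrite cntS A1 addn1 mulSn addnC.
         split; sp => //.
         ++ by move=> p hp; have [-> ->] := k3 p hp; apply: hO.
         ++ rewrite k5 eqS; split=> // x; rewrite k4 /upd; case: eqP => // _; exact: hRow.
         ++ move=> x; rewrite ltnS leq_eqVlt k4 => /orP[/eqP->|xj] Ax.
              rewrite upd_eq eqS; split=> // v vN.
              by rewrite k6 ifT ?addKn //; lia.
            rewrite upd_neq; last by lia.
            have [l1 l2] := hTab x xj Ax; split; first by rewrite eqS; lia.
            by move=> v vN; rewrite k6 ifF ?l2 //; lia.
         ++ move=> p; rewrite k6; case: ifP => // _; exact: gd_ge0.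
    * by rewrite mul1n.
  + apply: (okIf (T1 := 0)) => //; sp; rewrite ?ej ?eA ?A1 //; try by [].
    * by do !split; lia.
    * move=> _; apply: okWp => //=.
      have eqS : cnt j.+1 = cnt j by rewrite cntS A1 addn0.
      split; sp => //; rewrite ?eqS //.
      move=> x; rewrite ltnS leq_eqVlt => /orP[/eqP->|xj] Ax; last exact: hTab.
      by rewrite A1 in Ax.
- move=> s' _ F [[hpq1 hD1] hO [er hRow] hTab hpos]; split=> //.
    by move=> x v xN Ax vN; have [_ ->] := hTab x xN Ax.
  by move=> x; rewrite leq_add2r.
- rewrite (eq_bigr (fun j => 3 + warr s aInA j * TR)); last by move=> i _; lia.
  rewrite big_split /= sum_nat_const_nat -big_distrl /= big_mkord -/(cnt N) subn0; lia.
Qed.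

End NearLists.

(** * Greedy hitting sets *)

Lemma mem_take_index (l : seq nat) i x : i <= size l -> (x \in take i l) = (index x l < i).
Proof.
elim: l i => [|y l IH] [|i] //= hi; rewrite inE IH // eq_sym.
by case: eqP.
Qed.

Lemma count_take_lt (P : pred nat) (l : seq nat) i j :
  i <= j -> j < size l -> P (nth 0 l j) -> count P (take i l) < count P (take j.+1 l).
Proof.
move=> ij jl Pj; rewrite (take_nth 0) // -cats1 count_cat /= Pj addn0 addn1 ltnS.
by rewrite -(subnKC ij) takeD count_cat leq_addr.
Qed.

Lemma count_sum (N : nat) (P : pred nat) (l : seq nat) : uniq l -> {in l, forall x, x < N} ->
  count P l = \sum_(x < N) (((x : nat) \in l) && P x : nat).
Proof.
elim: l => [|y l IH] /=; first by move=> _ _; rewrite big1.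
move=> /andP[yl ul] hl; rewrite IH //; last by move=> x xl; apply: hl; rewrite inE xl orbT.
have yN : y < N by apply: hl; rewrite mem_head.
rewrite (bigD1 (Ordinal yN)) //= [in RHS](bigD1 (Ordinal yN)) //= mem_head (negPf yl) /= add0n.
congr (_ + _); apply: eq_bigr => x; rewrite -val_eqE /= => /negPf xy.
by rewrite inE xy.
Qed.

(* Bernoulli's inequality for [(1 + 1 / k) ^ k.+1]. *)
Lemma expn_double k : (k ^ k.+1) * 2 <= k.+1 ^ k.+1.
Proof.
have B j : k ^ j.+1 + j.+1 * k ^ j <= k.+1 ^ j.+1.
  elim: j => [|j IH]; first by rewrite !expn1 mul1n expn0 addn1.
  rewrite (expnS k.+1); apply: leq_trans (leq_mul (leqnn k.+1) IH).
  rewrite !mulSn !expnS; set z := k ^ j; nia.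
apply: leq_trans (B k); rewrite muln2 -addnn leq_add2l expnS leq_mul2r leqnSn orbT //.
Qed.

(** Each greedy choice leaves at most the fraction 1 - 1 / k of the windows. By [expn_double], [k]
    choices at least halve their number, so [k * l] choices would bring it below 1. *)
Lemma decay_bound k i a N l : 0 < k -> N < 2 ^ l -> a * k ^ i <= N * k.-1 ^ i ->
  0 < a -> i < k * l.
Proof.
case: k => // k _ hN ha a0; rewrite ltnNge; apply/negP => hi.
have E : k ^ (k.+1 * l) * 2 ^ l <= k.+1 ^ (k.+1 * l).
  by rewrite !expnM -expnMn; case: (l) => // j; rewrite leq_exp2r ?expn_double.
have E2 : k ^ i * 2 ^ l <= k.+1 ^ i.
  move: E hi; move: (k.+1 * l) => c E hi.
  rewrite -(subnKC hi) !expnD mulnAC; apply: leq_mul E _.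
  by case: (i - _) => // j; rewrite leq_exp2r.
have : a * 2 ^ l <= N.
  have K0 : 0 < k.+1 ^ i by rewrite expn_gt0.
  rewrite -(leq_pmul2r K0) mulnAC.
  apply: leq_trans (_ : N * k ^ i * 2 ^ l <= _); first by rewrite leq_mul2r ha orbT.
  by rewrite -mulnA leq_mul2l E2 orbT.
by rewrite leqNgt (leq_trans hN) // leq_pmull.
Qed.

Section GreedyMath.
Variables (N k h : nat) (L : nat -> seq nat) (W : pred nat).
Hypothesis L_uniq : forall u, u < N -> uniq (L u).
Hypothesis L_lt : forall u, u < N -> {in L u, forall x, x < N}.
Local Notation omega := (\sum_(x < N) (W x : nat)).

Definition hits (Act : pred nat) (wl : nat -> nat) x : nat :=
  \sum_(u < N) (Act u && (x \in take (wl u) (L u)) && W x : nat).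

Lemma hits_ext (Act Act' : pred nat) wl x : (forall u, u < N -> Act u = Act' u) ->
  hits Act wl x = hits Act' wl x.
Proof. by move=> e; apply: eq_bigr => u _; rewrite e. Qed.

Lemma hits_remove (Act : pred nat) wl u x : u < N -> Act u ->
  hits Act wl x = hits (fun v => Act v && (v != u)) wl x + ((x \in take (wl u) (L u)) && W x).
Proof.
move=> uN Au; rewrite /hits (bigD1 (Ordinal uN)) //= [X in _ = X + _](bigD1 (Ordinal uN)) //=.
rewrite Au eqxx /= add0n addnC; congr (_ + _); apply: eq_bigr => v.
by rewrite -val_eqE /= => ->; rewrite andbT.
Qed.

(** Count the pairs of an active window and a member of [W] in it. Each window contributes [h], each
    of the [omega] members at most [M]; since [omega <= h * k], the vertex hit most lies in at least
    a 1 / k share of the active windows. *)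
Lemma hits_max (Act : pred nat) wl M : 0 < omega -> omega <= h * k ->
  (forall u, u < N -> Act u -> count W (take (wl u) (L u)) = h) ->
  (forall x, x < N -> hits Act wl x <= M) ->
  \sum_(u < N) (Act u : nat) <= k * M.
Proof.
move=> o0 ohk hw hM; set a := \sum_(u < N) _.
have E : a * h = \sum_(x < N) hits Act wl x.
  rewrite /hits exchange_big big_distrl /=; apply: eq_bigr => u _.
  case Au : (Act u); last by rewrite mul0n big1.
  have tu := L_uniq (ltn_ord u).
  rewrite mul1n -(hw u) //= (count_sum (N := N)) ?take_uniq //.
  by move=> x /mem_take; apply: L_lt.
have E2 : a * h <= omega * M.
  rewrite E big_distrl /=; apply: leq_sum => x _.
  case Wx : (W x); first by rewrite mul1n hM.
  by rewrite mul0n /hits big1 // => u _; rewrite Wx andbF.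
rewrite -(leq_pmul2l o0); apply: leq_trans (_ : a * (h * k) <= _).
  by rewrite mulnC leq_mul2l ohk orbT.
by rewrite mulnA [X in X <= _]mulnC [X in _ <= X]mulnCA leq_mul2l E2 orbT.
Qed.

(** All balls together hold at most N omega / k, hence at most q omega, occurrences of members of
    [W]. A member of [W'] accounts for more than 2 q of them. *)
Lemma halving (b : nat -> nat) (s q : nat) (W' : pred nat) :
  h = omega %/ k + 1 -> s = q + q -> N <= q * k ->
  0 < q -> 0 < k ->
  (forall u, u < N -> count W (take (b u) (L u)) < h) ->
  (forall x, x < N -> W' x -> W x /\ s < \sum_(u < N) (x \in take (b u) (L u) : nat)) ->
  2 * \sum_(x < N) (W' x : nat) <= omega.
Proof.
move=> eh es Nqk q0 k0 hc hW'; set om' := \sum_(x < N) (W' x : nat).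
have h1 : s * om' <= N * (omega %/ k).
  apply: leq_trans (_ : \sum_(x < N) \sum_(u < N) (((x : nat) \in take (b u) (L u)) && W x : nat) <= _).
    rewrite big_distrr /=; apply: leq_sum => x _; case W'x : (W' x); last by rewrite muln0.
    have [Wx sx] := hW' x (ltn_ord x) W'x; rewrite muln1 (leq_trans (ltnW sx)) //.
    by apply: leq_sum => u _; rewrite Wx andbT.
  rewrite exchange_big /=; apply: leq_trans (_ : \sum_(u < N) (omega %/ k) <= _).
    apply: leq_sum => u _; have := hc u (ltn_ord u); rewrite eh addn1 ltnS.
    rewrite (count_sum (N := N)) ?take_uniq ?L_uniq //.
    by move=> x /mem_take; apply: L_lt.
  by rewrite sum_nat_const card_ord.
have h2 : N * (omega %/ k) <= q * omega.
  apply: leq_trans (_ : q * k * (omega %/ k) <= _); first by rewrite leq_mul2r Nqk orbT.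
  by rewrite -mulnA leq_mul2l mulnC leq_trunc_div orbT.
rewrite -(leq_pmul2l q0); apply: leq_trans h2; apply: leq_trans h1.
by rewrite es mulnA; lia.
Qed.

End GreedyMath.

(** * Choosing the landmarks *)

Local Notation omega := 33.
Local Notation hh := 34.
Local Notation bx := 35.
Local Notation go := 36.
Local Notation cw := 37.
Local Notation hI := 51.
Local Notation nI := 52.
Local Notation aW := 53.
Local Notation aCnt := 54.
Local Notation aCm := 55.
Local Notation aAct := 56.
Local Notation aCl := 57.

Definition zero (a : nat) : cmd := For dx (C 0) (V vN) (WStore a (V dx) (C 0)).

Definition inv_lists : cmd := (
  zero hI;;
  For du (C 0) (V vN) (
    For de (WRead aBase (V du)) (WRead aEnd (V du)) (
      dx ::= WRead oV (V de);; push hI nI dx de)))%cmd.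

Definition bump (a : nat) (hi : wexp) : cmd :=
  For tc (WRead aBase (V du)) hi (
    dx ::= WRead oV (V tc);;
    WStore a (V dx) (WRead a (V dx) :+ WRead aW (V dx)))%cmd.

(* The window of [u] ends after its first [hh] members of [W]; [aAct] is 0
   when there are fewer of them. *)
Definition windows : cmd := (
  hh ::= WDiv (V omega) (V vk) :+ C 1;;
  zero aCnt;;
  zero aCm;;
  For du (C 0) (V vN) (
    (de ::= WRead aBase (V du);; cw ::= C 0);;
    While (TAnd (TLt (V de) (WRead aEnd (V du))) (TLt (V cw) (V hh))) (
      cw ::= V cw :+ WRead aW (WRead oV (V de));; de ::= V de :+ C 1);;
    If (TLt (V cw) (V hh)) (WStore aAct (V du) (C 0))
      (WStore aAct (V du) (V de);; bump aCnt (V de))))%cmd.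

Section Balls.
Variables (R : realType) (cap len : nat) (g : mgraph R) (L : nat -> seq nat).
Implicit Types s : state R.
Local Notation N := (gN g).
Hypothesis L_uniq : forall u, u < N -> uniq (L u).
Hypothesis L_lt : forall u, u < N -> {in L u, forall x, x < N}.
Hypothesis N_len : N < len.
Hypothesis base_len : base L N <= len.
Hypothesis len_cap : len < cap.
Hypothesis cap2 : 2 < cap.

Lemma base_lt u : u < N -> base L u + size (L u) <= len.
Proof. by move=> uN; rewrite -baseS; apply: leq_trans (base_mono L uN) base_len. Qed.

Lemma mem_takeS i x (l : seq nat) : i < size l ->
  (x \in take i.+1 l) = (x \in take i l) || (x == nth 0 l i).
Proof. by move=> il; rewrite (take_nth 0) // mem_rcons inE orbC. Qed.

Lemma nth_notin_take (l : seq nat) i : uniq l -> i < size l -> nth 0 l i \notin take i l.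
Proof.
move=> ul il; rewrite -(cat_take_drop i l) cat_uniq (drop_nth 0) //= in ul.
by have /and3P[_ ] := ul; rewrite negb_or => /andP[].
Qed.

Lemma zeroP a s : wvar s vN = N ->
  ok cap len (zero a) s (3 * N + 2) (fun s' => forall x, x < N -> warr s' a x = 0).
Proof.
move=> eN; apply: (okFor (a := 0) (b := N) (f := 1)
  (I := fun j s' => forall x, x < j -> warr s' a x = 0)) => //; try nl.
- by rewrite /=; lia.
- by move=> s' F; split=> //=; fr F.
- move=> j s' /andP[_ jN] ej F h; apply: okWp => //; sp; rewrite ej; spl; try nl.
  move=> x xj; rewrite /upd2 upd_eq /upd; case: eqP => // ne; apply: h; lia.
Qed.

Definition Finv (b : nat -> nat) j x :=
  [seq base L u + index x (L u) | u <- below (fun u => x \in take (b u) (L u)) j].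

Lemma FinvS b j x : Finv b j.+1 x =
  if x \in take (b j) (L j) then base L j + index x (L j) :: Finv b j x else Finv b j x.
Proof. by rewrite /Finv belowS; case: ifP. Qed.

Lemma Finv_lt b j x e : e \in Finv b j x -> e < base L j.
Proof.
move=> /mapP[u]; rewrite mem_below => /andP[uj xu] ->.
apply: leq_trans (base_mono L uj); rewrite baseS ltn_add2l index_mem.
exact: mem_take xu.
Qed.

(** The program runs twice: on the full near lists, to find the windows through a chosen landmark,
    and on the final balls, to find the centres whose ball contains the head of an edge. *)
Lemma inv_listsP s b : wvar s vN = N -> layout g L N s ->
  (forall u, u < N -> b u <= size (L u) /\ warr s aEnd u = base L u + b u) ->
  ok cap len inv_lists s (7 * N + 5 * base L N + 4) (fun s' =>
    lists N (warr s' hI) (warr s' nI) (Finv b N)).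
Proof.
move=> eN hlay hb.
apply: (okS (zeroP hI eN) (T2 := 5 * base L N + 4 * N + 2)); last by lia.
move=> s1 F1 h1.
apply: (okForS (a := 0) (b := N) (f := fun j => 5 * size (L j) + 2)
  (I := fun j s' => lists N (warr s' hI) (warr s' nI) (Finv b j))) => //; try nl.
- by rewrite /=; lia.
- by move=> s' F; split=> //=; fr F; fr F1.
- move=> u s2 /andP[_ uN] ej F2 hl; have [b1 b2] := hb u uN.
  have [l1 l2 l3] := hlay u uN; have bl := base_lt uN.
  have e2 : warr s2 aBase u = base L u by fr F2; fr F1.
  apply: (okFor (a := base L u) (b := base L u + b u) (f := 3) (I := fun j s' =>
     lists N (warr s' hI) (warr s' nI) (fun x => if x \in take (j - base L u) (L u) then
       base L u + index x (L u) :: Finv b u x else Finv b u x))) => //; try nl.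
  + by rewrite /= ej; split=> //; lia.
  + by rewrite /= ej.
  + by move=> s' F; sp; fr F; rewrite ej; fr F2; fr F1; rewrite b2; do !split; lia.
  + by rewrite subnn take0; sp.
  + move=> j s3 hj ej3 F3 h3; set i := j - base L u in h3.
    have ij : j = base L u + i by rewrite /i; lia.
    have iL : i < size (L u) by lia.
    have [k1 k2 k3] := l3 i iL; set x := nth 0 (L u) i in k1 *.
    have xN : x < N by apply: L_lt (mem_nth 0 iL).
    have e3 : warr s3 oV j = x by fr F3; fr F2; fr F1; rewrite ij.
    have hx : index x (L u) = i by rewrite index_uniq // L_uniq.
    apply: okWp => //; sp; rewrite ej3 e3; spl; try nl.
    apply: lists_ext (lists_cons h3 xN (e := j) _ _).
    * move=> y yN; rewrite (_ : j.+1 - _ = i.+1); last by rewrite /i; lia.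
      rewrite mem_takeS // -/x; case: (eqVneq y x) => [->|ne]; last by rewrite orbF.
      by rewrite orbT hx -ij ifN // nth_notin_take // L_uniq.
    * by rewrite ij /base.
    * move=> y yN; apply/negP => /=.
      have ni : j \notin Finv b u y.
        by apply/negP => /Finv_lt; rewrite ij ltnNge leq_addr.
      case: ifP => yt; last by apply/negP.
      rewrite inE (negPf ni) orbF ij eqn_add2l => /eqP E.
      by rewrite mem_take_index ?(ltnW iL) // -E ltnn in yt.
  + move=> s3 _ F3 h3; apply: lists_ext h3 => x xN; rewrite FinvS addKn //.
- rewrite big_split /= big_split /= -big_distrr /= !sum_nat_const_nat big_mkord.
  rewrite -/(base L N); rewrite /base; lia.
Qed.

Lemma bumpP a hi s u w (W : pred nat) : a != aBase -> a != oV -> a != aW ->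
  layout g L N s -> u < N -> wvar s du = u -> w <= size (L u) ->
  (forall s', frame (bump a hi) s s' -> wsafe cap len s' hi /\ wden s' hi = base L u + w) ->
  (forall x, x < N -> warr s aW x = W x /\ warr s a x + 1 < cap) ->
  ok cap len (bump a hi) s (4 * w + 2) (fun s' => forall x, x < N ->
    warr s' a x = warr s a x + ((x \in take w (L u)) && W x)).
Proof.
move=> a1 a2 a3 hlay uN eu wL hhi hW; have [l1 l2 l3] := hlay u uN.
have bl := base_lt uN.
apply: (okFor (a := base L u) (b := base L u + w) (f := 2) (I := fun j s' =>
  forall x, x < N -> warr s' a x = warr s a x + ((x \in take (j - base L u) (L u)) && W x)))
  => //; try nl.
- by rewrite /= eu; split=> //; lia.
- by rewrite /= eu.
- by move=> x xN; rewrite subnn take0 addn0.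
- move=> j s' hj ej F h; pose i := j - base L u.
  have ij : j = base L u + i by rewrite /i; lia.
  have iL : i < size (L u) by lia.
  have [k1 k2 k3] := l3 i iL; set x := nth 0 (L u) i in k1 *.
  have xN : x < N by apply: L_lt (mem_nth 0 iL).
  have e1 : warr s' oV j = x by rewrite (fr_wa F) ?ij //= inE eq_sym.
  have [w1 w2] := hW x xN.
  have e2 : warr s' aW x = W x by rewrite (fr_wa F) //= inE eq_sym.
  have xt : x \in take i (L u) = false by apply: negbTE; apply: nth_notin_take => //; apply: L_uniq.
  have e3 : warr s' a x = warr s a x by rewrite h // -/i xt addn0.
  apply: okWp => //; sp; rewrite ej e1 e2 e3; spl; try nl.
  move=> y yN; rewrite (_ : j.+1 - _ = i.+1); last by rewrite /i; lia.
  rewrite mem_takeS // -/x /upd2 upd_eq /upd; case: eqP => [->|ne]; last by rewrite orbF h.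
  by rewrite orbT.
- by move=> s' _ _; rewrite addKn.
Qed.

Definition window_spec (W : pred nat) (b : nat -> nat) (h : nat) s (Act : pred nat) wl :=
  forall u, u < N -> [/\ wl u <= b u, warr s aAct u = if Act u then base L u + wl u else 0,
    Act u -> count W (take (wl u) (L u)) = h & ~~ Act u -> count W (take (b u) (L u)) < h].

Lemma hits_le (Act : pred nat) wl W x : hits N L W Act wl x <= N.
Proof.
rewrite -[X in _ <= X]card_ord -sum1_card; apply: leq_sum => u _; exact: leq_b1.
Qed.

Lemma windowsP s b (W : pred nat) k om Q : wvar s vN = N -> layout g L N s ->
  (forall u, u < N -> b u <= size (L u) /\ warr s aEnd u = base L u + b u) ->
  (forall u, u < N -> size (L u) <= Q) ->
  (forall x, x < N -> warr s aW x = W x) -> wvar s vk = k -> wvar s omega = om -> om <= N ->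
  ok cap len windows s (N * (7 * Q + 25) + 10) (fun s' =>
    exists (Act : pred nat) wl, [/\ window_spec W b (om %/ k + 1) s' Act wl,
      forall x, x < N -> warr s' aCnt x = hits N L W Act wl x &
      forall x, x < N -> warr s' aCm x = 0]).
Proof.
move=> eN hlay hb hQ hW ek eo oN; set h := om %/ k + 1.
have hN : h <= N + 1 by rewrite leq_add2r; apply: leq_trans (leq_div _ _) oN.
apply: (okWpS (T2 := N * (7 * Q + 25) + 8)); last by rewrite /=; lia.
sp; rewrite ek eo -/h; spl; try nl.
set s0 := set_wvar _ _ _.
apply: (okS (zeroP aCnt _) (T2 := N * (7 * Q + 22) + 6)); [by rewrite /s0; sp| |lia].
move=> s1 F1 z1.
apply: (okS (zeroP aCm _) (T2 := N * (7 * Q + 19) + 4)); [by fr F1; rewrite /s0; sp| |lia].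
move=> s2 F2 z2.
have eh2 : wvar s2 hh = h by fr F2; fr F1; rewrite /s0; sp.
pose J j s' := exists (Act : pred nat) wl, [/\ forall u, u < j -> [/\ wl u <= b u,
    warr s' aAct u = if Act u then base L u + wl u else 0,
    Act u -> count W (take (wl u) (L u)) = h & ~~ Act u -> count W (take (b u) (L u)) < h],
   (forall x, x < N -> warr s' aCnt x = \sum_(u < j) (Act u && (x \in take (wl u) (L u)) && W x : nat))
   & (forall x, x < N -> warr s' aCm x = 0)].
apply: (okFor (a := 0) (b := N) (f := 7 * Q + 17) (I := J)) => //; try nl.
- by rewrite /=; lia.
- by move=> s' F; split=> //=; fr F; fr F2; fr F1; rewrite /s0; sp.
- exists xpred0, (fun=> 0); split=> // x xN; rewrite big_ord0; sp.
  by fr F2; apply: z1.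
- move=> u s3 /andP[_ uN] ej F3 [Act [wl [hA hC hM]]].
  have [b1 b2] := hb u uN; have [l1 l2 l3] := hlay u uN; have bl := base_lt uN.
  have eB : warr s3 aBase u = base L u by fr F3; fr F2; fr F1; rewrite /s0; sp.
  apply: (okWpS (T2 := 7 * Q + 15)); last by rewrite /=; lia.
  sp; rewrite ej eB; spl; try nl.
  set s4 := set_wvar _ _ _.
  have frz s' : warr s' aBase = warr s3 aBase -> warr s' aEnd = warr s3 aEnd ->
     warr s' oV = warr s3 oV -> warr s' aW = warr s3 aW -> wvar s' hh = wvar s3 hh ->
     [/\ warr s' aEnd u = base L u + b u, wvar s' hh = h,
       forall i, i < size (L u) -> warr s' oV (base L u + i) = nth 0 (L u) i &
       forall x, x < N -> warr s' aW x = W x].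
    move=> E1 E2 E3 E4 E5; rewrite E2 E3 E4 E5; fr F3; rewrite eh2; split=> //.
    + by fr F2; fr F1; rewrite /s0; sp.
    + by move=> i /l3[<-]; fr F2; fr F1; rewrite /s0; sp.
    + by move=> x xN; fr F2; fr F1; rewrite /s0; sp; apply: hW.
  apply: (okS (T1 := 3 * Q + 1) (T2 := 4 * Q + 5) (Q1 := fun s' => exists i,
    [/\ i <= b u, wvar s' de = base L u + i, wvar s' cw = count W (take i (L u)),
       wvar s' cw <= h & (i == b u) || (wvar s' cw == h)])); last by lia.
  + apply: (okWhile (I := fun v s' => exists i, [/\ i <= b u, wvar s' de = base L u + i,
       wvar s' cw = count W (take i (L u)), wvar s' cw <= h & v = 3 * (b u - i)])).
    * by exists 0; rewrite /s4; sp; rewrite addn0 take0; split.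
    * by move=> v s' F _ /=; fr F; rewrite /s4; sp; rewrite ej; do !split; lia.
    * move=> v s' F [i [ib ed ec ch ->]] /=.
      have eu : wvar s' du = u by fr F; rewrite /s4; sp.
      have [||||| f1 f2 f3 f4] := frz s'; try by fr F; rewrite /s4; sp.
      rewrite eu ed f1 ec f2 ltn_add2l => /andP[ib' ci].
      have iL : i < size (L u) by lia.
      have xN : nth 0 (L u) i < N by apply: L_lt (mem_nth 0 iL).
      have wi : count W (take i.+1 (L u)) = count W (take i (L u)) + W (nth 0 (L u) i).
        by rewrite (take_nth 0) // -cats1 count_cat /= addn0.
      exists 2; apply: okWp => //; sp; rewrite ed ec f3 // f4 //; spl; try nl.
      exists (3 * (b u - i.+1)); last by lia.
      by exists i.+1; rewrite wi; split=> //; nl.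
    * move=> v s' F [i [ib ed ec ch _]] /=.
      have eu : wvar s' du = u by fr F; rewrite /s4; sp.
      have [||||| f1 f2 f3 f4] := frz s'; try by fr F; rewrite /s4; sp.
      rewrite eu f1 ed f2 ltn_add2l negb_and -!leqNgt => hor.
      by exists i; split=> //; lia.
    * by have := hQ u uN; lia.
  + move=> s5 F5 [i [ib ed ec ch hor]].
    have eu : wvar s5 du = u by fr F5; rewrite /s4; sp.
    have [||||| f1 f2 f3 f4] := frz s5; try by fr F5; rewrite /s4; sp.
    have eA5 : warr s5 aAct = warr s3 aAct by fr F5; rewrite /s4; sp.
    have eC5 : warr s5 aCnt = warr s3 aCnt by fr F5; rewrite /s4; sp.
    have eM5 : warr s5 aCm = warr s3 aCm by fr F5; rewrite /s4; sp.
    apply: (okIf (T1 := 4 * Q + 4)) => //; try by lia.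
    * sp; rewrite f2 => ch'; apply: okWp => //; sp; last by lia.
      rewrite eu; spl; try nl; try by [].
      have ib' : i = b u by apply/eqP; move: hor; rewrite (ltn_eqF ch') orbF.
      exists (fun w => if w == u then false else Act w), (fun w => if w == u then 0 else wl w).
      split=> [w|x xN|x xN]; sp; rewrite ?eA5 ?eC5 ?eM5.
      -- rewrite ltnS leq_eqVlt => /orP[/eqP->|wu]; first by rewrite eqxx upd_eq -ib' -ec.
         by rewrite upd_neq ?(ltn_eqF wu) ?(ltn_neq wu)//; apply: hA.
      -- rewrite hC // big_ord_recr /= eqxx addn0; apply: eq_bigr => w _.
         by rewrite (ltn_eqF (ltn_ord w)).
      -- exact: hM.
    * sp; rewrite f2 -leqNgt => ch'; apply: (okWpS (T2 := 4 * Q + 2)); last by rewrite /=; lia.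
      sp; rewrite eu; spl; try nl.
      set s6 := set_warr _ _ _ _.
      have lay6 : layout g L N s6.
        apply: layout_ext hlay _ _ _ _ _ => *; rewrite /s6; sp; fr F5; rewrite /s4; sp;
          fr F3; fr F2; fr F1; rewrite /s0; sp => //.
      apply: okW (bumpP (w := i) (W := W) _ _ _ lay6 uN _ _ _ _) _ _ => //.
      -- by lia.
      -- by move=> s' F; sp; fr F; rewrite /s6; sp.
      -- move=> x xN; rewrite /s6; sp; rewrite f4 // eC5 hC //; split=> //.
         have : \sum_(w < u) (Act w && (x \in take (wl w) (L w)) && W x : nat) <= u.
           by rewrite -[X in _ <= X]card_ord -sum1_card; apply: leq_sum => w _; exact: leq_b1.
         lia.
      -- move=> s7 F7 hc7.
         exists (fun w => if w == u then true else Act w), (fun w => if w == u then i else wl w).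
         split=> [w|x xN|x xN]; sp; fr F7; rewrite ?hc7 // /s6; sp; rewrite ?eA5 ?eC5 ?eM5.
         ++ rewrite ltnS leq_eqVlt => /orP[/eqP->|wu].
              by rewrite eqxx upd_eq ed -ec; split=> //; lia.
            by rewrite upd_neq ?(ltn_eqF wu) //; apply: hA.
         ++ rewrite hC // big_ord_recr /= eqxx; congr (_ + _); apply: eq_bigr => w _.
            by rewrite (ltn_eqF (ltn_ord w)).
         ++ exact: hM.
      -- by have := hQ u uN; lia.
Qed.

End Balls.

(** A position of the near list of [du] lies in its active window exactly if it is below [aAct du].
    Setting this to 0 deactivates the window, because positions start at 1. *)
Definition hit : cmd :=
  ForL de (WRead hI (V bx)) nI (
    du ::= WRead aOwn (V de);;
    If (TLt (V de) (WRead aAct (V du)))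
      (bump aCm (WRead aAct (V du));; WStore aAct (V du) (C 0)) Skip)%cmd.

(* The number of active windows that contain [x] is [aCnt x - aCm x]. *)
Definition argmax : cmd := (
  bx ::= C 0;;
  For dx (C 0) (V vN) (
    If (TLt (WRead aCnt (V bx) :+ WRead aCm (V dx)) (WRead aCnt (V dx) :+ WRead aCm (V bx)))
      (bx ::= V dx) Skip))%cmd.

Definition greedy : cmd := (
  go ::= C 1;;
  While (TLt (C 0) (V go)) (
    argmax;;
    If (TLt (WRead aCm (V bx)) (WRead aCnt (V bx)))
      (WStore aInA (V bx) (C 1);; hit)
      (go ::= C 0)))%cmd.

Section Greedy.
Variables (R : realType) (cap len : nat) (g : mgraph R) (L : nat -> seq nat) (Q : nat).
Implicit Types s : state R.
Local Notation N := (gN g).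
Hypothesis L_uniq : forall u, u < N -> uniq (L u).
Hypothesis L_lt : forall u, u < N -> {in L u, forall x, x < N}.
Hypothesis L_Q : forall u, u < N -> size (L u) <= Q.
Hypothesis N2_len : N + N < len.
Hypothesis base_len : base L N <= len.
Hypothesis len_cap : len < cap.
Hypothesis cap2 : 2 < cap.

Definition active (Act : pred nat) (wl : nat -> nat) s :=
  forall u, u < N -> wl u <= size (L u) /\ warr s aAct u = if Act u then base L u + wl u else 0.

Local Notation allF := (Finv L (fun u => size (L u)) N).

(** Removing a window costs O(Q), but happens once per window. The sum in the time bound is the
    number of windows removed here, so that these costs telescope over a greedy run. *)
Lemma hitP s x (Act W : pred nat) wl : layout g L N s -> lists N (warr s hI) (warr s nI) allF ->
  (forall y, y < N -> warr s aW y = W y) -> x < N -> wvar s bx = x -> active Act wl s ->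
  (forall y, y < N -> warr s aCm y + hits N L W Act wl y <= N) ->
  ok cap len hit s (4 * N + 2 + (4 * Q + 3) * \sum_(u < N) (Act u && (x \in take (wl u) (L u)) : nat))
  (fun s' => let Act' u := Act u && (x \notin take (wl u) (L u)) in
     active Act' wl s' /\
     forall y, y < N -> warr s' aCm y + hits N L W Act' wl y = warr s aCm y + hits N L W Act wl y).
Proof.
move=> hlay hl hW xN ex hA hM; have N_len : N < len by lia.
set us := below (fun u => x \in take (size (L u)) (L u)) N.
have us_N u : u \in us -> u < N by rewrite mem_below => /andP[].
have us_u : uniq us := below_uniq _ _.
(* The windows that are left after the first [j] occurrences of [x] have been handled. *)
pose P j u := Act u && ~~ ((u \in take j us) && (x \in take (wl u) (L u))).
have eF : allF x = [seq base L u + index x (L u) | u <- us] by [].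
have memL u : u \in us -> x \in L u by rewrite mem_below take_size => /andP[].
have lay u : u \in us -> [/\ base L u + index x (L u) < len,
   warr s aBase u = base L u & warr s aOwn (base L u + index x (L u)) = u].
  move=> uus; have uN := us_N u uus; have [l1 l2 l3] := hlay u uN.
  have il : index x (L u) < size (L u) by rewrite index_mem memL.
  have [_ _ ->] := l3 _ il; split=> //.
  by apply: leq_trans base_len; apply: leq_trans (base_mono L uN); rewrite baseS ltn_add2l.
have test u : u \in us -> (base L u + index x (L u) < (if Act u then base L u + wl u else 0)) =
    Act u && (x \in take (wl u) (L u)).
  move=> uus; have [w1 _] := hA u (us_N u uus); case: (Act u) => //.
  by rewrite ltn_add2l mem_take_index.
have sus : size us <= N by apply: uniq_lt_size.
pose f e := 2 + (if e < warr s aAct (warr s aOwn e) then 4 * Q + 3 else 0).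
apply: (okForLS (l := allF x) (f := f) (I := fun j s' => active (P j) wl s' /\
   forall y, y < N -> warr s' aCm y + hits N L W (P j) wl y = warr s aCm y + hits N L W Act wl y)) => //.
- by rewrite /= ex; split=> //; lia.
- by lia.
- by rewrite /= ex; apply: hl.
- by rewrite eF => e /mapP[u /lay[h _ _] ->].
- have e0 u : P 0 u = Act u by rewrite /P take0 andbT.
  split; first by move=> u uN; rewrite e0; sp; apply: hA.
  by move=> y yN; sp; congr (_ + _); apply: hits_ext => u _; rewrite e0.
- rewrite eF size_map => j s1 jus; rewrite (nth_map 0) //.
  set u := nth 0 us j => ede F1 [hA1 hM1].
  have uus : u \in us by rewrite mem_nth.
  have uN := us_N u uus; have [la lb lc] := lay u uus.
  have [w1 w2] := hA1 u uN.
  have ujs : u \notin take j us by apply: nth_notin_take.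
  have Pu : P j u = Act u by rewrite /P (negPf ujs) andbT.
  have w20 : warr s aAct u = if Act u then base L u + wl u else 0 by have [] := hA u uN.
  have Ptake v : (v \in take j.+1 us) = (v \in take j us) || (v == u) by rewrite mem_takeS.
  have eo1 : warr s1 aOwn (base L u + index x (L u)) = u by fr F1.
  apply: (okWpS (T2 := 1 + (if Act u && (x \in take (wl u) (L u)) then 4 * Q + 3 else 0))); last first.
    by rewrite /f lc w20 test //=.
  sp; rewrite ede eo1; split=> //.
  set s2 := set_wvar _ _ _.
  apply: (okIf (T1 := if Act u && (x \in take (wl u) (L u)) then 4 * Q + 3 else 0)) => //.
  + by rewrite /s2; sp; spl; nl.
  + rewrite /s2; sp; rewrite ede w2 Pu test // => h; rewrite h; case/andP: h => Au xw.
    apply: (okS (T1 := 4 * Q + 2) (T2 := 1)).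
    * have lay2 : layout g L N s2.
        by apply: layout_ext hlay _ _ _ _ _ => *; rewrite /s2; sp; fr F1.
      apply: okW (bumpP (w := wl u) (W := W) L_uniq L_lt N_len base_len len_cap cap2 _ _ _ lay2 uN _ _ _ _) (fun s' _ h => h) _ => //.
      -- by move=> s' F; sp; fr F; rewrite /s2; sp; rewrite w2 Pu Au; split=> //; nl.
      -- move=> y yN; rewrite /s2; sp; rewrite -(hW y yN); fr F1; split=> //.
         by have := hM1 y yN; have := hM y yN; lia.
      -- by have := L_Q uN; lia.
    * move=> s3 F3 hb; apply: okWp => //; sp; rewrite (fr_w F3) // /s2; sp; spl; try nl.
      have Pv v : P j.+1 v = P j v && (v != u).
        rewrite /P Ptake; case: (eqVneq v u) => [->|_]; last by rewrite orbF andbT.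
        by rewrite orbT xw !andbF.
      move=> v'; split.
        move=> v vN; have [w1' w2'] := hA1 v vN; split=> //; sp.
        rewrite Pv /upd; case: eqP => [_|_]; rewrite ?andbF // andbT -w2'.
        by fr F3; rewrite /s2; sp.
      move=> y yN; sp; rewrite hb // (hits_ext _ _ (Act' := fun v => P j v && (v != u))); last by move=> v _.
      have Pu' : P j u by rewrite Pu.
      by rewrite -hM1 // (hits_remove L W wl y uN Pu') /s2; sp; nl.
    * by lia.
  + rewrite /s2; sp; rewrite ede w2 Pu test // => h; apply: okWp => //=.
    have Pv v : P j.+1 v = P j v.
      rewrite /P Ptake; case: (eqVneq v u) => [->|_]; last by rewrite orbF.
      rewrite (negPf ujs) /= andbT; move: h; by case: (Act u) => //= /negPf->.
    move=> v'; split; first by move=> v vN; rewrite Pv; sp; apply: hA1.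
    by move=> y yN; sp; rewrite -hM1 //; congr (_ + _); apply: hits_ext => v _; rewrite Pv.
- rewrite eF size_map => s1 F1 [hA1 hM1].
  have Pv v : v < N -> P (size us) v = Act v && (x \notin take (wl v) (L v)).
    move=> vN; rewrite /P take_size mem_below vN take_size /=.
    case: (boolP (x \in take (wl v) (L v))) => xw; last by rewrite andbF.
    by rewrite (mem_take xw).
  split; first by move=> v vN; rewrite -Pv //; apply: hA1.
  by move=> y yN; rewrite -hM1 //; congr (_ + _); apply: hits_ext => v vN; rewrite Pv.
- rewrite eF big_map.
  rewrite (eq_big_seq (fun u => 4 + (4 * Q + 3) * (Act u && (x \in take (wl u) (L u))))); last first.
    move=> u uus; have [la lb lc] := lay u uus; have [_ w2] := hA u (us_N u uus).
    by rewrite /f lc w2 test //; case: (_ && _); lia.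
  rewrite big_split /= -big_distrr /= big_const_seq count_predT iter_addn_0.
  have := sum_uniq_le (fun u => Act u && (x \in take (wl u) (L u)) : nat) us_u us_N.
  move: (\sum_(_ <- _) _) (\sum_(_ < _) _) => p q pq.
  have : (4 * Q + 3) * p <= (4 * Q + 3) * q by rewrite leq_mul2l pq orbT.
  by lia.
Qed.

Lemma argmaxP s : wvar s vN = N -> 0 < N ->
  (forall x, x < N -> warr s aCnt x <= N /\ warr s aCm x <= N) ->
  ok cap len argmax s (4 * N + 3) (fun s' => wvar s' bx < N /\
    forall x, x < N -> warr s aCnt x + warr s aCm (wvar s' bx) <=
                       warr s aCnt (wvar s' bx) + warr s aCm x).
Proof.
move=> eN N0 hb; apply: (okWpS (T2 := 4 * N + 2)); last by rewrite /=; lia.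
sp; spl; try nl.
apply: (okFor (a := 0) (b := N) (f := 2) (I := fun j s' => wvar s' bx < N /\
    forall x, x < j -> warr s aCnt x + warr s aCm (wvar s' bx) <=
                       warr s aCnt (wvar s' bx) + warr s aCm x)) => //; try nl.
- by rewrite /=; lia.
- by move=> s' F; split=> //=; fr F; sp.
- move=> j s' /andP[_ jN] ej F [bN h].
  have e1 : warr s' aCnt = warr s aCnt by fr F; sp.
  have e2 : warr s' aCm = warr s aCm by fr F; sp.
  have [h1 h2] := hb j jN; have [h3 h4] := hb _ bN.
  apply: okWp => //; sp; rewrite ej e1 e2; spl; try nl.
  by case: ltnP => hlt; sp; rewrite ?ej; spl; try nl; move=> x;
    rewrite ltnS leq_eqVlt => /orP[/eqP->|/h ?]; nl.
Qed.

Lemma greedyP s (W Act A : pred nat) wl k l : layout g L N s -> wvar s vN = N -> 0 < N ->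
  lists N (warr s hI) (warr s nI) allF ->
  (forall x, x < N -> warr s aW x = W x) -> active Act wl s -> (forall x, warr s aInA x = A x) ->
  (forall x, x < N -> warr s aCnt x = hits N L W Act wl x) ->
  (forall x, x < N -> warr s aCm x = 0) ->
  let om := \sum_(x < N) (W x : nat) in 0 < om -> 0 < k -> N < 2 ^ l ->
  (forall u, u < N -> Act u -> count W (take (wl u) (L u)) = om %/ k + 1) ->
  ok cap len greedy s ((k * l).+1 * (8 * N + 10) + (4 * Q + 3) * N + 2) (fun s' =>
    exists A' : pred nat, [/\ forall x, warr s' aInA x = A' x, forall x, A x -> A' x,
      \sum_(x < N) (A' x : nat) <= \sum_(x < N) (A x : nat) + k * l &
      forall u, u < N -> Act u -> exists2 x, x \in take (wl u) (L u) & W x && A' x]).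
Proof.
move=> hlay eN N0 hl hW hA hInA hC hM om om0 k0 Nl hcnt; set h := om %/ k + 1 in hcnt.
have N_len : N < len by lia.
have ohk : om <= h * k.
  by rewrite {1}(divn_eq om k) /h mulnDl leq_add2l mul1n ltnW // ltn_pmod.
have hle B y : hits N L W B wl y <= N by apply: hits_le.
pose card (B : pred nat) := \sum_(u < N) (B u : nat).
have card_le B : card B <= N.
  by rewrite /card -[X in _ <= X]card_ord -sum1_card; apply: leq_sum => u _; exact: leq_b1.
(* The rounds to come, at most [k * l] successful ones and a last one that finds nothing to hit,
   plus the removal of the [a] windows that are still active. *)
pose bud i a := ((k * l).+1 - i) * (8 * N + 10) + (4 * Q + 3) * a.
pose J (i : nat) (Act' : pred nat) s' := exists A' : pred nat,
  [/\ [/\ forall x, warr s' aInA x = A' x, forall x, A x -> A' x &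
      \sum_(x < N) (A' x : nat) <= \sum_(x < N) (A x : nat) + i],
    (forall u, u < N -> Act' u -> Act u) /\
    (forall u, u < N -> Act u -> ~~ Act' u -> exists2 x, x \in take (wl u) (L u) & W x && A' x),
    active Act' wl s',
    (forall y, y < N -> warr s' aCm y + hits N L W Act' wl y = hits N L W Act wl y) &
    card Act' * k ^ i <= N * k.-1 ^ i /\ i <= k * l].
apply: (okWpS (T2 := bud 0 N + 1)); last by rewrite /= /bud; lia.
sp; spl; try nl.
apply: (okWhile (I := fun v s' => exists i Act', [/\ J i Act' s', wvar s' go <= 1,
    wvar s' go = 0 -> forall u, u < N -> ~~ Act' u &
    v = if wvar s' go == 0 then 0 else bud i (card Act')]) (v := bud 0 (card Act))) => //.
- exists 0, Act; split=> //; exists A; split=> //.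
  + by rewrite addn0.
  + by split=> // u uN ->.
  + by move=> y yN; sp; rewrite hM.
  + by rewrite !muln1.
- by move=> v s' _ _ /=; spl; lia.
- move=> v s1 F1 [i [Act1 [[A1 [[hI1 hI2 hI3] [hs hh] ha1 hm1 [hd hi]]] hgo _ ->]]].
  rewrite -[tden _ _]/(0 < wvar s1 go) => g0; rewrite ifN -?lt0n //.
  have eN1 : wvar s1 vN = N by fr F1; sp.
  have eC1 : warr s1 aCnt = warr s aCnt by fr F1; sp.
  have hW1 y : y < N -> warr s1 aW y = W y by move=> yN; fr F1; sp; apply: hW.
  have hbnd x : x < N -> warr s1 aCnt x <= N /\ warr s1 aCm x <= N.
    move=> xN; rewrite eC1 hC //.
    by have := hm1 x xN; have := hle Act x; lia.
  have [t1 [s2 [ex1 ht1 [bN hmax]]]] := argmaxP eN1 N0 hbnd.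
  have F2 := exec_frame ex1; set x := wvar s2 bx in bN hmax.
  set M := hits N L W Act1 wl x.
  have eC2 : warr s2 aCnt = warr s1 aCnt by fr F2.
  have eM2 : warr s2 aCm = warr s1 aCm by fr F2.
  have hM1 y : y < N -> warr s1 aCnt y = warr s1 aCm y + hits N L W Act1 wl y.
    by move=> yN; rewrite eC1 hC // hm1.
  have hmaxM y : y < N -> hits N L W Act1 wl y <= M.
    by move=> yN; have := hmax y yN; rewrite !hM1 // /M; lia.
  have a_kM : card Act1 <= k * M.
    apply: (@hits_max N k h L W L_uniq L_lt Act1 wl M om0 ohk) => //.
    by move=> u uN /(hs u uN); apply: hcnt.
  exists (8 * N + 8 + (4 * Q + 3) * M).
  apply: (okS (T1 := 4 * N + 3) (T2 := 4 * N + 5 + (4 * Q + 3) * M) (Q1 := fun s' => s' = s2));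
    [by exists t1, s2| |lia].
  move=> _ _ ->.
  apply: (okIf (T1 := 4 * N + 3 + (4 * Q + 3) * M)) => //; last by lia.
  + by sp; rewrite -/x; spl; nl.
  + rewrite /= -/x eC2 eM2 hM1 // -[X in X < _]addn0 ltn_add2l -/M => M0.
    have Wx : W x.
      by apply: contraTT M0 => /negPf Wx; rewrite -leqNgt /M /hits big1 // => u _; rewrite Wx andbF.
    have eM u : (Act1 u && (x \in take (wl u) (L u)) && W x) = Act1 u && (x \in take (wl u) (L u)).
      by rewrite Wx andbT.
    have MM : M = \sum_(u < N) (Act1 u && (x \in take (wl u) (L u)) : nat).
      by apply: eq_bigr => u _; rewrite eM.
    pose Act2 u := Act1 u && (x \notin take (wl u) (L u)).
    have cA : card Act1 = card Act2 + M.
      rewrite MM /card -big_split /=; apply: eq_bigr => u _; rewrite /Act2.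
      by case: (Act1 u) => //; case: (_ \in _).
    have a0 : 0 < card Act1 by rewrite cA addn_gt0 M0 orbT.
    have ik : i < k * l := decay_bound k0 Nl hd a0.
    (* By [hits_max] the chosen vertex hits at least a 1 / k share of the active windows, so at most
       the fraction (k - 1) / k survives. *)
    have dec : card Act2 * k ^ i.+1 <= N * k.-1 ^ i.+1.
      apply: leq_trans (_ : card Act1 * k.-1 * k ^ i <= _).
        rewrite expnS mulnA leq_mul2r; apply/orP; right.
        by rewrite -subn1 mulnBr muln1 cA leq_subRL; nia.
      by rewrite expnS mulnAC mulnA [X in _ <= X]mulnAC leq_mul2r hd orbT.
    apply: (okWpS (T2 := 4 * N + 2 + (4 * Q + 3) * M)); last by rewrite /=; lia.
    sp; rewrite -/x; spl; try nl.
    set s3 := set_warr _ _ _ _.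
    have lay3 : layout g L N s3.
      by apply: layout_ext hlay _ _ _ _ _ => *; rewrite /s3; sp; fr F2; fr F1; sp.
    rewrite {1}MM; apply: okW (hitP (W := W) (Act := Act1) (wl := wl) lay3 _ _ bN _ _ _) _ _ => //.
    * by rewrite /s3; sp; fr F2; fr F1; sp.
    * by move=> y yN; rewrite /s3; sp; fr F2; apply: hW1.
    * by move=> u uN; rewrite /s3; sp; fr F2; apply: ha1.
    * by move=> y yN; rewrite /s3; sp; rewrite eM2 hm1.
    * move=> s4 F4 /= [ha4 hm4].
      exists (bud i.+1 (card Act2)); last first.
        rewrite /bud cA; have -> : (k * l).+1 - i = ((k * l).+1 - i.+1).+1 by lia.
        by rewrite mulSn mulnDr; lia.
      exists i.+1, Act2; split.
      -- exists (fun y => (y == x) || A1 y); split=> //.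
         ++ split.
            ** move=> y; fr F4; rewrite /s3; sp; fr F2; rewrite /upd; case: eqP => // _; exact: hI1.
            ** by move=> y /hI2->; rewrite orbT.
            ** apply: leq_trans (_ : \sum_(y < N) ((y == x :> nat) + A1 y) <= _).
                 by apply: leq_sum => y _; case: (_ == _); case: (A1 y).
               rewrite big_split /= (bigD1 (Ordinal bN)) //= eqxx big1 => [|y]; first by rewrite add1n addnS ltnS.
               by rewrite -val_eqE /= => /negPf->.
         ++ split; first by move=> u uN /andP[/(hs u uN)].
            move=> u uN Au; rewrite /Act2 negb_and negbK.
            case: (boolP (Act1 u)) => [_ /= xu|nA _]; first by exists x; rewrite // Wx eqxx.
            by have [y y1 /andP[y2 y3]] := hh u uN Au nA; exists y; rewrite // y2 y3 orbT.
         ++ by move=> y yN; rewrite hm4 // /s3; sp; rewrite eM2 hm1.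
      -- by fr F4; rewrite /s3; sp; fr F2.
      -- by fr F4; rewrite /s3; sp; fr F2; move=> E; rewrite E in g0.
      -- by rewrite ifN // -lt0n; fr F4; rewrite /s3; sp; fr F2.
  + rewrite /= -/x eC2 eM2 hM1 // -[X in X < _]addn0 ltn_add2l -/M -eqn0Ngt => /eqP M0.
    have c0 : card Act1 = 0 by apply/eqP; rewrite -leqn0; rewrite M0 muln0 in a_kM.
    apply: okWp => //; sp; last by lia.
    spl; try nl.
    exists 0; last first.
      rewrite M0 c0 /bud (subSn hi) mulSn !muln0 !addn0 add0n.
      by apply: leq_trans (leq_addr _ _); lia.
    exists i, Act1; split=> //.
    * by exists A1; split=> //; [split=> // y; sp; fr F2; apply: hI1|
        move=> u uN; sp; fr F2; apply: ha1|move=> y yN; sp; fr F2; apply: hm1].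
    * move=> _ u uN; have := c0; rewrite /card (bigD1 (Ordinal uN)) //=.
      by case: (Act1 u).
- move=> v s1 F1 [i [Act1 [[A1 [[hI1 hI2 hI3] [hs hh] ha1 hm1 [hd hi]]] hgo hz _]]].
  rewrite -[tden _ _]/(0 < wvar s1 go) -eqn0Ngt => /eqP g0.
  exists A1; split=> //; first by apply: leq_trans hI3 _; rewrite leq_add2l.
  by move=> u uN Au; apply: hh => //; apply: hz.
- by rewrite /bud addn1 ltnS leq_add2l leq_mul2l card_le orbT.
Qed.

End Greedy.

(** * Phases that cut the balls at landmarks and thin out the crowded vertices *)

Definition cut_lists : cmd := (
  zero aCl;;
  For du (C 0) (V vN) (
    (de ::= WRead aBase (V du);; cw ::= C 1);;
    While (TAnd (TLt (C 0) (V cw)) (TLt (V de) (WRead aEnd (V du)))) (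
      If (TEq (WRead aInA (WRead oV (V de))) (C 1)) (cw ::= C 0)
        (dx ::= WRead oV (V de);;
         WStore aCl (V dx) (WRead aCl (V dx) :+ C 1);;
         de ::= V de :+ C 1));;
    WStore aEnd (V du) (V de)))%cmd.

Definition shrink : cmd := (
  omega ::= C 0;;
  For dx (C 0) (V vN) (
    If (TLt (V vs) (WRead aCl (V dx))) (omega ::= V omega :+ WRead aW (V dx))
      (WStore aW (V dx) (C 0))))%cmd.

(** [aW] marks the vertices that are still crowded, at first all of them. By [halving] each pass at
    least halves their number [omega], so that the loop ends after about log N passes. *)
Definition clusters : cmd := (
  inv_lists;;
  For dx (C 0) (V vN) (WStore aW (V dx) (C 1));;
  omega ::= V vN;;
  While (TLt (C 0) (V omega)) (windows;; greedy;; cut_lists;; shrink))%cmd.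

Lemma find_take (A : pred nat) (l : seq nat) i b : i <= b <= size l -> ~~ has A (take i l) ->
  (i == b) || A (nth 0 l i) -> find A (take b l) = i.
Proof.
move=> /andP[ib bl] hi hor.
rewrite -(subnKC ib) takeD find_cat (negPf hi) size_take_min.
have -> : minn i (size l) = i by apply/minn_idPl; lia.
case: eqP hor => [->|ne] /=; first by rewrite subnn take0 addn0.
have il : i < b by lia.
move=> Ai; rewrite (drop_nth 0) ?(leq_trans il) // (_ : b - i = (b - i).-1.+1); last by lia.
by rewrite /= Ai addn0.
Qed.

Section Clusters.
Variables (R : realType) (cap len : nat) (g : mgraph R) (L : nat -> seq nat) (Q : nat).
Implicit Types s : state R.
Local Notation N := (gN g).
Hypothesis L_uniq : forall u, u < N -> uniq (L u).
Hypothesis L_lt : forall u, u < N -> {in L u, forall x, x < N}.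
Hypothesis L_Q : forall u, u < N -> size (L u) <= Q.
Hypothesis N2_len : N + N < len.
Hypothesis base_len : base L N <= len.
Hypothesis len_cap : len < cap.
Hypothesis cap2 : 2 < cap.

Lemma cut_listsP s (A : pred nat) b : wvar s vN = N -> layout g L N s ->
  (forall u, u < N -> b u <= size (L u) /\ warr s aEnd u = base L u + b u) ->
  (forall x, warr s aInA x = A x) ->
  ok cap len cut_lists s (N * (5 * Q + 15) + 4) (fun s' =>
    let b' u := find A (take (b u) (L u)) in
    (forall u, u < N -> warr s' aEnd u = base L u + b' u) /\
    forall x, x < N -> warr s' aCl x = \sum_(u < N) (x \in take (b' u) (L u) : nat)).
Proof.
move=> eN hlay hb hA; have N_len : N < len by lia.
apply: (okS (zeroP N_len base_len len_cap cap2 aCl eN) (T2 := N * (5 * Q + 12) + 2)); last by lia.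
move=> s1 F1 z1; pose b' u := find A (take (b u) (L u)).
apply: (okFor (a := 0) (b := N) (f := 5 * Q + 10) (I := fun j s' =>
  (forall u, u < N -> warr s' aEnd u = base L u + if u < j then b' u else b u) /\
  forall x, x < N -> warr s' aCl x = \sum_(u < j) (x \in take (b' u) (L u) : nat))) => //; try nl.
- by rewrite /=; lia.
- by move=> s' F; split=> //=; fr F; fr F1.
- split; sp; last by move=> x xN; rewrite big_ord0 z1.
  by move=> u uN; fr F1; have [] := hb u uN.
- move=> u s2 /andP[_ uN] ej F2 [hE hC].
  have [b1 b2] := hb u uN; have [l1 l2 l3] := hlay u uN.
  have bl : base L u + size (L u) <= len by apply: base_lt uN.
  have eB : warr s2 aBase u = base L u by fr F2; fr F1.
  have clb x : x < N -> warr s2 aCl x <= u.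
    move=> xN; rewrite hC // -[X in _ <= X]card_ord -sum1_card.
    by apply: leq_sum => w _; exact: leq_b1.
  apply: (okWpS (T2 := 5 * Q + 8)); last by rewrite /=; lia.
  sp; rewrite ej eB; spl; try nl.
  set s4 := set_wvar _ _ _.
  apply: (okS (T1 := 5 * Q + 6) (T2 := 1) (Q1 := fun s' => wvar s' de = base L u + b' u /\
     forall x, x < N -> warr s' aCl x = warr s2 aCl x + (x \in take (b' u) (L u)))); last by lia.
  + apply: (okWhile (v := 5 * b u + 5) (I := fun v s' => exists i,
      [/\ [/\ i <= b u, wvar s' de = base L u + i & ~~ has A (take i (L u))], wvar s' cw <= 1,
       wvar s' cw = 0 -> A (nth 0 (L u) i) && (i < b u),
       forall x, x < N -> warr s' aCl x = warr s2 aCl x + (x \in take i (L u)) &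
       v = 5 * (b u - i) + 5 * wvar s' cw])).
    * exists 0; rewrite /s4; sp; rewrite take0 addn0 subn0; split=> // x xN.
      by rewrite addn0.
    * by move=> v s' F _ /=; fr F; rewrite /s4; sp; rewrite ej; spl; lia.
    * move=> v s' F [i [[ib ed hi] hc h0 hCl ->]] /=.
      have eu : wvar s' du = u by fr F; rewrite /s4; sp.
      have eE : warr s' aEnd u = base L u + b u by fr F; rewrite /s4; sp; rewrite hE // ltnn.
      rewrite eu ed eE ltn_add2l => /andP[c0 ib'].
      have iL : i < size (L u) by lia.
      have [k1 k2 k3] := l3 i iL; set x := nth 0 (L u) i in k1 h0 *.
      have xN : x < N by apply: L_lt (mem_nth 0 iL).
      have c1 : wvar s' cw = 1 by lia.
      have eO : warr s' oV (base L u + i) = x by fr F; rewrite /s4; sp; fr F2; fr F1.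
      have eA : warr s' aInA x = A x by fr F; rewrite /s4; sp; fr F2; fr F1.
      have xi : x \notin take i (L u) by apply: nth_notin_take => //; apply: L_uniq.
      have clx := clb x xN.
      have clx' : warr s' aCl x = warr s2 aCl x by rewrite hCl // (negPf xi) addn0.
      exists 4; apply: okWp => //; sp; rewrite ed eO eA; spl; try nl.
      have -> : ((A x : nat) == 1) = A x by case: (A x).
      case Ax : (A x); sp; rewrite ?ed ?eO ?clx'; spl; try nl.
        exists (5 * (b u - i)); last by rewrite c1; lia.
        by exists i; sp; split=> //; rewrite ?Ax ?ib' ?addn0.
      exists (5 * (b u - i.+1) + 5); last by rewrite c1; nl.
      exists i.+1; sp; rewrite c1; split=> //.
      -- by split=> //; [lia|rewrite (take_nth 0) // has_rcons negb_or hi -/x Ax].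
      -- move=> y yN; rewrite mem_takeS // -/x /upd; case: eqP => [->|_]; last by rewrite orbF hCl.
         by rewrite orbT.
    * move=> v s' F [i [[ib ed hi] hc h0 hCl _]] /=.
      have eu : wvar s' du = u by fr F; rewrite /s4; sp.
      have eE : warr s' aEnd u = base L u + b u by fr F; rewrite /s4; sp; rewrite hE // ltnn.
      rewrite eu ed eE ltn_add2l negb_and -!leqNgt => hor.
      have -> : b' u = i.
        apply: find_take => //; first by rewrite ib b1.
        have [E|] := posnP (wvar s' cw); first by have /andP[-> _] := h0 E; rewrite orbT.
        move=> c; have E : i = b u by lia.
        by rewrite E eqxx.
      by split.
    * by have := L_Q uN; lia.
  + move=> s5 F5 [ed hCl].
    have eu : wvar s5 du = u by fr F5; rewrite /s4; sp.
    apply: okWp => //; sp; rewrite eu ed; spl; try nl.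
    * move=> w wN; rewrite /upd ltnS leq_eqVlt; case: eqP => [->//|ne].
      by fr F5; rewrite /s4; sp; rewrite hE.
    * by move=> x xN; rewrite big_ord_recr /= hCl // hC.
- move=> s' _ F [h1 h2]; split=> // u uN; by rewrite h1 // uN.
Qed.

Lemma shrinkP s (W : pred nat) t : wvar s vN = N -> wvar s vs = t ->
  (forall x, x < N -> warr s aW x = W x) ->
  ok cap len shrink s (4 * N + 3) (fun s' =>
    let W' x := W x && (t < warr s aCl x) in
    (forall x, x < N -> warr s' aW x = W' x) /\ wvar s' omega = \sum_(x < N) (W' x : nat)).
Proof.
move=> eN es hW; apply: (okWpS (T2 := 4 * N + 2)); last by rewrite /=; lia.
sp; spl; try nl.
pose W' x := W x && (t < warr s aCl x).
apply: (okFor (a := 0) (b := N) (f := 2) (I := fun j s' =>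
  (forall x, x < N -> warr s' aW x = if x < j then W' x : nat else W x) /\
  wvar s' omega = \sum_(x < j) (W' x : nat))) => //; try nl.
- by rewrite /=; lia.
- by move=> s' F; split=> //=; fr F; sp.
- by split; sp => //; rewrite big_ord0.
- move=> j s' /andP[_ jN] ej F [h ho].
  have e1 : warr s' aCl j = warr s aCl j by fr F; sp.
  have e2 : wvar s' vs = t by fr F; sp.
  have oj : wvar s' omega <= j.
    rewrite ho -[X in _ <= X]card_ord -sum1_card.
    by apply: leq_sum => w _; exact: leq_b1.
  have eW : warr s' aW j = W j by rewrite h // ltnn.
  have hW' x : (x < j.+1) = (x < j) || (x == j) by rewrite ltnS leq_eqVlt orbC.
  apply: okWp => //; sp; rewrite ej e1 e2; spl; try nl.
  case: ltnP => hlt; sp; rewrite ?ej ?eW; spl; try nl.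
  + move=> x xN; rewrite h // hW'; case: eqP => [->|]; last by rewrite orbF.
    by rewrite orbT ltnn /W' hlt andbT.
  + by rewrite big_ord_recr /= -ho /W' hlt andbT.
  + move=> x xN; rewrite hW' /upd; case: eqP => [->|]; last by rewrite orbF h.
    by rewrite orbT /W' ltnNge hlt andbF.
  + by rewrite big_ord_recr /= -ho /W' ltnNge hlt andbF addn0.
- by move=> s' _ F [h1 h2]; split=> // x xN; rewrite h1 // xN.
Qed.

Definition phase_time k l := N * (7 * Q + 25) + 10 +
  ((k * l).+1 * (8 * N + 10) + (4 * Q + 3) * N + 2) + (N * (5 * Q + 15) + 4) + (4 * N + 3).

Lemma take_find (A : pred nat) (l : seq nat) b x : b <= size l -> x \in take b l -> A x ->
  find A (take b l) <= index x l.
Proof.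
move=> bl xb Ax; have il : index x l < b by rewrite -mem_take_index.
rewrite leqNgt; apply/negP => h; have := before_find 0 h.
by rewrite nth_take // nth_index ?Ax // (mem_take xb).
Qed.

Lemma clustersP s q l : layout g L N s -> wvar s vN = N -> 0 < N ->
  (forall u, u < N -> warr s aEnd u = base L u + size (L u)) ->
  (forall x, warr s aInA x = 0) -> 0 < q -> N <= q * (q * q) ->
  wvar s vk = q * q -> wvar s vs = q + q -> Q = N %/ (q * q) + 1 -> N < 2 ^ l ->
  ok cap len clusters s (10 * N + 5 * base L N + 10 + l * (phase_time (q * q) l + 1)) (fun s' =>
    exists (A : pred nat) b, [/\ forall x, warr s' aInA x = A x,
     \sum_(x < N) (A x : nat) <= q * q * l * l,
     forall u, u < N -> [/\ b u <= size (L u), warr s' aEnd u = base L u + b u,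
       b u < size (L u) -> A (nth 0 (L u) (b u)) & size (L u) = Q -> b u < size (L u)] &
     forall x, x < N -> \sum_(u < N) (x \in take (b u) (L u) : nat) <= q + q]).
Proof.
move=> hlay eN N0 hEnd hInA q0 Nq ek es eQ Nl; have N_len : N < len by lia.
have k0 : 0 < q * q by rewrite muln_gt0 q0.
set k := q * q in k0 ek eQ *; set TP := phase_time k l.
have hb0 u : u < N -> size (L u) <= size (L u) /\ warr s aEnd u = base L u + size (L u).
  by move=> uN; rewrite leqnn hEnd.
apply: (okS (inv_listsP L_uniq L_lt N_len base_len len_cap cap2 (b := fun u => size (L u)) eN hlay hb0)
  (T2 := 3 * N + 2 + 1 + l * (TP + 1) + 1)); last by lia.
move=> s1 F1 hl1.
apply: (okS (T1 := 3 * N + 2) (T2 := 1 + l * (TP + 1) + 1)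
  (Q1 := fun s' => forall x, x < N -> warr s' aW x = 1)); last by lia.
  apply: (okFor (a := 0) (b := N) (f := 1) (I := fun j s' => forall x, x < j -> warr s' aW x = 1)) => //; try nl.
  - by rewrite /=; lia.
  - by move=> s' F; split=> //=; fr F; fr F1.
  - move=> j s' /andP[_ jN] ej F h; apply: okWp => //; sp; rewrite ej; spl; try nl.
    by move=> x xj; rewrite /upd; case: eqP => // ne; apply: h; lia.
move=> s2 F2 hW2; apply: (okWpS (T2 := l * (TP + 1) + 1)); last by rewrite /=; lia.
have eN2 : wvar s2 vN = N by fr F2; fr F1.
sp; rewrite eN2; split=> //.
pose cl (b : nat -> nat) x := \sum_(u < N) (x \in take (b u) (L u) : nat).
(* After [p] phases at most N / 2^p vertices are crowded and at most [k * l * p] landmarks are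
   chosen. The alternative in the fourth clause, that all vertices are crowded, serves the start,
   where full lists are not cut yet. *)
pose J p (W : pred nat) s' := exists (A : pred nat) b,
  [/\ (forall x, x < N -> warr s' aW x = W x) /\ wvar s' omega = \sum_(x < N) (W x : nat),
   p <= l /\ 2 ^ p * \sum_(x < N) (W x : nat) <= N,
   (forall x, warr s' aInA x = A x) /\ \sum_(x < N) (A x : nat) <= k * l * p,
   (forall u, u < N -> [/\ b u <= size (L u), warr s' aEnd u = base L u + b u,
       b u < size (L u) -> A (nth 0 (L u) (b u)) & size (L u) = Q ->
       b u < size (L u) \/ forall x, x < N -> W x]) &
   forall x, x < N -> ~~ W x -> cl b x <= q + q].
apply: (okWhile (v := l * (TP + 1)) (I := fun v s' => exists p W, J p W s' /\ v = (l - p) * (TP + 1))).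
- exists 0, xpredT; rewrite subn0; split=> //; exists xpred0, (fun u => size (L u)).
  split=> //.
  + by split; sp; rewrite ?sum1_card ?card_ord.
  + by split=> //; rewrite mul1n sum1_card card_ord.
  + by split; [move=> x; sp; fr F2; fr F1; rewrite hInA|rewrite big1].
  + move=> u uN; split=> //; first by sp; fr F2; fr F1; apply: hEnd.
      by rewrite ltnn.
    by right.
- by move=> v s' _ _ /=; spl; lia.
- move=> v s3 F3 [p [W [[A [b [[hW ho] [hpl hp] [hA hcA] hb hcl]]] ->]]] /=; rewrite ho.
  set om := \sum_(x < N) _ in ho hp * => om0.
  have pl : p < l.
    rewrite -(ltn_exp2l (m := 2)) //; apply: leq_ltn_trans Nl; apply: leq_trans hp.
    by rewrite leq_pmulr.
  have eN3 : wvar s3 vN = N by fr F3.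
  have ek3 : wvar s3 vk = k by fr F3; sp; fr F2; fr F1.
  have es3 : wvar s3 vs = q + q by fr F3; sp; fr F2; fr F1.
  have lay s' : warr s' aBase = warr s3 aBase -> warr s' aLend = warr s3 aLend ->
      warr s' oV = warr s3 oV -> rarr s' oD = rarr s3 oD -> warr s' aOwn = warr s3 aOwn ->
      layout g L N s'.
    move=> E1 E2 E3 E4 E5; apply: layout_ext hlay _ _ _ _ _ => *;
      rewrite ?E1 ?E2 ?E3 ?E4 ?E5; fr F3; sp; fr F2; fr F1; by [].
  have lst s' : warr s' hI = warr s3 hI -> warr s' nI = warr s3 nI ->
      lists N (warr s' hI) (warr s' nI) (Finv L (fun u => size (L u)) N).
    by move=> -> ->; fr F3; sp; fr F2.
  have omN : om <= N.
    by rewrite /om -[X in _ <= X]card_ord -sum1_card; apply: leq_sum => w _; exact: leq_b1.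
  have hb' u : u < N -> b u <= size (L u) /\ warr s3 aEnd u = base L u + b u.
    by move=> uN; have [] := hb u uN.
  exists TP.
  apply: (okS (windowsP L_uniq L_lt N_len base_len len_cap cap2 eN3 (lay _ _ _ _ _ _) hb' L_Q hW ek3 ho omN)
    (T2 := ((k * l).+1 * (8 * N + 10) + (4 * Q + 3) * N + 2) + (N * (5 * Q + 15) + 4) + (4 * N + 3))) => //;
    last by rewrite /TP /phase_time; lia.
  move=> s4 F4 [Act [wl [hwin hC hM]]]; set h := om %/ k + 1 in hwin.
  apply: (okS (T2 := (N * (5 * Q + 15) + 4) + (4 * N + 3)) (greedyP (W := W) (Act := Act) (A := A) (wl := wl) (k := k) (l := l)
     L_uniq L_lt L_Q N2_len base_len len_cap cap2 (lay _ _ _ _ _ _) _ N0 (lst _ _ _) _ _ _ hC hM om0 k0 Nl _)); try by fr F4.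
  + by move=> u uN; have [w1 w2 _ _] := hwin u uN; have [? _] := hb' u uN; split=> //; lia.
  + by move=> u uN; have [] := hwin u uN.
  + move=> s5 F5 [A' [hA' AA' hcA' hhit]].
    apply: (okS (T2 := 4 * N + 3) (cut_listsP (A := A') (b := b) (s := s5) _ (lay _ _ _ _ _ _) _ hA')); try by fr F5; fr F4.
    * move=> s6 F6; set b' := fun u => find A' (take (b u) (L u)); move=> /= [hE hCl].
      have b'b u : u < N -> b' u <= b u.
        move=> uN; have [bs _] := hb' u uN; apply: leq_trans (find_size _ _) _.
        by rewrite size_takel.
      have hcount u : u < N -> count W (take (b' u) (L u)) < h.
        move=> uN; have [bs _] := hb' u uN; have [w1 _ w3 w4] := hwin u uN.
        have [Au|/w4 hlt] := boolP (Act u); last first.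
          apply: leq_ltn_trans hlt; rewrite -(subnKC (b'b u uN)) takeD count_cat leq_addr //.
        have [x xw /andP[Wx A'x]] := hhit u uN Au.
        have il : index x (L u) < wl u by rewrite -mem_take_index //; lia.
        have xb : x \in take (b u) (L u) by rewrite mem_take_index //; lia.
        have fi : b' u <= index x (L u) := take_find bs xb A'x.
        rewrite -(w3 Au); apply: leq_trans (count_take_lt (P := W) fi _ _) _; first by lia.
          by rewrite nth_index // (mem_take xb).
        by rewrite -(subnKC il) takeD count_cat leq_addr.
      have clm x : cl b' x <= cl b x.
        apply: leq_sum => u _; have [bs _] := hb' u (ltn_ord u).
        have := b'b u (ltn_ord u); case xt : (x \in take (b' u) _) => // bb.
        by rewrite -(subnKC bb) takeD mem_cat xt.
      have eN6 : wvar s6 vN = N by fr F6; fr F5; fr F4.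
      have es6 : wvar s6 vs = q + q by fr F6; fr F5; fr F4.
      have hW6 x : x < N -> warr s6 aW x = W x by move=> xN; fr F6; fr F5; fr F4; apply: hW.
      apply: okW (shrinkP eN6 es6 hW6) _ (leqnn _) => s7 F7.
      pose W' x := W x && (q + q < warr s6 aCl x); rewrite /= => -[hW7 ho7].
      exists ((l - p.+1) * (TP + 1)); last first.
        by rewrite (_ : l - p = (l - p.+1).+1) ?mulSn //; lia.
      exists p.+1, W'; split=> //; exists A', b'; split.
      -- by split.
      -- split=> //; apply: leq_trans hp; rewrite expnS [2 * _]mulnC -mulnA leq_mul2l; apply/orP; right.
         apply: (@halving N k h L W L_uniq L_lt b' (q + q) q W') => //.
         move=> x xN /andP[Wx]; rewrite hCl //.
      -- split; first by move=> x; fr F7; fr F6; apply: hA'.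
         by rewrite mulnS addnC; apply: leq_trans hcA' _; rewrite leq_add2r.
      -- move=> u uN; have [bs be bA bF] := hb u uN; have bb := b'b u uN.
         have bsz : b' u < size (L u) -> A' (nth 0 (L u) (b' u)).
           move=> hlt; move: bb; rewrite leq_eqVlt => /orP[/eqP E|bb].
             by rewrite E AA' // bA // -E.
           rewrite -(nth_take 0 bb) nth_find // has_find.
           by rewrite size_takel.
         split=> //.
         ++ by lia.
         ++ by fr F7; apply: hE.
         (* While all vertices count as crowded, a ball with at most omega / k of them has at most N
            / k members. A full list has N / k + 1 entries, so it is cut properly, at a landmark. *)
         ++ move=> sQ; left; have [hlt|hall] := bF sQ; first by lia.
            have E : count W (take (b' u) (L u)) = b' u.
              rewrite (eq_in_count (a2 := xpredT)) ?count_predT ?size_takel ?(leq_trans bb bs) //.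
              by move=> x /mem_take /(L_lt uN) xN; rewrite /= hall.
            have := hcount u uN; rewrite E sQ eQ /h => hlt.
            by apply: leq_trans hlt _; rewrite leq_add2r leq_div2r.
      -- move=> x xN; rewrite /W' negb_and -leqNgt => /orP[nW|]; last by rewrite hCl.
         by apply: leq_trans (clm x) _; apply: hcl.
    * by rewrite addnA.
- move=> v s3 F3 [p [W [[A [b [[hW ho] [hpl hp] [hA hcA] hb hcl]]] _]]] /=; rewrite ho.
  rewrite -eqn0Ngt => /eqP o0.
  have W0 x : x < N -> ~~ W x.
    by move=> xN; move: o0; rewrite (bigD1 (Ordinal xN)) //=; case: (W x).
  exists A, b; split=> //.
  + apply: leq_trans hcA _; by rewrite leq_mul2l hpl orbT.
  + move=> u uN; have [h1 h2 h3 h4] := hb u uN; split=> // /h4[//|hall].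
    by have := W0 0 N0; rewrite hall.
  + by move=> x xN; apply: hcl => //; apply: W0.
- by lia.
Qed.

End Clusters.

(** * Pairs of balls joined by an edge *)

Local Notation dv := 38.
Local Notation tp := 39.
Local Notation tt := 42.
Local Notation aTk := 60.
Local Notation aTv := 61.
Local Notation aTc := 62.
Local Notation aTst := 63.
Local Notation aTend := 64.
Local Notation aPrw := 65.
Local Notation rTmp := 14.
Local Notation rTd := 15.
Local Notation rR := 16.

(** The near list is sorted by distance and the ball ends before its first landmark, so the entry at
    [aEnd] is the pivot. A ball that fills its whole list has none and gets an infinite radius. *)
Definition pivots : cmd := (
  For du (C 0) (V vN) (
    If (TLt (WRead aEnd (V du)) (WRead aLend (V du)))
      (RStore rR (V du) (RRead oD (WRead aEnd (V du)));;
       WStore aPrw (V du) (WRead aRow (WRead oV (WRead aEnd (V du)))))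
      (RStore rR (V du) RInfty;; WStore aPrw (V du) (C 0))))%cmd.

Definition record_cand : cmd := (
  If (TLe RInfty (RRead rTmp (V du)))
    (WStore aTk (V tt) (V du);; WStore aTv (V tt) (V dv);;
     WStore aTc (V du) (WRead aTc (V du) :+ C 1);; tt ::= V tt :+ C 1) Skip;;
  If (TLe (RVar rnd) (RRead rTmp (V du))) (RStore rTmp (V du) (RVar rnd)) Skip)%cmd.

Definition scan_edge : cmd := (
  dy ::= WRead aT (V de);;
  ForL dk (WRead hI (V dy)) nI (
    (du ::= WRead aOwn (V dk);;
     RSet rnd (RAdd (RAdd (RRead oD (V tp)) (RRead rW (V de))) (RRead oD (V dk))));;
    record_cand))%cmd.

(** All candidates of one [v] are collected before the next, so that minima indexed by [u] alone
    suffice. They are reset along the list of recorded pairs, at a cost proportional to its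
    length. *)
Definition scan_source : cmd := (
  WStore aTst (V dv) (V tt);;
  For tp (WRead aBase (V dv)) (WRead aEnd (V dv)) (
    dx ::= WRead oV (V tp);;
    ForL de (WRead hF (V dx)) nF scan_edge);;
  WStore aTend (V dv) (V tt);;
  For tp (WRead aTst (V dv)) (V tt) (
    (du ::= WRead aTk (V tp);;
     RStore rTd (V tp) (RRead rTmp (V du)));; RStore rTmp (V du) RInfty))%cmd.

Definition near_pairs : cmd := (
  For du (C 0) (V vN) (RStore rTmp (V du) RInfty);;
  tt ::= C 1;;
  For dv (C 0) (V vN) scan_source)%cmd.

Lemma flatten_take_nth T (f : nat -> seq T) l j : j < size l ->
  flatten (map f (take j.+1 l)) = flatten (map f (take j l)) ++ f (nth 0 l j).
Proof. by move=> jl; rewrite (take_nth 0) // map_rcons flatten_rcons. Qed.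

Lemma sum_uniq (F : nat -> nat) N l : uniq l -> {in l, forall x, x < N} ->
  \sum_(x <- l) F x = \sum_(x < N) ((x : nat) \in l) * F x.
Proof.
move=> ul hl; rewrite -(big_mkord xpredT (fun x => (x \in l) * F x)).
rewrite [RHS](bigID (mem l)) /= [X in _ + X]big1 ?addn0; last by move=> x /negPf->.
rewrite -[RHS]big_filter; transitivity (\sum_(x <- [seq x <- index_iota 0 N | x \in l]) F x).
  apply: perm_big; apply: uniq_perm; rewrite ?filter_uniq ?iota_uniq //.
  by move=> x; rewrite mem_filter mem_index_iota; case xl : (x \in l) => //=; rewrite hl.
by apply: eq_big_seq => x; rewrite mem_filter => /andP[-> _]; rewrite mul1n.
Qed.

Definition toff (tl : nat -> seq nat) v := (\sum_(w < v) size (tl w)).+1.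

Lemma toffS tl v : toff tl v.+1 = toff tl v + size (tl v).
Proof. by rewrite /toff big_ord_recr. Qed.

Lemma toff_mono tl v w : v <= w -> toff tl v <= toff tl w.
Proof.
by elim: w => [|w IH]; [case: v|rewrite leq_eqVlt => /orP[/eqP->//|/IH h]; rewrite toffS; lia].
Qed.

Lemma toff_ext tl tl' v : (forall w, w < v -> tl w = tl' w) -> toff tl v = toff tl' v.
Proof. by move=> h; congr _.+1; apply: eq_bigr => w _; rewrite h. Qed.

Section NearPairs.
Variables (R : realType) (cap len : nat) (g : mgraph R) (L : nat -> seq nat) (b : nat -> nat) (t : nat).
Implicit Types s : state R.
Local Notation N := (gN g).
Local Notation Z := (gZ g).
Hypothesis L_uniq : forall u, u < N -> uniq (L u).
Hypothesis L_lt : forall u, u < N -> {in L u, forall x, x < N}.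
Hypothesis L_fin : forall u x, u < N -> x \in L u -> (gd g u x < +oo)%E.
Hypothesis b_le : forall u, u < N -> b u <= size (L u).
Hypothesis C_le : forall x, x < N -> \sum_(u < N) (x \in take (b u) (L u) : nat) <= t.
Hypothesis len_cap : len < cap.
Hypothesis cap2 : 2 < cap.
Hypothesis pairs_len : t * t * Z + N + N < len.
Hypothesis Z_len : Z <= len.
Hypothesis base_len : base L N <= len.

Definition Cl y := below (fun u => y \in take (b u) (L u)) N.

Definition cand_e v x e := [seq (u, (gd g v x + gw g e + gd g u (gt g e))%E) | u <- Cl (gt g e)].
Definition cand_x v x := flatten [seq cand_e v x e | e <- Fadj g x].
Definition cand v := flatten [seq cand_x v x | x <- take (b v) (L v)].

(** State after the candidates [cs] for [v]. Since candidates are finite, [rTmp u < +oo] serves as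
    the test whether [u] has been recorded; the functions [Tk0], [Tv0] and [tc0] are the contents
    before [v]. *)
Definition acc v st (Tk0 Tv0 tc0 : nat -> nat) (cs : seq (nat * \bar R)) s := exists ts,
  [/\ [/\ uniq ts, {in ts, forall u, u < N} & size ts <= size cs],
    wvar s tt = st + size ts /\
    (forall i, i < size ts -> warr s aTk (st + i) = nth 0 ts i /\ warr s aTv (st + i) = v),
    (forall i, i < st -> warr s aTk i = Tk0 i /\ warr s aTv i = Tv0 i) /\
    (forall u, u < N -> warr s aTc u = tc0 u + (u \in ts)),
    (forall u, u < N -> if u \in ts then (gd g u v <= rarr s rTmp u)%E && (rarr s rTmp u < +oo)%E
       else rarr s rTmp u == +oo%E) &
    forall uc, uc \in cs -> uc.1 \in ts /\ (rarr s rTmp uc.1 <= uc.2)%E].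

Lemma record_candP v st Tk0 Tv0 tc0 cs s u c : acc v st Tk0 Tv0 tc0 cs s ->
  wvar s du = u -> rvar s rnd = c -> wvar s dv = v -> u < N -> (gd g u v <= c)%E -> (c < +oo)%E ->
  st + N < len -> (forall u, u < N -> tc0 u <= N) ->
  ok cap len record_cand s 7 (acc v st Tk0 Tv0 tc0 (rcons cs (u, c))).
Proof.
move=> [ts [[ut tN st_le] [ett hT] [hT0 hc] htmp hcs]] eu ec ev uN gc cfin stN tcN.
have sN : size ts <= N by apply: uniq_lt_size.
have cu := tcN u uN; have hcu := hc u uN; have hu := htmp u uN.
apply: okWp => //; sp; rewrite eu; spl; try nl.
case: leP => hoo; sp; rewrite ?eu ?ev ?ett ?ec; spl; try nl.
- have uts : u \notin ts.
    by apply/negP => ui; move: hu; rewrite ui => /andP[_]; rewrite ltNge hoo.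
  move: hoo; rewrite leye_eq => /eqP eoo; rewrite eoo leey; sp; rewrite ?eu ?ec; spl; try nl.
  exists (rcons ts u); split.
  + by rewrite rcons_uniq uts ut !size_rcons; split=> // x; rewrite mem_rcons inE => /orP[/eqP->|/tN].
  + split; sp; first by rewrite size_rcons addn1 addnS.
    move=> i; rewrite size_rcons ltnS leq_eqVlt nth_rcons => /orP[/eqP->|hi].
      by rewrite !upd_eq ltnn eqxx.
    by rewrite !upd_neq ?hi; [apply: hT|lia..].
  + split; sp.
      by move=> i hi; rewrite !upd_neq; [apply: hT0|lia..].
    move=> w wN; rewrite mem_rcons inE /upd; case: eqP => [->|_] /=; last by rewrite hc.
    by rewrite hcu (negPf uts) addn0.
  + move=> w wN; rewrite mem_rcons inE; sp; rewrite /upd; case: eqP => [->|_] /=; last exact: htmp.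
    by rewrite gc cfin.
  + move=> uc; rewrite !mem_rcons !inE; sp; rewrite /upd => /orP[/eqP->|/hcs[h1 h]]; first by rewrite !eqxx.
    rewrite h1 orbT; split=> //.
    by case: eqP h => [->|//]; rewrite eoo leye_eq => /eqP->; rewrite leey.
- have uts : u \in ts by apply: contraTT hoo => ui; move: hu; rewrite (negPf ui) => /eqP->; rewrite ltxx.
  rewrite uts in hu; case/andP: hu => hu1 hu2.
  have base' s' : wvar s' tt = wvar s tt -> warr s' aTk = warr s aTk -> warr s' aTv = warr s aTv ->
     warr s' aTc = warr s aTc -> (forall w, w < N -> rarr s' rTmp w = if w == u then Order.min c (rarr s rTmp u) else rarr s rTmp w) ->
     acc v st Tk0 Tv0 tc0 (rcons cs (u, c)) s'.
    move=> E1 E2 E3 E4 E5; exists ts; rewrite E1 E2 E3 E4; split=> //.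
    + by split=> //; rewrite size_rcons; lia.
    + move=> w wN; rewrite E5 //; case: eqP => [->|_]; last exact: htmp.
      by rewrite uts le_min gt_min gc hu1 cfin.
    + move=> uc; rewrite mem_rcons inE => /orP[/eqP->|uccs]; first by rewrite E5 //= eqxx ge_min lexx.
      have [uc1 h] := hcs _ uccs; split=> //; rewrite E5 ?tN //; case: eqP h => // -> h.
      by rewrite ge_min h orbT.
  case: leP => hcu2; sp; rewrite ?eu ?ec; spl; try nl.
  + apply: base'; sp => // w wN; rewrite /upd; case: eqP => // _.
    by rewrite min_l.
  + apply: base'; sp => // w wN; case: eqP => // ->.
    by rewrite min_r // ltW.
Qed.

Lemma scan_edgeP v x e cs st Tk0 Tv0 tc0 s i : gst g s -> layout g L N s ->
  lists N (warr s hI) (warr s nI) (Finv L b N) -> acc v st Tk0 Tv0 tc0 cs s ->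
  v < N -> i < b v -> x = nth 0 (L v) i -> wvar s tp = base L v + i ->
  wvar s dv = v -> wvar s de = e -> e \in Fadj g x ->
  st + N < len -> (forall u, u < N -> tc0 u <= N) ->
  ok cap len scan_edge s (11 * t + 3) (acc v st Tk0 Tv0 tc0 (cs ++ cand_e v x e)).
Proof.
move=> [eN eZ eS eT eW] hlay hl ha vN ib ex etp ev ee eF stN tcN.
have iL : i < size (L v) := leq_trans ib (b_le vN).
have xN : x < N by rewrite ex; apply: L_lt (mem_nth 0 iL).
have /andP[he /eqP se] := Fadj_edge xN eF; have yN := gt_lt he; set y := gt g e in yN.
have [l1 l2 l3] := hlay v vN; have [k1 k2 k3] := l3 i iL; rewrite -ex in k1 k2.
have tpl : base L v + i < len.
  by apply: leq_trans base_len; apply: leq_trans (base_mono L vN); rewrite baseS ltn_add2l.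
have xfin : (gd g v x < +oo)%E by rewrite ex; apply: L_fin => //; apply: mem_nth.
have CN : size (Cl y) <= t.
  apply: leq_trans (C_le yN); rewrite -sum1_size.
  have -> : \sum_(u <- Cl y) 1 = \sum_(u <- Cl y) (y \in take (b u) (L u)).
    by apply: eq_big_seq => u; rewrite mem_below => /andP[_ ->].
  apply: sum_uniq_le; first exact: below_uniq.
  by move=> u; rewrite mem_below => /andP[].
apply: (okWpS (T2 := 11 * t + 2)); last by rewrite /=; lia.
have eZe : e < len by case/andP: he => _ eZe; lia.
sp; rewrite ee eT // -/y; spl; try nl.
set s1 := set_wvar _ _ _.
have mem_pos u : u \in Cl y -> [/\ u < N, base L u + index y (L u) < len,
    warr s aOwn (base L u + index y (L u)) = u,
    rarr s oD (base L u + index y (L u)) = gd g u y & (gd g u y < +oo)%E].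
  rewrite mem_below => /andP[uN yu]; have yL := mem_take yu.
  have il : index y (L u) < size (L u) by rewrite index_mem.
  have [_ _ h3] := hlay u uN; have [_ h4 h5] := h3 _ il; rewrite h4 h5 nth_index //; split=> //.
    by apply: leq_trans base_len; apply: leq_trans (base_mono L uN); rewrite baseS ltn_add2l.
  exact: L_fin.
have eFi : Finv L b N y = [seq base L u + index y (L u) | u <- Cl y] by [].
pose cu u := (u, (gd g v x + gw g e + gd g u y)%E).
apply: (okForLS (l := Finv L b N y) (f := fun=> 9) (I := fun j s' =>
  acc v st Tk0 Tv0 tc0 (cs ++ map cu (take j (Cl y))) s')) => //; try nl.
- by rewrite /s1; sp; spl; lia.
- by rewrite /s1; sp; apply: hl.
- by rewrite eFi => p /mapP[u /mem_pos[_ h _ _ _] ->].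
- by rewrite take0 cats0.
- rewrite eFi size_map => j s2 jl; rewrite (nth_map 0) //; set u := nth 0 (Cl y) j => ek F2 ha2.
  have [uN pl po pd pf] := mem_pos u (mem_nth 0 jl).
  have es1 : wvar s2 tp = base L v + i by fr F2; rewrite /s1; sp.
  have es2 : wvar s2 de = e by fr F2; rewrite /s1; sp.
  have es3 : wvar s2 dv = v by fr F2; rewrite /s1; sp.
  have es4 : rarr s2 rW e = gw g e by fr F2; rewrite /s1; sp; apply: eW.
  have es5 : rarr s2 oD (base L v + i) = gd g v x by fr F2; rewrite /s1; sp.
  have es6 : rarr s2 oD (base L u + index y (L u)) = gd g u y by fr F2; rewrite /s1; sp.
  have es7 : warr s2 aOwn (base L u + index y (L u)) = u by fr F2; rewrite /s1; sp.
  apply: (okWpS (T2 := 7)); last by [].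
  sp; rewrite ek es1 es2 es7; spl; try nl.
  rewrite es4 es5 es6.
  apply: okW (record_candP (v := v) (st := st) (Tk0 := Tk0) (Tv0 := Tv0) (tc0 := tc0) (u := u) (c := (gd g v x + gw g e + gd g u y)%E) (cs := cs ++ map cu (take j (Cl y))) _ _ _ _ uN _ _ stN tcN) _ (leqnn _) => //.
  + rewrite gd_sym; apply: le_trans (@gd_tri _ g v x u xN) _; rewrite -addeA leeD2l //.
    apply: le_trans (@gd_tri _ g x y u yN) _; rewrite (gd_sym g y u) leeD2r //.
    by rewrite -se; apply: gd_edge.
  + by rewrite !lte_add_pinfty // gw_fin.
  + move=> s3 F3 h3 w; rewrite (take_nth 0) // map_rcons -rcons_cat; exact: h3.
- by move=> s2 F2; rewrite eFi size_map take_size.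
- by rewrite big_const_seq count_predT iter_addn_0 eFi size_map; nl.
Qed.

Lemma sum_take (F : nat -> nat) (l : seq nat) B w : w <= size l ->
  \sum_(B <= j < B + w) F (nth 0 l (j - B)) = \sum_(x <- take w l) F x.
Proof.
move=> wl; rewrite -{1}[B]add0n big_addn addKn [RHS](big_nth 0) size_takel //.
by rewrite !big_mkord; apply: eq_bigr => i _; rewrite addnK nth_take.
Qed.

(** After exchanging the sums, [x] contributes [F x] once per ball that contains it, hence at most
    [t] times. *)
Lemma sum_near (F : nat -> nat) :
  \sum_(v < N) \sum_(x <- take (b v) (L v)) F x <= t * \sum_(x < N) F x.
Proof.
have E v : v < N -> \sum_(x <- take (b v) (L v)) F x = \sum_(x < N) ((x : nat) \in take (b v) (L v)) * F x.
  move=> vN; apply: sum_uniq; first by rewrite take_uniq // L_uniq.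
  by move=> x /mem_take /(L_lt vN).
rewrite (eq_bigr (fun v : 'I_N => \sum_(x < N) ((x : nat) \in take (b v) (L v)) * F x)); last by move=> v _; apply: E.
rewrite exchange_big big_distrr /=; apply: leq_sum => x _.
by rewrite -big_distrl leq_mul2r C_le ?orbT.
Qed.

Lemma size_Cl y : y < N -> size (Cl y) <= t.
Proof.
move=> yN; apply: leq_trans (C_le yN); rewrite -sum1_size.
have -> : \sum_(u <- Cl y) 1 = \sum_(u <- Cl y) (y \in take (b u) (L u)).
  by apply: eq_big_seq => u; rewrite mem_below => /andP[_ ->].
apply: sum_uniq_le; first exact: below_uniq.
by move=> u; rewrite mem_below => /andP[].
Qed.

Lemma size_flatten_le (T S : eqType) (f : T -> seq S) l F : {in l, forall x, size (f x) <= F x} ->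
  size (flatten (map f l)) <= \sum_(x <- l) F x.
Proof.
move=> h; rewrite size_flatten sumnE /shape -map_comp big_map.
by rewrite big_seq [X in _ <= X]big_seq; apply: leq_sum => x /h.
Qed.

Lemma size_cand v : v < N -> size (cand v) <= \sum_(x <- take (b v) (L v)) size (Fadj g x) * t.
Proof.
move=> vN; apply: size_flatten_le => x /mem_take /(L_lt vN) xN.
apply: leq_trans (size_flatten_le (F := fun=> t) _) _.
  move=> e eF; rewrite size_map size_Cl //; apply: gt_lt.
  by have /andP[] := Fadj_edge xN eF.
by rewrite big_const_seq count_predT iter_addn_0 mulnC.
Qed.

Definition scan_time v := 10 + \sum_(x <- take (b v) (L v)) (5 + size (Fadj g x) * (16 * t + 5)).

Lemma scan_sourceP v st s : gst g s -> layout g L N s ->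
  lists N (warr s hF) (warr s nF) (Fadj g) ->
  lists N (warr s hI) (warr s nI) (Finv L b N) ->
  (forall u, u < N -> warr s aEnd u = base L u + b u) ->
  v < N -> wvar s dv = v -> wvar s tt = st -> st + N < len ->
  (forall u, u < N -> rarr s rTmp u = +oo%E) -> (forall u, u < N -> warr s aTc u <= N) ->
  ok cap len scan_source s (scan_time v) (fun s' => exists ts,
    [/\ [/\ uniq ts, {in ts, forall u, u < N} & size ts <= size (cand v)],
      [/\ wvar s' tt = st + size ts, warr s' aTst = upd (warr s aTst) v st &
          warr s' aTend = upd (warr s aTend) v (st + size ts)],
      (forall i, i < size ts -> [/\ warr s' aTk (st + i) = nth 0 ts i, warr s' aTv (st + i) = v &
         (gd g (nth 0%N ts i) v <= rarr s' rTd (st + i))%E]) /\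
      (forall i, i < st -> [/\ warr s' aTk i = warr s aTk i, warr s' aTv i = warr s aTv i &
         rarr s' rTd i = rarr s rTd i]),
      (forall uc, uc \in cand v -> exists2 i, i < size ts & nth 0 ts i = uc.1 /\
         (rarr s' rTd (st + i) <= uc.2)%E) &
      (forall u, u < N -> warr s' aTc u = warr s aTc u + (u \in ts)) /\
      (forall u, u < N -> rarr s' rTmp u = +oo%E)]).
Proof.
move=> hg hlay hlF hlI hEnd vN ev ett stN htmp htc; have [eN eZ eS eT eW] := hg.
have bv := b_le vN; have [l1 l2 l3] := hlay v vN.
have tpl i : i < b v -> base L v + i < len.
  move=> ib; apply: leq_trans base_len; apply: leq_trans (base_mono L vN).
  by rewrite baseS ltn_add2l (leq_trans ib).
have bl : base L v + b v <= len.
  apply: leq_trans base_len; apply: leq_trans (base_mono L vN).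
  by rewrite baseS leq_add2l.
have vl : v < len by lia.
set S1 := \sum_(x <- take (b v) (L v)) (5 + size (Fadj g x) * (11 * t + 5)).
set S2 := \sum_(x <- take (b v) (L v)) size (Fadj g x) * t.
have S12 : S1 + 5 * S2 = \sum_(x <- take (b v) (L v)) (5 + size (Fadj g x) * (16 * t + 5)).
  by rewrite /S1 /S2 big_distrr -big_split /=; apply: eq_bigr => x _; nia.
rewrite /scan_time -S12.
apply: (okWpS (T2 := S1 + 5 * S2 + 9)); last by rewrite /=; lia.
sp; rewrite ev ett; spl; try nl.
set s1 := set_warr _ _ _ _.
pose A cs s' := acc v st (warr s aTk) (warr s aTv) (warr s aTc) cs s'.
have frs s' : frame (For tp (WRead aBase (V dv)) (WRead aEnd (V dv)) (
    dx ::= WRead oV (V tp);;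
    ForL de (WRead hF (V dx)) nF scan_edge)%cmd) s1 s' ->
    [/\ gst g s', layout g L N s', lists N (warr s' hI) (warr s' nI) (Finv L b N),
      lists N (warr s' hF) (warr s' nF) (Fadj g) & wvar s' dv = v].
  move=> F; split.
  - by split=> *; fr F; rewrite /s1; sp; auto.
  - by apply: layout_ext hlay _ _ _ _ _ => *; fr F; rewrite /s1; sp.
  - by fr F; rewrite /s1; sp.
  - by fr F; rewrite /s1; sp.
  - by fr F; rewrite /s1; sp.
apply: (okS (T1 := S1 + 2) (T2 := 5 * S2 + 7) (Q1 := A (cand v))).
  apply: (okForS (a := base L v) (b := base L v + b v)
    (f := fun j => 3 + size (Fadj g (nth 0 (L v) (j - base L v))) * (11 * t + 5))
    (I := fun j s' => A (flatten [seq cand_x v x | x <- take (j - base L v) (L v)]) s')) => //; try nl.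
  - by rewrite /s1; sp; rewrite ev; split=> //; lia.
  - by rewrite /s1; sp; rewrite ev.
  - by move=> s' F; sp; fr F; rewrite /s1; sp; rewrite ev hEnd //; spl; lia.
  - rewrite subnn take0; exists [::]; rewrite /s1; sp; split=> //.
    + by rewrite addn0.
    + by split=> // u uN; rewrite addn0.
    + by move=> u uN; rewrite htmp.
  - move=> j s2 hj ej F2 hA2; pose i := j - base L v.
    have ij : j = base L v + i by rewrite /i; lia.
    have ib : i < b v by lia.
    have iL : i < size (L v) := leq_trans ib bv.
    have [g2 lay2 hI2 hF2 ev2] := frs s2 F2.
    set x := nth 0 (L v) (j - _); have xN : x < N by apply: L_lt (mem_nth 0 iL).
    have eo : warr s2 oV j = x.
      by have [_ _ h] := lay2 v vN; have [h1 _ _] := h i iL; rewrite ij h1 /x -/i.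
    have jl : j < len by rewrite ij tpl.
    apply: (okWpS (T2 := 2 + size (Fadj g x) * (11 * t + 5))); last by rewrite /=; lia.
    sp; rewrite ej eo; spl; try nl.
    set s3 := set_wvar _ _ _.
    rewrite (_ : j.+1 - base L v = i.+1); last by rewrite /i; lia.
    rewrite flatten_take_nth // -/i -/x.
    have xl : x < len by lia.
    apply: (okForLS (l := Fadj g x) (f := fun=> 11 * t + 3) (I := fun m s' =>
      A (flatten [seq cand_x v y | y <- take i (L v)] ++ flatten [seq cand_e v x e | e <- take m (Fadj g x)]) s')) => //; try nl.
    + by rewrite /s3; sp; apply: hF2.
    + by move=> e eF; have /andP[/andP[_ ?] _] := Fadj_edge xN eF; lia.
    + by rewrite take0 cats0.
    + move=> m s4 ml ee F4 hA4; set e := nth 0 (Fadj g x) m in ee.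
      have [_ _ _ _ _] := g2.
      have g4 : gst g s4 by case: g2 => *; split=> *; fr F4; rewrite /s3; sp; auto.
      have lay4 : layout g L N s4 by apply: layout_ext lay2 _ _ _ _ _ => *; fr F4; rewrite /s3; sp.
      apply: okW (scan_edgeP (v := v) (x := x) (e := e) (i := i) g4 lay4 _ hA4 vN ib _ _ _ _ _ stN htc) _ (leqnn _) => //.
      * by fr F4; rewrite /s3; sp.
      * by fr F4; rewrite /s3; sp; rewrite ej.
      * by fr F4; rewrite /s3; sp.
      * exact: mem_nth.
      * by move=> s5 F5 h5 w; rewrite flatten_take_nth // catA; exact: h5.
    + by move=> s4 F4; rewrite take_size.
    + by rewrite big_const_seq count_predT iter_addn_0; nl.
  - by move=> s' _ F; rewrite addKn.
  - rewrite (sum_take (fun x => 3 + size (Fadj g x) * (11 * t + 5) + 2)) // /S1 leq_add2r.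
    by apply: leq_sum => x _; lia.
- move=> s2 F2 [ts [[ut tN sts] [et hT] [hT0 hc] hm hcs]].
  have ev2 : wvar s2 dv = v by fr F2; rewrite /s1; sp.
  have sN : size ts <= N by apply: uniq_lt_size.
  have sS : size ts <= S2 by apply: leq_trans sts (size_cand vN).
  apply: (okWpS (T2 := 5 * S2 + 6)); last by rewrite /=; lia.
  sp; rewrite ev2 et; spl; try nl.
  set s3 := set_warr _ _ _ _.
  have est : warr s2 aTst v = st by fr F2; rewrite /s1; sp; rewrite upd_eq.
  apply: (okFor (a := st) (b := st + size ts) (f := 3) (I := fun j s' =>
    (forall i, i < j - st -> rarr s' rTd (st + i) = rarr s2 rTmp (nth 0 ts i)) /\
    (forall i, i < st -> rarr s' rTd i = rarr s2 rTd i) /\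
    forall u, u < N -> rarr s' rTmp u = if u \in drop (j - st) ts then rarr s2 rTmp u else +oo%E)) => //; try nl.
  + by rewrite /s3; sp; rewrite ev2; spl; nl.
  + by rewrite /s3; sp; rewrite ev2.
  + by move=> s' F; split=> //; sp; fr F; rewrite /s3; sp.
  + rewrite subnn; split=> //; split=> // u uN; rewrite drop0 /s3; sp.
    by have := hm u uN; case: (u \in ts) => // /eqP.
  + move=> j s4 hj ej F4 [h1 [h2 h3]]; pose i := j - st.
    have ij : j = st + i by rewrite /i; lia.
    have its : i < size ts by lia.
    set u := nth 0 ts i; have uN : u < N by apply: tN (mem_nth 0 its).
    have eu : warr s4 aTk j = u by fr F4; rewrite /s3; sp; rewrite ij; have [] := hT i its.
    have ud : u \notin drop i.+1 ts.
      have := ut; rewrite -{1}(cat_take_drop i ts) (drop_nth 0) // cat_uniq => /and3P[_ _] /=.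
      by case/andP.
    have etm : rarr s4 rTmp u = rarr s2 rTmp u.
      by rewrite h3 // -/i (drop_nth 0) // mem_head.
    apply: okWp => //; sp; rewrite ej eu etm; spl; try nl.
      move=> i' hi'; rewrite /upd; have [->|ne] := eqVneq i' i; first by rewrite -ij eqxx.
      by rewrite ifN; [apply: h1; lia|lia].
      by move=> i' hi'; rewrite upd_neq; [apply: h2|lia].
    move=> w wN; rewrite (_ : j.+1 - st = i.+1); last by rewrite /i; lia.
    rewrite /upd; case: eqP => [->|ne]; first by rewrite (negPf ud).
    rewrite h3 // -/i (drop_nth 0 its) in_cons -/u; case: eqP ne => //.
  + move=> s4 _ F4 [h1 [h2 h3]]; rewrite addKn in h1 h3.
    exists ts; split=> //.
    * split; fr F4; rewrite /s3; sp => //.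
      -- by fr F2; rewrite /s1; sp.
      -- by fr F2; rewrite /s1; sp.
    * split=> i hi; first have [k1 k2] := hT i hi; last have [k1 k2] := hT0 i hi.
        rewrite h1 //; split; fr F4; rewrite /s3; sp => //.
        have := hm (nth 0 ts i); rewrite mem_nth // => /(_ (tN _ (mem_nth 0 hi))) /andP[-> _] //.
      rewrite h2 //; split; fr F4; rewrite /s3; sp => //.
      by fr F2; rewrite /s1; sp.
    * move=> uc ucc; have [uts h] := hcs _ ucc.
      by exists (index uc.1 ts); rewrite ?index_mem // nth_index // h1 ?index_mem // nth_index.
    * split=> u uN; first by fr F4; rewrite /s3; sp; apply: hc.
      by rewrite h3 // drop_size in_nil.
- by lia.
Qed.

(* [tl v] lists the [u] for which some candidate connects [u] to [v]; the items of
   all [v] are stored one after the other. *)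
Record pair_table (tl : nat -> seq nat) k s : Prop := PairTable {
  pt_uniq : forall v, v < k -> uniq (tl v);
  pt_lt : forall v, v < k -> {in tl v, forall u, u < N};
  pt_size : forall v, v < k -> size (tl v) <= size (cand v);
  pt_st : forall v, v < k -> warr s aTst v = toff tl v /\ warr s aTend v = toff tl v.+1;
  pt_item : forall v i, v < k -> i < size (tl v) ->
    [/\ warr s aTk (toff tl v + i) = nth 0 (tl v) i, warr s aTv (toff tl v + i) = v &
        (gd g (nth 0%N (tl v) i) v <= rarr s rTd (toff tl v + i))%E];
  pt_cand : forall v uc, v < k -> uc \in cand v -> exists2 i, i < size (tl v) &
    nth 0 (tl v) i = uc.1 /\ (rarr s rTd (toff tl v + i) <= uc.2)%E;
  pt_cnt : forall u, u < N -> warr s aTc u = \sum_(v < k) (u \in tl v : nat) }.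

(** An edge is reached from at most [t] balls through its source and paired with at most [t] balls
    through its head. *)
Lemma toff_le tl k : k <= N -> (forall v, v < k -> size (tl v) <= size (cand v)) ->
  toff tl k <= (t * t * Z).+1.
Proof.
move=> kN h; rewrite ltnS; apply: leq_trans (_ : \sum_(v < N) size (cand v) <= _).
  rewrite (big_ord_widen N (fun w => size (tl w)) kN) [X in _ <= X](bigID (fun v : 'I_N => v < k)) /=.
  by apply: leq_trans (leq_addr _ _); apply: leq_sum => v; apply: h.
apply: leq_trans (_ : t * \sum_(x < N) size (Fadj g x) * t <= _).
  apply: leq_trans (sum_near (fun x => size (Fadj g x) * t)).
  by apply: leq_sum => v _; apply: size_cand.
rewrite -big_distrl mulnCA mulnC leq_mul2l; apply/orP; right.
exact: sum_size_below.
Qed.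

Lemma sum_scan : \sum_(v < N) (scan_time v + 2) <= 12 * N + t * (5 * N + Z * (16 * t + 5)).
Proof.
rewrite /scan_time big_split /= big_split /= !sum_nat_const card_ord.
have := sum_near (fun x => 5 + size (Fadj g x) * (16 * t + 5)).
have -> : \sum_(x < N) (5 + size (Fadj g x) * (16 * t + 5)) =
    N * 5 + (\sum_(x < N) size (Fadj g x)) * (16 * t + 5).
  by rewrite big_split /= sum_nat_const card_ord -big_distrl.
move=> h.
have h2 : t * (N * 5 + (\sum_(i < N) size (Fadj g i)) * (16 * t + 5)) <= t * (5 * N + Z * (16 * t + 5)).
  rewrite leq_mul2l; apply/orP; right; rewrite [5 * N]mulnC leq_add2l leq_mul2r.
  by apply/orP; right; apply: sum_size_below.
move: (leq_trans h h2); move: (\sum_(v < N) _) (t * (5 * N + _)) => p q pq; lia.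
Qed.

Lemma near_pairsP s : gst g s -> layout g L N s ->
  lists N (warr s hF) (warr s nF) (Fadj g) ->
  lists N (warr s hI) (warr s nI) (Finv L b N) ->
  (forall u, u < N -> warr s aEnd u = base L u + b u) ->
  (forall u, warr s aTc u = 0) ->
  ok cap len near_pairs s (15 * N + 5 + t * (5 * N + Z * (16 * t + 5))) (fun s' =>
    exists tl, pair_table tl N s' /\ wvar s' tt = toff tl N).
Proof.
move=> hg hlay hlF hlI hEnd htc; have [eN eZ eS eT eW] := hg.
apply: (okS (T1 := 3 * N + 2) (T2 := 12 * N + t * (5 * N + Z * (16 * t + 5)) + 3)
  (Q1 := fun s' => forall u, u < N -> rarr s' rTmp u = +oo%E)); last by lia.
  apply: (okFor (a := 0) (b := N) (f := 1) (I := fun j s' => forall u, u < j -> rarr s' rTmp u = +oo%E)) => //; try nl.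
  - by rewrite /=; lia.
  - by move=> s' F; split=> //=; fr F.
  - move=> j s' /andP[_ jN] ej F h; apply: okWp => //; sp; rewrite ej; spl; try nl.
    by move=> u uj; rewrite /upd; case: eqP => // ne; apply: h; lia.
move=> s1 F1 htmp; apply: (okWpS (T2 := 12 * N + t * (5 * N + Z * (16 * t + 5)) + 2)); last by rewrite /=; lia.
sp; split; first by lia.
set s2 := set_wvar _ _ _.
apply: (okForS (a := 0) (b := N) (f := scan_time) (I := fun j s' =>
  [/\ exists tl, pair_table tl j s' /\ wvar s' tt = toff tl j &
   forall u, u < N -> rarr s' rTmp u = +oo%E])) => //; try nl.
- by rewrite /=; lia.
- by move=> s' F; split=> //=; fr F; rewrite /s2; sp; fr F1.
- split=> //; exists (fun=> [::]); split; last by rewrite /s2; sp; rewrite /toff big_ord0.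
  by split=> // u uN; rewrite big_ord0 /s2; sp; fr F1.
- move=> v s3 /andP[_ vN] ev F3 [[tl [P3 et3]] htmp3]; have [p1 p2 p3 p4 p5 p6 p7] := P3.
  have tle : toff tl v <= (t * t * Z).+1 by apply: toff_le => //; exact: ltnW.
  have cntv u : u < N -> warr s3 aTc u <= v.
    move=> uN; rewrite p7 // -[X in _ <= X]card_ord -sum1_card; apply: leq_sum => w _; exact: leq_b1.
  apply: okW (scan_sourceP (v := v) (st := toff tl v) _ _ _ _ _ vN ev et3 _ htmp3 _) _ (leqnn _).
  + by split=> *; fr F3; rewrite /s2; sp; fr F1; auto.
  + by apply: layout_ext hlay _ _ _ _ _ => *; fr F3; rewrite /s2; sp; fr F1.
  + by fr F3; rewrite /s2; sp; fr F1.
  + by fr F3; rewrite /s2; sp; fr F1.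
  + by move=> u uN; fr F3; rewrite /s2; sp; fr F1; apply: hEnd.
  + by lia.
  + by move=> u uN; have := cntv u uN; lia.
  + move=> s4 F4 [ts [[q1 q2 q3] [q4 q5 q6] [q7 q8] q9 [q10 q11]]].
    split; last by sp; exact: q11.
    pose tl' w := if w == v then ts else tl w.
    have tlw w : w < v -> tl w = tl' w by rewrite /tl'; case: eqP => // ->; rewrite ltnn.
    have tlv : tl' v = ts by rewrite /tl' eqxx.
    have tof w : w <= v -> toff tl' w = toff tl w.
      by move=> wv; apply: toff_ext => x xw; rewrite -tlw //; lia.
    have lt w : w < v.+1 -> w != v -> w < v by rewrite ltnS leq_eqVlt => /orP[->//|].
    have itm w i : w < v -> i < size (tl w) -> toff tl w + i < toff tl v.
      by move=> wv il; apply: leq_trans (toff_mono tl wv); rewrite toffS ltn_add2l.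
    exists tl'; split; last by sp; rewrite q4 toffS tlv tof.
    split; sp.
    * by move=> w wv; case: (eqVneq w v) => [->|ne]; rewrite ?tlv // -tlw ?lt // p1 ?lt.
    * by move=> w wv; case: (eqVneq w v) => [->|ne]; rewrite ?tlv // -tlw ?lt //; apply: p2; apply: lt.
    * by move=> w wv; case: (eqVneq w v) => [->|ne]; rewrite ?tlv // -tlw ?lt //; apply: p3; apply: lt.
    * move=> w wv; rewrite q5 q6; case: (eqVneq w v) => [->|ne].
        by rewrite !upd_eq toffS tof // tlv.
      by have wv' := lt w wv ne; rewrite !upd_neq // !tof ?(ltnW wv') //; apply: p4.
    * move=> w i wv; case: (eqVneq w v) => [->|ne]; first by rewrite tof // tlv; apply: q7.
      have wv' := lt w wv ne; rewrite tof ?(ltnW wv') // -tlw // => il.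
      by have [-> -> ->] := q8 _ (itm w i wv' il); apply: p5.
    * move=> w uc wv; case: (eqVneq w v) => [->|ne]; first by rewrite tof // tlv; apply: q9.
      have wv' := lt w wv ne; rewrite tof ?(ltnW wv') // -tlw // => ucw.
      have [i il [e1 e2]] := p6 w uc wv' ucw; exists i => //; split=> //.
      by have [_ _ ->] := q8 _ (itm w i wv' il).
    * move=> u uN; rewrite q10 // big_ord_recr /= tlv p7 //; congr (_ + _).
      by apply: eq_bigr => w _; rewrite -tlw.
- by move=> s3 _ F3 [h _].
- by rewrite big_mkord leq_add2r sum_scan.
Qed.

Lemma pivotsP s (A : pred nat) : wvar s vN = N -> layout g L N s ->
  (forall u, u < N -> warr s aEnd u = base L u + b u) ->
  (forall u, u < N -> b u < size (L u) -> A (nth 0 (L u) (b u))) ->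
  ok cap len pivots s (5 * N + 2) (fun s' => forall u, u < N ->
    if b u < size (L u) then rarr s' rR u = gd g u (nth 0 (L u) (b u)) /\
       warr s' aPrw u = warr s aRow (nth 0 (L u) (b u))
    else rarr s' rR u = +oo%E /\ warr s' aPrw u = 0).
Proof.
move=> eN hlay hEnd hA.
pose P u s' := if b u < size (L u) then rarr s' rR u = gd g u (nth 0 (L u) (b u)) /\
       warr s' aPrw u = warr s aRow (nth 0 (L u) (b u))
    else rarr s' rR u = +oo%E /\ warr s' aPrw u = 0.
apply: (okFor (a := 0) (b := N) (f := 3) (I := fun j s' => forall u, u < j -> P u s')) => //; try nl.
- by rewrite /=; lia.
- by move=> s' F; split=> //=; fr F.
- move=> u s1 /andP[_ uN] eu F1 h1; have [l1 l2 l3] := hlay u uN.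
  have e1 : warr s1 aEnd u = base L u + b u by fr F1; apply: hEnd.
  have e2 : warr s1 aLend u = base L u + size (L u) by fr F1; rewrite l2 baseS.
  have old (s' : state R) : (forall w, w < u -> rarr s' rR w = rarr s1 rR w /\ warr s' aPrw w = warr s1 aPrw w) ->
      P u s' -> forall w, w < u.+1 -> P w (set_wvar s' du u.+1).
    move=> E hu w; rewrite ltnS leq_eqVlt => /orP[/eqP->//|wu].
    by have [E1 E2] := E w wu; rewrite /P; sp; rewrite E1 E2; apply: h1.
  apply: okWp => //; sp; rewrite eu e1 e2 ltn_add2l; spl; try nl.
  case: ifP => hb; sp.
  + have [k1 k2 _] := l3 _ hb; set x := nth 0 (L u) (b u) in k1 k2 *.
    have xN : x < N by apply: L_lt (mem_nth 0 hb).
    have pl : base L u + b u < len.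
      by apply: leq_trans base_len; apply: leq_trans (base_mono L uN); rewrite baseS ltn_add2l.
    have e3 : warr s1 oV (base L u + b u) = x by fr F1.
    have e4 : rarr s1 oD (base L u + b u) = gd g u x by fr F1.
    rewrite e3 e4; spl; try nl.
    apply: old.
      by move=> w wu; sp; rewrite !upd_neq //; lia.
    by rewrite /P hb; sp; rewrite !upd_eq; split=> //; fr F1.
  + spl; try nl.
    apply: old.
      by move=> w wu; sp; rewrite !upd_neq //; lia.
    by rewrite /P hb; sp; rewrite !upd_eq.
Qed.

End NearPairs.

(** * Separating numbers by a small modulus *)

(* The Leibniz harmonic triangle: [1 / (m.+1 * 'C(n, m.+1))] is the difference
   of [1 / (m * 'C(n.-1, m))] and [1 / (m * 'C(n, m))]. *)
Lemma dvdn_harmonic n m X : (forall j, 0 < j <= n -> j %| X) -> 0 < m <= n -> m * 'C(n, m) %| X.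
Proof.
case: m => // m; elim: m n X => [|m IH] n X hX /andP[_ mn]; first by rewrite bin1 mul1n hX // mn /=.
case: n mn hX => // n mn hX.
have /dvdnP[A EA] : m.+1 * 'C(n, m.+1) %| X.
  by apply: IH => // j /andP[j0 jn]; apply: hX; rewrite j0 leqW.
have /dvdnP[B EB] : m.+1 * 'C(n.+1, m.+1) %| X by apply: IH hX _; rewrite /= (ltnW mn).
set a := m.+1 * _ in EA; set b := m.+1 * _ in EB; set c := _ * _.
have a0 : 0 < a by rewrite muln_gt0 bin_gt0.
have b0 : 0 < b by rewrite muln_gt0 bin_gt0 /= (ltnW mn).
have ab : b = a + m.+1 * 'C(n, m) by rewrite /b binS mulnDr.
have cE : c * (m.+1 * 'C(n, m)) = a * b.
  rewrite /c -(mul_bin_diag n.+1 m.+1) /= /a /b -(mul_bin_diag n.+1 m) /=; nia.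
apply/dvdnP; exists (A - B); apply/eqP; rewrite -(@eqn_pmul2l (a * b)); last by rewrite muln_gt0 a0.
rewrite mulnBl mulnBr.
have -> : a * b * (A * c) = c * b * X by rewrite EA; nia.
have -> : a * b * (B * c) = c * a * X by rewrite EB; nia.
by rewrite -mulnBl -mulnBr ab addKn cE -ab.
Qed.

Lemma bin_double k : 2 ^ k <= 'C(k + k, k).
Proof.
elim: k => // k IH; rewrite expnS addSn addnS binS.
have -> : 'C((k + k).+1, k.+1) = 'C((k + k).+1, k).
  by rewrite -bin_sub ?subSS ?addnK; [|lia].
by rewrite mul2n -addnn leq_add // (leq_trans IH) // leq_bin2l.
Qed.

(** A lower bound for the least common multiple of 1, ..., 2 k: by [dvdn_harmonic] it is a multiple
    of [k * 'C(k + k, k)]. *)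
Lemma dvdn_all_ge k X : 0 < X -> (forall j, 0 < j <= k + k -> j %| X) -> 2 ^ k <= X.
Proof.
case: k => // k X0 hX; apply: leq_trans (bin_double k.+1) _.
apply: leq_trans (leq_pmull _ (ltn0Sn k)) _.
by apply: dvdn_leq => //; apply: dvdn_harmonic => //; rewrite leq_addr.
Qed.

(** If every p up to 2 k merged two of the numbers, each would divide the product of all
    differences. That product is below 2^k, against [dvdn_all_ge]. *)
Lemma small_modulus N l k (vs : seq nat) : uniq vs -> {in vs, forall v, v < N} -> N <= 2 ^ l ->
  size vs * size vs * l < k -> exists2 p, 0 < p <= k + k & uniq [seq v %% p | v <- vs].
Proof.
(* The value 1 keeps the pairs with [y <= x] from annihilating the product. *)
move=> uv hN hl hk; pose d x y := if x < y then y - x else 1.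
pose X := \prod_(x <- vs) \prod_(y <- vs) d x y.
have d0 x y : 0 < d x y by rewrite /d; case: (ltnP x y) => //= xy; rewrite subn_gt0.
have X0 : 0 < X by rewrite prodn_gt0 // => x; rewrite prodn_gt0.
have Xle : X <= 2 ^ (size vs * size vs * l).
  have h1 x : x \in vs -> \prod_(y <- vs) d x y <= 2 ^ (l * size vs).
    move=> xv; apply: leq_trans (_ : \prod_(y <- vs) 2 ^ l <= _).
      rewrite big_seq [X in _ <= X]big_seq; apply: leq_prod => y yv.
      apply: leq_trans hl; rewrite /d; case: (ltnP x y) => [_|_]; last exact: leq_ltn_trans (hN _ yv).
      by apply: leq_trans (leq_subr _ _) (ltnW (hN _ yv)).
    by rewrite big_const_seq count_predT iter_muln_1 expnM.
  apply: leq_trans (_ : \prod_(x <- vs) 2 ^ (l * size vs) <= _).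
    by rewrite /X big_seq [X in _ <= X]big_seq; apply: leq_prod.
  by rewrite big_const_seq count_predT iter_muln_1 -expnM leq_exp2l //; nia.
have [/hasP[p hp up]|/hasPn h] := boolP (has (fun p => uniq [seq v %% p | v <- vs]) (iota 1 (k + k))).
  by exists p => //; move: hp; rewrite mem_iota; lia.
suff : 2 ^ k <= X by rewrite leqNgt (leq_ltn_trans Xle) // ltn_exp2l.
apply: dvdn_all_ge => // p hp.
have : ~~ uniq [seq v %% p | v <- vs] by apply: h; rewrite mem_iota; lia.
apply: contraR => pX; rewrite map_inj_in_uniq // => x y xv yv E.
have main a b : a \in vs -> b \in vs -> a < b -> a %% p = b %% p -> p %| X.
  move=> av bv ab /eqP E'; apply: dvdn_trans (_ : d a b %| X).
    by rewrite /d ab -eqn_mod_dvd 1?ltnW // eq_sym.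
  rewrite /X (bigD1_seq a) //=; apply: dvdn_mulr.
  by rewrite (bigD1_seq b) //=; apply: dvdn_mulr.
by case: (ltngtP x y) => // xy; case/negP: pX; [apply: main E|apply: main (esym E)].
Qed.

(** * A static dictionary for the pairs *)

(* Vertex [v] gets a leaf [aFn v] of a complete binary tree with [hk] leaves, and
   the pair [(u, v)] goes to the cell [aUo u + aFn v %/ aWu u], that is, to the
   ancestor of that leaf on the level with [aK u] nodes, in the table of [u]. *)
Local Notation hk := 43.
Local Notation kk := 44.
Local Notation off := 45.
Local Notation nd := 46.
Local Notation sa := 47.
Local Notation sb := 48.
Local Notation lf := 49.
Local Notation dl := 50.
Local Notation aK := 66.
Local Notation aWu := 67.
Local Notation aUo := 68.
Local Notation aP := 69.
Local Notation aFn := 70.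
Local Notation bH := 71.
Local Notation bN := 72.

Definition double_to (x : nat) (hi : wexp) : cmd := (
  x ::= C 1;; While (TLt (V x) hi) (x ::= V x :+ V x))%cmd.

(** The number of leaves for [u] is a power of two and at least twice its number of pairs, which
    [potential_bound] turns into a factor 2. The global tree has at least 2 N leaves, so that every
    table is a coarsening of it, by the width [aWu u]. *)
Definition table_sizes : cmd := (
  double_to hk (V vN :+ V vN);;
  off ::= C 0;;
  For du (C 0) (V vN) (
    double_to kk (WRead aTc (V du) :+ WRead aTc (V du));;
    (WStore aK (V du) (V kk);; WStore aWu (V du) (WDiv (V hk) (V kk));;
     WStore aUo (V du) (V off);; off ::= V off :+ V kk :+ V kk)))%cmd.

(** The leaf of [v] is fixed bit by bit; [sa] and [sb] are the loads below the two children, summed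
    over the partners of [v], and the lighter child is taken. Tables whose leaf level has been
    reached would add the same to both sides and are skipped. *)
Definition choose_node : cmd := (
  nd ::= C 1;;
  While (TLt (V nd) (V hk)) (
    (sa ::= C 0;; sb ::= C 0);;
    For tp (WRead aTst (V dv)) (WRead aTend (V dv)) (
      du ::= WRead aTk (V tp);;
      If (TLt (V nd) (WRead aK (V du)))
        (lf ::= WRead aUo (V du) :+ V nd :+ V nd;;
         sa ::= V sa :+ WRead aP (V lf);; sb ::= V sb :+ WRead aP (V lf :+ C 1)) Skip);;
    nd ::= V nd :+ V nd;;
    If (TLt (V sb) (V sa)) (nd ::= V nd :+ C 1) Skip))%cmd.

Definition add_path : cmd :=
  While (TLt (C 0) (V lf)) (
    dx ::= WRead aUo (V du) :+ V lf;;
    WStore aP (V dx) (WRead aP (V dx) :+ V dl);;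
    lf ::= WDiv (V lf) (C 2))%cmd.

Definition insert_items : cmd := (
  WStore aFn (V dv) (V nd);;
  For tp (WRead aTst (V dv)) (WRead aTend (V dv)) (
    (du ::= WRead aTk (V tp);;
     lf ::= WDiv (V nd) (WRead aWu (V du));;
     dx ::= WRead aUo (V du) :+ V lf;;
     dl ::= WRead aP (V dx) :+ WRead aWu (V du);;
     push bH bN dx tp);;
    add_path))%cmd.

Definition hash_all : cmd :=
  For dv (C 0) (V vN) (choose_node;; insert_items)%cmd.

(** * Sum trees, and the choice of a leaf by conditional expectations *)

Definition sumtree K (T : nat -> nat) :=
  forall i, 0 < i < K -> T i = T (i + i) + T (i + i + 1).

Lemma sumtree_le K T i : sumtree K T -> 0 < i < K + K -> T i <= T 1.
Proof.
move=> h; have [n] := ubnP i; elim: n i => // n IH i; rewrite ltnS => iN hi.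
case: (ltnP 1 i) => [i1|]; last by move=> i1; have -> : i = 1 by lia.
have hi2 : 0 < i %/ 2 < K by lia.
have hi3 : 0 < i %/ 2 < K + K by lia.
apply: leq_trans (_ : T (i %/ 2) <= _); last by apply: IH => //; lia.
rewrite (h _ hi2); have [E|E] : i = i %/ 2 + i %/ 2 \/ i = i %/ 2 + i %/ 2 + 1 by lia.
  by rewrite {1}E leq_addr.
by rewrite {1}E leq_addl.
Qed.

Section Hashing.
Variables (R : realType) (cap len : nat).
Implicit Types s : state R.

Lemma double_toP x hi s B l :
  (forall s', frame (double_to x hi) s s' -> wsafe cap len s' hi /\ wden s' hi = B) ->
  B <= 2 ^ l -> 2 ^ l < cap ->
  ok cap len (double_to x hi) s (2 * l + 2) (fun s' => exists j,
    [/\ wvar s' x = 2 ^ j, B <= 2 ^ j <= B + B + 1 & forall i, B <= 2 ^ i -> j <= i]).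
Proof.
move=> hhi hl lcap; have cap1 : 1 < cap by apply: leq_ltn_trans lcap; rewrite expn_gt0.
apply: (okWpS (T2 := 2 * l + 1)); last by rewrite /=; lia.
sp; split=> //.
have F0 : frame (double_to x hi) s (set_wvar s x 1).
  by split=> //= y; rewrite inE => /norP[/negPf h _]; rewrite /upd h.
have fr' s' : frame (While (TLt (V x) hi) (x ::= V x :+ V x)%cmd) (set_wvar s x 1) s' ->
    frame (double_to x hi) s s'.
  by move=> F; apply: frame_trans F0 (frame_seqr _ F).
apply: (okWhile (v := 2 * l) (I := fun v s' => exists j, [/\ wvar s' x = 2 ^ j, 2 ^ j <= B + B + 1,
  forall i, B <= 2 ^ i -> j <= i & v = 2 * (l - j)])).
- by exists 0; rewrite /= upd_eq subn0; split=> //; rewrite addn1.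
- by move=> v s' /fr'/hhi[h1 h2] _ /=.
- move=> v s' F [j [ex jB hj ->]] /=; have [h1 ->] := hhi s' (fr' _ F); rewrite ex => ltB.
  have jl : j < l by rewrite -(ltn_exp2l (m := 2)) // (leq_trans ltB).
  have e2 : 2 ^ j + 2 ^ j = 2 ^ j.+1 by rewrite expnS mul2n addnn.
  exists 1; apply: okWp => //; sp; rewrite ex e2; spl.
    by apply: leq_ltn_trans lcap; rewrite leq_exp2l.
  exists (2 * (l - j.+1)); last by lia.
  exists j.+1; rewrite upd_eq; split=> //; first by lia.
  by move=> i Bi; rewrite -(ltn_exp2l (m := 2)) // (leq_trans ltB).
- move=> v s' F [j [ex jB hj _]] /=; have [h1 ->] := hhi s' (fr' _ F); rewrite ex -leqNgt => Bj.
  by exists j; rewrite Bj jB.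
- by lia.
Qed.

(** Offset of the table of [u]. A tree with K leaves has its nodes at 1, ..., 2 K - 1, hence the
    doubled powers. *)
Definition cells (jj : nat -> nat) u := \sum_(w < u) (2 ^ jj w + 2 ^ jj w).

Lemma cellsS jj u : cells jj u.+1 = cells jj u + (2 ^ jj u + 2 ^ jj u).
Proof. by rewrite /cells big_ord_recr. Qed.

Lemma cells_mono jj u v : u <= v -> cells jj u <= cells jj v.
Proof.
by elim: v => [|v IH]; [case: u|rewrite leq_eqVlt => /orP[/eqP->//|/IH h]; rewrite cellsS; lia].
Qed.

Lemma cells_le jj (cnt : nat -> nat) u : (forall w, w < u -> 2 ^ jj w <= 4 * cnt w + 1) ->
  cells jj u <= 8 * (\sum_(w < u) cnt w) + 2 * u.
Proof.
move=> h; apply: leq_trans (_ : \sum_(w < u) (8 * cnt w + 2) <= _).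
  by apply: leq_sum => w _; have := h w (ltn_ord w); lia.
by rewrite big_split /= -big_distrr sum_nat_const card_ord mulnC.
Qed.

Record sized (N J : nat) (cnt jj : nat -> nat) s : Prop := Sized {
  sz_hk : wvar s hk = 2 ^ J;
  sz_J : N + N <= 2 ^ J <= 4 * N + 1;
  sz_K : forall u, u < N -> [/\ warr s aK u = 2 ^ jj u, warr s aWu u = 2 ^ (J - jj u) &
    warr s aUo u = cells jj u];
  sz_le : forall u, u < N -> jj u <= J;
  sz_cnt : forall u, u < N -> cnt u + cnt u <= 2 ^ jj u <= 4 * cnt u + 1 }.

Lemma table_sizesP N l cnt s : wvar s vN = N -> N + N <= 2 ^ l -> 2 ^ l < cap -> N + N < cap ->
  (forall u, u < N -> warr s aTc u = cnt u /\ cnt u <= N) -> N <= len ->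
  8 * (\sum_(w < N) cnt w) + 2 * N < cap -> 2 < cap ->
  ok cap len table_sizes s (2 * l + 5 + N * (2 * l + 8)) (fun s' => exists J jj,
    sized N J cnt jj s' /\ wvar s' off = cells jj N).
Proof.
move=> eN Nl lcap Ncap hc Nlen hcap cap2.
apply: (okS (double_toP (B := N + N) (l := l) _ Nl lcap) (T2 := 3 + N * (2 * l + 8))).
- by move=> s' F; sp; rewrite (fr_w F) // eN.
- move=> s1 F1 [J [eJ hJ minJ]].
  apply: (okWpS (T2 := 2 + N * (2 * l + 8))); last by rewrite /=; lia.
  sp; split; first by lia.
  have cells_cap jj u : u <= N -> (forall w, w < u -> 2 ^ jj w <= 4 * cnt w + 1) -> cells jj u < cap.
    move=> uN h; apply: leq_ltn_trans (cells_le h) _; apply: leq_ltn_trans hcap.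
    rewrite leq_add ?leq_mul2l ?uN // -!(big_mkord xpredT cnt).
    by rewrite [X in _ <= X](big_cat_nat (leq0n u) uN) //= leq_addr.
  apply: (okFor (a := 0) (b := N) (f := 2 * l + 6) (I := fun j s' => exists jj,
    [/\ wvar s' hk = 2 ^ J, wvar s' off = cells jj j,
     forall u, u < j -> [/\ warr s' aK u = 2 ^ jj u, warr s' aWu u = 2 ^ (J - jj u) &
       warr s' aUo u = cells jj u],
     forall u, u < j -> jj u <= J &
     forall u, u < j -> cnt u + cnt u <= 2 ^ jj u <= 4 * cnt u + 1])) => //; try nl.
  + by rewrite /=; lia.
  + by move=> s' F; split=> //; rewrite /= (fr_w F) //= upd_neq // (fr_w F1).
  + by exists (fun=> 0); split; sp => //; rewrite /cells big_ord0.
  + move=> u s2 /andP[_ uN] eu F2 [jj [h1 h2 h3 h4 h5]]; have [c1 c2] := hc u uN.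
    have ec : warr s2 aTc u = cnt u by fr F2; sp; fr F1.
    apply: (okS (double_toP (B := cnt u + cnt u) (l := l) _ _ lcap) (T2 := 4)).
    * by move=> s' F; sp; fr F; rewrite eu ec; spl; lia.
    * by apply: leq_trans Nl; lia.
    * move=> s3 F3 [j [ej hj minj]].
      have jJ : j <= J by apply: minj; lia.
      pose jj' w := if w == u then j else jj w.
      have jw w : w < u -> jj w = jj' w by rewrite /jj'; case: eqP => // ->; rewrite ltnn.
      have cw w : w <= u -> cells jj' w = cells jj w.
        by move=> wu; apply: eq_bigr => x _; rewrite -jw //; have := ltn_ord x; lia.
      have hcs w : w < u.+1 -> 2 ^ jj' w <= 4 * cnt w + 1.
        rewrite ltnS leq_eqVlt => /orP[/eqP->|wu]; first by rewrite /jj' eqxx; lia.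
        by rewrite -jw //; have := h5 w wu; lia.
      have cc1 := cells_cap jj' u.+1 uN hcs.
      have ju : jj' u = j by rewrite /jj' eqxx.
      rewrite cellsS ju cw // in cc1.
      have e1 : wvar s3 hk = 2 ^ J by fr F3.
      have e2 : wvar s3 off = cells jj u by fr F3.
      have e3 : wvar s3 du = u by fr F3.
      apply: okWp => //; sp; rewrite e3 ej e1 e2; spl; try nl.
      exists jj'; split; sp; rewrite ?e1 ?cellsS ?ju ?cw //.
      -- by rewrite -addnA.
      -- move=> w; rewrite ltnS leq_eqVlt => /orP[/eqP->|wu].
           by rewrite !upd_eq ju cw //; split=> //; rewrite -expnB.
         by rewrite !upd_neq ?(ltn_eqF wu) // -jw // cw ?(ltnW wu) //; fr F3; apply: h3.
      -- by move=> w; rewrite ltnS leq_eqVlt => /orP[/eqP->|wu]; rewrite ?ju // -jw // h4.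
      -- by move=> w; rewrite ltnS leq_eqVlt => /orP[/eqP->|wu]; rewrite ?ju -?jw ?h5 //; lia.
    * by lia.
  + move=> s2 _ F2 [jj [h1 h2 h3 h4 h5]]; exists J, jj; split=> //.
    by split=> //; lia.
- by lia.
Qed.

(* The branch taken at each level of the tree keeps the (scaled) conditional
   expectation of the cost from growing. *)
Lemma choose_nodeP s v J (jj uo : nat -> nat) ts st : wvar s dv = v -> wvar s hk = 2 ^ J ->
  v < len -> warr s aTst v = st -> warr s aTend v = st + size ts -> st + size ts <= len ->
  (forall i, i < size ts -> warr s aTk (st + i) = nth 0 ts i) ->
  {in ts, forall u, [/\ u < len, warr s aK u = 2 ^ jj u, warr s aUo u = uo u, jj u <= J &
    uo u + (2 ^ jj u + 2 ^ jj u) <= len]} ->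
  {in ts, forall u, sumtree (2 ^ jj u) (fun i => warr s aP (uo u + i))} ->
  \sum_(u <- ts) warr s aP (uo u + 1) < cap -> 2 ^ J + 2 ^ J < cap -> len < cap -> 2 < cap ->
  ok cap len choose_node s (J * (7 * size ts + 8) + 2) (fun s' =>
    2 ^ J <= wvar s' nd < 2 ^ J + 2 ^ J /\
    \sum_(u <- ts) 2 ^ jj u * warr s aP (uo u + wvar s' nd %/ 2 ^ (J - jj u)) <=
    \sum_(u <- ts) warr s aP (uo u + 1)).
Proof.
move=> ev eh vlen est een stlen hTk hK hT scap Jcap len_cap cap2.
set P := warr s aP in hT scap *; set S := \sum_(u <- ts) _ in scap *.
(* This is [2 ^ jj u] times the mean weight of the leaves of the table of [u] below node [x] of
   level [j]. The values at the two children average to the value at the parent, so the child with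
   the smaller sum does not exceed it. *)
pose Vu j x u := 2 ^ minn j (jj u) * P (uo u + x %/ 2 ^ (j - jj u)).
pose I j x := \sum_(u <- ts) Vu j x u.
pose A j x b := \sum_(u <- ts) if j < jj u then P (uo u + (x + x + b)) else 0.
have stepV j x : 2 ^ j <= x < 2 ^ j + 2 ^ j ->
   [/\ I j.+1 (x + x) + I j.+1 (x + x + 1) = I j x + I j x,
     A j x 1 < A j x 0 -> I j.+1 (x + x + 1) <= I j.+1 (x + x) &
     A j x 0 <= A j x 1 -> I j.+1 (x + x) <= I j.+1 (x + x + 1)].
  move=> hx; pose B := \sum_(u <- ts) if j < jj u then 0 else Vu j x u.
  have pw u : j < jj u -> x < 2 ^ jj u.
    by move=> h; have := leq_pexp2l (isT : 0 < 2) h; rewrite expnS; lia.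
  have hI b : b <= 1 -> I j.+1 (x + x + b) = B + 2 ^ j.+1 * A j x b.
    move=> b1; rewrite /I /B /A big_distrr -big_split /=; apply: eq_bigr => u _.
    rewrite /Vu; case: ltnP => ju.
      by rewrite (minn_idPl ju) add0n (_ : j.+1 - jj u = 0) ?divn1 //; lia.
    rewrite (minn_idPr (leqW ju)) muln0 addn0 subSn // expnS divnMA.
    by congr (_ * P (_ + _ %/ _)); lia.
  have hI0 : I j x = B + 2 ^ j * (A j x 0 + A j x 1).
    rewrite /I /B /A -big_split big_distrr -big_split /=; apply: eq_big_seq => u uts.
    rewrite /Vu; case: ltnP => ju; last by rewrite muln0 addn0.
    rewrite add0n (_ : j - jj u = 0) ?divn1; last by lia.
    by rewrite (hT u uts x) ?addn0 // pw // andbT; have := expn_gt0 2 j; lia.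
  have := hI 0 isT; rewrite addn0 => ->; rewrite hI // hI0 expnS.
  by split; [nia|move=> h; rewrite leq_add2l leq_mul2l (ltnW h) orbT
    |move=> h; rewrite leq_add2l leq_mul2l h orbT].
apply: (okWpS (T2 := J * (7 * size ts + 8) + 1)); last by rewrite /=; lia.
sp; split; first by lia.
apply: (okWhile (v := J * (7 * size ts + 8)) (I := fun v s' => exists j, [/\ j <= J, 2 ^ j <= wvar s' nd < 2 ^ j + 2 ^ j,
   I j (wvar s' nd) <= S & v = (J - j) * (7 * size ts + 8)])).
- exists 0; sp; rewrite subn0; split=> //.
  by apply: leq_sum => u _; rewrite /Vu min0n mul1n sub0n divn1.
- by move=> v' s' _ _ /=.
- move=> v' s1 F1 [j [jJ hx hI ->]] /=; set x := wvar s1 nd in hx hI *.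
  have eh1 : wvar s1 hk = 2 ^ J by fr F1; sp.
  have ev1 : wvar s1 dv = v by fr F1; sp.
  have eP1 : warr s1 aP = P by fr F1; sp.
  rewrite eh1 => xJ; have jJ' : j < J by rewrite -(ltn_exp2l (m := 2)) //; lia.
  have [st1 st2 st3] := stepV j x hx.
  have Au_le b i : b <= 1 -> \sum_(u <- take i ts) (if j < jj u then P (uo u + (x + x + b)) else 0) <= S.
    move=> b1; apply: leq_trans (_ : \sum_(u <- ts) (if j < jj u then P (uo u + (x + x + b)) else 0) <= _).
      by rewrite -[in X in _ <= X](cat_take_drop i ts) big_cat leq_addr.
    rewrite /S big_seq [X in _ <= X]big_seq; apply: leq_sum => u uts; case: ifP => // ju.
    apply: (sumtree_le (hT u uts)).
    by move: hx; have := leq_pexp2l (isT : 0 < 2) ju; rewrite expnS; lia.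
  exists (7 * size ts + 7).
  apply: (okWpS (T2 := 7 * size ts + 5)); last by rewrite /=; lia.
  sp; split; first by lia.
  split; first by lia.
  set s2 := set_wvar _ _ _.
  apply: (okS (T1 := 7 * size ts + 2) (T2 := 3) (Q1 := fun s' => wvar s' sa = A j x 0 /\ wvar s' sb = A j x 1)).
  + apply: (okFor (a := st) (b := st + size ts) (f := 5) (I := fun t s' =>
      wvar s' sa = \sum_(u <- take (t - st) ts) (if j < jj u then P (uo u + (x + x + 0)) else 0) /\
      wvar s' sb = \sum_(u <- take (t - st) ts) (if j < jj u then P (uo u + (x + x + 1)) else 0))) => //; try nl.
    * by rewrite /s2; sp; rewrite ev1.
    * by rewrite /s2; sp; rewrite ev1; fr F1; sp.
    * by move=> s' F; sp; fr F; rewrite /s2; sp; rewrite ev1; fr F1; sp.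
    * by rewrite subnn take0 !big_nil /s2; sp.
    * move=> t s3 ht et F3 [h1 h2]; pose i := t - st.
      have it : t = st + i by rewrite /i; lia.
      have its : i < size ts by lia.
      set u := nth 0 ts i; have uts : u \in ts by apply: mem_nth.
      have [ul uK uU uJ uU2] := hK u uts.
      have e1 : warr s3 aTk t = u by fr F3; rewrite /s2; sp; fr F1; sp; rewrite it hTk.
      have e2 : warr s3 aK u = 2 ^ jj u by fr F3; rewrite /s2; sp; fr F1; sp.
      have e3 : wvar s3 nd = x by fr F3; rewrite /s2; sp.
      have e4 : warr s3 aUo u = uo u by fr F3; rewrite /s2; sp; fr F1; sp.
      have e5 : warr s3 aP = P by fr F3; rewrite /s2; sp.
      have xjj : (x < 2 ^ jj u) = (j < jj u).
        apply/idP/idP => h; first by rewrite -(ltn_exp2l (m := 2)) //; lia.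
        by have := leq_pexp2l (isT : 0 < 2) h; rewrite expnS; lia.
      have ti : t.+1 - st = i.+1 by rewrite /i; lia.
      have b0 := Au_le 0 i.+1 isT; have b1 := Au_le 1 i.+1 isT.
      rewrite (take_nth 0) // -cats1 big_cat big_seq1 /= -/u in b0.
      rewrite (take_nth 0) // -cats1 big_cat big_seq1 /= -/u in b1.
      rewrite ti (take_nth 0) // -cats1 !big_cat !big_seq1 /= -/u.
      rewrite -/i in h1 h2.
      apply: okWp => //; sp; rewrite et e1 e3 e2; spl; try nl.
      rewrite xjj; case: ifP => jju; sp; last by rewrite h1 h2 jju !addn0.
      rewrite jju in b0 b1 *; rewrite e4 e5 h1 h2.
      have q1 : uo u + x + x + 1 = uo u + (x + x + 1) by lia.
      have q0 : uo u + x + x = uo u + (x + x + 0) by lia.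
      have ub : uo u + (x + x + 1) < len by lia.
      by rewrite q1 q0; spl; try nl; lia.
    * by move=> s3 _ F3; rewrite addKn take_size.
  + move=> s3 F3 [h1 h2]; have e3 : wvar s3 nd = x by fr F3; rewrite /s2; sp.
    have fin b y : b <= 1 -> y = x + x + b -> I j.+1 (x + x + b) <= S ->
        exists2 v', (exists j0, [/\ j0 <= J, 2 ^ j0 <= y < 2 ^ j0 + 2 ^ j0,
          I j0 y <= S & v' = (J - j0) * (7 * size ts + 8)]) &
        v' + (7 * size ts + 7) < (J - j) * (7 * size ts + 8).
      move=> b1 E hh; exists ((J - j.+1) * (7 * size ts + 8)).
        by exists j.+1; rewrite E expnS; split=> //; lia.
      by rewrite (_ : J - j = (J - j.+1).+1) ?mulSn; lia.
    apply: okWp => //; sp; rewrite e3 h1 h2; spl; try nl.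
    case: ltnP => hA; sp; spl; try nl.
      apply: (fin 1) => //; have := st2 hA; lia.
    apply: (fin 0) => //; rewrite ?addn0 //; have := st3 hA; lia.
  + by lia.
- move=> v' s1 F1 [j [jJ hx hI _]] /=; have eh1 : wvar s1 hk = 2 ^ J by fr F1; sp.
  rewrite eh1 -leqNgt => Jx.
  have ej : j = J.
    apply/eqP; rewrite eqn_leq jJ -ltnS -(ltn_exp2l (m := 2)) // expnS; lia.
  rewrite ej in hx hI; split=> //; apply: leq_trans hI.
  rewrite /I big_seq [X in _ <= X]big_seq; apply: leq_sum => u uts.
  by have [_ _ _ uJ _] := hK u uts; rewrite /Vu (minn_idPr uJ).
- by lia.
Qed.

Lemma add_pathP s u u0 K leaf d : wvar s du = u -> u < len -> warr s aUo u = u0 ->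
  wvar s lf = leaf -> wvar s dl = d -> K <= leaf < K + K -> u0 + (K + K) <= len -> len < cap -> 2 < cap ->
  sumtree K (fun i => warr s aP (u0 + i)) -> warr s aP (u0 + 1) + d < cap ->
  ok cap len add_path s (4 * trunc_log 2 leaf + 5) (fun s' =>
    let P i := warr s aP (u0 + i) in let P' i := warr s' aP (u0 + i) in
    [/\ sumtree K P', P' 1 = P 1 + d, forall c, K <= c < K + K -> P' c = P c + (c == leaf) * d &
      forall x, (x < u0) || (u0 + (K + K) <= x) -> warr s' aP x = warr s aP x]).
Proof.
move=> eu ul eU el ed hleaf hlen len_cap cap2 hT hcap.
set P := fun i => warr s aP (u0 + i) in hT hcap *; have hcap1 : P 1 + d < cap by [].
(* During the climb the sum equation is off by [d] exactly at the node [c] that is to be updated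
   next; at the leaf no equation is violated yet, and at 0 all hold again. *)
apply: (okWhile (v := 4 * (trunc_log 2 leaf).+1) (I := fun v s' => exists c,
  [/\ wvar s' lf = c /\ c <= leaf /\ (c < K \/ c = leaf),
    (forall i, 0 < i < K -> warr s' aP (u0 + (i + i)) + warr s' aP (u0 + (i + i + 1)) =
        warr s' aP (u0 + i) + (i == c) * d) /\ (forall i, 0 < i <= c -> warr s' aP (u0 + i) = P i),
    warr s' aP (u0 + 1) = P 1 + (c == 0) * d,
    (forall c', K <= c' < K + K -> warr s' aP (u0 + c') = P c' + ((c' == leaf) && (c != leaf)) * d) /\
    (forall x, (x < u0) || (u0 + (K + K) <= x) -> warr s' aP x = warr s aP x) &
    v = if c == 0 then 0 else 4 * (trunc_log 2 c).+1])).
- exists leaf; have l0 : leaf != 0 by lia.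
  rewrite (negPf l0) !addn0; split=> //.
  + by split=> //; split=> //; right.
  + split=> // i hi; rewrite -hT //; have -> : (i == leaf) = false by lia.
    by rewrite addn0.
  + by split=> // c hc; rewrite eqxx andbF addn0.
- by move=> v s' _ _ /=; split=> //; lia.
- move=> v s1 F1 [c [[ec [cl cK]] [hS hlow] h1 [hL hO] ->]] /=; rewrite ec => c0.
  rewrite ifN; last by lia.
  have e1 : wvar s1 du = u by fr F1.
  have e2 : warr s1 aUo u = u0 by fr F1.
  have e3 : wvar s1 dl = d by fr F1.
  have ePc : warr s1 aP (u0 + c) = P c by apply: hlow; lia.
  have Pc : P c <= P 1 by apply: sumtree_le hT _; lia.
  exists 3; apply: okWp => //; sp; rewrite e1 e2 e3 ec ePc; spl; try nl.
  set p1 := upd _ _ _.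
  have up i : p1 (u0 + i) = if i == c then P c + d else warr s1 aP (u0 + i).
    by rewrite /p1 /upd eqn_add2l.
  have div2 : c %/ 2 < c by lia.
  exists (if c %/ 2 == 0 then 0 else 4 * (trunc_log 2 (c %/ 2)).+1); last first.
    case: eqP => [|ne]; first by lia.
    have c1 : 1 < c by lia.
    have -> : trunc_log 2 c = (trunc_log 2 (c %/ 2)).+1 by rewrite trunc_log2S // divn2.
    by lia.
  exists (c %/ 2); sp; split=> //.
  + by split=> //; split; [lia|left; lia].
  + split=> i hi; rewrite !up; last first.
      by rewrite ifN; [apply: hlow; lia|lia].
    have hi' := hS i hi; case: (eqVneq i c) => [ic|nic].
      rewrite ic !ifN; [|lia..].
      have -> : (c == c %/ 2) = false by lia.
      rewrite ic eqxx in hi'; rewrite addn0 hi'; have -> : warr s1 aP (u0 + c) = P c by [].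
      by rewrite mul1n.
    rewrite (negPf nic) mul0n addn0 in hi'.
    have [E|E] := eqVneq i (c %/ 2).
      rewrite mul1n -hi'; have [E2|E2] : c = i + i \/ c = i + i + 1 by lia.
        rewrite E2 eqxx ifN; last by lia.
        by rewrite -E2 ePc; lia.
      rewrite E2 eqxx ifN; last by lia.
      by rewrite -E2 ePc; lia.
    by rewrite !ifN; [rewrite addn0|lia..].
  + rewrite up; case: eqP => [E|ne]; first by rewrite -E /= mul1n.
    have -> : (c %/ 2 == 0) = false by lia.
    by rewrite h1; have -> : (c == 0) = false by lia.
  + split=> [c' hc'|x hx].
      have c2 : c %/ 2 != leaf by lia.
      rewrite up c2 andbT; case: eqP => [E|ne].
        by rewrite E (_ : c = leaf) ?eqxx ?mul1n //; lia.
      rewrite hL //; case: eqP => // E2; have [cK'|cl'] := cK; last by rewrite cl' E2 in ne.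
      by have -> : c != leaf by lia.
    by rewrite /p1 upd_neq ?hO //; lia.
- move=> v s1 F1 [c [[ec [cl cK]] [hS hlow] h1 [hL hO] _]] /=; rewrite ec -eqn0Ngt => /eqP c0.
  rewrite c0 in hS h1 hL; split=> //.
  + move=> i hi; rewrite hS //; have -> : (i == 0) = false by lia.
    by rewrite mul0n addn0.
  + by rewrite h1 mul1n.
  + move=> c' hc'; rewrite hL //; have -> : 0 != leaf by lia.
    by rewrite andbT.
- by lia.
Qed.

End Hashing.

Lemma toff_inv tl v e : 0 < e < toff tl v ->
  exists w i, [/\ w < v, i < size (tl w) & e = toff tl w + i].
Proof.
elim: v => [|v IH]; first by rewrite /toff big_ord0; lia.
case: (ltnP e (toff tl v)) => [ev /andP[e0 _]|ve].
  by have [|w [i [wv il E]]] := IH; [rewrite e0|exists w, i; rewrite leqW].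
rewrite toffS => /andP[_ h]; exists v, (e - toff tl v); rewrite ltnSn; split=> //; lia.
Qed.

(** * The exponential potential and the load of the cells *)

Definition listed (tl : nat -> seq nat) v u := \sum_(w < v) (u \in tl w : nat).

Lemma listedS tl v u : listed tl v.+1 u = listed tl v u + (u \in tl v).
Proof. by rewrite /listed big_ord_recr. Qed.

(** [T u] is the root weight of the table of [u], and [lv u] the weight of the cell that receives
    the new pair. The scaled cell weights are at most the sum of the [T u], by the choice of the
    leaf; this is absorbed by the growth of [cnt u * T u]. The term [2 ^ (J - jj u)], scaled, gives
    [2 ^ J] per pair. *)
Lemma potential_step N J (jj T T' lv cnt : nat -> nat) ts : uniq ts -> {in ts, forall u, u < N} ->
  (forall u, u < N -> jj u <= J) ->
  (forall u, u < N -> T' u = T u + (u \in ts) * (lv u + 2 ^ (J - jj u))) ->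
  \sum_(u <- ts) 2 ^ jj u * lv u <= \sum_(u <- ts) T u ->
  \sum_(u < N) 2 ^ jj u * T u <= 2 ^ J * (\sum_(u < N) cnt u) + \sum_(u < N) cnt u * T u ->
  \sum_(u < N) 2 ^ jj u * T' u <=
    2 ^ J * (\sum_(u < N) (cnt u + ((u : nat) \in ts))) + \sum_(u < N) (cnt u + ((u : nat) \in ts)) * T' u.
Proof.
move=> ut tN jJ hT'; rewrite (sum_uniq (fun u => 2 ^ jj u * lv u) ut tN) (sum_uniq T ut tN) => h1 h2.
have -> : \sum_(u < N) 2 ^ jj u * T' u = \sum_(u < N) 2 ^ jj u * T u +
    \sum_(u < N) ((u : nat) \in ts) * (2 ^ jj u * lv u) + 2 ^ J * \sum_(u < N) ((u : nat) \in ts : nat).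
  rewrite big_distrr -!big_split /=; apply: eq_bigr => u _; rewrite hT' //.
  have E : 2 ^ J = 2 ^ jj u * 2 ^ (J - jj u) by rewrite -expnD subnKC // jJ.
  by rewrite E; case: (_ \in _); rewrite ?mul0n ?mul1n ?muln0 ?muln1 ?addn0 //; nia.
have h3 : \sum_(u < N) cnt u * T u + \sum_(u < N) ((u : nat) \in ts) * T u <=
    \sum_(u < N) (cnt u + ((u : nat) \in ts)) * T' u.
  rewrite -big_split /=; apply: leq_sum => u _; rewrite -mulnDl leq_mul2l hT' //.
  by rewrite leq_addr orbT.
rewrite [X in 2 ^ J * X + _]big_split /= mulnDr.
apply: leq_trans (leq_add (leq_add h2 h1) (leqnn _)) _.
by rewrite [X in _ <= X]addnAC leq_add2r -addnA leq_add2l.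
Qed.

(** A table has twice as many leaves as pairs, so the last sum is at most half of the left side and
    can be moved there. *)
Lemma potential_bound N J (jj T cnt : nat -> nat) :
  (forall u, u < N -> cnt u + cnt u <= 2 ^ jj u) ->
  \sum_(u < N) 2 ^ jj u * T u <= 2 ^ J * (\sum_(u < N) cnt u) + \sum_(u < N) cnt u * T u ->
  \sum_(u < N) 2 ^ jj u * T u <= 2 * (2 ^ J * \sum_(u < N) cnt u).
Proof.
move=> hc h; have h2 : 2 * \sum_(u < N) cnt u * T u <= \sum_(u < N) 2 ^ jj u * T u.
  rewrite big_distrr /=; apply: leq_sum => u _; rewrite mulnA leq_mul2r.
  by rewrite mul2n -addnn hc ?orbT.
lia.
Qed.

Section Hashing.
Variables (R : realType) (cap len N J : nat) (tl : nat -> seq nat) (jj tk tv : nat -> nat).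
Implicit Types s : state R.
Hypothesis tl_uniq : forall v, v < N -> uniq (tl v).
Hypothesis tl_lt : forall v, v < N -> {in tl v, forall u, u < N}.
Hypothesis tk_tl : forall v i, v < N -> i < size (tl v) -> tk (toff tl v + i) = nth 0 (tl v) i.
Hypothesis tv_tl : forall v i, v < N -> i < size (tl v) -> tv (toff tl v + i) = v.
Local Notation cnt := (listed tl).
Local Notation M := (\sum_(v < N) size (tl v)).
Hypothesis jj_le : forall u, u < N -> jj u <= J.
Hypothesis cnt_jj : forall u, u < N -> cnt N u + cnt N u <= 2 ^ jj u.
Hypothesis cells_len : cells jj N <= len.
Hypothesis N_len : N < len.
Hypothesis toff_len : toff tl N <= len.
Hypothesis cap_big : 2 ^ J * (4 * M + 4) < cap.
Hypothesis len_cap : len < cap.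
Hypothesis cap2 : 2 < cap.

Definition items s := [/\ wvar s hk = 2 ^ J,
  forall u, u < N -> [/\ warr s aK u = 2 ^ jj u, warr s aWu u = 2 ^ (J - jj u) &
    warr s aUo u = cells jj u],
  forall v, v < N -> warr s aTst v = toff tl v /\ warr s aTend v = toff tl v.+1,
  warr s aTk = tk & warr s aTv = tv].

Definition cell (fn : nat -> nat) e := cells jj (tk e) + fn (tv e) %/ 2 ^ (J - jj (tk e)).

Definition bucket fn k a := below (fun e => (0 < e) && (cell fn e == a)) k.

(** A cell with b pairs weighs its width times 2^b - 1. One more pair adds the old weight plus the
    width, which is what [insert_items] computes; and a weight bounded by the number of pairs makes
    b logarithmic. *)
Record hashed fn k s : Prop := Hashed {
  ha_lists : lists (cells jj N) (warr s bH) (warr s bN) (bucket fn k);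
  ha_tree : forall u, u < N -> sumtree (2 ^ jj u) (fun i => warr s aP (cells jj u + i));
  ha_leaf : forall u c, u < N -> 2 ^ jj u <= c < 2 ^ jj u + 2 ^ jj u ->
    warr s aP (cells jj u + c) = 2 ^ (J - jj u) * (2 ^ size (bucket fn k (cells jj u + c)) - 1) }.

Lemma cells_far u w c : u < N -> w < N -> w != u -> c < 2 ^ jj w + 2 ^ jj w ->
  (cells jj w + c < cells jj u) || (cells jj u + (2 ^ jj u + 2 ^ jj u) <= cells jj w + c).
Proof.
move=> uN wN; case: (ltngtP w u) => // wu _ hc; apply/orP; [left|right].
  by apply: leq_trans (cells_mono jj wu); rewrite cellsS ltn_add2l.
by rewrite -cellsS; apply: leq_trans (cells_mono jj wu) (leq_addr _ _).
Qed.

Lemma leaf_range u x : u < N -> 2 ^ J <= x < 2 ^ J + 2 ^ J ->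
  2 ^ jj u <= x %/ 2 ^ (J - jj u) < 2 ^ jj u + 2 ^ jj u.
Proof.
move=> uN hx; have E : 2 ^ J = 2 ^ jj u * 2 ^ (J - jj u) by rewrite -expnD subnKC // jj_le.
have w0 : 0 < 2 ^ (J - jj u) by rewrite expn_gt0.
rewrite leq_divRL // ltn_divLR // mulnDl -E; exact: hx.
Qed.

Lemma cell_lt u c : u < N -> c < 2 ^ jj u + 2 ^ jj u -> cells jj u + c < cells jj N.
Proof.
by move=> uN hc; apply: leq_trans (cells_mono jj uN); rewrite cellsS ltn_add2l.
Qed.

Lemma bucket_ext fn fn' v : v <= N -> (forall w, w < v -> fn w = fn' w) ->
  bucket fn (toff tl v) =1 bucket fn' (toff tl v).
Proof.
move=> vN h a; apply: eq_in_filter => e; rewrite mem_rev mem_iota add0n => /andP[_ ev].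
case: (posnP e) => //= e0; have [|w [i [wv il E]]] := @toff_inv tl v e; first by rewrite e0.
by rewrite /cell E tv_tl ?(leq_trans wv) // h.
Qed.

Lemma insert_itemsP fn v x s : v < N -> wvar s dv = v -> wvar s nd = x ->
  2 ^ J <= x < 2 ^ J + 2 ^ J -> items s -> hashed fn (toff tl v) s ->
  (forall u, u < N -> warr s aP (cells jj u + 1) <= 2 * (2 ^ J * M)) ->
  ok cap len insert_items s (size (tl v) * (4 * J + 13) + 3) (fun s' =>
    [/\ hashed (upd fn v x) (toff tl v.+1) s', warr s' aFn = upd (warr s aFn) v x &
      forall u, u < N -> warr s' aP (cells jj u + 1) = warr s aP (cells jj u + 1) +
        (u \in tl v) * (warr s aP (cells jj u + x %/ 2 ^ (J - jj u)) + 2 ^ (J - jj u))]).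
Proof.
move=> vN ev en hx [eh hU hTs hTk hTv] [hl ht hf] hP1; have [est een] := hTs v vN.
have toff_v : toff tl v + size (tl v) <= len.
  by rewrite -toffS; apply: leq_trans (toff_mono tl vN) toff_len.
set ts := tl v in toff_v *; set st := toff tl v in est hl hf toff_v *.
pose fn' := upd fn v x; pose P := warr s aP.
have est1 : toff tl v.+1 = st + size ts by rewrite toffS.
apply: (okWpS (T2 := size ts * (4 * J + 13) + 2)); last by rewrite /=; lia.
sp; rewrite ev en; spl; try nl.
set s1 := set_warr _ _ _ _.
pose dlt u := P (cells jj u + x %/ 2 ^ (J - jj u)) + 2 ^ (J - jj u).
(* Each [u] occurs once in [ts] and the tables are disjoint, so the weights read for [u] are still
   those on which the choice of the leaf was based. *)
apply: (okFor (a := st) (b := st + size ts) (f := 4 * J + 11) (I := fun j s' =>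
  [/\ hashed fn' j s',
     forall u c, u < N -> u \notin take (j - st) ts -> c < 2 ^ jj u + 2 ^ jj u ->
       warr s' aP (cells jj u + c) = P (cells jj u + c) &
     forall u, u < N -> warr s' aP (cells jj u + 1) = P (cells jj u + 1) + (u \in take (j - st) ts) * dlt u])) => //; try nl.
- by rewrite /s1; sp; rewrite ev; spl; nl.
- by rewrite /s1; sp; rewrite ev.
- by move=> s' F; sp; fr F; rewrite /s1; sp; rewrite ev een est1; spl; nl.
- have be : bucket fn st =1 bucket fn' st.
    by apply: bucket_ext (ltnW vN) _ => w wv; rewrite /fn' upd_neq ?(ltn_eqF wv).
  split.
  + split; rewrite /s1; sp => //.
      by apply: lists_ext hl => a _; apply: be.
    by move=> u c uN hc; rewrite hf // be.
  + by move=> u c uN _ hc; rewrite /s1; sp.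
  + by move=> u uN; rewrite subnn take0 addn0 /s1; sp.
- move=> j s2 hj ej F2 [[hl2 ht2 hf2] hn2 h12]; pose i := j - st.
  have ij : j = st + i by rewrite /i; lia.
  have its : i < size ts by lia.
  set u := nth 0 ts i; have uts : u \in ts by apply: mem_nth.
  have uN : u < N := tl_lt vN uts.
  have uti : u \notin take i ts by apply: nth_notin_take => //; apply: tl_uniq.
  have [uK uW uU] := hU u uN.
  set lfv := x %/ 2 ^ (J - jj u).
  have hlf : 2 ^ jj u <= lfv < 2 ^ jj u + 2 ^ jj u by apply: leaf_range.
  have e1 : warr s2 aTk j = u by fr F2; rewrite /s1; sp; rewrite hTk ij tk_tl.
  have e2 : wvar s2 nd = x by fr F2; rewrite /s1; sp.
  have e3 : warr s2 aWu u = 2 ^ (J - jj u) by fr F2; rewrite /s1; sp.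
  have e4 : warr s2 aUo u = cells jj u by fr F2; rewrite /s1; sp.
  have e5 : warr s2 aP (cells jj u + lfv) = P (cells jj u + lfv) by apply: hn2 => //; lia.
  have e6 : warr s2 aP (cells jj u + 1) = P (cells jj u + 1).
    by apply: hn2 => //; have := expn_gt0 2 (jj u); lia.
  have Ple : P (cells jj u + lfv) <= P (cells jj u + 1).
    by apply: (sumtree_le (ht u uN)); have := expn_gt0 2 (jj u); lia.
  have wJ : 2 ^ (J - jj u) <= 2 ^ J by rewrite leq_exp2l // leq_subr.
  have p1 := hP1 u uN; rewrite -/P in p1.
  have dcap : P (cells jj u + 1) + dlt u < cap by rewrite /dlt -/lfv; nia.
  have cl1 : cells jj u + lfv < cells jj N by apply: cell_lt => //; lia.
  have cl2 : cells jj u + (2 ^ jj u + 2 ^ jj u) <= len.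
    by rewrite -cellsS; apply: leq_trans (cells_mono jj uN) cells_len.
  have ecell : cell fn' j = cells jj u + lfv.
    by rewrite /cell ij tk_tl // tv_tl // -/u /fn' upd_eq.
  have j0 : 0 < j by rewrite ij /st /toff addSn.
  have bS a : bucket fn' j.+1 a = if a == cells jj u + lfv then j :: bucket fn' j a else bucket fn' j a.
    by rewrite /bucket belowS j0 ecell eq_sym.
  apply: (okWpS (T2 := 4 * J + 5)); last by rewrite /=; lia.
  have dl0 : P (cells jj u + lfv) + 2 ^ (J - jj u) < cap by move: dcap; rewrite /dlt -/lfv; lia.
  sp; rewrite ej e1 e2 e3 e4 -/lfv e5; spl; try nl.
  set s3 := set_warr _ _ _ _.
  have tlJ : trunc_log 2 lfv <= J.
    rewrite -ltnS; case: (posnP lfv) => [->|l0]; first by rewrite trunc_log0.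
    rewrite -(ltn_exp2l (m := 2)) //; apply: leq_ltn_trans (trunc_logP _ l0) _ => //.
    have := jj_le uN; rewrite -(leq_exp2l (m := 2)) // expnS; lia.
  apply: okW (add_pathP (u := u) (u0 := cells jj u) (K := 2 ^ jj u) (leaf := lfv) (d := dlt u) _ _ _ _ _ hlf cl2 len_cap cap2 _ _) _ _.
  + by rewrite /s3; sp.
  + by lia.
  + by rewrite /s3; sp.
  + by rewrite /s3; sp.
  + by rewrite /s3; sp.
  + by rewrite /s3; sp; apply: ht2.
  + by rewrite /s3; sp; rewrite e6.
  + move=> s4 F4; rewrite (_ : warr s3 aP = warr s2 aP); last by rewrite /s3; sp.
    move=> [q1 q2 q3 q4]; rewrite (_ : j.+1 - st = i.+1); last by rewrite /i; lia.
    rewrite -/i in hn2 h12.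
    have far w c : w < N -> w != u -> c < 2 ^ jj w + 2 ^ jj w ->
        warr s4 aP (cells jj w + c) = warr s2 aP (cells jj w + c).
      by move=> wN wu hc; apply: q4; apply: cells_far.
    split.
    * split; sp.
      -- fr F4; rewrite /s3; sp.
         apply: (lists_ext (F := fun a => if a == cells jj u + lfv then j :: bucket fn' j a else bucket fn' j a)).
           by move=> a _; rewrite bS.
         apply: lists_cons => //; first by lia.
         by move=> a _; rewrite mem_below ltnn.
      -- move=> w wN; have [->|wu] := eqVneq w u; first exact: q1.
         move=> i' hi'; have := ht2 w wN i' hi'; rewrite !far //; lia.
      -- move=> w c wN hc; rewrite bS; have [wu|wu] := eqVneq w u.
           rewrite wu in hc *; rewrite q3 // hf2 // eqn_add2l; case: eqP => [->|_]; last by rewrite addn0.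
           rewrite mul1n /dlt -/lfv -e5 hf2 //= expnS; set z := 2 ^ size _.
           have : 0 < z by rewrite expn_gt0.
           case: z => // z _; rewrite (_ : 2 * z.+1 - 1 = z + z + 1); last by lia.
           by rewrite subn1 /= !mulnDr muln1 addnA.
         rewrite far //; last by lia.
         rewrite hf2 // ifN //.
         by have := @cells_far u w c uN wN wu ltac:(lia); lia.
    * move=> w c wN; rewrite mem_takeS // -/u negb_or => /andP[wt wu] hc; sp.
      by rewrite far // hn2.
    * move=> w wN; rewrite mem_takeS // -/u; sp; have [->|wu] := eqVneq w u.
        by rewrite orbT mul1n q2 e6.
      by rewrite orbF far ?h12 //; have := expn_gt0 2 (jj w); lia.
  + by lia.
- move=> s2 _ F2 [h1 _ h3]; rewrite est1; split=> //.
    by fr F2; rewrite /s1; sp.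
  by move=> u uN; rewrite h3 // addKn take_size.
Qed.

Lemma sum_cnt v : v <= N -> \sum_(u < N) cnt v u <= M.
Proof.
move=> vN; rewrite /listed exchange_big /=.
have -> : \sum_(w < v) \sum_(u < N) (((u : nat) \in tl w) : nat) = \sum_(w < v) size (tl w).
  apply: eq_bigr => w _; have wN := leq_trans (ltn_ord w) vN.
  rewrite -[RHS]sum1_size (sum_uniq (fun=> 1) (tl_uniq wN) (tl_lt wN)).
  by apply: eq_bigr => u _; rewrite muln1.
rewrite -!(big_mkord xpredT (fun w => size (tl w))).
by rewrite [X in _ <= X](big_cat_nat (leq0n v) vN) //= leq_addr.
Qed.

Lemma cnt_mono v u : v <= N -> cnt v u <= cnt N u.
Proof.
move=> vN; rewrite /listed -!(big_mkord xpredT (fun w => (u \in tl w) : nat)).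
by rewrite [X in _ <= X](big_cat_nat (leq0n v) vN) //= leq_addr.
Qed.

Lemma hash_allP s : items s -> wvar s vN = N -> (forall a, warr s aP a = 0) -> (forall a, warr s bH a = 0) ->
  ok cap len hash_all s (M * (11 * J + 13) + N * (8 * J + 7) + 2) (fun s' => exists2 fn,
    (forall w, w < N -> warr s' aFn w = fn w /\ 2 ^ J <= fn w < 2 ^ J + 2 ^ J) &
    lists (cells jj N) (warr s' bH) (warr s' bN) (bucket fn (toff tl N)) /\
    forall a, 2 ^ size (bucket fn (toff tl N) a) <= 2 * M + 1).
Proof.
move=> hit eN hP hB.
pose pot v (T : nat -> nat) := \sum_(u < N) 2 ^ jj u * T u <=
  2 ^ J * (\sum_(u < N) cnt v u) + \sum_(u < N) cnt v u * T u.
have potb v T : v <= N -> pot v T -> \sum_(u < N) 2 ^ jj u * T u <= 2 * (2 ^ J * M).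
  move=> vN h; apply: leq_trans (potential_bound (cnt := cnt v) _ h) _.
    by move=> u uN; have := cnt_jj uN; have := cnt_mono u vN; lia.
  by rewrite !leq_mul2l sum_cnt ?orbT.
have rootb v T u : v <= N -> pot v T -> u < N -> 2 ^ jj u * T u <= 2 * (2 ^ J * M).
  move=> vN h uN; apply: leq_trans (potb v T vN h).
  by rewrite (bigD1 (Ordinal uN)) //= leq_addr.
apply: (okForS (a := 0) (b := N) (f := fun v => size (tl v) * (11 * J + 13) + 8 * J + 5) (I := fun v s' => exists fn,
  [/\ hashed fn (toff tl v) s',
   forall w, w < v -> warr s' aFn w = fn w /\ 2 ^ J <= fn w < 2 ^ J + 2 ^ J &
   pot v (fun u => warr s' aP (cells jj u + 1))])) => //; try nl.
- by rewrite /=; lia.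
- by move=> s' F; split=> //=; fr F.
- exists (fun=> 0).
  rewrite /toff big_ord0; split=> //.
  + split; sp.
    * by move=> a _; rewrite hB.
    * by move=> u uN i _; rewrite !hP.
    * by move=> u c uN hc; rewrite hP muln0.
  + by rewrite /pot big1 // => u _; sp; rewrite hP muln0.
- move=> v s1 /andP[_ vN] ev F1 [fn [hh hfn hpot]].
  have it1 : items s1.
    by case: hit => *; split; [fr F1; sp|fr F1; sp|fr F1; sp|fr F1; sp|fr F1; sp].
  have [eh hU hTs hTk hTv] := it1; have [est een] := hTs v vN.
  have rb u : u < N -> warr s1 aP (cells jj u + 1) <= 2 * (2 ^ J * M).
    move=> uN; apply: leq_trans (rootb v _ u (ltnW vN) hpot uN).
    by rewrite leq_pmull // expn_gt0.
  have toff_v : toff tl v + size (tl v) <= len.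
    by rewrite -toffS; apply: leq_trans (toff_mono tl vN) toff_len.
  have tin u : u \in tl v -> u < N by apply: tl_lt.
  apply: (okS (choose_nodeP (v := v) (J := J) (jj := jj) (uo := cells jj) (ts := tl v) (st := toff tl v)
     ev eh _ est _ toff_v _ _ _ _ _ len_cap cap2) (T2 := size (tl v) * (4 * J + 13) + 3)).
  + by lia.
  + by rewrite een toffS.
  + by move=> i il; rewrite hTk tk_tl.
  + move=> u /tin uN; have [h1 h2 h3] := hU u uN; split=> //; [by lia|exact: jj_le|].
    by rewrite -cellsS; apply: leq_trans (cells_mono jj uN) cells_len.
  + by move=> u /tin uN; apply: ha_tree hh _ uN.
  + apply: leq_ltn_trans (sum_uniq_le _ (tl_uniq vN) (tl_lt vN)) _.
    apply: leq_ltn_trans (_ : 2 * (2 ^ J * M) < cap); last by nia.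
    apply: leq_trans (potb v _ (ltnW vN) hpot); apply: leq_sum => u _.
    by rewrite leq_pmull // expn_gt0.
  + by nia.
  + move=> s2 F2 [hx hsum]; set x := wvar s2 nd in hx hsum.
    have eP2 : warr s2 aP = warr s1 aP by fr F2.
    have h2 : hashed fn (toff tl v) s2.
      by case: hh => *; split; [fr F2|rewrite eP2|rewrite eP2].
    apply: okW (insert_itemsP (v := v) (x := x) vN _ (erefl _) hx _ h2 _) _ (leqnn _).
    * by fr F2.
    * by split; fr F2.
    * by move=> u uN; rewrite eP2 rb.
    * move=> s3 F3 [h3 hfn3 hroot]; exists (upd fn v x); split=> //.
      -- by case: h3 => *; split.
      -- move=> w; rewrite ltnS leq_eqVlt; sp; rewrite hfn3 => /orP[/eqP->|wv]; first by rewrite !upd_eq.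
         by rewrite !upd_neq ?(ltn_eqF wv) //; fr F2; apply: hfn.
      -- have step := potential_step (T := fun u => warr s1 aP (cells jj u + 1))
           (lv := fun u => warr s1 aP (cells jj u + x %/ 2 ^ (J - jj u)))
           (T' := fun u => warr s3 aP (cells jj u + 1)) (tl_uniq vN) (tl_lt vN) jj_le _ hsum hpot.
         rewrite /pot; sp; apply: leq_trans (step _) _; first by move=> u uN; rewrite hroot // eP2.
         rewrite leq_eqVlt; apply/orP; left; apply/eqP; congr (_ * _ + _).
           by apply: eq_bigr => u _; rewrite listedS.
         by apply: eq_bigr => u _; rewrite listedS.
  + by lia.
- move=> s1 _ F1 [fn [hh hfn hpot]]; exists fn => //; split; first exact: ha_lists hh.
  move=> a; case E : (bucket fn (toff tl N) a) => [|e l]; first by rewrite expn0; lia.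
  have : e \in bucket fn (toff tl N) a by rewrite E mem_head.
  rewrite mem_below => /and3P[el e0 /eqP ea]; rewrite -E.
  have [|w [i [wN il Ee]]] := @toff_inv tl N e; first by rewrite e0.
  set u := nth 0 (tl w) i; have uN : u < N by apply: tl_lt wN _ (mem_nth 0 il).
  have [_ hw] := hfn w wN.
  have hlf := leaf_range uN hw; set lfv := fn w %/ 2 ^ (J - jj u) in hlf.
  have ea' : a = cells jj u + lfv by rewrite -ea /cell Ee tk_tl // tv_tl.
  have hl := ha_leaf hh uN hlf; rewrite -ea' in hl.
  have le1 : warr s1 aP a <= warr s1 aP (cells jj u + 1).
    by rewrite ea'; apply: (sumtree_le (ha_tree hh uN)); have := expn_gt0 2 (jj u); lia.
  (* The cell weighs no more than its root, and the root at most [2 * 2 ^ J * M / 2 ^ jj u].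
     Cancelling the common factor [2 ^ J] leaves 2^b - 1 at most 2 M. *)
  have := rootb N _ u (leqnn N) hpot uN.
  have E2 : 2 ^ J = 2 ^ jj u * 2 ^ (J - jj u) by rewrite -expnD subnKC // jj_le.
  rewrite E2 -!mulnA [2 * _]mulnCA leq_pmul2l ?expn_gt0 // => h.
  have := leq_trans le1 h; rewrite hl mulnCA leq_pmul2l ?expn_gt0 //; lia.
- rewrite big_mkord (eq_bigr (fun v : 'I_N => size (tl v) * (11 * J + 13) + (8 * J + 7))); last by move=> v _; lia.
  by rewrite big_split /= -big_distrl sum_nat_const card_ord.
Qed.

End Hashing.

(* Item [e] of cell [a] takes the slot [aSB a + aTv e %% aMod a]. *)
Local Notation sl := 51.
Local Notation pm := 52.
Local Notation ca := 53.
Local Notation aMod := 73.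
Local Notation aSB := 74.
Local Notation aSlot := 75.

(** [go] is raised by a collision, upon which the next modulus is tried. Attempts write at [sl] and
    above only, so they cannot disturb the slots of earlier cells. *)
Definition try_modulus : cmd := (
  (pm ::= V pm :+ C 1;; go ::= C 0);;
  For tp (V sl) (V sl :+ V pm) (WStore aSlot (V tp) (C 0));;
  ForL de (WRead bH (V ca)) bN (
    dx ::= V sl :+ WMod (WRead aTv (V de)) (V pm);;
    If (TEq (WRead aSlot (V dx)) (C 0)) (WStore aSlot (V dx) (V de)) (go ::= C 1)))%cmd.

Definition slots : cmd := (
  sl ::= C 0;;
  For ca (C 0) (V off) (
    (pm ::= C 0;; go ::= C 1);;
    While (TLt (C 0) (V go)) try_modulus;;
    (WStore aMod (V ca) (V pm);; WStore aSB (V ca) (V sl);; sl ::= V sl :+ V pm)))%cmd.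

(** * Slots without collisions inside each cell *)

Section Slots.
Variables (R : realType) (cap len Cn T S PM : nat) (F : nat -> seq nat) (tv : nat -> nat).
Implicit Types s : state R.
Hypothesis F_ids : forall a e, a < Cn -> e \in F a -> 0 < e < T.
Hypothesis F_size : forall a, a < Cn -> size (F a) <= S.
Hypothesis F_mod : forall a, a < Cn -> exists2 p, 0 < p <= PM & uniq [seq tv e %% p | e <- F a].
Hypothesis T_len : T <= len.
Hypothesis T0 : 0 < T.
Hypothesis PM_len : Cn * PM + PM <= len.
Hypothesis Cn_len : Cn <= len.
Hypothesis len_cap : len < cap.
Hypothesis cap2 : 2 < cap.

Definition placed a p b s :=
  forall e, e \in F a -> warr s aSlot (b + tv e %% p) = e.

Lemma try_modulusP s a b p : a < Cn -> wvar s ca = a -> wvar s sl = b -> wvar s pm = p ->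
  warr s aTv = tv -> p < PM -> b + PM <= len ->
  chain (warr s bN) (warr s bH a) (F a) -> (forall i, warr s aSlot i < T) ->
  ok cap len try_modulus s (3 * PM + 5 * S + 6) (fun s' =>
    [/\ wvar s' pm = p.+1,
      if wvar s' go == 0 then placed a p.+1 b s' else ~~ uniq [seq tv e %% p.+1 | e <- F a],
      wvar s' go <= 1, forall i, i < b -> warr s' aSlot i = warr s aSlot i &
      forall i, warr s' aSlot i < T]).
Proof.
move=> aC ea eb ep et pP bP hch hT.
apply: (okWpS (T2 := 3 * PM + 5 * S + 4)); last by rewrite /=; lia.
sp; rewrite ep; spl; try nl.
set s1 := set_wvar _ _ _.
apply: (okS (T1 := 3 * p.+1 + 2) (T2 := 5 * S + 2) (Q1 := fun s' =>
  [/\ forall i, b <= i < b + p.+1 -> warr s' aSlot i = 0, forall i, i < b -> warr s' aSlot i = warr s aSlot i &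
      forall i, warr s' aSlot i < T])); last by lia.
- apply: (okFor (a := b) (b := b + p.+1) (f := 1) (I := fun j s' =>
  [/\ forall i, b <= i < j -> warr s' aSlot i = 0, forall i, i < b -> warr s' aSlot i = warr s aSlot i &
      forall i, warr s' aSlot i < T])) => //; try nl.
  + by move=> s' G; sp; fr G; rewrite /s1; sp; rewrite eb addn1; spl; lia.
  + by split; rewrite /s1; sp => // i; lia.
  + move=> j s2 hj ej F2 [h1 h2 h3]; apply: okWp => //; sp; rewrite ej; spl; try nl.
    * by move=> i; rewrite /upd; case: eqP => // ne hi; apply: h1; lia.
    * by move=> i ib; rewrite upd_neq; [apply: h2|lia].
    * by move=> i; rewrite /upd; case: eqP.
- move=> s2 F2 [h1 h2 h3].
  pose r e := tv e %% p.+1.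
  have rp e : r e < p.+1 by rewrite ltn_mod.
  have e2 : wvar s2 sl = b by fr F2; rewrite /s1; sp.
  apply: (okForLS (l := F a) (f := fun=> 3) (I := fun j s' =>
    [/\ wvar s' go <= 1,
       if wvar s' go == 0 then {in take j (F a), forall e, warr s' aSlot (b + r e) = e} /\
         (forall x, x < p.+1 -> warr s' aSlot (b + x) != 0 -> x \in map r (take j (F a)))
       else ~~ uniq (map r (F a)),
       forall i, i < b -> warr s' aSlot i = warr s aSlot i &
       forall i, warr s' aSlot i < T])) => //.
  + by sp; fr F2; rewrite /s1; sp; rewrite ea; spl; lia.
  + by lia.
  + by sp; fr F2; rewrite /s1; sp; rewrite ea.
  + by move=> e /(F_ids aC); lia.
  + rewrite take0; split=> //; sp; fr F2; rewrite /s1; sp => //; split=> // x xp.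
    by rewrite (_ : warr s2 aSlot (b + x) = 0) // h1 //; lia.
  + move=> j s3 jl ee F3 [hgo hif hb hT3]; set e := nth 0 (F a) j in ee *.
    have eF : e \in F a by rewrite mem_nth.
    have /andP[e0 eT] := F_ids aC eF.
    have e1 : wvar s3 sl = b by fr F3.
    have e3 : wvar s3 pm = p.+1 by fr F3; fr F2; rewrite /s1; sp; rewrite addn1.
    have e4 : warr s3 aTv e = tv e by fr F3; fr F2; rewrite /s1; sp; rewrite et.
    have mapS : map r (take j.+1 (F a)) = rcons (map r (take j (F a))) (r e).
      by rewrite (take_nth 0) // map_rcons.
    have sub : subseq (map r (take j.+1 (F a))) (map r (F a)) by rewrite map_subseq // take_subseq.
    have rpe := rp e.
    apply: okWp => //; sp; rewrite ee e1 e3 e4 -/(r e); spl; try nl.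
    case: eqP => h0; sp; rewrite ?ee; spl; try nl.
    * move=> w; split; sp => //; last by move=> i; rewrite /upd; case: eqP.
        case: eqP hif => // _ [k1 k2]; split.
          move=> e'; rewrite (take_nth 0) // mem_rcons inE => /orP[/eqP->|e't]; first by rewrite upd_eq.
          rewrite upd_neq ?k1 // eqn_add2l; apply/eqP => E.
          by have := k1 e' e't; rewrite E h0 => E2; have := F_ids aC (mem_take e't); rewrite -E2.
        move=> x xp; rewrite mapS mem_rcons inE /upd eqn_add2l; case: (x =P r e) => //= _.
        exact: k2.
      by move=> i ib; rewrite upd_neq ?hb //; lia.
    * move=> w; split; sp => //; case: eqP hif => // _ [k1 k2].
      apply: contraTN (k2 _ rpe ltac:(by apply/eqP)) => /(subseq_uniq sub).
      by rewrite mapS rcons_uniq => /andP[].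
  + move=> s3 F3 [hgo hif hb hT3]; split=> //.
      by fr F3; fr F2; rewrite /s1; sp; rewrite addn1.
    rewrite take_size in hif; case: eqP hif => // _ [k1 _] e /k1; exact.
  + rewrite big_const_seq count_predT iter_addn_0; have := F_size aC; lia.
Qed.

(** The last clause covers all slots. A query for an absent pair may find the item of another pair;
    it has to be able to read its keys safely in order to reject it. *)
Lemma slotsP s : wvar s off = Cn -> warr s aTv = tv -> lists Cn (warr s bH) (warr s bN) F ->
  (forall i, warr s aSlot i = 0) ->
  ok cap len slots s (Cn * (PM * (3 * PM + 5 * S + 7) + 8) + 3) (fun s' =>
    (forall a, a < Cn -> [/\ 0 < warr s' aMod a, warr s' aSB a + warr s' aMod a <= Cn * PM &
      placed a (warr s' aMod a) (warr s' aSB a) s']) /\ forall i, warr s' aSlot i < T).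
Proof.
move=> eo et hl h0.
apply: (okWpS (T2 := Cn * (PM * (3 * PM + 5 * S + 7) + 8) + 2)); last by rewrite /=; lia.
sp; split; first by lia.
apply: (okFor (a := 0) (b := Cn) (f := PM * (3 * PM + 5 * S + 7) + 6) (I := fun j s' =>
  [/\ wvar s' sl <= j * PM,
    forall a, a < j -> [/\ 0 < warr s' aMod a, warr s' aSB a + warr s' aMod a <= wvar s' sl &
      placed a (warr s' aMod a) (warr s' aSB a) s'] & forall i, warr s' aSlot i < T])) => //; try nl.
- by rewrite /=; lia.
- by move=> s' G; split=> //=; fr G; sp.
- by split; sp => // i; rewrite h0.
- move=> a s1 /andP[_ aC] ea F1 [hsl hpl hT]; set b := wvar s1 sl in hsl hpl.
  have [p0 /andP[p00 p0P] hp0] := F_mod aC.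
  have bP : b + PM <= len.
    by apply: leq_trans PM_len; rewrite leq_add2r (leq_trans hsl) // leq_mul2r ltnW ?orbT.
  apply: (okWpS (T2 := PM * (3 * PM + 5 * S + 7) + 4)); last by rewrite /=; lia.
  sp; split; first by lia.
  split; first by lia.
  set s2 := set_wvar _ _ _.
  apply: (okS (T1 := PM * (3 * PM + 5 * S + 7) + 1) (T2 := 3) (Q1 := fun s' => exists2 p, 0 < p <= PM &
    [/\ wvar s' pm = p, placed a p b s', forall i, i < b -> warr s' aSlot i = warr s1 aSlot i &
      forall i, warr s' aSlot i < T])).
  + apply: (okWhile (v := PM * (3 * PM + 5 * S + 7)) (I := fun v s' => exists p,
      [/\ wvar s' pm = p /\ p <= PM, wvar s' go <= 1 /\ (if wvar s' go == 0 then 0 < p /\ placed a p b s'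
         else forall p', 0 < p' <= p -> ~~ uniq [seq tv e %% p' | e <- F a]),
        forall i, i < b -> warr s' aSlot i = warr s1 aSlot i, forall i, warr s' aSlot i < T &
        v = (PM - p) * (3 * PM + 5 * S + 7)])).
    * exists 0; rewrite /s2; sp; rewrite subn0; split=> //; split=> // p'; lia.
    * by move=> v s' _ _ /=; split=> //; lia.
    * move=> v s3 F3 [p [[ep pP] [hgo hif] hb hT3 ->]] /=; rewrite lt0n => /negPf g0.
      rewrite g0 in hif; have pP' : p < p0.
        by rewrite ltnNge; apply/negP => h; have := hif p0; rewrite p00 h hp0 => /(_ isT).
      exists (3 * PM + 5 * S + 6).
      apply: okW (try_modulusP (a := a) (b := b) (p := p) aC _ _ ep _ _ bP _ hT3) _ (leqnn _).
      -- by fr F3; rewrite /s2; sp.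
      -- by fr F3; rewrite /s2; sp.
      -- by fr F3; rewrite /s2; sp; fr F1; sp.
      -- exact: leq_trans pP' p0P.
      -- by fr F3; rewrite /s2; sp; fr F1; sp; apply: hl.
      -- move=> s4 F4 [k1 k2 k3 k4 k5]; exists ((PM - p.+1) * (3 * PM + 5 * S + 7)); last first.
           by rewrite (_ : PM - p = (PM - p.+1).+1) ?mulSn; lia.
         exists p.+1; split=> //; last by move=> i ib; rewrite k4 // hb.
           by split=> //; lia.
         split=> //; case: eqP k2 => // _ nu p' hp'.
         have [->|ne] := eqVneq p' p.+1; first exact: nu.
         by apply: hif; lia.
    * move=> v s3 F3 [p [[ep pP] [hgo hif] hb hT3 _]] /=; rewrite -eqn0Ngt => g0.
      by rewrite g0 in hif; case: hif => p_0 hpl'; exists p; rewrite ?p_0.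
    * by lia.
  + move=> s3 F3 [p /andP[p_0 pP] [ep hpl' hb hT3]].
    have e1 : wvar s3 ca = a by fr F3; rewrite /s2; sp.
    have e2 : wvar s3 sl = b by fr F3; rewrite /s2; sp.
    have e3 : warr s3 aMod = warr s1 aMod by fr F3; rewrite /s2; sp.
    have e4 : warr s3 aSB = warr s1 aSB by fr F3; rewrite /s2; sp.
    apply: okWp => //; sp; rewrite e1 e2 ep; spl; try nl.
    rewrite e3 e4 => a'; rewrite ltnS leq_eqVlt => /orP[/eqP->|a'a].
      by rewrite !upd_eq.
    rewrite !upd_neq ?(ltn_eqF a'a) //; have [k1 k2 k3] := hpl a' a'a; split=> //; first by lia.
    move=> e eF; rewrite /placed in k3; sp; rewrite hb ?k3 //; apply: leq_trans k2.
    by rewrite ltn_add2l ltn_mod.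
    exact: hT3.
  + by lia.
- move=> s' _ F1 [hsl hpl hT]; split=> // a aC; have [k1 k2 k3] := hpl a aC; split=> //.
  exact: leq_trans hsl.
Qed.

End Slots.

(** * The preprocessing *)

Definition core : cmd := (
  params;; pq_init;; full_adj;; light_adj;; near_lists;; clusters;; inv_lists;;
  land_table;; pivots;; near_pairs;; table_sizes;; hash_all;; slots)%cmd.

(** If the ball is cut at a pivot, the order of the list excludes the entries from there on, and
    [nl_far] the vertices outside the list. Otherwise the list is not full, so it contains every
    vertex at finite distance. *)
Lemma ballP (R : realType) (g : mgraph R) Q u x (l : seq nat) b (r : \bar R) : nlist g Q u l ->
  b <= size l -> (if b < size l then r = gd g u (nth 0%N l b) else r = +oo%E) ->
  (size l = Q -> b < size l) -> x < gN g -> (gd g u x < r)%E -> x \in take b l.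
Proof.
move=> hl bl hr hQ xN lt; case: ltnP hr => hb hr.
- have xl : x \in l.
    rewrite -[_ \in _]negbK; apply/negP => xl.
    by have := nl_far hl (mem_nth 0 hb) xN xl; rewrite -hr leNgt lt.
  rewrite mem_take_index // ltnNge; apply/negP => bi.
  have := @nl_sort _ _ _ _ _ hl b (index x l); rewrite bi index_mem xl => /(_ isT).
  by rewrite nth_index // -hr leNgt lt.
- have xl : x \in l.
    rewrite -[_ \in _]negbK; apply/negP => xl.
    have [/hQ|E] := nl_full hl xN xl; first by rewrite ltnNge hb.
    by move: lt; rewrite E hr ltxx.
  by rewrite take_oversize.
Qed.

Lemma room N Z q a b len : 0 < q -> N <= q * (q * q) -> N <= Z -> 0 < N -> 0 < b ->
  40 * (q * q * Z) * (2 * b + a) <= len ->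
  [/\ 80 * (q * q * Z) <= len, N * (N %/ (q * q) + 1) <= 2 * (q * q * Z), Z <= q * q * Z,
    N %/ (q * q) + 1 < len & q * q * a * N + N <= len] /\
  40 * (q * q * Z) * (2 * b) <= len.
Proof.
move=> q0 Nq NZ N0 b0 h; set k := q * q in Nq h *; have k0 : 0 < k by rewrite muln_gt0 q0.
have qk : q <= k by rewrite leq_pmulr.
have ZD : Z <= k * Z by rewrite leq_pmull.
have Qq : N %/ k <= q by rewrite -(mulnK q k0) leq_div2r.
have aN : k * a * N <= k * Z * a by rewrite mulnAC leq_mul2r leq_mul2l NZ !orbT.
move: h; rewrite mulnDr => h; set D := k * Z in h ZD aN *.
have h2 : 80 * D <= 40 * D * (2 * b).
  by rewrite mulnA (_ : 80 * D = 40 * D * 2) ?leq_pmulr //; lia.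
have NQ : N * (N %/ k + 1) <= 2 * D.
  apply: leq_trans (_ : Z * (2 * k) <= _); last by rewrite /D; lia.
  by apply: leq_mul => //; lia.
have NQ2 : N %/ k + 1 <= N * (N %/ k + 1) by rewrite leq_pmull.
have aD : D * a <= 40 * D * a by rewrite -mulnA leq_pmull.
by split=> //; last (by lia); split=> //; lia.
Qed.

Lemma cells_inj N (jj : nat -> nat) u w c c' : u < N -> w < N ->
  c < 2 ^ jj u + 2 ^ jj u -> c' < 2 ^ jj w + 2 ^ jj w -> cells jj u + c = cells jj w + c' -> u = w.
Proof.
move=> uN wN hc hc' E; apply/eqP; rewrite -[_ == _]negbK; apply/negP => ne.
have := @cells_far N jj u w c' uN wN; rewrite eq_sym ne -E => /(_ isT hc').
by rewrite ltnNge leq_addr leq_add2l leqNgt hc.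
Qed.

Ltac frs := repeat (match goal with F : frame _ _ _ |- _ => progress (fr F) end).

Section Core.
Variables (R : realType) (cap len : nat) (g : mgraph R).
Implicit Types s : state R.
Local Notation N := (gN g).
Local Notation Z := (gZ g).
Local Notation tlZ := (trunc_log 2 Z).
Local Notation l := (trunc_log 2 N).+1.

Definition found s u v : \bar R :=
  let a := warr s aUo u + warr s aFn v %/ warr s aWu u in
  let i := warr s aSlot (warr s aSB a + v %% warr s aMod a) in
  if [&& 0 < i, warr s aTk i == u & warr s aTv i == v] then rarr s rTd i else +oo%E.

(** The contract between preprocessing and query. [or_sound] holds whether or not the pair is
    stored, while [or_complete] only speaks of edges that join the two open balls, as in
    [query_bound]. *)
Record oracle_spec s : Prop := Oracle {
  or_row : forall u, u < N -> warr s aPrw u + N <= len;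
  or_near : forall u v, u < N -> v < N -> let d := (rarr s rR u + rarr s rTab (warr s aPrw u + v))%E in
    [/\ (gd g u v <= d)%E, (d <= rarr s rR u + (rarr s rR u + gd g u v))%E & (0 <= rarr s rR u)%E];
  or_cell : forall u v, u < N -> v < N ->
    let a := warr s aUo u + warr s aFn v %/ warr s aWu u in
    let j := warr s aSB a + v %% warr s aMod a in
    [/\ a < len, j < len & warr s aSlot j < len];
  or_sound : forall u v, u < N -> v < N -> (gd g u v <= found s u v)%E;
  or_complete : forall u v e, u < N -> v < N -> 0 < e < Z ->
    (gd g v (gs g e) < rarr s rR v)%E -> (gd g u (gt g e) < rarr s rR u)%E ->
    (found s u v <= gd g v (gs g e) + gw g e + gd g u (gt g e))%E }.

(** There are at most 4 q^2 Z pairs, and [hash_allP] bounds 2 to the load by twice this number plus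
    1. [max_mod] is the bound 2 k of [small_modulus] for the least admissible k. *)
Definition max_load q := trunc_log 2 (8 * (q * q * Z) + 1).
Definition max_mod q := 2 * (max_load q * max_load q * l + 1).

(** The summands follow the parts of [core] after [params] and are bracketed to the right like the
    program, so that every use of [okS] splits one off. *)
Definition core_time q :=
  let D := q * q * Z in let Q := N %/ (q * q) + 1 in let t := q + q in let PM := max_mod q in
  let NQ := N * Q + 1 in
  (3 * (Z + Z) + 3 * N + 4) + ((Z * (5 * tlZ + 14) + 2) + ((Z * (9 * tlZ + 24) + 1) +
  ((N * (Q * (Q.+1 * (9 * tlZ + 30) + 1) + (Q * Q).+1 * (5 * tlZ + 13) + 5 * tlZ + 3 * Q + 26) + 3) +
  ((10 * N + 5 * NQ + 10 + l * (phase_time g Q (q * q) l + 1)) +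
  ((7 * N + 5 * NQ + 4) +
  ((q * q * l * l * ((Z + N) * (14 * tlZ + 45) + 4 * N + 10 * tlZ + 60) + 3 * N + 4) +
  ((5 * N + 2) +
  ((15 * N + 5 + t * (5 * N + Z * (16 * t + 5))) +
  ((2 * l.+1 + 5 + N * (2 * l.+1 + 8)) +
  ((4 * D * (11 * l.+1 + 13) + N * (8 * l.+1 + 7) + 2) +
  ((32 * D + 2 * N) * (PM * (3 * PM + 5 * max_load q + 7) + 8) + 3))))))))))).

Hypothesis len_cap : len < cap.

Lemma coreP s TT : gst g s -> 0 < N -> 1 < Z ->
  {in [:: hF; hT; aDeg; aInA; aRow; aTc; aP; bH; aSlot], forall a, forall i, warr s a i = 0} ->
  (forall i, rarr s rTab i = 0%E) ->
  80 * Z <= len -> 80 * (N + 1) <= cap ->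
  (forall q, 0 < q -> N <= q * (q * q) -> q * (q * q) <= 8 * N ->
     [/\ 40 * (q * q * Z) * (max_mod q + l * l) <= len, (4 * N + 4) * (20 * (q * q * Z)) < cap &
       core_time q <= TT]) ->
  ok cap len core s (7 * trunc_log 2 N + 14 + TT) oracle_spec.
Proof.
move=> hg N0 Z1 hz hR h80 cap80 hq; have [eN eZ eS eT eW] := hg; have NZ := gNZ g.
have Z_len : Z + Z <= len by lia.
have cap2 : 2 < cap by lia.
have cap8 : 8 * N < cap by lia.
have zr a i : a \in [:: hF; hT; aDeg; aInA; aRow; aTc; aP; bH; aSlot] -> warr s a i = 0 by move/hz.
apply: (okS (paramsP (cap := cap) len eN N0 cap8 _) (T2 := TT)); [lia| |lia].
move=> s1 F1 [q q0 [eq1 eq2 /andP[q3 q4] eq5 eq6]].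
have [rm cp ht] := hq q q0 q3 q4.
set t := q + q in eq5; set D := q * q * Z in rm cp; set Q := N %/ (q * q) + 1 in eq6.
have [|[rm1 NQ ZD Qlen rm2] rm3] := room (b := max_load q * max_load q * l + 1) (a := l * l) q0 q3 NZ N0 _ rm.
  by rewrite addn1.
rewrite -/D -/Q in rm1 NQ ZD Qlen.
have NQ1 : N * Q + N < len by lia.
apply: okW (fun s' _ h => h) ht; rewrite /core_time -/D -/Q -/t.
have g1 : gst g s1 by split=> *; frs; auto.
apply: okS (pq_initP Z_len len_cap cap2 g1) _ (leqnn _).
move=> s2 F2 [hpq2 hD2]; have g2 : gst g s2 by split=> *; frs; auto.
apply: okS (full_adjP Z_len len_cap cap2 g2 Z1 hpq2 _) _ (leqnn _).
  by move=> x; frs; apply: zr.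
move=> s3 F3 [hlF3 hpq3]; have g3 : gst g s3 by split=> *; frs; auto.
apply: okS (light_adjP Z_len len_cap cap2 g3 _ Qlen (ltnW Z1) hpq3 _ _) _ (leqnn _).
- by frs.
- by move=> x; frs; apply: zr.
- by move=> x; frs; apply: zr.
move=> s4 F4 [hpq4 [T LT hlT4]]; have g4 : gst g s4 by split=> *; frs; auto.
apply: okS (near_listsP Z_len len_cap cap2 g4 _ LT hlT4 hpq4 _ NQ1) _ (leqnn _).
- by frs.
- by move=> x xN; frs; apply: hD2.
move=> s5 F5 [L hL [lay5 hEnd5 op5 hpq5 hD5]].

have Lu u : u < N -> uniq (L u) by move=> uN; apply: nl_uniq (hL u uN).
have Ll u : u < N -> {in L u, forall x, x < N} by move=> uN; apply: nl_lt (hL u uN).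
have LQ u : u < N -> size (L u) <= Q by move=> uN; apply: nl_size (hL u uN).
have Lf u x : u < N -> x \in L u -> (gd g u x < +oo)%E by move=> uN; case: (hL u uN) => ? ? ? ? h ? ?; apply: h.
have bl : base L N <= N * Q + 1 by rewrite addn1; apply: base_le.
have bl' : base L N <= len by lia.
have NN : N + N < len by lia.
have l2 : N < 2 ^ l by apply: trunc_log_ltn.
have g5 : gst g s5 by split=> *; frs; auto.
apply: okS (okW (clustersP Lu Ll LQ NN bl' len_cap cap2 (q := q) (l := l) lay5 _ N0 _ _ q0 q3 _ _ _ l2)
  (fun s' _ h => h) (_ : _ <= 10 * N + 5 * (N * Q + 1) + 10 + l * (phase_time g Q (q * q) l + 1))) _ (leqnn _).
- by frs.
- by move=> u uN; rewrite hEnd5 // baseS.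
- by move=> x; frs; apply: zr.
- by frs.
- by frs.
- by [].
- by lia.
move=> s6 F6 [A [b [hA6 hAs hb6 hCl]]].
have lay6 : layout g L N s6 by apply: layout_ext lay5 _ _ _ _ _ => *; frs.
have b_le u : u < N -> b u <= size (L u) by case/hb6.
have g6 : gst g s6 by split=> *; frs; auto.
apply: okS (okW (inv_listsP Lu Ll _ bl' len_cap cap2 (b := b) _ lay6 _)
  (fun s' _ h => h) (_ : _ <= 7 * N + 5 * (N * Q + 1) + 4)) _ (leqnn _).
- by lia.
- by frs.
- by move=> u /hb6[].
- by lia.
move=> s7 F7 hlI7.
have lay7 : layout g L N s7 by apply: layout_ext lay6 _ _ _ _ _ => *; frs.
have g7 : gst g s7 by split=> *; frs; auto.
have sA : \sum_(x < N) warr s7 aInA x = \sum_(x < N) (A x : nat).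
  by apply: eq_bigr => x _; frs; rewrite hA6.
have sA2 : (\sum_(x < N) (A x : nat)) * N <= q * q * (l * l) * N by rewrite leq_mul2r mulnA hAs orbT.
apply: okS (okW (land_tableP Z_len len_cap cap2 (top := base L N) g7 _ _ _ _ _ _ _ _ _)
  (fun s' _ h => h) (_ : _ <= q * q * l * l * ((Z + N) * (14 * tlZ + 45) + 4 * N + 10 * tlZ + 60) + 3 * N + 4)) _ (leqnn _).
- by frs.
- by frs.
- by move=> x xN; frs; apply: hD5.
- by move=> x; frs; rewrite hA6 leq_b1.
- by frs.
- by move=> x; frs; rewrite hR.
- by move=> x; frs; apply: zr.
- by lia.
- by rewrite sA; lia.
- by rewrite sA !leq_add2r leq_mul2r hAs orbT.
move=> s8 F8 [hov8 hTab8 hRow8 hT08].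
have lay8 : layout g L N s8.
  by apply: layout_ext lay7 _ _ _ _ _ => [*|*|p /hov8[]|p /hov8[]|*] //; frs.
have g8 : gst g s8 by split=> *; frs; auto.
have hEnd8 u : u < N -> warr s8 aEnd u = base L u + b u by move=> uN; frs; case: (hb6 u uN).
have pl : t * t * Z + N + N < len by rewrite (_ : t * t * Z = 4 * D); [lia|rewrite /t /D; lia].
have Zl : Z <= len by lia.
have hA u : u < N -> b u < size (L u) -> A (nth 0 (L u) (b u)) by case/hb6.
apply: okS (pivotsP Ll len_cap cap2 pl Zl bl' (A := A) _ lay8 hEnd8 hA) _ (leqnn _); first by frs.
move=> s9 F9 hR9.
have lay9 : layout g L N s9 by apply: layout_ext lay8 _ _ _ _ _ => *; frs.
have g9 : gst g s9 by split=> *; frs; auto.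
apply: okS (near_pairsP Lu Ll Lf b_le hCl len_cap cap2 pl Zl bl' g9 lay9 _ _ _ _) _ (leqnn _).
- by frs.
- by frs.
- by move=> u uN; frs; case: (hb6 u uN).
- by move=> x; frs; apply: zr.
move=> s10 F10 [tl [pt tt10]].
have [tl_u tl_l tl_s tl_st tl_it tl_cd tl_ct] := pt.
have toffD : toff tl N <= (4 * D).+1.
  apply: leq_trans (toff_le Lu Ll hCl (leqnn N) tl_s) _; rewrite ltnS /t /D; lia.
set M := \sum_(v < N) size (tl v).
have M4 : M <= 4 * D by move: toffD; rewrite /toff ltnS.
have sM := sum_cnt tl_u tl_l (leqnn N).
rewrite -/M in sM.
have tl0 : 2 ^ l <= 2 * N by rewrite expnS leq_mul2l /= trunc_logP.
have g10 : gst g s10 by split=> *; frs; auto.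
apply: okS (table_sizesP (l := l.+1) (cnt := listed tl N) (s := s10) (len := len) (cap := cap) (N := N) _ _ _ _ _ _ _ cap2)
  _ (leqnn _).
- by frs.
- by rewrite expnS; lia.
- by rewrite expnS; lia.
- by lia.
- move=> u uN; split; first exact: tl_ct.
  rewrite /listed; apply: leq_trans (_ : \sum_(w < N) 1 <= _); last by rewrite sum_nat_const card_ord muln1.
  by apply: leq_sum => w _; apply: leq_b1.
- by lia.
- by lia.
move=> s11 F11 [J [jj [[hk11 J11 K11 jjJ cnt11] off11]]].
have Jl : J <= l.+1.
  rewrite -ltnS -(@ltn_exp2l 2) // !expnS; move: l2; rewrite expnS; case/andP: J11; lia.
have Cn : cells jj N <= 8 * M + 2 * N.
  apply: leq_trans (_ : 8 * \sum_(u < N) listed tl N u + 2 * N <= _); last by lia.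
  by apply: cells_le => w /cnt11/andP[].
have Cl32 : cells jj N <= 32 * D + 2 * N by lia.
have cap_big : 2 ^ J * (4 * M + 4) < cap.
  apply: leq_ltn_trans cp; apply: leq_mul; [case/andP: J11|]; lia.
have g11 : gst g s11 by split=> *; frs; auto.
have tk_tl v i : v < N -> i < size (tl v) -> warr s11 aTk (toff tl v + i) = nth 0 (tl v) i.
  by move=> vN iv; frs; case: (tl_it v i vN iv).
have tv_tl v i : v < N -> i < size (tl v) -> warr s11 aTv (toff tl v + i) = v.
  by move=> vN iv; frs; case: (tl_it v i vN iv).
have cntjj u : u < N -> listed tl N u + listed tl N u <= 2 ^ jj u by case/cnt11/andP.
apply: okS (okW (hash_allP tl_u tl_l tk_tl tv_tl jjJ cntjj _ _ _ cap_big len_cap cap2 (s := s11) _ _ _ _)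
  (fun s' _ h => h) (_ : _ <= 4 * D * (11 * l.+1 + 13) + N * (8 * l.+1 + 7) + 2)) _ (leqnn _).
- by lia.
- by lia.
- by lia.
- by split=> // v vN; frs; apply: tl_st.
- by frs.
- by move=> x; frs; apply: zr.
- by move=> x; frs; apply: zr.
- by rewrite !leq_add ?leq_mul ?leq_add // leq_mul.
move=> s12 F12 [fn hfn [hl12 hsz12]].
set F := bucket _ _ _ _ _ _ in hl12 hsz12.
have leaf u v : u < N -> v < N -> fn v %/ 2 ^ (J - jj u) < 2 ^ jj u + 2 ^ jj u.
  by move=> uN vN; case/andP: (leaf_range jjJ uN (proj2 (hfn v vN))).
have FP a e : e \in F a -> 0 < e < toff tl N /\ exists w i,
    [/\ w < N, i < size (tl w) /\ e = toff tl w + i, warr s11 aTv e = w, nth 0 (tl w) i < N &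
        a = cells jj (nth 0 (tl w) i) + fn w %/ 2 ^ (J - jj (nth 0 (tl w) i))].
  rewrite mem_below => /and3P[eM e0 /eqP ea]; rewrite e0 eM; split=> //.
  have /toff_inv[w [i [wN iw E]]] : 0 < e < toff tl N by rewrite e0.
  exists w, i; have E1 := tk_tl w i wN iw; have E2 := tv_tl w i wN iw; rewrite -E in E1 E2.
  by split=> //; [apply: tl_l (mem_nth 0 iw)|rewrite -ea /cell E1 E2].
(* A cell belongs to the table of one [u], so two of its items with the same [v] would store the
   same pair. *)
have uF a : uniq [seq warr s11 aTv e | e <- F a].
  rewrite map_inj_in_uniq ?below_uniq // => e e' /FP[_ [w [i [wN [iw ->] -> uN ->]]]].
  move=> /FP[_ [w' [i' [wN' [iw' ->] -> uN' E]]]] ww; rewrite -{w'}ww in wN' iw' uN' E *.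
  move/cells_inj: E => /(_ N uN uN' (leaf _ _ uN wN) (leaf _ _ uN' wN')) E.
  by congr (_ + _); apply/eqP; rewrite -(nth_uniq 0 iw iw' (tl_u w wN)) E.
have szF a : size (F a) <= max_load q.
  by apply: trunc_log_max => //; apply: leq_trans (hsz12 a) _; rewrite leq_add2r -/D -/M; lia.
have PM : cells jj N * max_mod q + max_mod q <= len.
  apply: leq_trans rm3; rewrite -mulSnr leq_mul //; lia.
have PML : cells jj N * max_mod q <= len by apply: leq_trans PM; apply: leq_addr.
have CnL : cells jj N <= len by lia.
have TL : toff tl N <= len by lia.
apply: okW (slotsP (F := F) (tv := warr s11 aTv) (T := toff tl N) (S := max_load q) (PM := max_mod q)
  (s := s12) _ _ _ _ _ PM _ len_cap cap2 _ _ hl12 _) _ _.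
- by move=> a e _ /FP[].
- by [].
- move=> a _; have [p p1 p2] : exists2 p, 0 < p <= max_mod q & uniq [seq v %% p | v <- [seq warr s11 aTv e | e <- F a]].
    rewrite /max_mod mul2n -addnn; apply: (small_modulus (N := N) (l := l)) => //.
    - by move=> v /mapP[e /FP[_ [w [i [wN _ -> _ _]]]] ->].
    - exact: ltnW.
    - by rewrite size_map addn1 ltnS leq_mul2r leq_mul ?orbT.
  by exists p => //; rewrite -map_comp in p2.
- by lia.
- by [].
- by lia.
- by frs.
- by frs.
- by move=> x; frs; apply: zr.
- move=> s13 F13 [hsl hT13].
  have hRow x : warr s8 aRow x + N <= len by apply: leq_trans (hRow8 x) _; rewrite sA; lia.
  have cellE u v : u < N -> v < N -> warr s13 aUo u + warr s13 aFn v %/ warr s13 aWu u =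
      cells jj u + fn v %/ 2 ^ (J - jj u).
    by move=> uN vN; frs; have [_ -> ->] := K11 u uN; have [-> _] := hfn v vN.
  have cell_len u v : u < N -> v < N -> cells jj u + fn v %/ 2 ^ (J - jj u) < cells jj N.
    by move=> uN vN; apply: cell_lt => //; apply: leaf.
  have hTab u v : u < N -> v < N -> b u < size (L u) ->
      rarr s13 rTab (warr s13 aPrw u + v) = gd g (nth 0 (L u) (b u)) v.
    move=> uN vN bu; frs; have := hR9 u uN; rewrite bu => -[_ ->].
    apply: hTab8 => //; first by apply: (Ll u uN); apply: mem_nth.
    by frs; rewrite hA6 hA.
  have hR13 u : u < N -> rarr s13 rR u = if b u < size (L u) then gd g u (nth 0 (L u) (b u)) else +oo%E.
    by move=> uN; frs; have := hR9 u uN; case: ifP => _ [].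
  split.
  + by move=> u uN; frs; have := hR9 u uN; case: ifP => _ [_ ->] //; lia.
  (* Without a pivot the table entry is meaningless, but it is nonnegative and the radius is +oo, so
     the sum is +oo and all bounds are trivial. *)
  + move=> u v uN vN d; rewrite /d hR13 //; case: ltnP => bu; last first.
      have h : (0 <= rarr s13 rTab (warr s13 aPrw u + v))%E by frs; apply: hT08.
      have ny (x : \bar R) : (0 <= x)%E -> x != -oo%E by case: x.
      by rewrite !addye ?leey // ny // gd_ge0.
    rewrite hTab //; set p := nth _ _ _.
    have pN : p < N by apply: (Ll u uN); apply: mem_nth.
    by split; [apply: gd_tri|rewrite leeD2l // (gd_sym _ u p); apply: gd_tri|apply: gd_ge0].
  + move=> u v uN vN a j; rewrite /j /a cellE //; have cl := cell_len u v uN vN.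
    have [m0 mB _] := hsl _ cl; split; first exact: leq_trans cl CnL.
      by apply: leq_trans (leq_trans mB PML); rewrite ltn_add2l ltn_mod.
    exact: leq_trans (hT13 _) TL.
  + move=> u v uN vN; rewrite /found; set i := warr s13 aSlot _; case: ifP => [|_]; last exact: leey.
    case/and3P=> i0 /eqP tku /eqP tvv.
    have /toff_inv[w [k [wN kw E]]] : 0 < i < toff tl N by rewrite i0 hT13.
    have [E1 E2 E3] := tl_it w k wN kw; rewrite -E in E1 E2 E3.
    by move: tku tvv; frs; rewrite E1 E2 => <- <-.
  + move=> u v e uN vN he d1 d2.
    have inb z x : z < N -> x < N -> (gd g z x < rarr s13 rR z)%E -> x \in take (b z) (L z).
      move=> zN xN; rewrite hR13 // => lt; have [bz _ _ hQz] := hb6 z zN.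
      refine (ballP (hL z zN) bz _ hQz xN lt); by case: (b z < _).
    have xb := inb v (gs g e) vN (gs_lt he) d1; have yb := inb u (gt g e) uN (gt_lt he) d2.
    have [i il [Ei hi]] : exists2 i, i < size (tl v) & nth 0 (tl v) i = u /\
        (rarr s10 rTd (toff tl v + i) <= gd g v (gs g e) + gw g e + gd g u (gt g e))%E.
      apply: (tl_cd v (u, _)) vN _; apply/flattenP; exists (cand_x g L b v (gs g e)); first exact: map_f.
      apply/flattenP; exists (cand_e g L b v (gs g e) e).
        by apply: map_f; rewrite mem_below eqxx andbT andbC.
      by apply/mapP; exists u => //; rewrite mem_below uN.
    have eF : toff tl v + i \in F (cells jj u + fn v %/ 2 ^ (J - jj u)).
      rewrite mem_below /cell (tk_tl v i vN il) (tv_tl v i vN il) Ei eqxx andbT addn_gt0 /=.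
      by rewrite andbT; apply: leq_trans (toff_mono tl vN); rewrite toffS ltn_add2l.
    have [_ _ /(_ _ eF)] := hsl _ (cell_len u v uN vN); rewrite (tv_tl v i vN il) => pl13.
    rewrite /found cellE // pl13.
    have -> : warr s13 aTk (toff tl v + i) = u by frs; have [-> _ _] := tl_it v i vN il.
    have -> : warr s13 aTv (toff tl v + i) = v by frs; have [_ -> _] := tl_it v i vN il.
    by rewrite !eqxx addn_gt0 /=; frs.
- by rewrite leq_add2r leq_mul.
Qed.

End Core.

(** * Queries *)

(** Addresses in blocks are positive, so [y = 0] can report that the vertex has no edge. *)
Definition locate (x y z : nat) : cmd := (
  y ::= WRead aRoot (WDiv (V x) (WRead aPar (C 1)));;
  If (TEq (V y) (C 0)) Skip (
    y ::= V y :+ WMod (V x) (WRead aPar (C 1));;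
    If (TEq (WRead aPres (V y)) (C 1)) (z ::= WRead aCid (V y)) (y ::= C 0)))%cmd.

Definition answer : cmd := (
  RSet 1 (RAdd (RRead rR (V 4)) (RRead rTab (WRead aPrw (V 4) :+ V 5)));;
  RSet 2 (RAdd (RRead rR (V 5)) (RRead rTab (WRead aPrw (V 5) :+ V 4)));;
  6 ::= WRead aUo (V 4) :+ WDiv (WRead aFn (V 5)) (WRead aWu (V 4));;
  7 ::= WRead aSlot (WRead aSB (V 6) :+ WMod (V 5) (WRead aMod (V 6)));;
  If (TAnd (TLt (C 0) (V 7)) (TAnd (TEq (WRead aTk (V 7)) (V 4)) (TEq (WRead aTv (V 7)) (V 5))))
    (RSet 0 (RRead rTd (V 7))) Skip;;
  If (TLe (RVar 1) (RVar 0)) (RSet 0 (RVar 1)) Skip;;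
  If (TLe (RVar 2) (RVar 0)) (RSet 0 (RVar 2)) Skip)%cmd.

(** Weight variable 0 starts at 0, which is the answer for equal vertices. On a graph without edges
    nothing has been built, and the flag in [aPar] sends the query straight to +oo. *)
Definition query_prog : cmd := (
  If (TEq (V 0) (V 1)) Skip (
    RSet 0 RInfty;;
    If (TEq (WRead aPar (C 0)) (C 1)) (
      locate 0 2 4;;
      locate 1 3 5;;
      If (TAnd (TLt (C 0) (V 2)) (TLt (C 0) (V 3))) answer Skip) Skip))%cmd.

Section Query.
Variables (R : realType) (cap len n : nat).
Implicit Types s : state R.
Hypothesis len_cap : len < cap.
Hypothesis len2 : 1 < len.

Lemma answerP (g : mgraph R) s i j : wvar s 4 = i -> wvar s 5 = j -> i < gN g -> j < gN g -> i != j ->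
  gN g <= len -> oracle_spec len g s -> rvar s 0 = +oo%E ->
  ok cap len answer s 10 (fun s' =>
    (gd g i j <= rvar s' 0)%E /\ (rvar s' 0 <= 2%:E * gd g i j)%E).
Proof.
move=> ei ej iN jN ij Nl [orow onear ocell osound ocomp] s0.
have [n1 n2 n3] := onear i j iN jN; have [m1 m2 m3] := onear j i jN iN.
have ri := orow i iN; have rj := orow j jN; have [c1 c2 c3] := ocell i j iN jN.
set d1 := (rarr s rR i + _)%E in n1 n2; set d2 := (rarr s rR j + _)%E in m1 m2.
have sd := osound i j iN jN; have cp e := ocomp i j e iN jN.
have qb := query_bound iN jN ij n3 m3 n2 (_ : (d2 <= rarr s rR j + (rarr s rR j + gd g i j))%E) (t := found s i j) cp.
rewrite gd_sym in m2; rewrite gd_sym in m1; have {}qb := qb m2.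
have lo : (gd g i j <= Order.min (found s i j) (Order.min d1 d2))%E by rewrite !le_min sd n1 m1.
apply: okWp => //; rewrite /answer.
sp; rewrite ei ej; spl; try nl.
have fin x : (gd g i j <= x)%E -> (Order.min x (Order.min d1 d2) <= 2%:E * gd g i j)%E ->
    if (d1 <= x)%E then True /\ (True /\ True) /\
      (if (d2 <= d1)%E then True /\ (gd g i j <= d2)%E /\ (d2 <= 2%:E * gd g i j)%E
       else (gd g i j <= d1)%E /\ (d1 <= 2%:E * gd g i j)%E)
    else (True /\ True) /\
      (if (d2 <= x)%E then True /\ (gd g i j <= d2)%E /\ (d2 <= 2%:E * gd g i j)%E
       else (gd g i j <= x)%E /\ (x <= 2%:E * gd g i j)%E).
  move=> hx hm; case: (leP d1 x) => h1; [case: (leP d2 d1) => h2|case: (leP d2 x) => h2];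
    do !split=> //; apply: le_trans hm; rewrite !le_min lexx ?h1 ?h2 ?(ltW h1) ?(ltW h2) //=.
  - by rewrite (le_trans h2 h1).
  - by rewrite (le_trans h2 (ltW h1)).
rewrite s0 -/d1 -/d2; move: sd qb; rewrite /found; set k := warr s 75 _.
by case: ifP => _ sd qb; do !split=> //; try nl; apply: fin.
Qed.

Lemma locateP nm k s s0 x y z a : trie n k nm s0 -> wvar s0 al + wvar s0 vB <= len ->
  warr s aRoot = warr s0 aRoot -> warr s aPres = warr s0 aPres -> warr s aCid = warr s0 aCid ->
  warr s aPar 1 = wvar s0 vB -> wvar s x = a -> a < n -> x != y -> y != z ->
  ok cap len (locate x y z) s 5 (fun s' => if a \in nm then 0 < wvar s' y /\ wvar s' z = index a nm
    else wvar s' y = 0).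
Proof.
move=> T hB e1 e2 e3 eP ex an xy yz; have B0 := tr_B T; have aB := tr_BB T.
set B := wvar s0 vB in hB eP B0 aB.
have dB : a %/ B < B by rewrite ltn_divLR //; apply: leq_trans aB.
have mB : a %% B < B by rewrite ltn_mod.
have Bl : a %/ B < len by apply: leq_trans dB (leq_trans (leq_addl _ _) hB).
have c1 : 1 < cap by apply: ltn_trans len_cap.
apply: okWp => //=; rewrite upd_eq e1 ex eP; split; first by split.
split; first by split=> //; apply: ltnW.
case: eqP => r0 /=.
  by rewrite (_ : a \in nm = false) ?upd_eq //; apply: contra_eqF r0 => /(tr_none T).
have /eqP r1 := r0; have [j rj rl] := tr_root T dB r1.
have adl : warr s0 aRoot (a %/ B) + a %% B < len.
  by apply: leq_trans hB; rewrite -addSn leq_add // ltnW.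
have [p1 p2] := tr_pres T an r1; rewrite -/B in p1 p2.
rewrite !(upd_neq _ _ xy) ex; split.
  by split=> //; apply: ltn_trans adl len_cap.
rewrite upd_eq e2 p1; split; first by split.
case: (boolP (a \in nm)) => am /=.
  rewrite (upd_neq _ _ yz) !upd_eq e3 p2 //; do !split=> //.
  by rewrite addn_gt0 lt0n r1.
by rewrite upd_eq; split=> //; apply: ltnW.
Qed.

Lemma queryP (G : wgraph R n) es names p0 hes hu hn hs s s0 k :
  trie n k [seq val x | x <- names] s0 -> wvar s0 al + wvar s0 vB <= len ->
  (forall a, a \in [:: aRoot; aPres; aCid; aPar] -> warr s a = warr s0 a) ->
  warr s0 aPar 0 = 1 -> warr s0 aPar 1 = wvar s0 vB -> size names <= len ->
  oracle_spec len (@named_graph R n G es names p0 hes hu hn hs) s ->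
  answers_2approx G cap len 25 query_prog s.
Proof.
set g := named_graph _ _ _ _ _ => T hB ha eP0 eP1 Nl Or u v.
have arr a : a \in [:: aRoot; aPres; aCid; aPar] -> warr (query_state s u v) a = warr s0 a by exact: ha.
suff [t [s' [h1 h2 [h3 h4]]]] : ok cap len query_prog (query_state s u v) 25 (fun s' =>
    (dist G u v <= rvar s' 0)%E /\ (rvar s' 0 <= 2%:E * dist G u v)%E).
  exists t, s'; split=> //; first by have := fr_wa (exec_frame h1); move=> h; apply: funext => a; apply: h.
  by have := fr_ra (exec_frame h1); move=> h; apply: funext => a; apply: h.
have c2 : 1 < cap by apply: ltn_trans len_cap.
set s1 := query_state s u v in arr *.
apply: (okIf (T1 := 24)) => //= [/eqP/val_inj ->|ne].
  apply: (okWp (c := Skip)) => //=; rewrite dist_refl mule0 lexx; by split.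
have {}ne : u != v by apply: contra ne => /eqP->.
apply: (okWpS (T2 := 22)) => //; sp.
split=> //; apply: (okIf (T1 := 21)) => //=; try by rewrite arr // eP0.
  by do !split=> //; apply: ltnW.
move=> _; have P x : (val x \in [seq val x | x <- names]) = (x \in names).
  by rewrite mem_map //; apply: val_inj.
have I x : index (val x) [seq val x | x <- names] = index x names.
  by rewrite index_map //; apply: val_inj.
apply: (okS (T2 := 16)) (locateP (y := 2) (z := 4) (a := u) T hB _ _ _ _ _ _ _ _) _ _ => //; rewrite ?arr //.
move=> s2 F2; rewrite P I => h2.
apply: (okS (T2 := 11)) (locateP (y := 3) (z := 5) (a := v) T hB _ _ _ _ _ _ _ _) _ _ => //; try by fr F2; rewrite ?arr.
move=> s3 F3; rewrite P I => h3.
have e2 : wvar s3 2 = wvar s2 2 by fr F3.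
have e4 : wvar s3 4 = wvar s2 4 by fr F3.
have r0 : rvar s3 0 = +oo%E by fr F3; fr F2; sp.
have un x y : x \notin names -> x != y -> dist G x y = +oo%E by apply: (dist_unnamed (es := es) p0).
apply: (okIf (T1 := 10)) => //=.
- by rewrite ltnW.
- rewrite e2 => /andP[g2 g3].
  case: ifP h2 g2 => [un2 [_ h4] _|_ ->] //; case: ifP h3 g3 => [vn3 [_ h5] _|_ ->] //.
  have iN : index u names < gN g by rewrite index_mem.
  have jN : index v names < gN g by rewrite index_mem.
  have ij : index u names != index v names.
    by apply: contra ne => /eqP E; rewrite -(nth_index p0.1 un2) E nth_index.
  have Or3 : oracle_spec len g s3.
    have E1 : warr s3 = warr s by apply: funext => a; fr F3; fr F2.
    have E2 : rarr s3 = rarr s by apply: funext => a; fr F3; fr F2.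
    by case: Or => *; split; rewrite /found ?E1 ?E2.
  apply: okW (answerP _ h5 iN jN ij Nl Or3 r0) _ (leqnn _); first by rewrite e4.
  by move=> s' _; rewrite /= !nth_index.
- rewrite e2 negb_and -!leqNgt !leqn0 => h.
  have -> : dist G u v = +oo%E.
    case/orP: h => /eqP h; [|rewrite dist_sym]; apply: un; rewrite ?(eq_sym v) //.
      by apply/negP => un2; move: h2; rewrite un2 h => -[].
    by apply/negP => vn3; move: h3; rewrite vn3 h => -[].
  apply: (okWp (c := Skip)) => //=; rewrite r0 leey; split=> //.
  by rewrite mulry gtr0_sg // mul1e.
Qed.

End Query.

(** * Space and time bounds *)

Lemma max_mod_le (R : realType) (g : mgraph R) q W : 0 < W -> (trunc_log 2 (gN g)).+1 <= W ->
  max_load g q <= 10 * W -> max_mod g q <= 202 * (W * W * W).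
Proof.
move=> W0 hl hL; rewrite /max_mod; set l := _.+1 in hl *; set L := max_load g q in hL *.
have h1 : L * L * l <= 10 * W * (10 * W) * W by rewrite !leq_mul.
have h2 : 0 < W * W * W by rewrite !muln_gt0 W0.
rewrite (_ : 10 * W * (10 * W) * W = 100 * (W * W * W)) in h1; lia.
Qed.

(** [W] stands for log n + 1. The sixth power comes from the search for moduli: they are O(W^3), and
    trying all of them costs their square per cell. *)
Lemma core_time_le : exists K, forall (R : realType) (g : mgraph R) q W,
  0 < q -> gN g <= q * (q * q) -> 0 < gN g -> 0 < W -> (trunc_log 2 (gN g)).+1 <= W ->
  trunc_log 2 (gZ g) <= 3 * W -> max_load g q <= 10 * W ->
  core_time g q <= K * (q * q * gZ g * (W * W * W * (W * W * W))).
Proof.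
eexists => R g q W q0 Nq N0 W0 hl hT hL; have hPM := max_mod_le W0 hl hL.
rewrite /core_time /phase_time; set l := _.+1 in hl *; set L := max_load g q in hL *; set T := trunc_log 2 _ in hT *.
set PM := max_mod g q in hPM *; set N := gN g in Nq N0 *; set Z := gZ g.
have NZ : N <= Z := gNZ g.
set k := q * q in Nq *; have k0 : 0 < k by rewrite muln_gt0 q0.
set D := k * Z; set Q := N %/ k + 1.
have qk : q <= k by rewrite leq_pmulr.
have Q2 : Q <= 2 * q.
  have : N %/ k <= q by rewrite -(mulnK q k0) leq_div2r.
  by rewrite /Q; lia.
have Q0 : 0 < Q by rewrite /Q addn1.
have kND : k * N <= D by rewrite leq_mul2l NZ orbT.
have ZD : Z <= D by rewrite leq_pmull.
have qZD : q * Z <= D by rewrite leq_mul2r qk orbT.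
have QQ : Q * Q <= 4 * k by apply: leq_trans (leq_mul Q2 Q2) _; rewrite /k; lia.
have NQ2 : N * (Q * Q) <= 4 * D.
  by apply: leq_trans (leq_mul (leqnn N) QQ) _; lia.
have NQ : N * Q <= N * (Q * Q) by rewrite leq_mul2l leq_pmulr ?orbT.
have kD : k <= D by rewrite leq_pmulr // (leq_trans N0).
have qN : q * N <= D by apply: leq_trans qZD; rewrite leq_mul2l NZ orbT.
have tt : q * q = k by [].
clearbody PM L T l k Q Z N.
(* Each of the twelve summands is bounded by a numeral times [P], and [K] is then read off as the
   sum of the numerals. *)
set W3 := W * W * W in hPM *; set P := D * (W3 * W3).
have W31 : 0 < W3 by rewrite /W3 !muln_gt0 W0.
have W1 : W <= W3 by rewrite /W3 -mulnA leq_pmulr // muln_gt0 W0.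
have W2 : W * W <= W3 by rewrite leq_pmulr.
have P3 : D * W3 <= P by rewrite leq_mul2l leq_pmulr ?orbT.
have PW : D * W <= P by apply: leq_trans P3; rewrite leq_mul2l W1 orbT.
have PW2 : D * (W * W) <= P by apply: leq_trans P3; rewrite leq_mul2l W2 orbT.
have P0 : D <= P by apply: leq_trans P3; rewrite leq_pmulr.
have D0 : 0 < D by apply: leq_trans kD.
have QW : 0 < Q * W by rewrite muln_gt0 Q0.
have QQW : Q * W <= Q * Q * W by rewrite leq_mul2r leq_pmulr ?orbT.
have WQW : W <= Q * W by rewrite leq_pmull.
have QQQ : Q <= Q * Q by rewrite leq_pmulr.
have QQQW : Q * Q <= Q * Q * W by rewrite leq_pmulr.
have DW : D <= D * W by rewrite leq_pmulr.
have WDW : W <= D * W by rewrite leq_pmull.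
have a1 : 3 * (Z + Z) + 3 * N + 4 <= 13 * P by lia.
have a2 : Z * (5 * T + 14) + 2 <= 31 * P.
  have : Z * (5 * T + 14) <= D * (29 * W) by rewrite leq_mul //; lia.
  by lia.
have a3 : Z * (9 * T + 24) + 1 <= 52 * P.
  have : Z * (9 * T + 24) <= D * (51 * W) by rewrite leq_mul //; lia.
  by lia.
have a4 : N * (Q * (Q.+1 * (9 * T + 30) + 1) + (Q * Q).+1 * (5 * T + 13) + 5 * T + 3 * Q + 26) + 3 <= 900 * P.
  have i1 : Q.+1 * (9 * T + 30) <= 2 * Q * (57 * W) by rewrite leq_mul //; lia.
  have i2 : Q * (Q.+1 * (9 * T + 30) + 1) <= Q * (Q * (115 * W)) by rewrite leq_mul //; lia.
  have i3 : (Q * Q).+1 * (5 * T + 13) <= 2 * (Q * Q) * (28 * W) by rewrite leq_mul //; lia.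
  set x := Q * (_ + 1) in i2 *; set y := (Q * Q).+1 * _ in i3 *.
  have i4 : x + y + 5 * T + 3 * Q + 26 <= 215 * (Q * Q * W) by lia.
  apply: leq_trans (_ : N * (215 * (Q * Q * W)) + 3 <= _); first by rewrite leq_add2r leq_mul2l i4 orbT.
  have : N * (Q * Q) * W <= 4 * D * W by rewrite leq_mul2r NQ2 orbT.
  by lia.
have a5 : 10 * N + 5 * (N * Q + 1) + 10 + l * (N * (7 * Q + 25) + 10 +
    ((k * l).+1 * (8 * N + 10) + (4 * Q + 3) * N + 2) + (N * (5 * Q + 15) + 4) + (4 * N + 3) + 1) <= 300 * P.
  have j1 : k * N * l <= D * W by rewrite leq_mul.
  have j2 : k * l <= D * W by rewrite leq_mul.
  set x := _ + (4 * N + 3) + 1.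
  have j3 : x <= 167 * (D * W) by rewrite /x; lia.
  have j4 : l * x <= W * (167 * (D * W)) by rewrite leq_mul.
  by lia.
have a6 : 7 * N + 5 * (N * Q + 1) + 4 <= 36 * P by lia.
have a7 : k * l * l * ((Z + N) * (14 * T + 45) + 4 * N + 10 * T + 60) + 3 * N + 4 <= 300 * P.
  have i1 : (Z + N) * (14 * T + 45) <= 2 * Z * (87 * W) by rewrite leq_mul //; lia.
  have ZW : W <= Z * W by rewrite leq_pmull // (leq_trans N0).
  have ZZW : Z <= Z * W by rewrite leq_pmulr.
  set x := (Z + N) * _ in i1 *; have i2 : x + 4 * N + 10 * T + 60 <= 268 * (Z * W) by lia.
  have i3 : k * l * l * (x + 4 * N + 10 * T + 60) <= k * W * W * (268 * (Z * W)) by rewrite !leq_mul.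
  have i4 : k * W * W * (268 * (Z * W)) = 268 * (D * W3) by rewrite /D /W3; lia.
  by lia.
have a8 : 5 * N + 2 <= 7 * P by lia.
have a9 : 15 * N + 5 + (q + q) * (5 * N + Z * (16 * (q + q) + 5)) <= 104 * P.
  have : q * q * Z = D by rewrite tt.
  by lia.
have a10 : 2 * l.+1 + 5 + N * (2 * l.+1 + 8) <= 21 * P.
  have : N * (2 * l.+1 + 8) <= D * (12 * W) by rewrite leq_mul //; lia.
  by lia.
have a11 : 4 * D * (11 * l.+1 + 13) + N * (8 * l.+1 + 7) + 2 <= 165 * P.
  have : 4 * D * (11 * l.+1 + 13) <= 4 * D * (35 * W) by rewrite leq_mul //; lia.
  have : N * (8 * l.+1 + 7) <= D * (23 * W) by rewrite leq_mul //; lia.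
  by lia.
have a12 : (32 * D + 2 * N) * (PM * (3 * PM + 5 * L + 7) + 8) + 3 <= (34 * (202 * 663 + 8) + 3) * P.
  have WW0 : 0 < W3 * W3 by rewrite muln_gt0 W31.
  have i1 : PM * (3 * PM + 5 * L + 7) <= 202 * W3 * (663 * W3) by rewrite leq_mul //; lia.
  have i2 : (32 * D + 2 * N) * (PM * (3 * PM + 5 * L + 7) + 8) <=
      34 * D * ((202 * 663 + 8) * (W3 * W3)) by rewrite leq_mul //; lia.
  have i3 : 34 * D * ((202 * 663 + 8) * (W3 * W3)) = 34 * (202 * 663 + 8) * P by rewrite /P; lia.
  by lia.
apply: leq_trans (_ : (13 + (31 + (52 + (900 + (300 + (36 + (300 + (7 + (104 + (21 + (165 +
  (34 * (202 * 663 + 8) + 3)))))))))))) * P <= _); last exact: leqnn.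
have add a b c d : a <= c * P -> b <= d * P -> a + b <= (c + d) * P by rewrite mulnDl; apply: leq_add.
exact (add _ _ _ _ a1 (add _ _ _ _ a2 (add _ _ _ _ a3 (add _ _ _ _ a4 (add _ _ _ _ a5 (add _ _ _ _ a6
  (add _ _ _ _ a7 (add _ _ _ _ a8 (add _ _ _ _ a9 (add _ _ _ _ a10 (add _ _ _ _ a11 a12))))))))))).
Qed.

Lemma trunc_log_le x k : x < 2 ^ k.+1 -> trunc_log 2 x <= k.
Proof.
case: x => [|x] h; first by rewrite trunc_log0.
by rewrite -ltnS -(@ltn_exp2l 2) //; apply: leq_ltn_trans h; apply: trunc_logP.
Qed.

(** Used for [8 * n]: the program computes [q] from [N], and [r] bounds all values it may choose,
    since [q ^ 3 <= 8 * N]. Thus the space can be fixed before the run. *)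
Lemma cbrt_floor x : exists r, r * (r * r) <= x < r.+1 * (r.+1 * r.+1).
Proof.
elim: x => [|x [r /andP[h1 h2]]]; first by exists 0.
have [h|h] := ltnP x.+1 (r.+1 * (r.+1 * r.+1)); first by exists r; rewrite h (leq_trans h1).
by exists r.+1; rewrite h /=; lia.
Qed.

(** The trie takes O(m) blocks of length about sqrt n, and this fits into the space m r^2. *)
Lemma sqrt_le_cbrt n r B : 0 < n -> 8 * n < r.+1 * (r.+1 * r.+1) -> B * B <= 4 * n -> B <= r * r.
Proof.
move=> n0 h hB; have r2 : 1 < r by case: r h => [|[|]] //; lia.
rewrite leqNgt; apply/negP => lt.
have h1 : r * r * (r * r) < B * B by apply: ltn_mul.
have h2 : r * r * 2 <= r * r * r by rewrite leq_mul2l r2 orbT.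
have h3 : r * r * r * 2 <= r * r * r * r by rewrite leq_mul2l r2 orbT.
have h4 : r * 2 <= r * r by rewrite leq_mul2l r2 orbT.
lia.
Qed.

(** The cube of r / 2 is at most n, so r^2 is at most 4 n^(2/3); together with 2 m + 1 <= 3 m this
    gives the constant 12. *)
Lemma soft_boundI (R : realType) n m r x K (W := (trunc_log 2 n).+1) : 0 < m -> r * (r * r) <= 8 * n ->
  x <= K * (r * r * m.*2.+1 * (W * W * W * (W * W * W))) ->
  soft_bound (R := R) (12 * K) 6 n (m%:R * n%:R `^ (2 / 3))%R x.
Proof.
move=> m0 hr hx; rewrite /soft_bound -/W.
have {}hx : x <= 3 * K * (r ^ 2 * m * W ^ 6).
  apply: leq_trans hx _; have -> : W * W * W * (W * W * W) = W ^ 6 by rewrite !expnS expn0 muln1; lia.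
  rewrite (mulnC 3) -(mulnA K) leq_mul2l; apply/orP; right.
  rewrite mulnA leq_mul2r; apply/orP; right; rewrite -mulnn.
  have : r * r <= r * r * m by rewrite leq_pmulr.
  lia.
pose y : R := (r%:R / 2)%R; have y0 : (0 <= y)%R by rewrite divr_ge0.
have y3 : (y ^+ 3 <= n%:R)%R.
  rewrite expr_div_n ler_pdivrMr ?exprn_gt0 // -!natrX -natrM ler_nat; move: hr; rewrite !expnS expn0 !muln1; lia.
have y2 : (y ^+ 2 <= n%:R `^ (2 / 3))%R.
  have -> : (y ^+ 2 = (y ^+ 3) `^ (2 / 3))%R.
    by rewrite -!powR_mulrn // -powRrM; congr (_ `^ _)%R; field.
  by apply: ge0_ler_powR => //; rewrite ?nnegrE ?exprn_ge0 ?divr_ge0.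
have r2 : ((r ^ 2)%:R <= 4 * n%:R `^ (2 / 3) :> R)%R.
  have -> : ((r ^ 2)%:R = 4 * y ^+ 2 :> R)%R by rewrite natrX /y; field.
  by rewrite ler_pM2l.
apply: le_trans (_ : (3 * K * (r ^ 2 * m * W ^ 6))%:R <= _)%R; first by rewrite ler_nat.
have eW : ((W ^ 6)%:R = W%:R ^+ 6 :> R)%R by rewrite natrX.
rewrite -eW; move: (r ^ 2) (W ^ 6) r2 => a b r2; set f := (_ `^ _)%R in r2 *.
rewrite !natrM; have h : (a%:R * m%:R <= 4 * (m%:R * f + 1) :> R)%R.
  by have := ler_wpM2r (ler0n R m) r2; nra.
have -> : (12%:R * K%:R * (m%:R * f + 1) * b%:R = 3%:R * K%:R * (4 * (m%:R * f + 1) * b%:R) :> R)%R by ring.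
by rewrite ler_wpM2l ?mulr_ge0 // ler_wpM2r.
Qed.

(** The dictionary dominates: fewer than 40 q^2 Z cells, each with a range of slots of length at
    most [max_mod], hence at most 202 W^3; one more W^3 makes room for the table of landmark
    distances. *)
Definition space_bound n m r := let W := (trunc_log 2 n).+1 in 40 * (203 * (r * r * m.*2.+1 * (W * W * W))).

Lemma size_edge_list (R : realType) n (G : wgraph R n) es : edge_list G es -> size es <= n * n.
Proof.
by case=> u _ _; rewrite -(card_uniqP u) (leq_trans (max_card _)) // card_prod card_ord.
Qed.

Lemma pow_le M k j : 1 < M -> k <= 2 ^ j -> k <= M ^ j.
Proof. by move=> M1 h; apply: leq_trans h _; case: j => // j; rewrite leq_exp2r. Qed.

Lemma cube w : w ^ 3 = w * w * w.
Proof. by rewrite !expnS expn0 muln1 mulnA. Qed.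

Lemma constructionP K : (forall (R : realType) (g : mgraph R) q W,
    0 < q -> gN g <= q * (q * q) -> 0 < gN g -> 0 < W -> (trunc_log 2 (gN g)).+1 <= W ->
    trunc_log 2 (gZ g) <= 3 * W -> max_load g q <= 10 * W ->
    core_time g q <= K * (q * q * gZ g * (W * W * W * (W * W * W)))) ->
  forall (R : realType) n (G : wgraph R n) es r (W := (trunc_log 2 n).+1) (m := size es),
  edge_list G es -> 0 < m -> r * (r * r) <= 8 * n < r.+1 * (r.+1 * r.+1) ->
  ok (word_cap 30 n) (space_bound n m r) (compress;; core)%cmd (input_state G es)
    (5 * trunc_log 2 n + 33 * m + 16 + (7 * trunc_log 2 n + 14 + K * (r * r * m.*2.+1 * (W * W * W * (W * W * W)))))
    (answers_2approx G (word_cap 30 n) (space_bound n m r) 25 query_prog).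
Proof.
move=> hK R n G es r W m hes m0 /andP[r1 r2].
have [p0 p0es] : exists p, p \in es by move: m0; rewrite /m; case: (es) => // p l _; exists p; apply: mem_head.
have n0 : 0 < n by case: p0 {p0es} => -[x xn] _; apply: leq_ltn_trans xn.
have mn : m <= n * n by apply: size_edge_list hes.
have Wn : W <= n.
  by apply: leq_trans (trunc_logP (p := 2) _ n0) => //; apply: ltn_expl.
have r0 : 1 < r by case: r r1 r2 => [|[|r']] //; lia.
have rr8 : r * r <= 8 * n by apply: leq_trans r1; rewrite leq_pmull // ltnW.
have Zn : m.*2.+1 <= 3 * (n * n) by have := muln_gt0 n n; rewrite n0; lia.
have W0 : 0 < W by [].
have nW : n < 2 ^ W by apply: trunc_log_ltn.
set cap := word_cap 30 n; set len := space_bound n m r.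
pose M := n + 2; have M1 : 1 < M by rewrite /M addn2.
have nM : n <= M by apply: leq_addr.
have pM k j : k <= 2 ^ j -> k <= M ^ j by apply: pow_le.
have rrM : r * r <= M ^ 4 by apply: leq_trans rr8 _; rewrite (expnD M 3 1) expn1 leq_mul ?pM.
have ZM : m.*2.+1 <= M ^ 4 by apply: leq_trans Zn _; rewrite (expnD M 2 2) -(mulnn M) !leq_mul // mulnn pM.
have WM : W <= M by apply: leq_trans nM.
have capM a j : a <= M ^ j -> j < 30 -> a < cap.
  by move=> ha hj; apply: leq_ltn_trans ha _; rewrite /cap /word_cap ltn_exp2l.
(* The factors of the space bound are at most powers of n + 2 with exponents 6, 8, 4, 4 and 3. The
   exponent 30 of the word capacity leaves some slack over their sum 25. *)
have len_cap : len < cap.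
  apply: (capM _ 25) => //; rewrite /len /space_bound -/W.
  apply: leq_trans (_ : M ^ 6 * (M ^ 8 * (M ^ 4 * M ^ 4 * M ^ 3)) <= _).
    apply: leq_mul; first exact: pM.
    apply: leq_mul; first exact: pM.
    by apply: leq_mul; [apply: leq_mul|rewrite (expnD M 2 1) expn1 -mulnn !leq_mul].
  by rewrite -!expnD.
set Dr := r * r * m.*2.+1.
have W3 : 0 < W * W * W by rewrite !muln_gt0 W0.
have lenD : 800 * Dr <= len.
  rewrite (_ : 800 * Dr = 40 * (20 * Dr)); last by lia.
  by rewrite /len /space_bound -/W -/Dr leq_mul2l /= leq_mul // leq_pmulr.
have rr4 : 4 <= r * r by apply: (leq_mul r0 r0).
have Dr4 : 4 * m.*2.+1 <= Dr by rewrite leq_mul2r rr4 orbT.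
have trieB B : B * B <= 4 * n -> 1 + (m + m).+2 * B <= len.
  move/(sqrt_le_cbrt n0 r2) => hB.
  apply: leq_trans (_ : 3 * Dr <= _); last by lia.
  have : (m + m).+2 * B <= 2 * m.*2.+1 * (r * r) by rewrite leq_mul //; lia.
  rewrite (_ : 2 * m.*2.+1 * (r * r) = 2 * Dr); [lia|rewrite /Dr; lia].
apply: (okS (compressP p0 hes m0 n0 _ len_cap _ trieB)) (leqnn _).
- by apply: (capM _ 3) => //; rewrite (expnD M 2 1) expn1 leq_mul // pM.
- by lia.
move=> s1 F1 [names [hu [hn [hs [g1 T1 [p01 p11 N0 B1]]]]]].
set g := named_graph _ _ _ _ _ in g1; have NE : gN g = size names by []; have ZE : gZ g = m.*2.+1 by [].
have Nn : gN g <= n by rewrite NE -(card_uniqP hu) (leq_trans (max_card _)) // card_ord.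
have lW : (trunc_log 2 (gN g)).+1 <= W by rewrite ltnS leq_trunc_log.
have w1 : 1 < 2 ^ W by apply: leq_trans nW; rewrite ltnS.
have ww : n * n < 2 ^ W * 2 ^ W by rewrite ltn_mul.
have www : n * n * n < 2 ^ W * 2 ^ W * 2 ^ W by rewrite ltn_mul.
have tZ : trunc_log 2 (gZ g) <= 3 * W.
  apply: trunc_log_le; rewrite ZE expnS (mulnC 3) expnM cube.
  set w := 2 ^ W in w1 ww www *.
  have : w * w * 2 <= w * w * w by rewrite leq_mul2l w1 orbT.
  by lia.
have DDr q : q <= r -> q * q * gZ g <= Dr by move=> qr; rewrite ZE /Dr !leq_mul.
have hload q : q <= r -> max_load g q <= 10 * W.
  move=> /DDr qD; apply: trunc_log_le; rewrite expnS (mulnC 10) expnM (expnD _ 7 3) cube.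
  set w := 2 ^ W in w1 ww www *.
  have h7 : 128 <= w ^ 7 by apply: pow_le.
  have : 128 * (w * w * w) <= w ^ 7 * (w * w * w) by rewrite leq_mul2r h7 orbT.
  have : Dr <= 24 * (n * n * n).
    by apply: leq_trans (leq_mul rr8 Zn) _; lia.
  by lia.
have zr a i : a \in [:: hF; hT; aDeg; aInA; aRow; aTc; aP; bH; aSlot] -> warr s1 a i = 0.
  move=> ha; have /allP/(_ a ha)/andP[a1 a2] : all (fun a => (1 < a) && (a \notin wam compress))
    [:: hF; hT; aDeg; aInA; aRow; aTc; aP; bH; aSlot] by [].
  by rewrite (fr_wa F1 a2) /= (nth_default [::]) ?nth_nil.
apply: okW (coreP len_cap (TT := K * (Dr * (W * W * W * (W * W * W)))) g1 N0 _ _ _ _ _ _) _ _.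
- by rewrite ZE; lia.
- by move=> a ha i; apply: zr.
- by move=> i; rewrite (fr_ra F1 (x := rTab)) //= nth_nil.
- by rewrite ZE; lia.
- apply/ltnW/(capM _ (7 + 2)) => //; rewrite expnD; apply: leq_mul; first exact: pM.
  by apply: leq_trans (_ : 2 * M <= _); [lia|rewrite -mulnn leq_mul].
- move=> q q0 q3 q4; have qr : q <= r.
    rewrite leqNgt; apply/negP => rq.
    by have := leq_mul rq (leq_mul rq rq); lia.
  have hP := max_mod_le W0 lW (hload q qr).
  have ll := leq_mul lW lW; have W23 : W * W <= W * W * W by rewrite leq_pmulr.
  split.
  + rewrite /len /space_bound -/W -/Dr; apply: leq_trans (_ : 40 * Dr * (203 * (W * W * W)) <= _); last by lia.
    by rewrite leq_mul ?leq_mul2l ?DDr //; lia.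
  + apply: (capM _ (4 + (5 + (4 + 4)))) => //; rewrite !expnD; apply: leq_mul.
      by apply: leq_trans (_ : 8 * n <= _); [lia|rewrite (expnD M 3 1) expn1 leq_mul ?pM].
    by apply: leq_mul; [exact: pM|apply: leq_trans (DDr q qr) _; apply: leq_mul].
  + apply: leq_trans (hK R g q W q0 q3 N0 W0 lW tZ (hload q qr)) _.
    by rewrite leq_mul2l leq_mul2r DDr ?orbT.
- move=> s2 F2 Or; apply: (queryP len_cap _ T1 _ _ p01 p11 _ Or).
  + by lia.
  + have [j -> jm] := tr_al T1.
    have : (j + 1) * wvar s1 vB <= (m + m).+2 * wvar s1 vB by rewrite leq_mul2r; apply/orP; right; lia.
    by move: B1; rewrite mulnDl mul1n; lia.
  + move=> a ha; have /allP/(_ a ha) a2 : all (fun a => a \notin wam core) [:: aRoot; aPres; aCid; aPar] by [].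
    exact: fr_wa F2 _ a2.
  + by rewrite -NE; have := gNZ g; rewrite ZE; lia.
- by rewrite leq_add2r leq_add2r leq_mul2l leq_trunc_log.
Qed.

Lemma query_no_edges (R : realType) n (G : wgraph R n) cap len : edge_list G [::] -> 1 < cap -> 0 < len ->
  answers_2approx G cap len 25 query_prog (input_state G [::]).
Proof.
move=> hes c1 len0 u v; set s := input_state G [::].
suff [t [s' [h1 h2 [h3 h4]]]] : ok cap len query_prog (query_state s u v) 25 (fun s' =>
    (dist G u v <= rvar s' 0)%E /\ (rvar s' 0 <= 2%:E * dist G u v)%E).
  exists t, s'; split=> //; first by have := fr_wa (exec_frame h1); move=> h; apply: funext => a; apply: h.
  by have := fr_ra (exec_frame h1); move=> h; apply: funext => a; apply: h.
apply: (okIf (T1 := 24)) => //= [/eqP/val_inj ->|ne].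
  apply: (okWp (c := Skip)) => //=; rewrite dist_refl mule0 lexx; by split.
have {}ne : u != v by apply: contra ne => /eqP->.
have -> : dist G u v = +oo%E by apply: (dist_unnamed (es := [::]) (names := [::]) (u, v)).
apply: (okWpS (T2 := 22)) => //=; split=> //; apply: (okIf (T1 := 21)) => //=.
  by do !split=> //; apply: ltnW.
move=> _; apply: (okWp (c := Skip)) => //=; rewrite leey; split=> //.
by rewrite mulry gtr0_sg // mul1e.
Qed.

Lemma word_cap_gt1 c n : 0 < c -> 1 < word_cap c n.
Proof. by move=> c0; rewrite /word_cap -{1}(exp1n c) ltn_exp2r // addn2. Qed.

Lemma budget n m r K t (W := (trunc_log 2 n).+1)
    (X := r * r * m.*2.+1 * (W * W * W * (W * W * W))) : 0 < r ->
  t <= 5 * trunc_log 2 n + 33 * m + 16 + (7 * trunc_log 2 n + 14 + K * X) ->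
  space_bound n m r <= (K + 40 * 203) * X /\ t.+1 <= (K + 40 * 203) * X.
Proof.
move=> r0 ht; have W3 : 0 < W * W * W by [].
have rr : 0 < r * r by rewrite muln_gt0 r0.
have h1 : r * r * m.*2.+1 * (W * W * W) <= X by rewrite leq_mul2l leq_pmulr ?orbT.
have h2 : W <= X.
  apply: leq_trans h1; apply: leq_trans (_ : W * W * W <= _); first by rewrite -mulnA leq_pmulr.
  by rewrite leq_pmull // muln_gt0 rr.
have h3 : m.*2.+1 <= X by rewrite /X -mulnA mulnCA leq_pmulr // muln_gt0 rr.
have h4 : space_bound n m r <= 40 * 203 * X by rewrite /space_bound -/W -(mulnA 40); do 2!apply: leq_mul => //.
split; first by apply: leq_trans h4 _; rewrite leq_mul2r leq_addl orbT.
rewrite mulnDl (_ : trunc_log 2 n = W - 1) in ht *; last by rewrite /W; lia.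
by clearbody W X; lia.
Qed.

Local Open Scope classical_set_scope.
Local Open Scope ring_scope.

Theorem theorem1p4 :
  exists (preproc query : cmd) (c q C k : nat),
    forall (R : realType) (n : nat) (G : wgraph R n)
      (es : seq ('I_n * 'I_n)),
      edge_list G es ->
      exists (space time : nat) (oracle : state R),
        [/\ soft_bound (R := R) C k n ((num_edges G)%:R * n%:R `^ (2 / 3)) space,
            soft_bound (R := R) C k n ((num_edges G)%:R * n%:R `^ (2 / 3)) time,
            exec (word_cap c n) space preproc (input_state G es) time oracle &
            answers_2approx G (word_cap c n) space q query oracle].
Proof.
have [K hK] := core_time_le; pose A := (K + 40 * 203)%N.
(* [A] covers the constant [K] of the time and the constant [40 * 203] of the space at once; 12 and
   the exponent 6 come from [soft_boundI]. *)
exists (If (TEq (V 1) (C 0)) Skip (Seq compress core)), query_prog, 30%N, 25%N, (12 * A)%N, 6%N.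
move=> R n G es hes; rewrite -(edge_list_size hes).
have cap0 : (1 < word_cap 30 n)%N by apply: word_cap_gt1.
have [m0|m0] := posnP (size es).
  have es0 : es = [::] by apply: size0nil.
  (* Without edges the bound is a constant times a power of the logarithm, and a single test is all
     that the preprocessing does. *)
  have soft x : (x <= 2)%N -> soft_bound (R := R) (12 * A) 6 n ((size es)%:R * n%:R `^ (2 / 3)) x.
    move=> x2; rewrite /soft_bound m0 mul0r add0r mulr1 -natrX -natrM ler_nat.
    apply: leq_trans x2 _; apply: leq_trans (_ : 12 * A * 1 <= _)%N; first by rewrite /A; lia.
    by rewrite leq_mul2l expn_gt0 orbT.
  exists 2%N, 1%N, (input_state G es); split; [exact: soft|exact: soft| |].
    apply: (ExecIf (r := true)); last exact: ExecSkip.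
    by rewrite /= m0 /guard (ltnW cap0).
  by rewrite es0 in hes *; apply: query_no_edges.
have [r hr] := cbrt_floor (8 * n); have /andP[hr1 _] := hr.
have [t [s [ht1 ht2 ht3]]] := constructionP hK hes m0 hr.
have r0 : (0 < r)%N.
  case: r hr {hr1 ht1 ht2 ht3} => // /andP[_ h].
  have := size_edge_list hes; move: (size es) m0 => m m0.
  by rewrite (_ : n = 0)%N; lia.
have [b1 b2] := budget r0 ht2.
exists (space_bound n (size es) r), t.+1, s; split=> //.
- exact: soft_boundI m0 hr1 b1.
- exact: soft_boundI m0 hr1 b2.
- apply: (ExecIf (r := false)) ht1.
  by rewrite /= /guard (ltnW cap0) /= (gtn_eqF m0).
Qed.
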